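(* Fix any integers $n,m\geq 2$. The following hold: (1) $\mathsf{RRT}^{m}_{n}$ holds in $\mathcal{N}_{1}$. Thus, $\mathsf{RRT}^{m}_{n}$ does not imply ''There are no amorphous sets'' in $\mathsf{ZFA}$. (2) $\mathsf{RRT}^{m}_{n}$ holds in $\mathcal{N}_{3}$. Consequently, $\mathsf{RRT}^{m}_{n}$ implies none of $\mathsf{WOAM}$, $\mathsf{CS}$, and $\mathsf{A}$ (the Antichain Principle) in $\mathsf{ZFA}$. (3) $\mathsf{RRT}^{m}_{n}+\Delta SL$ holds in $\mathcal{N}_{26}$.
   Context: $\mathsf{ZFA}$ is Zermelo–Fraenkel set theory (without choice) with Extensionality weakened to allow atoms. ''$\Phi$ does not imply $\Psi$ in $\mathsf{ZFA}$'' means that $\Phi\to\Psi$ is not provable in $\mathsf{ZFA}$ (under the usual consistency assumption). Principles. $[X]^{m}$ is the set of $m$-element subsets of $X$. A coloring $\chi:[X]^{m}\to C$ is $n$-bounded if $|\chi^{-1}[\{c\}]|\leq n$ for each $c\in C$; $Z\subseteq X$ is polychromatic for $\chi$ if distinct members of $[Z]^{m}$ receive distinct colors. $\mathsf{RRT}^{m}_{n}$: if $X$ is an infinite set and $\chi:[X]^{m}\to C$ is an $n$-bounded coloring for some infinite set $C$, then there is an infinite $Y\subseteq X$ polychromatic for $\chi$. An infinite set is amorphous if it is not a disjoint union of two infinite subsets. $\mathsf{WOAM}$: every set is either well-orderable or has an amorphous subset. $\mathsf{CS}$: every partially ordered set without a maximal element has two disjoint cofinal subsets ($C\subseteq P$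 is cofinal if every $x\in P$ satisfies $x\le c$ for some $c\in C$). $\mathsf{A}$: every partially ordered set has a maximal antichain (an antichain is a set of pairwise incomparable elements). A set $X$ is uncountable if $|X|\not\leq\aleph_{0}$. A family $\mathcal{B}$ is a $\Delta$-system if there is a set $r$ with $x\cap y=r$ for any two distinct $x,y\in\mathcal{B}$. $\Delta SL$: every uncountable family $\mathcal{A}$ of finite sets has an uncountable subfamily which forms a $\Delta$-system. Permutation models. Let $M$ be a model of $\mathsf{ZFA}+\mathsf{AC}$ with set of atoms $A$, $\mathcal{G}$ a group of permutations of $A$ (acting on $M$ in the usual way), $\mathrm{sym}_{\mathcal{G}}(x)=\{g\in\mathcal{G}: g(x)=x\}$, $\mathrm{fix}_{\mathcal{G}}(E)=\{\phi\in\mathcal{G}:(\forall y\in E)\,\phi(y)=y\}$. For a normal filter $\mathcal{F}$ of subgroups of $\mathcal{G}$, the permutation model determined by $M,\mathcal{G},\mathcal{F}$ is $\{x\in M:(\forall t\in \mathrm{TC}(\{x\}))\ \mathrm{sym}_{\mathcal{G}}(t)\in\mathcal{F}\}$, where $\mathrm{TC}$ denotes transitive closure. In each of the three models below, $\mathcal{F}$ is the filter generated by $\{\mathrm{fix}_{\mathcal{G}}(E): E\in[A]^{<\omega}\}$, where $[A]^{<\omega}$ is the set of finite subsets of $A$. - $\mathcal{N}_{1}$ (basic Fraenkel model): $A$ is countably infinite and $\mathcal{G}$ is the group of all permutations of $A$. - $\mathcal{N}_{3}$ (Mostowski linearly ordered model): $A$ is countably infinite with an ordering $<$ such that $(A,<)\cong(\mathbb{Q},<)$,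 and $\mathcal{G}$ is the group of all order automorphisms of $(A,<)$. - $\mathcal{N}_{26}$ (Brunner/Pincus model): $A=\bigcup\{P_{i}: i\in\omega\}$ is a disjoint union with $|P_{i}|=\aleph_{0}$ for all $i\in\omega$, and $\mathcal{G}$ is the group of all permutations $\phi$ of $A$ with $\phi(P_{i})=P_{i}$ for all $i\in\omega$. *)

(* Defs.v *)
From Stdlib Require Import List.
Import ListNotations.

(** * First-order logic in the language of ZFA

    The language has equality, a binary symbol [Mem] for membership and a unary
    symbol [Atm] for "is an atom".  There are no function symbols, so terms are
    variables, in de Bruijn style (index 0 is the innermost binder). *)

Inductive form : Type :=
| Mem (i j : nat)
| Eql (i j : nat)
| Atm (i : nat)
| Bot
| Imp (p q : form)
| And (p q : form)
| Or (p q : form)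
| All (p : form)
| Ex (p : form).

Definition Neg (p : form) : form := Imp p Bot.
Definition Iff (p q : form) : form := And (Imp p q) (Imp q p).

Definition scons {X : Type} (x : X) (f : nat -> X) (k : nat) : X :=
  match k with 0 => x | S k => f k end.

Infix ".:" := scons (at level 55, right associativity).

Fixpoint ren (r : nat -> nat) (p : form) : form :=
  match p with
  | Mem i j => Mem (r i) (r j)
  | Eql i j => Eql (r i) (r j)
  | Atm i => Atm (r i)
  | Bot => Bot
  | Imp p q => Imp (ren r p) (ren r q)
  | And p q => And (ren r p) (ren r q)
  | Or p q => Or (ren r p) (ren r q)
  | All p => All (ren (0 .: fun k => S (r k)) p)
  | Ex p => Ex (ren (0 .: fun k => S (r k)) p)
  end.

Definition shift : form -> form := ren S.
Definition inst (p : form) (t : nat) : form := ren (t .: fun k => k) p.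

(** Classical natural deduction.  An axiom of [T] may have free variables and
    stands for its universal closure: [prv_ax] applies in every context, and
    [prv_allI] does not shift [T]. *)

Inductive prv (T : form -> Prop) : list form -> form -> Prop :=
| prv_ax G p : T p -> prv T G p
| prv_hyp G p : In p G -> prv T G p
| prv_impI G p q : prv T (p :: G) q -> prv T G (Imp p q)
| prv_impE G p q : prv T G (Imp p q) -> prv T G p -> prv T G q
| prv_raa G p : prv T (Neg p :: G) Bot -> prv T G p
| prv_andI G p q : prv T G p -> prv T G q -> prv T G (And p q)
| prv_andE1 G p q : prv T G (And p q) -> prv T G p
| prv_andE2 G p q : prv T G (And p q) -> prv T G q
| prv_orI1 G p q : prv T G p -> prv T G (Or p q)
| prv_orI2 G p q : prv T G q -> prv T G (Or p q)
| prv_orE G p q r :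
    prv T G (Or p q) -> prv T (p :: G) r -> prv T (q :: G) r -> prv T G r
| prv_allI G p : prv T (map shift G) p -> prv T G (All p)
| prv_allE G p t : prv T G (All p) -> prv T G (inst p t)
| prv_exI G p t : prv T G (inst p t) -> prv T G (Ex p)
| prv_exE G p q :
    prv T G (Ex p) -> prv T (p :: map shift G) (shift q) -> prv T G q
| prv_refl G t : prv T G (Eql t t)
| prv_subst G p s t :
    prv T G (Eql s t) -> prv T G (inst p s) -> prv T G (inst p t).

Definition provable (T : form -> Prop) (p : form) : Prop := prv T [] p.
Definition consistent (T : form -> Prop) : Prop := ~ provable T Bot.

Record structure : Type := Structure {
  dom :> Type;
  rmem : dom -> dom -> Prop;
  ratm : dom -> Prop
}.

Fixpoint sat (M : structure) (e : nat -> M) (p : form) : Prop :=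
  match p with
  | Mem i j => rmem M (e i) (e j)
  | Eql i j => e i = e j
  | Atm i => ratm M (e i)
  | Bot => False
  | Imp p q => sat M e p -> sat M e q
  | And p q => sat M e p /\ sat M e q
  | Or p q => sat M e p \/ sat M e q
  | All p => forall x : M, sat M (x .: e) p
  | Ex p => exists x : M, sat M (x .: e) p
  end.

(** * Named variables

    To write formulas with named bound variables, an [fm] is a formula
    parametrised by the number [d] of binders above it.  A name is the de Bruijn
    level of its binder (counted from the outside), i.e. the index [d - S x] at
    depth [d].  A closed formula [P : fm] denotes [P 0]. *)

Definition fm : Type := nat -> form.

Declare Scope fm_scope.
Delimit Scope fm_scope with fm.
Bind Scope fm_scope with fm.

Definition fmem (x y : nat) : fm := fun d => Mem (d - S x) (d - S y).
Definition feql (x y : nat) : fm := fun d => Eql (d - S x) (d - S y).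
Definition Atom (x : nat) : fm := fun d => Atm (d - S x).
Definition fneg (P : fm) : fm := fun d => Neg (P d).
Definition fimp (P Q : fm) : fm := fun d => Imp (P d) (Q d).
Definition fand (P Q : fm) : fm := fun d => And (P d) (Q d).
Definition for_ (P Q : fm) : fm := fun d => Or (P d) (Q d).
Definition fiff (P Q : fm) : fm := fun d => Iff (P d) (Q d).
Definition fall (P : nat -> fm) : fm := fun d => All (P d (S d)).
Definition fex (P : nat -> fm) : fm := fun d => Ex (P d (S d)).

Notation "x ∈ y" := (fmem x y) (at level 70) : fm_scope.
Notation "x ≐ y" := (feql x y) (at level 70) : fm_scope.
Notation "¬ P" := (fneg P) (at level 75, right associativity) : fm_scope.
Notation "P ∧ Q" := (fand P Q) (at level 80, right associativity) : fm_scope.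
Notation "P ∨ Q" := (for_ P Q) (at level 85, right associativity) : fm_scope.
Notation "P ⇒ Q" := (fimp P Q)
  (at level 90, Q at level 200, right associativity) : fm_scope.
Notation "P ⇔ Q" := (fiff P Q) (at level 95) : fm_scope.
Notation "∀ x .. y , P" := (fall (fun x => .. (fall (fun y => P)) ..))
  (at level 200, x binder, y binder, right associativity) : fm_scope.
Notation "∃ x .. y , P" := (fex (fun x => .. (fex (fun y => P)) ..))
  (at level 200, x binder, y binder, right associativity) : fm_scope.

Local Open Scope fm_scope.

Definition holds (M : structure) (P : fm) : Prop :=
  forall e : nat -> M, sat M e (P 0).

Definition holds2 (M : structure) (P : nat -> nat -> fm) (a b : M) : Prop :=
  sat M (b .: a .: fun _ => a) (P 0 1 2).

Definition holds3 (M : structure) (P : nat -> nat -> nat -> fm) (a b c : M) : Prop :=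
  sat M (c .: b .: a .: fun _ => a) (P 0 1 2 3).

(** * Basic set theory *)

Definition IsSet x : fm := ¬ Atom x.
Definition Empty x : fm := IsSet x ∧ ∀ z, ¬ z ∈ x.
(** [x] is a set and [x ⊆ y] *)
Definition Sub x y : fm := IsSet x ∧ ∀ z, z ∈ x ⇒ z ∈ y.
(** [u = {a, b}] *)
Definition IsUPair u a b : fm := IsSet u ∧ ∀ z, z ∈ u ⇔ z ≐ a ∨ z ≐ b.
(** [p = (a, b)] (Kuratowski) *)
Definition IsPair p a b : fm :=
  ∃ u v, IsUPair u a a ∧ IsUPair v a b ∧ IsUPair p u v.
(** [(a, b) ∈ R]; for a function [R] this says [R(a) = b] *)
Definition App R a b : fm := ∃ p, IsPair p a b ∧ p ∈ R.
(** [y = x ∪ {x}] *)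
Definition IsSucc x y : fm := IsSet y ∧ ∀ z, z ∈ y ⇔ z ∈ x ∨ z ≐ x.
Definition Inductive_ w : fm :=
  IsSet w ∧ (∃ z, Empty z ∧ z ∈ w) ∧ (∀ x, x ∈ w ⇒ ∃ y, IsSucc x y ∧ y ∈ w).
(** [w = ω] *)
Definition IsOmega w : fm := Inductive_ w ∧ ∀ v, Inductive_ v ⇒ Sub w v.
(** [A] is the set of all atoms *)
Definition IsAtomSet A : fm := IsSet A ∧ ∀ x, x ∈ A ⇔ Atom x.
Definition Disjoint x y : fm := ∀ z, ¬ (z ∈ x ∧ z ∈ y).

(** [R ⊆ X × Y] *)
Definition IsRel R X Y : fm :=
  IsSet R ∧ ∀ p, p ∈ R ⇒ ∃ a b, a ∈ X ∧ b ∈ Y ∧ IsPair p a b.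
Definition IsFun f X Y : fm :=
  IsRel f X Y ∧
  ∀ a, a ∈ X ⇒ (∃ b, App f a b) ∧ (∀ b c, App f a b ⇒ App f a c ⇒ b ≐ c).
Definition IsInj f X Y : fm :=
  IsFun f X Y ∧ ∀ a b c, App f a c ⇒ App f b c ⇒ a ≐ b.
Definition IsBij f X Y : fm :=
  IsInj f X Y ∧ ∀ c, c ∈ Y ⇒ ∃ a, App f a c.

Definition Finite x : fm :=
  ∃ w n f, IsOmega w ∧ n ∈ w ∧ IsBij f n x.
Definition Infinite x : fm := IsSet x ∧ ¬ Finite x.
Definition CountablyInfinite x : fm :=
  IsSet x ∧ ∃ w f, IsOmega w ∧ IsBij f w x.
(** [|x| ≰ ℵ₀] *)
Definition Uncountable x : fm :=
  IsSet x ∧ ¬ ∃ w f, IsOmega w ∧ IsInj f x w.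

(** [s] is a set with exactly (at most) [k] elements, [k] a standard number *)
Fixpoint CardEq (k : nat) (s : nat) : fm :=
  match k with
  | 0 => Empty s
  | S k => IsSet s ∧
           ∃ x t, CardEq k t ∧ ¬ x ∈ t ∧ ∀ z, z ∈ s ⇔ z ∈ t ∨ z ≐ x
  end.
Fixpoint CardLe (k : nat) (s : nat) : fm :=
  match k with
  | 0 => CardEq 0 s
  | S k => CardLe k s ∨ CardEq (S k) s
  end.

(** * ZFA and AC *)

Definition AxAtom : fm := ∀ x, Atom x ⇒ ∀ y, ¬ y ∈ x.
Definition AxAtomSet : fm := ∃ A, IsAtomSet A.
Definition AxExt : fm :=
  ∀ x y, IsSet x ⇒ IsSet y ⇒ (∀ z, z ∈ x ⇔ z ∈ y) ⇒ x ≐ y.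
Definition AxPairing : fm := ∀ a b, ∃ u, IsUPair u a b.
Definition AxUnion : fm :=
  ∀ x, ∃ y, IsSet y ∧ ∀ z, z ∈ y ⇔ ∃ t, t ∈ x ∧ z ∈ t.
Definition AxPower : fm := ∀ x, ∃ y, IsSet y ∧ ∀ z, z ∈ y ⇔ Sub z x.
Definition AxInfinity : fm := ∃ w, Inductive_ w.
Definition AxFoundation : fm :=
  ∀ x, (∃ y, y ∈ x) ⇒ ∃ y, y ∈ x ∧ Disjoint y x.

(** [∀ x ∃ y (y is a set ∧ ∀ z (z ∈ y ⇔ z ∈ x ∧ p(z, x, ...)))]: in [p], index 0
    is [z], index 1 is [x], the others are parameters; [y] is not free in [p]. *)
Definition AxSeparation (p : form) : form :=
  All (Ex (And (Neg (Atm 0))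
    (All (Iff (Mem 0 1) (And (Mem 0 2) (ren (0 .: fun k => k + 2) p)))))).

(** [∀ x ((∀ u ∈ x) (∀ v v') (p(v, u, x, ...) ⇒ p(v', u, x, ...) ⇒ v = v') ⇒
          ∃ y (y is a set ∧ ∀ v (v ∈ y ⇔ (∃ u ∈ x) p(v, u, x, ...))))]:
    in [p], index 0 is [v], 1 is [u], 2 is [x], the others are parameters. *)
Definition AxReplacement (p : form) : form :=
  All (Imp
    (All (Imp (Mem 0 1)
       (All (All (Imp (ren (1 .: 2 .: fun k => k + 3) p)
                 (Imp (ren (0 .: 2 .: fun k => k + 3) p) (Eql 1 0)))))))
    (Ex (And (Neg (Atm 0))
       (All (Iff (Mem 0 1)
                 (Ex (And (Mem 0 3) (ren (1 .: 0 .: fun k => k + 3) p)))))))).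

Inductive ZFA : form -> Prop :=
| ZFA_atom : ZFA (AxAtom 0)
| ZFA_atomset : ZFA (AxAtomSet 0)
| ZFA_ext : ZFA (AxExt 0)
| ZFA_pairing : ZFA (AxPairing 0)
| ZFA_union : ZFA (AxUnion 0)
| ZFA_power : ZFA (AxPower 0)
| ZFA_infinity : ZFA (AxInfinity 0)
| ZFA_foundation : ZFA (AxFoundation 0)
| ZFA_separation p : ZFA (AxSeparation p)
| ZFA_replacement p : ZFA (AxReplacement p).

(** every set of nonempty sets has a choice function *)
Definition AxChoice : fm :=
  ∀ X, (∀ x, x ∈ X ⇒ ∃ y, y ∈ x) ⇒
  ∃ f U, IsFun f X U ∧ ∀ x y, App f x y ⇒ y ∈ x.

Definition models_ZFA_AC (M : structure) : Prop :=
  (forall p, ZFA p -> forall e, sat M e p) /\ holds M AxChoice.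

(** non-implication in ZFA, under the consistency assumption *)
Definition does_not_imply (P Q : fm) : Prop :=
  consistent ZFA -> ~ provable ZFA ((P ⇒ Q) 0).

(** * The principles *)

(** [D = [X]^m] *)
Definition IsSubsets (m : nat) X D : fm :=
  IsSet D ∧ ∀ s, s ∈ D ⇔ Sub s X ∧ CardEq m s.

(** every fibre of [χ] over [C] has at most [n] elements *)
Definition Bounded (n : nat) χ C : fm :=
  ∀ c F, c ∈ C ⇒ IsSet F ⇒ (∀ s, s ∈ F ⇔ App χ s c) ⇒ CardLe n F.

Definition Polychromatic (m : nat) χ Z : fm :=
  ∀ s t c, Sub s Z ⇒ CardEq m s ⇒ Sub t Z ⇒ CardEq m t ⇒ ¬ s ≐ t ⇒
           ¬ (App χ s c ∧ App χ t c).

Definition RRT (m n : nat) : fm :=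
  ∀ X C D χ,
    Infinite X ⇒ Infinite C ⇒ IsSubsets m X D ⇒ IsFun χ D C ⇒ Bounded n χ C ⇒
    ∃ Y, Sub Y X ∧ Infinite Y ∧ Polychromatic m χ Y.

Definition Amorphous X : fm :=
  Infinite X ∧
  ¬ ∃ Y Z, Infinite Y ∧ Infinite Z ∧ Disjoint Y Z ∧
           ∀ x, x ∈ X ⇔ x ∈ Y ∨ x ∈ Z.

Definition NoAmorphous : fm := ¬ ∃ X, Amorphous X.

(** the strict relation [R] well-orders [X] *)
Definition WellOrders R X : fm :=
  IsRel R X X ∧
  (∀ x, ¬ App R x x) ∧
  (∀ x y z, App R x y ⇒ App R y z ⇒ App R x z) ∧
  (∀ x y, x ∈ X ⇒ y ∈ X ⇒ App R x y ∨ x ≐ y ∨ App R y x) ∧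
  (∀ S, Sub S X ⇒ (∃ x, x ∈ S) ⇒
        ∃ x, x ∈ S ∧ ∀ y, y ∈ S ⇒ x ≐ y ∨ App R x y).

Definition WOAM : fm :=
  ∀ X, IsSet X ⇒ (∃ R, WellOrders R X) ∨ (∃ Y, Sub Y X ∧ Amorphous Y).

Definition PartialOrder R P : fm :=
  IsSet P ∧ IsRel R P P ∧
  (∀ x, x ∈ P ⇒ App R x x) ∧
  (∀ x y, App R x y ⇒ App R y x ⇒ x ≐ y) ∧
  (∀ x y z, App R x y ⇒ App R y z ⇒ App R x z).

Definition HasMaximal R P : fm :=
  ∃ x, x ∈ P ∧ ∀ y, App R x y ⇒ y ≐ x.

Definition Cofinal C R P : fm :=
  Sub C P ∧ ∀ x, x ∈ P ⇒ ∃ c, c ∈ C ∧ App R x c.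

Definition CS : fm :=
  ∀ P R, PartialOrder R P ⇒ ¬ HasMaximal R P ⇒
  ∃ C D, Cofinal C R P ∧ Cofinal D R P ∧ Disjoint C D.

Definition Antichain Q R P : fm :=
  Sub Q P ∧
  ∀ x y, x ∈ Q ⇒ y ∈ Q ⇒ ¬ x ≐ y ⇒ ¬ App R x y ∧ ¬ App R y x.

Definition AntichainPrinciple : fm :=
  ∀ P R, PartialOrder R P ⇒
  ∃ Q, Antichain Q R P ∧ ∀ Q', Antichain Q' R P ⇒ Sub Q Q' ⇒ Q' ≐ Q.

Definition DeltaSystem B : fm :=
  ∃ r, IsSet r ∧
       ∀ x y, x ∈ B ⇒ y ∈ B ⇒ ¬ x ≐ y ⇒ ∀ z, z ∈ r ⇔ z ∈ x ∧ z ∈ y.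

Definition DeltaSL : fm :=
  ∀ A, Uncountable A ⇒ (∀ x, x ∈ A ⇒ IsSet x ∧ Finite x) ⇒
  ∃ B, Sub B A ∧ Uncountable B ∧ DeltaSystem B.

(** * Permutation models

    Everything is formulated inside [M]: the group [G], its elements, its
    subgroups and the filter [F] are elements of [M]. *)

Definition IsTransitive T : fm := ∀ x y, x ∈ T ⇒ y ∈ x ⇒ y ∈ T.

(** [T] is the transitive closure of [x], the least transitive set including [x] *)
Definition IsTC x T : fm :=
  Sub x T ∧ IsTransitive T ∧ ∀ T', IsTransitive T' ⇒ Sub x T' ⇒ Sub T T'.

(** [g(x) = y] for the extension of the permutation [g] of the atoms to the
    universe, defined by ∈-recursion: [g(t) = {g(s) : s ∈ t}] for sets [t].
    [f] is the restriction of this extension to a transitive set [T]. *)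
Definition Acts g x y : fm :=
  ∃ T U f, IsTransitive T ∧ x ∈ T ∧ IsFun f T U ∧
    (∀ t u, App f t u ⇒ Atom t ⇒ App g t u) ∧
    (∀ t u, App f t u ⇒ IsSet t ⇒
            IsSet u ∧ ∀ v, v ∈ u ⇔ ∃ s, s ∈ t ∧ App f s v) ∧
    App f x y.

(** [S = sym_G(x)] *)
Definition IsSym G x S : fm := IsSet S ∧ ∀ g, g ∈ S ⇔ g ∈ G ∧ Acts g x x.

(** [S = fix_G(E)] *)
Definition IsFix G E S : fm :=
  IsSet S ∧ ∀ g, g ∈ S ⇔ g ∈ G ∧ ∀ y, y ∈ E ⇒ Acts g y y.

(** [e = id_A], [h = f ∘ g], [h = f⁻¹] *)
Definition IsId e A : fm :=
  IsSet e ∧ ∀ p, p ∈ e ⇔ ∃ x, x ∈ A ∧ IsPair p x x.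
Definition IsComp f g h : fm :=
  IsSet h ∧ ∀ p, p ∈ h ⇔ ∃ x y z, IsPair p x z ∧ App g x y ∧ App f y z.
Definition IsInv f h : fm :=
  IsSet h ∧ ∀ p, p ∈ h ⇔ ∃ x y, IsPair p y x ∧ App f x y.

Definition IsSubgroup H G A : fm :=
  Sub H G ∧
  (∀ e, IsId e A ⇒ e ∈ H) ∧
  (∀ f g h, f ∈ H ⇒ g ∈ H ⇒ IsComp f g h ⇒ h ∈ H) ∧
  (∀ f h, f ∈ H ⇒ IsInv f h ⇒ h ∈ H).

(** [F] is a filter of subgroups of [G] *)
Definition IsFilter F G A : fm :=
  IsSet F ∧
  (∀ H, H ∈ F ⇒ IsSubgroup H G A) ∧
  G ∈ F ∧
  (∀ H K, H ∈ F ⇒ IsSubgroup K G A ⇒ Sub H K ⇒ K ∈ F) ∧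
  (∀ H K L, H ∈ F ⇒ K ∈ F ⇒ IsSet L ⇒ (∀ g, g ∈ L ⇔ g ∈ H ∧ g ∈ K) ⇒ L ∈ F).

Definition ContainsFixes F G A : fm :=
  ∀ E S, Sub E A ⇒ Finite E ⇒ IsFix G E S ⇒ S ∈ F.

(** [F] is the filter generated by [{fix_G(E) : E ∈ [A]^{<ω}}] *)
Definition IsFiniteSupportFilter F G A : fm :=
  IsFilter F G A ∧ ContainsFixes F G A ∧
  ∀ F', IsFilter F' G A ⇒ ContainsFixes F' G A ⇒ Sub F F'.

(** [sym_G(t) ∈ F] for all [t ∈ TC({x})] *)
Definition HereditarilySymmetric G F x : fm :=
  ∃ u T, IsUPair u x x ∧ IsTC u T ∧
    ∀ t, t ∈ T ⇒ ∃ S, IsSym G t S ∧ S ∈ F.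

Definition PermModel (M : structure) (G F : M) : structure := {|
  dom := {x : M | holds3 M HereditarilySymmetric G F x};
  rmem := fun x y => rmem M (proj1_sig x) (proj1_sig y);
  ratm := fun x => ratm M (proj1_sig x)
|}.

(** ** The group and filter of the basic Fraenkel model *)

Definition IsN1 G F : fm :=
  ∃ A, IsAtomSet A ∧ CountablyInfinite A ∧
    IsSet G ∧ (∀ g, g ∈ G ⇔ IsBij g A A) ∧
    IsFiniteSupportFilter F G A.

(** ** The group and filter of the Mostowski model

    [ℚ] is the set of equivalence classes of fractions [(p - q) / d], coded as
    [((p, q), d)] with [p, q, d ∈ ω], [d ≠ 0]. *)

(** [a + b = c] and [a * b = c] in [ω], by recursion on [b] *)
Definition NatAdd a b c : fm :=
  ∃ w f, IsOmega w ∧ a ∈ w ∧ IsFun f w w ∧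
    (∀ z, Empty z ⇒ App f z a) ∧
    (∀ k k' v v', App f k v ⇒ IsSucc k k' ⇒ IsSucc v v' ⇒ App f k' v') ∧
    App f b c.
Definition NatMul a b c : fm :=
  ∃ w f, IsOmega w ∧ a ∈ w ∧ IsFun f w w ∧
    (∀ z, Empty z ⇒ App f z z) ∧
    (∀ k k' v v', App f k v ⇒ IsSucc k k' ⇒ NatAdd v a v' ⇒ App f k' v') ∧
    App f b c.

Definition IsFrac p q d : fm :=
  ∃ w, IsOmega w ∧ p ∈ w ∧ q ∈ w ∧ d ∈ w ∧ ¬ Empty d.
Definition FracCode t p q d : fm := ∃ u, IsPair u p q ∧ IsPair t u d.

(** [l = p * d' + q' * d] and [r = p' * d + q * d'], so that
    [(p - q) / d < (p' - q') / d'] iff [l < r], and similarly for equality *)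
Definition CrossSums p q d p' q' d' l r : fm :=
  ∃ a b a' b', NatMul p d' a ∧ NatMul q' d b ∧ NatAdd a b l ∧
               NatMul p' d a' ∧ NatMul q d' b' ∧ NatAdd a' b' r.
Definition FracEq p q d p' q' d' : fm :=
  ∃ l, CrossSums p q d p' q' d' l l.
Definition FracLt p q d p' q' d' : fm :=
  ∃ l r, CrossSums p q d p' q' d' l r ∧ l ∈ r.

Definition IsRational x : fm :=
  ∃ p q d, IsFrac p q d ∧ IsSet x ∧
    ∀ t, t ∈ x ⇔
      ∃ p' q' d', IsFrac p' q' d' ∧ FracCode t p' q' d' ∧ FracEq p q d p' q' d'.
Definition RatLt x y : fm :=
  ∃ p q d p' q' d' s t,
    FracCode s p q d ∧ s ∈ x ∧ FracCode t p' q' d' ∧ t ∈ y ∧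
    FracLt p q d p' q' d'.

(** [(A, L) ≅ (ℚ, <)] *)
Definition IsoRationals A L : fm :=
  IsRel L A A ∧
  ∃ Q h, IsSet Q ∧ (∀ x, x ∈ Q ⇔ IsRational x) ∧ IsBij h A Q ∧
    ∀ a b x y, App h a x ⇒ App h b y ⇒ (App L a b ⇔ RatLt x y).

Definition IsOrderAut g A L : fm :=
  IsBij g A A ∧
  ∀ a b a' b', App g a a' ⇒ App g b b' ⇒ (App L a b ⇔ App L a' b').

Definition IsN3 G F : fm :=
  ∃ A L, IsAtomSet A ∧ CountablyInfinite A ∧ IsoRationals A L ∧
    IsSet G ∧ (∀ g, g ∈ G ⇔ IsOrderAut g A L) ∧
    IsFiniteSupportFilter F G A.

(** ** The group and filter of the Brunner/Pincus model

    The family [(P_i)_{i ∈ ω}] is a function [P] with domain [ω]. *)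

(** [g[p] = p] *)
Definition MapsOnto g p : fm :=
  ∀ y, y ∈ p ⇔ ∃ x, x ∈ p ∧ App g x y.

Definition IsN26 G F : fm :=
  ∃ A w P V, IsAtomSet A ∧ IsOmega w ∧ IsFun P w V ∧
    (∀ i p, App P i p ⇒ CountablyInfinite p) ∧
    (∀ i j p q, App P i p ⇒ App P j q ⇒ ¬ i ≐ j ⇒ Disjoint p q) ∧
    (∀ a, a ∈ A ⇔ ∃ i p, App P i p ∧ a ∈ p) ∧
    IsSet G ∧
    (∀ g, g ∈ G ⇔ IsBij g A A ∧ ∀ i p, App P i p ⇒ MapsOnto g p) ∧
    IsFiniteSupportFilter F G A.

(* Main.v *)
(** Work inside a model [M] of ZFA + AC, which may be nonstandard, so that Separation is only
    available for definable classes.  Let [x] be an element of a set [X] of the permutation model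
    which is not supported by the finite set [E] of atoms.  Removing atoms one at a time from a
    support of [x] yields a finite [E' ⊇ E] and an atom [a ∉ E'] such that [E' ∪ {a}] supports [x]
    and [E'] does not.  In the three models the orbit of [a] under [fix(E')] is infinite and
    [fix(E' ∪ {a})] is a maximal subgroup of [fix(E')]; hence [g a ↦ g x], [g ∈ fix(E')], is a
    well-defined bijection between the orbits of [a] and [x].

    RRT: if all elements of [X] have a common finite support, then so do the elements of an infinite
    polychromatic subset obtained in [M] from Ramsey's theorem.  Otherwise let [E] support [X] and the
    colouring; the orbit of [x] is polychromatic: if [s] and [t] are distinct [m]-subsets of the same
    colour, the elements of a finite support of the members of [s] can be fixed while a member of
    [t \ s] takes infinitely many values, which gives infinitely many sets of that colour.

    Delta-systems: in the first case use the Delta-system lemma of [M]; in the second case the orbit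
    of [x] is a Delta-system, whose root consists of the members of [x] supported by [E'].

    For the independence results the ground model consists of Aczel's well-founded trees over a type
    of atoms.  In the basic Fraenkel model the set of atoms is amorphous.  In the Mostowski model the
    set of atoms refutes WOAM, its order refutes CS, and [{(a, b) : a < b}], ordered by comparing
    second components of pairs with equal first components, has no maximal antichain. *)

(* Why the two orbits correspond: the stabilizer of [x] in fix([E']) contains fix([E' ∪ {a}]), the
   stabilizer of [a], and is not all of fix([E']); by maximality the two stabilizers coincide. The
   three models enter the positive results only through the infinitude of the orbit of [a] and this
   maximality, isolated as [moving] and [primitive]. They come from transpositions in two models and
   from a back-and-forth argument in the Mostowski model.

   The obstacle is that finiteness, [omega] and functions are those of an arbitrary model.
   Induction, recursion, Zorn's lemma and Ramsey's theorem therefore have to be proved inside it,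
   for predicates definable with parameters; the tactic [dn] discharges definability. Only [m] and
   [n] are standard, which permits recursion over the exponent in the metatheory and lists for
   [m]-subsets and colour classes.

   In the tree model Separation and Replacement hold for all predicates. Hence ZFA can be verified
   in its permutation models directly, using that group elements act as automorphisms, without
   translating truth in the permutation model back into a formula. *)
From Stdlib Require Import List Arith Lia Ring ZArith QArith Qcanon Cantor Lqa.
From Stdlib Require Import Classical ClassicalEpsilon FunctionalExtensionality.
From Stdlib Require Import PropExtensionality ProofIrrelevance.
Require Import Defs.
Import ListNotations.
Local Open Scope nat_scope.

(** * First-order logic *)

Lemma env_ext {X : Type} (e1 e2 : nat -> X) : (forall k, e1 k = e2 k) -> e1 = e2.
Proof. apply functional_extensionality. Qed.

Lemma sat_ren (M : structure) (p : form) : forall (r : nat -> nat) (e : nat -> M),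
  sat M e (ren r p) <-> sat M (fun k => e (r k)) p.
Proof.
  assert (H : forall (r : nat -> nat) (e : nat -> M) x,
    (fun k => (x .: e) ((0 .: fun k => S (r k)) k)) = (x .: fun k => e (r k))).
  { intros r e x; apply env_ext; intros [|k]; reflexivity. }
  induction p; intros r e; simpl; try tauto.
  - rewrite IHp1, IHp2; tauto.
  - rewrite IHp1, IHp2; tauto.
  - rewrite IHp1, IHp2; tauto.
  - split; intros K x; specialize (K x).
    + apply IHp in K. rewrite H in K; exact K.
    + apply IHp. rewrite H; exact K.
  - split; intros [x K]; exists x.
    + apply IHp in K. rewrite H in K; exact K.
    + apply IHp. rewrite H; exact K.
Qed.

Lemma sat_env_ext (M : structure) (e1 e2 : nat -> M) p :
  (forall k, e1 k = e2 k) -> sat M e1 p <-> sat M e2 p.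
Proof. intros H; rewrite (env_ext e1 e2 H); tauto. Qed.

Lemma sat_shift (M : structure) p x (e : nat -> M) :
  sat M (x .: e) (shift p) <-> sat M e p.
Proof. unfold shift; rewrite sat_ren; reflexivity. Qed.

Lemma sat_inst (M : structure) p t (e : nat -> M) :
  sat M e (inst p t) <-> sat M (e t .: e) p.
Proof.
  unfold inst; rewrite sat_ren.
  apply sat_env_ext; intros [|k]; reflexivity.
Qed.

Lemma soundness (T : form -> Prop) (M : structure) :
  (forall q, T q -> forall e, sat M e q) ->
  forall G p, prv T G p -> forall e, (forall q, In q G -> sat M e q) -> sat M e p.
Proof.
  intros HT G p H; induction H; intros e HG; simpl in *.
  - apply HT; assumption.
  - apply HG; assumption.
  - intros K. apply IHprv. intros r [<-|]; auto.
  - apply IHprv1; auto.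
  - apply NNPP; intros K. apply (IHprv e). intros r [<-|]; auto.
  - auto.
  - apply (IHprv e HG).
  - apply (IHprv e HG).
  - auto.
  - auto.
  - destruct (IHprv1 e HG); [apply IHprv2 | apply IHprv3]; intros s [<-|]; auto.
  - intros x. apply IHprv. intros q Hq. apply in_map_iff in Hq as [q' [<- Hq]].
    apply sat_shift; auto.
  - apply sat_inst. apply IHprv; auto.
  - exists (e t). apply sat_inst; auto.
  - destruct (IHprv1 e HG) as [x Hx]. apply (sat_shift M q x). apply IHprv2.
    intros r [<-|Hr]; auto. apply in_map_iff in Hr as [q' [<- Hr]].
    apply sat_shift; auto.
  - reflexivity.
  - apply sat_inst. rewrite <- (IHprv1 e HG). apply sat_inst; auto.
Qed.

Lemma provable_sat (T : form -> Prop) (M : structure) p :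
  provable T p -> (forall q, T q -> forall e, sat M e q) -> forall e, sat M e p.
Proof. intros H HT e. apply (soundness T M HT [] p H). intros q []. Qed.

(** Later applied to the map by which a group element acts on a permutation model; sets defined from
    supported parameters thereby inherit a support. The right inverse [h'] supplies witnesses for
    the quantifiers. *)
Lemma sat_iso (M : structure) (h h' : M -> M) :
  (forall x, h (h' x) = x) -> (forall x y, h x = h y -> x = y) ->
  (forall x y, rmem M (h x) (h y) <-> rmem M x y) ->
  (forall x, ratm M (h x) <-> ratm M x) ->
  forall p e, sat M (fun k => h (e k)) p <-> sat M e p.
Proof.
  intros hK hI hM hA.
  assert (H : forall x e, (fun k => h ((x .: e) k)) = (h x .: fun k => h (e k))).
  { intros x e; apply env_ext; intros [|k]; reflexivity. }
  induction p; intros e; simpl; auto; try tauto.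
  - split; [apply hI | congruence].
  - rewrite IHp1, IHp2; tauto.
  - rewrite IHp1, IHp2; tauto.
  - rewrite IHp1, IHp2; tauto.
  - split; intros K x.
    + apply IHp. rewrite H; apply K.
    + rewrite <- (hK x), <- H. apply IHp, K.
  - split; intros [x K].
    + exists (h' x). apply IHp. rewrite H, hK; exact K.
    + exists (h x). rewrite <- H. apply IHp, K.
Qed.

(** Bounds the free indices, so that a formula reads only finitely many entries of its environment;
    finitely many parameters have a common finite support. *)
Fixpoint var_bound (p : form) : nat :=
  match p with
  | Mem i j => S (max i j)
  | Eql i j => S (max i j)
  | Atm i => S i
  | Bot => 0
  | Imp p q | And p q | Or p q => max (var_bound p) (var_bound q)
  | All p | Ex p => pred (var_bound p)
  end.

Lemma sat_var_bound (M : structure) p : forall e1 e2 : nat -> M,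
  (forall k, k < var_bound p -> e1 k = e2 k) -> (sat M e1 p <-> sat M e2 p).
Proof.
  induction p; intros e1 e2 H; simpl in *.
  - rewrite (H i), (H j) by lia; tauto.
  - rewrite (H i), (H j) by lia; tauto.
  - rewrite (H i) by lia; tauto.
  - tauto.
  - rewrite (IHp1 e1 e2), (IHp2 e1 e2) by (intros; apply H; lia); tauto.
  - rewrite (IHp1 e1 e2), (IHp2 e1 e2) by (intros; apply H; lia); tauto.
  - rewrite (IHp1 e1 e2), (IHp2 e1 e2) by (intros; apply H; lia); tauto.
  - assert (K : forall x, sat M (x .: e1) p <-> sat M (x .: e2) p).
    { intros x; apply IHp; intros [|k] Hk; simpl; auto. apply H; lia. }
    split; intros L x; apply K, L.
  - assert (K : forall x, sat M (x .: e1) p <-> sat M (x .: e2) p).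
    { intros x; apply IHp; intros [|k] Hk; simpl; auto. apply H; lia. }
    split; intros [x L]; exists x; apply K, L.
Qed.

(** * Definability with parameters *)

Section Definability.
Context {M : structure}.

(** [inl j] is the [j]-th argument, [inr c] the parameter [c] *)
Definition arg (e : nat -> M) (v : nat + M) : M :=
  match v with inl j => e j | inr c => c end.

(** Separation and Replacement of the object theory only apply to predicates [P] of the
    metatheory with [Dn P]: those given by a formula with parameters. *)
Definition Dn (P : (nat -> M) -> Prop) : Prop :=
  exists (p : form) (r : nat -> nat + M), forall e, P e <-> sat M (fun i => arg e (r i)) p.

(** A term is definable when its graph is. The value sits at index 0 and the arguments are shifted,
    as if the value were a freshly bound variable. *)
Definition Dt (t : (nat -> M) -> M) : Prop :=
  Dn (fun e => e 0 = t (fun i => e (S i))).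

Definition D1 (R : M -> Prop) : Prop := Dn (fun e => R (e 0)).
Definition D2 (R : M -> M -> Prop) : Prop := Dn (fun e => R (e 0) (e 1)).
Definition D3 (R : M -> M -> M -> Prop) : Prop := Dn (fun e => R (e 0) (e 1) (e 2)).
Definition D4 (R : M -> M -> M -> M -> Prop) : Prop :=
  Dn (fun e => R (e 0) (e 1) (e 2) (e 3)).

Lemma Dn_ext P Q : (forall e, P e <-> Q e) -> Dn P -> Dn Q.
Proof. intros H (p & r & K); exists p, r; intros e; rewrite <- H; apply K. Qed.

Lemma Dn_bin (c : form -> form -> form) (C : Prop -> Prop -> Prop) P Q :
  (forall e p q, sat M e (c p q) <-> C (sat M e p) (sat M e q)) ->
  (forall A A' B B', (A <-> A') -> (B <-> B') -> (C A B <-> C A' B')) ->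
  Dn P -> Dn Q -> Dn (fun e => C (P e) (Q e)).
Proof.
  intros Hc HC (p & r & Hp) (q & s & Hq).
  (* The two formulas read disjoint parts of a common environment: [p] the even indices, [q] the odd
     ones. *)
  exists (c (ren (fun i => 2 * i) p) (ren (fun i => 2 * i + 1) q)).
  exists (fun i => if Nat.even i then r (Nat.div2 i) else s (Nat.div2 i)).
  intros e. rewrite Hc. apply HC; rewrite sat_ren.
  - rewrite Hp. apply sat_env_ext; intros k.
    rewrite Nat.even_mul; simpl Nat.even.
    rewrite Nat.div2_double; reflexivity.
  - rewrite Hq. apply sat_env_ext; intros k.
    rewrite Nat.add_1_r, Nat.even_succ, Nat.odd_mul, Nat.div2_succ_double; reflexivity.
Qed.

Lemma Dn_imp (P Q : (nat -> M) -> Prop) : Dn P -> Dn Q -> Dn (fun e => P e -> Q e).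
Proof. apply (Dn_bin Imp (fun A B => A -> B)); simpl; tauto. Qed.
Lemma Dn_and (P Q : (nat -> M) -> Prop) : Dn P -> Dn Q -> Dn (fun e => P e /\ Q e).
Proof. apply (Dn_bin And and); simpl; tauto. Qed.
Lemma Dn_or (P Q : (nat -> M) -> Prop) : Dn P -> Dn Q -> Dn (fun e => P e \/ Q e).
Proof. apply (Dn_bin Or or); simpl; tauto. Qed.
Lemma Dn_false : Dn (fun _ => False).
Proof. exists Bot, inl; simpl; tauto. Qed.
Lemma Dn_true : Dn (fun _ => True).
Proof. exists (Imp Bot Bot), inl; simpl; tauto. Qed.
Lemma Dn_not (P : (nat -> M) -> Prop) : Dn P -> Dn (fun e => ~ P e).
Proof. intros H; apply (Dn_imp P _ H Dn_false). Qed.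
Lemma Dn_iff (P Q : (nat -> M) -> Prop) : Dn P -> Dn Q -> Dn (fun e => P e <-> Q e).
Proof. intros; apply Dn_and; apply Dn_imp; assumption. Qed.

(** Excluded middle turns a proposition without arguments into truth or falsity, so arbitrary facts
    of the metatheory may occur inside a definable predicate. *)
Lemma Dn_const (P : Prop) : Dn (fun _ => P).
Proof.
  destruct (classic P) as [H|H].
  - apply (Dn_ext (fun _ => True)); [tauto | apply Dn_true].
  - apply (Dn_ext (fun _ => False)); [tauto | apply Dn_false].
Qed.

(** A quantifier over standard numbers below a standard bound is a finite conjunction. *)
Lemma Dn_lt (P : nat -> (nat -> M) -> Prop) n :
  (forall k, Dn (P k)) -> Dn (fun e => forall k, k < n -> P k e).
Proof.
  intros H; induction n.
  - apply (Dn_ext (fun _ => True)); [intros e; split; auto; lia | apply Dn_true].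
  - apply (Dn_ext (fun e => (forall k, k < n -> P k e) /\ P n e)); [|apply Dn_and; auto].
    intros e; split.
    + intros [K L] k Hk. destruct (Nat.eq_dec k n) as [->|]; auto. apply K; lia.
    + auto.
Qed.

(** Passing a binder: an index that reads argument 0 becomes the bound variable, every other index
    [i] becomes [S i], and the remaining arguments are lowered by one. The value at [inl 0] is a
    filler, since [bind_index] leaves no variable that reads it. *)
Definition under_binder (v : nat + M) : nat + M :=
  match v with inl 0 => inl 0 | inl (S j) => inl j | inr c => inr c end.
Definition bind_index (r : nat -> nat + M) (i : nat) : nat :=
  match r i with inl 0 => 0 | _ => S i end.

Lemma bind_env (r : nat -> nat + M) (e : nat -> M) x :
  (fun k => (x .: fun i => arg e (under_binder (r i))) (bind_index r k)) =
  (fun i => arg (x .: e) (r i)).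
Proof.
  apply env_ext; intros k; unfold bind_index.
  destruct (r k) as [[|j]|c] eqn:E; simpl; rewrite ?E; reflexivity.
Qed.

Lemma Dn_all (Q : M -> (nat -> M) -> Prop) :
  Dn (fun e => Q (e 0) (fun i => e (S i))) -> Dn (fun e => forall x, Q x e).
Proof.
  intros (p & r & H). exists (All (ren (bind_index r) p)), (fun i => under_binder (r i)).
  intros e; simpl. split; intros K x; specialize (K x).
  - rewrite sat_ren, bind_env. apply (H (x .: e)), K.
  - rewrite sat_ren, bind_env in K. apply (H (x .: e)) in K. exact K.
Qed.

Lemma Dn_ex (Q : M -> (nat -> M) -> Prop) :
  Dn (fun e => Q (e 0) (fun i => e (S i))) -> Dn (fun e => exists x, Q x e).
Proof.
  intros (p & r & H). exists (Ex (ren (bind_index r) p)), (fun i => under_binder (r i)).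
  intros e; simpl. split; intros [x K]; exists x.
  - rewrite sat_ren, bind_env. apply (H (x .: e)), K.
  - rewrite sat_ren, bind_env in K. apply (H (x .: e)) in K. exact K.
Qed.

Lemma Dn_comp (P : (nat -> M) -> Prop) (r : nat -> nat + M) :
  Dn P -> Dn (fun e => P (fun i => arg e (r i))).
Proof.
  intros (p & s & H).
  exists p, (fun i => match s i with inl j => r j | inr c => inr c end).
  intros e. rewrite H. apply sat_env_ext; intros k; destruct (s k); reflexivity.
Qed.

Lemma D2_mem : D2 (rmem M).
Proof. exists (Mem 0 1), inl; simpl; tauto. Qed.
Lemma D2_eq : D2 eq.
Proof. exists (Eql 0 1), inl; simpl; tauto. Qed.
Lemma D1_atm : D1 (ratm M).
Proof. exists (Atm 0), inl; simpl; tauto. Qed.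

Lemma Dt_var i : Dt (fun e => e i).
Proof. exists (Eql 0 1), (fun k => match k with 0 => inl 0 | _ => inl (S i) end); simpl; tauto. Qed.
Lemma Dt_const c : Dt (fun _ => c).
Proof. exists (Eql 0 1), (fun k => match k with 0 => inl 0 | _ => inr c end); simpl; tauto. Qed.

(** The object language has no function symbols, so a term is substituted by quantifying over a
    variable that equals it. *)
Lemma Dn_subst (P : M -> (nat -> M) -> Prop) (t : (nat -> M) -> M) :
  Dn (fun e => P (e 0) (fun i => e (S i))) -> Dt t -> Dn (fun e => P (t e) e).
Proof.
  intros HP Ht.
  apply (Dn_ext (fun e => exists x, x = t e /\ P x e)).
  - intros e; split; [intros (x & -> & K); exact K | eauto].
  - apply (Dn_ex (fun x e => x = t e /\ P x e)). apply Dn_and; assumption.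
Qed.

Lemma Dn_D1 (R : M -> Prop) t : D1 R -> Dt t -> Dn (fun e => R (t e)).
Proof.
  intros HR Ht. apply (Dn_subst (fun x e => R x)); [|assumption]. exact HR.
Qed.

Lemma Dn_D2 (R : M -> M -> Prop) t u : D2 R -> Dt t -> Dt u -> Dn (fun e => R (t e) (u e)).
Proof.
  intros HR Ht Hu. apply (Dn_subst (fun x e => R x (u e))); [|assumption].
  apply (Dn_subst (fun y e => R (e 0) y) (fun e => u (fun i => e (S i)))).
  - apply (Dn_comp (fun e => R (e 0) (e 1))
      (fun i => match i with 0 => inl 1 | _ => inl 0 end)) in HR. exact HR.
  - apply (Dn_comp _ (fun i => match i with 0 => inl 0 | S i => inl (S (S i)) end)) in Hu.
    exact Hu.
Qed.

Lemma Dn_D3 (R : M -> M -> M -> Prop) t u v :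
  D3 R -> Dt t -> Dt u -> Dt v -> Dn (fun e => R (t e) (u e) (v e)).
Proof.
  intros HR Ht Hu Hv.
  apply (Dn_ext (fun e => exists x, x = v e /\ exists y, y = u e /\ exists z, z = t e /\ R z y x)).
  { intros e; split; [intros (x & -> & y & -> & z & -> & K); exact K | eauto 10]. }
  apply (Dn_ex (fun x e => x = v e /\ exists y, y = u e /\ exists z, z = t e /\ R z y x)).
  apply Dn_and; [exact Hv|].
  apply (Dn_ex (fun y e => y = u (fun i => e (S i)) /\ exists z, z = t (fun i => e (S i)) /\ R z y (e 0))).
  apply Dn_and.
  - apply (Dn_comp _ (fun i => match i with 0 => inl 0 | S i => inl (S (S i)) end)) in Hu.
    exact Hu.
  - apply (Dn_ex (fun z e => z = t (fun i => e (S (S i))) /\ R z (e 0) (e 1))).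
    apply Dn_and.
    + apply (Dn_comp _ (fun i => match i with 0 => inl 0 | S i => inl (S (S (S i))) end)) in Ht.
      exact Ht.
    + exact HR.
Qed.

Lemma Dn_D4 (R : M -> M -> M -> M -> Prop) t u v w :
  D4 R -> Dt t -> Dt u -> Dt v -> Dt w -> Dn (fun e => R (t e) (u e) (v e) (w e)).
Proof.
  intros HR Ht Hu Hv Hw.
  apply (Dn_ext (fun e => exists s, s = w e /\ exists x, x = v e /\ exists y, y = u e /\ exists z, z = t e /\ R z y x s)).
  { intros e; split; [intros (s & -> & x & -> & y & -> & z & -> & K); exact K | eauto 12]. }
  apply (Dn_ex (fun s e => s = w e /\ exists x, x = v e /\ exists y, y = u e /\ exists z, z = t e /\ R z y x s)).
  apply Dn_and; [exact Hw|].
  apply (Dn_ex (fun x e => x = v (fun i => e (S i)) /\ exists y, y = u (fun i => e (S i)) /\ exists z, z = t (fun i => e (S i)) /\ R z y x (e 0))).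
  apply Dn_and.
  { apply (Dn_comp _ (fun i => match i with 0 => inl 0 | S i => inl (S (S i)) end)) in Hv.
    exact Hv. }
  apply (Dn_ex (fun y e => y = u (fun i => e (S (S i))) /\ exists z, z = t (fun i => e (S (S i))) /\ R z y (e 0) (e 1))).
  apply Dn_and.
  { apply (Dn_comp _ (fun i => match i with 0 => inl 0 | S i => inl (S (S (S i))) end)) in Hu.
    exact Hu. }
  apply (Dn_ex (fun z e => z = t (fun i => e (S (S (S i)))) /\ R z (e 0) (e 1) (e 2))).
  apply Dn_and.
  - apply (Dn_comp _ (fun i => match i with 0 => inl 0 | S i => inl (S (S (S (S i)))) end)) in Ht.
    exact Ht.
  - exact HR.
Qed.

Definition F1 (f : M -> M) : Prop := D2 (fun y x => y = f x).
Definition F2 (f : M -> M -> M) : Prop := D3 (fun z x y => z = f x y).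
Definition F3 (f : M -> M -> M -> M) : Prop := D4 (fun z x y w => z = f x y w).

Lemma Dt_shift t : Dt t -> Dt (fun e => t (fun i => e (S i))).
Proof.
  intros Ht.
  apply (Dn_comp _ (fun i => match i with 0 => inl 0 | S i => inl (S (S i)) end)) in Ht.
  exact Ht.
Qed.

Lemma Dt_F1 f t : F1 f -> Dt t -> Dt (fun e => f (t e)).
Proof.
  intros Hf Ht. apply (Dn_D2 (fun y x => y = f x) (fun e => e 0) (fun e => t (fun i => e (S i)))); auto.
  - apply Dt_var.
  - apply Dt_shift; auto.
Qed.
Lemma Dt_F2 f t u : F2 f -> Dt t -> Dt u -> Dt (fun e => f (t e) (u e)).
Proof.
  intros Hf Ht Hu.
  apply (Dn_D3 (fun z x y => z = f x y) (fun e => e 0) (fun e => t (fun i => e (S i)))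
    (fun e => u (fun i => e (S i)))); auto using Dt_var, Dt_shift.
Qed.
Lemma Dt_F3 f t u v : F3 f -> Dt t -> Dt u -> Dt v -> Dt (fun e => f (t e) (u e) (v e)).
Proof.
  intros Hf Ht Hu Hv.
  apply (Dn_D4 (fun z x y w => z = f x y w) (fun e => e 0) (fun e => t (fun i => e (S i)))
    (fun e => u (fun i => e (S i))) (fun e => v (fun i => e (S i)))); auto using Dt_var, Dt_shift.
Qed.

End Definability.

Create HintDb dn discriminated.
#[export] Hint Resolve D2_mem D2_eq D1_atm : dn.

Ltac dn_rel := solve [eauto 2 with dn nocore].

(** Hooks called by [dn]; they are redefined further down, once set comprehension, [iota] and
    recursion have become definable terms. *)
Ltac dn_extra := fail.
Ltac dn_unfold := fail.

Ltac dn :=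
  cbv beta;
  match goal with
  | |- D1 _ => first [dn_rel | unfold D1; dn]
  | |- D2 _ => first [dn_rel | unfold D2; dn]
  | |- D3 _ => first [dn_rel | unfold D3; dn]
  | |- D4 _ => first [dn_rel | unfold D4; dn]
  | |- F1 _ => first [dn_rel | unfold F1, D2; dn]
  | |- F2 _ => first [dn_rel | unfold F2, D3; dn]
  | |- F3 _ => first [dn_rel | unfold F3, D4; dn]
  | |- Dt _ => dn_term
  | |- Dn (fun _ => ?P) => apply (Dn_const P)
  | |- Dn (fun e => @?P e /\ @?Q e) => apply (Dn_and P Q); dn
  | |- Dn (fun e => @?P e \/ @?Q e) => apply (Dn_or P Q); dn
  | |- Dn (fun e => ~ @?P e) => apply (Dn_not P); dn
  | |- Dn (fun e => @?P e <-> @?Q e) => apply (Dn_iff P Q); dn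
  | |- Dn (fun e => @?P e -> @?Q e) => apply (Dn_imp P Q); dn
  | |- Dn (fun e => forall x, @?Q e x) => apply (Dn_all (fun x e => Q e x)); dn
  | |- Dn (fun e => exists x, @?Q e x) => apply (Dn_ex (fun x e => Q e x)); dn
  | |- Dn (fun e => ?R (@?a e) (@?b e) (@?c e) (@?d e)) =>
      apply (Dn_D4 R a b c d); [dn_rel | dn | dn | dn | dn]
  | |- Dn (fun e => ?R (@?a e) (@?b e) (@?c e)) =>
      apply (Dn_D3 R a b c); [dn_rel | dn | dn | dn]
  | |- Dn (fun e => ?R (@?a e) (@?b e)) => apply (Dn_D2 R a b); [dn_rel | dn | dn]
  | |- Dn (fun e => ?R (@?a e)) => apply (Dn_D1 R a); [dn_rel | dn]
  end
with dn_term :=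
  match goal with
  | |- Dt (fun _ => ?c) => apply (Dt_const c)
  | |- Dt (fun e => e ?i) => apply (Dt_var i)
  | |- Dt (fun e => ?f (@?a e) (@?b e) (@?c e)) =>
      apply (Dt_F3 f a b c); [dn_rel | dn | dn | dn]
  | |- Dt (fun e => ?f (@?a e) (@?b e)) => apply (Dt_F2 f a b); [dn_rel | dn | dn]
  | |- Dt (fun e => ?f (@?a e)) => apply (Dt_F1 f a); [dn_rel | dn]
  | |- _ => dn_extra
  end.

(** * Meaning of the formulas in a structure *)

Section Meaning.
Context (M : structure).
Local Notation "x ∊ y" := (rmem M x y) (at level 70).

(** The definitions of this section copy the object formulas connective by connective, so that [sat]
    mostly unfolds to them by conversion. *)
Definition isset (x : M) := ~ ratm M x.
Definition empty (x : M) := isset x /\ forall z, ~ z ∊ x.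
Definition sub (x y : M) := isset x /\ forall z, z ∊ x -> z ∊ y.
Definition isupair (u a b : M) := isset u /\ forall z, z ∊ u <-> z = a \/ z = b.
Definition ispair (p a b : M) := exists u v, isupair u a a /\ isupair v a b /\ isupair p u v.
Definition app (R a b : M) := exists p, ispair p a b /\ p ∊ R.
Definition issucc (x y : M) := isset y /\ forall z, z ∊ y <-> z ∊ x \/ z = x.
Definition inductive (w : M) :=
  isset w /\ (exists z, empty z /\ z ∊ w) /\ (forall x, x ∊ w -> exists y, issucc x y /\ y ∊ w).
Definition isomega (w : M) := inductive w /\ forall v, inductive v -> sub w v.
Definition isatomset (A : M) := isset A /\ forall x, x ∊ A <-> ratm M x.
Definition disjoint (x y : M) := forall z, ~ (z ∊ x /\ z ∊ y).
Definition isrel (R X Y : M) :=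
  isset R /\ forall p, p ∊ R -> exists a b, a ∊ X /\ b ∊ Y /\ ispair p a b.
Definition isfun (f X Y : M) :=
  isrel f X Y /\
  forall a, a ∊ X -> (exists b, app f a b) /\ (forall b c, app f a b -> app f a c -> b = c).
Definition isinj (f X Y : M) :=
  isfun f X Y /\ forall a b c, app f a c -> app f b c -> a = b.
Definition isbij (f X Y : M) := isinj f X Y /\ forall c, c ∊ Y -> exists a, app f a c.
Definition finite (x : M) := exists w n f, isomega w /\ n ∊ w /\ isbij f n x.
Definition infinite (x : M) := isset x /\ ~ finite x.
Definition cinfinite (x : M) := isset x /\ exists w f, isomega w /\ isbij f w x.
Definition uncountable (x : M) := isset x /\ ~ exists w f, isomega w /\ isinj f x w.

Fixpoint cardeq (k : nat) (s : M) : Prop :=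
  match k with
  | 0 => empty s
  | S k => isset s /\ exists x t, cardeq k t /\ ~ x ∊ t /\ forall z, z ∊ s <-> z ∊ t \/ z = x
  end.
Fixpoint cardle (k : nat) (s : M) : Prop :=
  match k with 0 => cardeq 0 s | S k => cardle k s \/ cardeq (S k) s end.

Definition issubsets (m : nat) (X D : M) :=
  isset D /\ forall s, s ∊ D <-> sub s X /\ cardeq m s.
Definition bounded (n : nat) (χ C : M) :=
  forall c F, c ∊ C -> isset F -> (forall s, s ∊ F <-> app χ s c) -> cardle n F.
Definition polychromatic (m : nat) (χ Z : M) :=
  forall s t c, sub s Z -> cardeq m s -> sub t Z -> cardeq m t -> ~ s = t ->
    ~ (app χ s c /\ app χ t c).
Definition rrt (m n : nat) :=
  forall X C D χ, infinite X -> infinite C -> issubsets m X D -> isfun χ D C ->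
    bounded n χ C -> exists Y, sub Y X /\ infinite Y /\ polychromatic m χ Y.

Definition amorphous (X : M) :=
  infinite X /\ ~ exists Y Z, infinite Y /\ infinite Z /\ disjoint Y Z /\
    forall x, x ∊ X <-> x ∊ Y \/ x ∊ Z.
Definition noamorphous := ~ exists X, amorphous X.

Definition wellorders (R X : M) :=
  isrel R X X /\ (forall x, ~ app R x x) /\
  (forall x y z, app R x y -> app R y z -> app R x z) /\
  (forall x y, x ∊ X -> y ∊ X -> app R x y \/ x = y \/ app R y x) /\
  (forall S, sub S X -> (exists x, x ∊ S) ->
     exists x, x ∊ S /\ forall y, y ∊ S -> x = y \/ app R x y).
Definition woam :=
  forall X, isset X -> (exists R, wellorders R X) \/ (exists Y, sub Y X /\ amorphous Y).

Definition partialorder (R P : M) :=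
  isset P /\ isrel R P P /\ (forall x, x ∊ P -> app R x x) /\
  (forall x y, app R x y -> app R y x -> x = y) /\
  (forall x y z, app R x y -> app R y z -> app R x z).
Definition hasmaximal (R P : M) := exists x, x ∊ P /\ forall y, app R x y -> y = x.
Definition cofinal (C R P : M) := sub C P /\ forall x, x ∊ P -> exists c, c ∊ C /\ app R x c.
Definition cs :=
  forall P R, partialorder R P -> ~ hasmaximal R P ->
    exists C D, cofinal C R P /\ cofinal D R P /\ disjoint C D.
Definition antichain (Q R P : M) :=
  sub Q P /\ forall x y, x ∊ Q -> y ∊ Q -> ~ x = y -> ~ app R x y /\ ~ app R y x.
Definition antichain_principle :=
  forall P R, partialorder R P ->
    exists Q, antichain Q R P /\ forall Q', antichain Q' R P -> sub Q Q' -> Q' = Q.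

Definition deltasystem (B : M) :=
  exists r, isset r /\ forall x y, x ∊ B -> y ∊ B -> ~ x = y -> forall z, z ∊ r <-> z ∊ x /\ z ∊ y.
Definition deltasl :=
  forall A, uncountable A -> (forall x, x ∊ A -> isset x /\ finite x) ->
    exists B, sub B A /\ uncountable B /\ deltasystem B.

Definition transitive (T : M) := forall x y, x ∊ T -> y ∊ x -> y ∊ T.
Definition istc (x T : M) :=
  sub x T /\ transitive T /\ forall T', transitive T' -> sub x T' -> sub T T'.
Definition acts (g x y : M) :=
  exists T U f, transitive T /\ x ∊ T /\ isfun f T U /\
    (forall t u, app f t u -> ratm M t -> app g t u) /\
    (forall t u, app f t u -> isset t ->
       isset u /\ forall v, v ∊ u <-> exists s, s ∊ t /\ app f s v) /\
    app f x y.
Definition issym (G x S : M) := isset S /\ forall g, g ∊ S <-> g ∊ G /\ acts g x x.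
Definition isfix (G E S : M) :=
  isset S /\ forall g, g ∊ S <-> g ∊ G /\ forall y, y ∊ E -> acts g y y.
Definition isid (e A : M) := isset e /\ forall p, p ∊ e <-> exists x, x ∊ A /\ ispair p x x.
Definition iscomp (f g h : M) :=
  isset h /\ forall p, p ∊ h <-> exists x y z, ispair p x z /\ app g x y /\ app f y z.
Definition isinv (f h : M) := isset h /\ forall p, p ∊ h <-> exists x y, ispair p y x /\ app f x y.
Definition issubgroup (H G A : M) :=
  sub H G /\ (forall e, isid e A -> e ∊ H) /\
  (forall f g h, f ∊ H -> g ∊ H -> iscomp f g h -> h ∊ H) /\
  (forall f h, f ∊ H -> isinv f h -> h ∊ H).
Definition isfilter (F G A : M) :=
  isset F /\ (forall H, H ∊ F -> issubgroup H G A) /\ G ∊ F /\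
  (forall H K, H ∊ F -> issubgroup K G A -> sub H K -> K ∊ F) /\
  (forall H K L, H ∊ F -> K ∊ F -> isset L -> (forall g, g ∊ L <-> g ∊ H /\ g ∊ K) -> L ∊ F).
Definition containsfixes (F G A : M) :=
  forall E S, sub E A -> finite E -> isfix G E S -> S ∊ F.
Definition isfsfilter (F G A : M) :=
  isfilter F G A /\ containsfixes F G A /\
  forall F', isfilter F' G A -> containsfixes F' G A -> sub F F'.
Definition hersym (G F x : M) :=
  exists u T, isupair u x x /\ istc u T /\ forall t, t ∊ T -> exists S, issym G t S /\ S ∊ F.

Definition isN1 (G F : M) :=
  exists A, isatomset A /\ cinfinite A /\ isset G /\ (forall g, g ∊ G <-> isbij g A A) /\
    isfsfilter F G A.

Definition natadd (a b c : M) :=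
  exists w f, isomega w /\ a ∊ w /\ isfun f w w /\ (forall z, empty z -> app f z a) /\
    (forall k k' v v', app f k v -> issucc k k' -> issucc v v' -> app f k' v') /\ app f b c.
Definition natmul (a b c : M) :=
  exists w f, isomega w /\ a ∊ w /\ isfun f w w /\ (forall z, empty z -> app f z z) /\
    (forall k k' v v', app f k v -> issucc k k' -> natadd v a v' -> app f k' v') /\ app f b c.
Definition isfrac (p q d : M) :=
  exists w, isomega w /\ p ∊ w /\ q ∊ w /\ d ∊ w /\ ~ empty d.
Definition fraccode (t p q d : M) := exists u, ispair u p q /\ ispair t u d.
Definition crosssums (p q d p' q' d' l r : M) :=
  exists a b a' b', natmul p d' a /\ natmul q' d b /\ natadd a b l /\
    natmul p' d a' /\ natmul q d' b' /\ natadd a' b' r.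
Definition fraceq (p q d p' q' d' : M) := exists l, crosssums p q d p' q' d' l l.
Definition fraclt (p q d p' q' d' : M) := exists l r, crosssums p q d p' q' d' l r /\ l ∊ r.
Definition isrational (x : M) :=
  exists p q d, isfrac p q d /\ isset x /\
    forall t, t ∊ x <->
      exists p' q' d', isfrac p' q' d' /\ fraccode t p' q' d' /\ fraceq p q d p' q' d'.
Definition ratlt (x y : M) :=
  exists p q d p' q' d' s t,
    fraccode s p q d /\ s ∊ x /\ fraccode t p' q' d' /\ t ∊ y /\ fraclt p q d p' q' d'.
Definition isorationals (A L : M) :=
  isrel L A A /\
  exists Q h, isset Q /\ (forall x, x ∊ Q <-> isrational x) /\ isbij h A Q /\
    forall a b x y, app h a x -> app h b y -> (app L a b <-> ratlt x y).
Definition isorderaut (g A L : M) :=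
  isbij g A A /\ forall a b a' b', app g a a' -> app g b b' -> (app L a b <-> app L a' b').
Definition isN3 (G F : M) :=
  exists A L, isatomset A /\ cinfinite A /\ isorationals A L /\ isset G /\
    (forall g, g ∊ G <-> isorderaut g A L) /\ isfsfilter F G A.

Definition mapsonto (g p : M) := forall y, y ∊ p <-> exists x, x ∊ p /\ app g x y.
Definition isN26 (G F : M) :=
  exists A w P V, isatomset A /\ isomega w /\ isfun P w V /\
    (forall i p, app P i p -> cinfinite p) /\
    (forall i j p q, app P i p -> app P j q -> ~ i = j -> disjoint p q) /\
    (forall a, a ∊ A <-> exists i p, app P i p /\ a ∊ p) /\
    isset G /\
    (forall g, g ∊ G <-> isbij g A A /\ forall i p, app P i p -> mapsonto g p) /\
    isfsfilter F G A.

End Meaning.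

(** The recursion over [k] blocks conversion. Names are binder levels, so the induction has to allow
    every depth [d] above the name [s]. *)
Lemma sat_CardEq (M : structure) k : forall s d (e : nat -> M), s < d ->
  sat M e (CardEq k s d) <-> cardeq M k (e (d - S s)).
Proof.
  induction k; intros s d e Hs.
  - cbn -[Nat.sub]. assert (E : S d - S s = S (d - S s)) by lia. unfold empty, isset.
    rewrite (Nat.sub_diag (S d)), E. reflexivity.
  - cbn -[Nat.sub]. unfold isset.
    assert (E : S (S (S d)) - S s = S (S (S (d - S s)))) by lia.
    replace (S (S (S d)) - S (S (S d))) with 0 by lia.
    replace (S (S (S d)) - S (S d)) with 1 by lia.
    replace (S (S (S d)) - S d) with 2 by lia.
    replace (S (S d) - S (S d)) with 0 by lia.
    replace (S (S d) - S d) with 1 by lia.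
    rewrite E; cbn -[Nat.sub].
    split; intros [H (x & t & K & L)]; (split; [exact H|]); exists x, t; split; try exact L;
      specialize (IHk (S d) (S (S d)) (t .: x .: e) ltac:(lia));
      replace (S (S d) - S (S d)) with 0 in IHk by lia; apply IHk, K.
Qed.

Lemma sat_CardLe (M : structure) k s d (e : nat -> M) : s < d ->
  sat M e (CardLe k s d) <-> cardle M k (e (d - S s)).
Proof.
  intros Hs; induction k.
  - apply (sat_CardEq M 0); auto.
  - change (sat M e (CardLe k s d) \/ sat M e (CardEq (S k) s d) <->
            cardle M k (e (d - S s)) \/ cardeq M (S k) (e (d - S s))).
    rewrite IHk, sat_CardEq; tauto.
Qed.

Lemma iff_all {X} (P Q : X -> Prop) :
  (forall x, P x <-> Q x) -> ((forall x, P x) <-> (forall x, Q x)).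
Proof. firstorder. Qed.
Lemma iff_ex {X} (P Q : X -> Prop) :
  (forall x, P x <-> Q x) -> ((exists x, P x) <-> (exists x, Q x)).
Proof. firstorder. Qed.
Lemma iff_imp (P P' Q Q' : Prop) : (P <-> P') -> (Q <-> Q') -> ((P -> Q) <-> (P' -> Q')).
Proof. tauto. Qed.
Lemma iff_and (P P' Q Q' : Prop) : (P <-> P') -> (Q <-> Q') -> ((P /\ Q) <-> (P' /\ Q')).
Proof. tauto. Qed.

(** Conversion settles every subformula except those containing [CardEq] or [CardLe]. *)
Lemma sat_RRT (M : structure) m n (e : nat -> M) : sat M e (RRT m n 0) <-> rrt M m n.
Proof.
  unfold rrt. do 4 (apply iff_all; intro).
  apply iff_imp; [apply iff_refl|].
  apply iff_imp; [apply iff_refl|].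
  apply iff_imp.
  { apply iff_and; [apply iff_refl|]. apply iff_all; intro.
    apply iff_and; apply iff_imp; try apply iff_refl;
      (apply iff_and; [apply iff_refl|]); apply sat_CardEq; lia. }
  apply iff_imp; [apply iff_refl|].
  apply iff_imp.
  { do 2 (apply iff_all; intro). do 3 (apply iff_imp; [apply iff_refl|]).
    apply sat_CardLe; lia. }
  apply iff_ex; intro. apply iff_and; [apply iff_refl|]. apply iff_and; [apply iff_refl|].
  do 3 (apply iff_all; intro).
  apply iff_imp; [apply iff_refl|]. apply iff_imp; [apply sat_CardEq; lia|].
  apply iff_imp; [apply iff_refl|]. apply iff_imp; [apply sat_CardEq; lia|].
  apply iff_refl.
Qed.

Lemma sat_NoAmorphous (M : structure) (e : nat -> M) : sat M e (NoAmorphous 0) <-> noamorphous M.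
Proof. apply iff_refl. Qed.
Lemma sat_WOAM (M : structure) (e : nat -> M) : sat M e (WOAM 0) <-> woam M.
Proof. apply iff_refl. Qed.
Lemma sat_CS (M : structure) (e : nat -> M) : sat M e (CS 0) <-> cs M.
Proof. apply iff_refl. Qed.
Lemma sat_Antichain (M : structure) (e : nat -> M) :
  sat M e (AntichainPrinciple 0) <-> antichain_principle M.
Proof. apply iff_refl. Qed.

(** * Set theory inside a model of ZFA *)

Class zfa_model := {
  uni :> structure;
  dflt : uni;
  zfa_sat : forall p, ZFA p -> forall e : nat -> uni, sat uni e p
}.

Notation "x ∊ y" := (rmem uni x y) (at level 70).
Notation set := (isset uni).

Section Basics.
Context {Z : zfa_model}.

(** The value [dflt] when there is no unique witness makes [iota] definable without side condition. *)
Definition iota (P : uni -> Prop) : uni :=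
  epsilon (inhabits dflt) (fun y =>
    (P y /\ forall y', P y' -> y' = y) \/
    (~ (exists y, P y /\ forall y', P y' -> y' = y) /\ y = dflt)).

Lemma iota_spec (P : uni -> Prop) y :
  y = iota P <->
  ((P y /\ forall y', P y' -> y' = y) \/
   (~ (exists y, P y /\ forall y', P y' -> y' = y) /\ y = dflt)).
Proof.
  unfold iota. set (Q := fun y => _).
  assert (H : Q (epsilon (inhabits dflt) Q)).
  { apply epsilon_spec. unfold Q.
    destruct (classic (exists y, P y /\ forall y', P y' -> y' = y)) as [[x K]|K]; eauto. }
  assert (Hu : forall a b, Q a -> Q b -> a = b).
  { unfold Q; intros a b [[Ha Ha']|[Ha ->]] [[Hb Hb']|[Hb ->]]; auto; exfalso; eauto. }
  split; [intros ->; exact H | intros K; apply Hu; assumption].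
Qed.

Lemma iotaP (P : uni -> Prop) y : P y -> (forall y', P y' -> y' = y) -> P (iota P).
Proof. intros H K. replace (iota P) with y; auto. apply iota_spec; auto. Qed.

Lemma iota_eq (P : uni -> Prop) y : P y -> (forall y', P y' -> y' = y) -> iota P = y.
Proof. intros H K. symmetry; apply iota_spec; auto. Qed.

Lemma Dt_iota (P : (nat -> uni) -> uni -> Prop) :
  Dn (fun e => P (fun i => e (S i)) (e 0)) -> Dt (fun e => iota (P e)).
Proof.
  intros H.
  assert (H' : forall j, Dn (fun e => P (fun i => e (j + i)) (e 0)) ).
  { intros j.
    apply (Dn_comp _ (fun i => match i with 0 => inl 0 | S i => inl (j + i) end)) in H.
    exact H. }
  assert (H1 : Dn (fun e => P (fun i => e (S (S i))) (e 0))) by apply (H' 2).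
  assert (H2 : Dn (fun e => P (fun i => e (S (S (S i)))) (e 0))) by apply (H' 3).
  assert (K : Dn (fun e => exists y, P (fun i => e (S i)) y /\
              forall y', P (fun i => e (S i)) y' -> y' = y)).
  { apply (Dn_ex (fun y e => P (fun i => e (S i)) y /\ forall y', P (fun i => e (S i)) y' -> y' = y)).
    apply Dn_and; [exact H1|].
    apply (Dn_all (fun y' e => P (fun i => e (S (S i))) y' -> y' = e 0)).
    apply Dn_imp; [exact H2 | dn]. }
  unfold Dt. eapply Dn_ext; [intros e; symmetry; apply iota_spec|].
  apply Dn_or; apply Dn_and.
  - exact H.
  - apply (Dn_all (fun y' e => P (fun i => e (S i)) y' -> y' = e 0)).
    apply Dn_imp; [exact H1 | dn].
  - apply Dn_not, K.
  - dn.
Qed.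

Definition small (P : uni -> Prop) := exists y, set y /\ forall z, z ∊ y <-> P z.
Definition setof (P : uni -> Prop) : uni := iota (fun y => set y /\ forall z, z ∊ y <-> P z).

Lemma atom_empty x y : ratm uni x -> ~ y ∊ x.
Proof. intros H. exact (zfa_sat _ ZFA_atom (fun _ => x) x H y). Qed.

Lemma mem_set x y : y ∊ x -> set x.
Proof. intros H K. exact (atom_empty x y K H). Qed.

Lemma set_ext x y : set x -> set y -> (forall z, z ∊ x <-> z ∊ y) -> x = y.
Proof. exact (zfa_sat _ ZFA_ext (fun _ => x) x y). Qed.

Lemma sub_antisym x y : set x -> set y -> sub uni x y -> sub uni y x -> x = y.
Proof. intros Hx Hy [_ H] [_ K]; apply set_ext; auto. split; auto. Qed.

Lemma setofP (P : uni -> Prop) : small P -> set (setof P) /\ forall z, z ∊ setof P <-> P z.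
Proof.
  intros (y & Hy & H). unfold setof. apply iotaP with y; auto.
  intros y' [K L]. apply set_ext; auto. intros z; rewrite H, L; tauto.
Qed.
Lemma in_setof (P : uni -> Prop) : small P -> forall z, z ∊ setof P <-> P z.
Proof. intros H; apply (setofP P H). Qed.
Lemma set_setof (P : uni -> Prop) : small P -> set (setof P).
Proof. intros H; apply (setofP P H). Qed.

Lemma Dt_setof (P : (nat -> uni) -> uni -> Prop) :
  Dn (fun e => P (fun i => e (S i)) (e 0)) -> Dt (fun e => setof (P e)).
Proof.
  intros H. unfold setof.
  apply (Dt_iota (fun e y => set y /\ forall z, z ∊ y <-> P e z)). unfold isset.
  apply Dn_and; [dn|].
  apply (Dn_all (fun z e => z ∊ e 0 <-> P (fun i => e (S i)) z)).
  apply Dn_iff; [dn|].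
  apply (Dn_comp _ (fun i => match i with 0 => inl 0 | S i => inl (S (S i)) end)) in H.
  exact H.
Qed.

Lemma small_sep (P : uni -> Prop) x : D1 P -> small (fun z => z ∊ x /\ P z).
Proof.
  intros (p & r & H).
  (* The parameters of [p] are moved behind [z] and [x] in the environment. An index that names an
     absent argument reads the arbitrary value [x]. *)
  pose (q := ren (fun i => match r i with inl 0 => 0 | _ => S (S i) end) p).
  pose (e := fun i => match r i with inr c => c | inl _ => x end).
  destruct (zfa_sat _ (ZFA_separation q) e x) as (y & Hy & K).
  exists y; split; [exact Hy|]. intros z. specialize (K z).
  change (z ∊ y <-> z ∊ x /\ sat uni (z .: y .: x .: e) (ren (0 .: fun k => k + 2) q)) in K.
  rewrite K. apply iff_and; [tauto|]. unfold q.
  rewrite !sat_ren, (H (fun i => match i with 0 => z | _ => x end)).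
  apply sat_env_ext. intros k. unfold e.
  destruct (r k) as [[|j]|c] eqn:E; cbn; rewrite ?E; try reflexivity;
    replace (k + 2) with (S (S k)) by lia; cbn; rewrite E; reflexivity.
Qed.

Lemma small_bound (P : uni -> Prop) x : D1 P -> (forall z, P z -> z ∊ x) -> small P.
Proof.
  intros H K. destruct (small_sep P x H) as (y & Hy & L). exists y; split; auto.
  intros z; rewrite L; split; [tauto | auto].
Qed.

Lemma small_repl (R : uni -> uni -> Prop) x : D2 R ->
  (forall u v v', u ∊ x -> R u v -> R u v' -> v = v') ->
  small (fun v => exists u, u ∊ x /\ R u v).
Proof.
  intros (p & r & H) HR.
  pose (q := ren (fun i => match r i with inl 0 => 1 | inl 1 => 0 | _ => S (S (S i)) end) p).
  pose (e := fun i => match r i with inr c => c | inl _ => x end).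
  assert (Hq : forall u v, sat uni (v .: u .: x .: e) q <-> R u v).
  { intros u v. unfold q. rewrite sat_ren, (H (fun i => match i with 0 => u | 1 => v | _ => x end)).
    apply sat_env_ext; intros k. unfold e.
    destruct (r k) as [[|[|j]]|c] eqn:E; cbn; rewrite ?E; reflexivity. }
  destruct (zfa_sat _ (ZFA_replacement q) e x) as (y & Hy & K).
  - intros u Hu v v' K1 K2. apply (HR u); auto; apply Hq.
    + change (sat uni (v' .: v .: u .: x .: e) (ren (1 .: 2 .: fun k => k + 3) q)) in K1.
      rewrite sat_ren in K1. eapply sat_env_ext; [|exact K1].
      intros [|[|[|k]]]; try reflexivity. cbn. rewrite Nat.add_comm; reflexivity.
    + change (sat uni (v' .: v .: u .: x .: e) (ren (0 .: 2 .: fun k => k + 3) q)) in K2.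
      rewrite sat_ren in K2. eapply sat_env_ext; [|exact K2].
      intros [|[|[|k]]]; try reflexivity. cbn. rewrite Nat.add_comm; reflexivity.
  - exists y; split; [exact Hy|]. intros v. specialize (K v).
    change (v ∊ y <-> exists u, u ∊ x /\
      sat uni (u .: v .: y .: x .: e) (ren (1 .: 0 .: fun k => k + 3) q)) in K.
    rewrite K. apply iff_ex; intros u. apply iff_and; [tauto|]. rewrite sat_ren, <- Hq.
    apply sat_env_ext. intros [|[|[|k]]]; try reflexivity. cbn. rewrite Nat.add_comm; reflexivity.
Qed.

Definition upair a b := setof (fun z => z = a \/ z = b).
Definition pair a b := upair (upair a a) (upair a b).
Definition union x := setof (fun z => exists t, t ∊ x /\ z ∊ t).
Definition pow x := setof (fun z => sub uni z x).
Definition sep x (P : uni -> Prop) := setof (fun z => z ∊ x /\ P z).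
Definition repl x (f : uni -> uni) := setof (fun v => exists u, u ∊ x /\ v = f u).
Definition emp := setof (fun _ => False).
Definition adj x a := setof (fun z => z ∊ x \/ z = a).
Definition cup x y := setof (fun z => z ∊ x \/ z ∊ y).

Lemma upairP a b : small (fun z => z = a \/ z = b).
Proof.
  destruct (zfa_sat _ ZFA_pairing (fun _ => a) a b) as (u & Hu & H). exists u; split; [exact Hu | exact H].
Qed.
Lemma in_upair a b z : z ∊ upair a b <-> z = a \/ z = b.
Proof. apply in_setof, upairP. Qed.
Lemma set_upair a b : set (upair a b).
Proof. apply set_setof, upairP. Qed.
Lemma unionP x : small (fun z => exists t, t ∊ x /\ z ∊ t).
Proof.
  destruct (zfa_sat _ ZFA_union (fun _ => x) x) as (u & Hu & H). exists u; split; [exact Hu | exact H].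
Qed.
Lemma in_union x z : z ∊ union x <-> exists t, t ∊ x /\ z ∊ t.
Proof. apply in_setof, unionP. Qed.
Lemma set_union x : set (union x).
Proof. apply set_setof, unionP. Qed.
Lemma powP x : small (fun z => sub uni z x).
Proof.
  destruct (zfa_sat _ ZFA_power (fun _ => x) x) as (u & Hu & H). exists u; split; [exact Hu | exact H].
Qed.
Lemma in_pow x z : z ∊ pow x <-> sub uni z x.
Proof. apply (in_setof (fun z => sub uni z x)), powP. Qed.
Lemma set_pow x : set (pow x).
Proof. apply (set_setof (fun z => sub uni z x)), powP. Qed.
Lemma in_sep x P z : D1 P -> z ∊ sep x P <-> z ∊ x /\ P z.
Proof. intros; apply (in_setof (fun z => z ∊ x /\ P z)), small_sep; auto. Qed.
Lemma set_sep x P : D1 P -> set (sep x P).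
Proof. intros; apply set_setof, small_sep; auto. Qed.
Lemma sub_sep x P : D1 P -> sub uni (sep x P) x.
Proof. intros H; split; [apply set_sep; auto | intros z K; apply in_sep in K; tauto]. Qed.
Lemma small_F1 x f : F1 f -> small (fun v => exists u, u ∊ x /\ v = f u).
Proof.
  intros H. apply (small_repl (fun u v => v = f u)); [|congruence].
  apply (Dn_comp _ (fun i => match i with 0 => inl 1 | _ => inl 0 end)) in H. exact H.
Qed.
Lemma in_repl x f v : F1 f -> v ∊ repl x f <-> exists u, u ∊ x /\ v = f u.
Proof. intros; apply in_setof, small_F1; auto. Qed.
Lemma set_repl x f : F1 f -> set (repl x f).
Proof. intros; apply set_setof, small_F1; auto. Qed.
Lemma empP : small (fun _ => False).
Proof. apply (small_bound _ dflt); [dn | tauto]. Qed.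
Lemma in_emp z : ~ z ∊ emp.
Proof. intros H. apply (in_setof _ empP) in H. exact H. Qed.
Lemma set_emp : set emp.
Proof. apply set_setof, empP. Qed.
Lemma cupP x y : small (fun z => z ∊ x \/ z ∊ y).
Proof.
  apply (small_bound _ (union (upair x y))); [dn|].
  intros z H; apply in_union. destruct H; [exists x | exists y]; rewrite in_upair; auto.
Qed.
Lemma in_cup x y z : z ∊ cup x y <-> z ∊ x \/ z ∊ y.
Proof. apply in_setof, cupP. Qed.
Lemma set_cup x y : set (cup x y).
Proof. apply set_setof, cupP. Qed.
Lemma adjP x a : small (fun z => z ∊ x \/ z = a).
Proof.
  destruct (cupP x (upair a a)) as (y & Hy & H). exists y; split; auto.
  intros z; rewrite H, in_upair; tauto.
Qed.
Lemma in_adj x a z : z ∊ adj x a <-> z ∊ x \/ z = a.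
Proof. apply in_setof, adjP. Qed.
Lemma set_adj x a : set (adj x a).
Proof. apply set_setof, adjP. Qed.

Lemma empty_emp x : empty uni x <-> x = emp.
Proof.
  split.
  - intros [H K]. apply set_ext; auto using set_emp. intros z; split; intros L.
    + destruct (K z L).
    + destruct (in_emp z L).
  - intros ->; split; [apply set_emp | apply in_emp].
Qed.
Lemma isupair_iff u a b : isupair uni u a b <-> u = upair a b.
Proof.
  split.
  - intros [H K]; apply set_ext; auto using set_upair. intros z; rewrite K, in_upair; tauto.
  - intros ->; split; [apply set_upair | intros; apply in_upair].
Qed.
Lemma ispair_iff p a b : ispair uni p a b <-> p = pair a b.
Proof.
  unfold ispair. split.
  - intros (u & v & H1 & H2 & H3). apply isupair_iff in H1, H2, H3. subst; reflexivity.
  - intros ->. exists (upair a a), (upair a b). rewrite !isupair_iff; auto.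
Qed.
Lemma upair_inj a b c d : upair a b = upair c d -> (a = c /\ b = d) \/ (a = d /\ b = c).
Proof.
  intros H.
  assert (K : forall z, (z = a \/ z = b) <-> (z = c \/ z = d)).
  { intros z; rewrite <- !in_upair, H; tauto. }
  pose proof (proj1 (K a) (or_introl eq_refl)). pose proof (proj1 (K b) (or_intror eq_refl)).
  pose proof (proj2 (K c) (or_introl eq_refl)). pose proof (proj2 (K d) (or_intror eq_refl)).
  intuition congruence.
Qed.
Lemma pair_inj a b c d : pair a b = pair c d -> a = c /\ b = d.
Proof.
  unfold pair; intros H. apply upair_inj in H as [[H K]|[H K]];
    apply upair_inj in H; apply upair_inj in K; intuition congruence.
Qed.
Lemma set_pair a b : set (pair a b).
Proof. apply set_upair. Qed.
Lemma app_iff R a b : app uni R a b <-> pair a b ∊ R.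
Proof.
  unfold app; split.
  - intros (p & H & K). apply ispair_iff in H; subst; auto.
  - intros H; exists (pair a b); rewrite ispair_iff; auto.
Qed.
Lemma issucc_iff x y : issucc uni x y <-> y = adj x x.
Proof.
  split.
  - intros [H K]; apply set_ext; auto using set_adj. intros z; rewrite K, in_adj; tauto.
  - intros ->; split; [apply set_adj | intros; apply in_adj].
Qed.

Lemma adj_mem x a : a ∊ x -> adj x a = x.
Proof.
  intros H. apply set_ext; auto using set_adj; [eapply mem_set; eauto|].
  intros z; rewrite in_adj. split; [intros [K| ->]; auto | auto].
Qed.
End Basics.

Ltac dn_extra ::=
  match goal with
  | |- Dt (fun e => setof (fun z => @?P e z)) => apply (Dt_setof (fun e z => P e z)); dn
  | |- Dt (fun e => iota (fun z => @?P e z)) => apply (Dt_iota (fun e z => P e z)); dn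
  | |- Dt (fun e => sep _ _) => unfold sep at 1; dn
  | |- Dt (fun e => repl _ _) => unfold repl at 1; dn
  | |- _ => dn_unfold
  end.

(** * Definability of the basic notions of set theory *)

Section Definable.
Context {Z : zfa_model}.
Lemma D1_set : D1 set. Proof. unfold isset; dn. Qed.
Lemma D2_sub : D2 (sub uni). Proof. unfold sub, isset; dn. Qed.
Lemma F2_upair : F2 upair. Proof. change (Dt (fun e => upair (e 0) (e 1))); unfold upair; dn. Qed.
Hint Resolve F2_upair D1_set D2_sub : dn.
Lemma F2_pair : F2 pair. Proof. change (Dt (fun e => pair (e 0) (e 1))); unfold pair; dn. Qed.
Lemma F1_union : F1 union. Proof. change (Dt (fun e => union (e 0))); unfold union; dn. Qed.
Lemma F1_pow : F1 pow. Proof. change (Dt (fun e => pow (e 0))); unfold pow; dn. Qed.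
Lemma F2_adj : F2 adj. Proof. change (Dt (fun e => adj (e 0) (e 1))); unfold adj; dn. Qed.
Lemma F2_cup : F2 cup. Proof. change (Dt (fun e => cup (e 0) (e 1))); unfold cup; dn. Qed.
Lemma D1_empty : D1 (empty uni). Proof. unfold empty; dn. Qed.
Lemma D3_isupair : D3 (isupair uni). Proof. unfold isupair; dn. Qed.
Hint Resolve D3_isupair : dn.
Lemma D3_ispair : D3 (ispair uni). Proof. unfold ispair; dn. Qed.
Hint Resolve D3_ispair : dn.
Lemma D3_app : D3 (app uni). Proof. unfold app; dn. Qed.
Lemma D2_issucc : D2 (issucc uni). Proof. unfold issucc; dn. Qed.
Hint Resolve D3_app D2_issucc D1_empty : dn.
Lemma D1_inductive : D1 (inductive uni). Proof. unfold inductive; dn. Qed.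
Hint Resolve D1_inductive : dn.
Lemma D1_isomega : D1 (isomega uni). Proof. unfold isomega; dn. Qed.
Lemma D2_disjoint : D2 (disjoint uni). Proof. unfold disjoint; dn. Qed.
Lemma D3_isrel : D3 (isrel uni). Proof. unfold isrel; dn. Qed.
Hint Resolve D3_isrel D1_isomega : dn.
Lemma D3_isfun : D3 (isfun uni). Proof. unfold isfun; dn. Qed.
Hint Resolve D3_isfun : dn.
Lemma D3_isinj : D3 (isinj uni). Proof. unfold isinj; dn. Qed.
Hint Resolve D3_isinj : dn.
Lemma D3_isbij : D3 (isbij uni). Proof. unfold isbij; dn. Qed.
Hint Resolve D3_isbij : dn.
Lemma D1_finite : D1 (finite uni). Proof. unfold finite; dn. Qed.
Hint Resolve D1_finite : dn.
Lemma D1_infinite : D1 (infinite uni). Proof. unfold infinite; dn. Qed.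
Lemma D1_uncountable : D1 (uncountable uni). Proof. unfold uncountable; dn. Qed.
Lemma D1_transitive : D1 (transitive uni). Proof. unfold transitive; dn. Qed.
Hint Resolve D1_transitive : dn.
Lemma D2_istc : D2 (istc uni). Proof. unfold istc; dn. Qed.
Lemma D3_acts : D3 (acts uni). Proof. unfold acts; dn. Qed.
Lemma D1_cardeq k : D1 (cardeq uni k). Proof. induction k; simpl; dn. Qed.
End Definable.
#[export] Hint Resolve D1_set D2_sub F2_upair F2_pair F1_union F1_pow F2_adj F2_cup D1_empty
  D3_isupair D3_ispair D3_app D2_issucc D1_inductive D1_isomega D2_disjoint D3_isrel D3_isfun
  D3_isinj D3_isbij D1_finite D1_infinite D1_uncountable D1_transitive D2_istc D3_acts D1_cardeq : dn.

(** * Products, graphs and functions *)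

Section Functions.
Context {Z : zfa_model}.

Lemma sub_trans x y z : sub uni x y -> sub uni y z -> sub uni x z.
Proof. intros [H K] [_ L]; split; auto. Qed.
Lemma sub_refl x : set x -> sub uni x x.
Proof. split; auto. Qed.

Definition prod X Y := setof (fun p => exists a b, a ∊ X /\ b ∊ Y /\ p = pair a b).

Lemma prodP X Y : small (fun p => exists a b, a ∊ X /\ b ∊ Y /\ p = pair a b).
Proof.
  apply (small_bound _ (pow (pow (cup X Y)))); [dn|].
  intros p (a & b & Ha & Hb & ->). apply in_pow. split; [apply set_pair|].
  intros u Hu. apply in_pow. apply in_upair in Hu as [->| ->]; (split; [apply set_upair|]);
    intros z Hz; apply in_upair in Hz as [->| ->]; apply in_cup; auto.
Qed.
Lemma in_prod X Y a b : pair a b ∊ prod X Y <-> a ∊ X /\ b ∊ Y.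
Proof.
  unfold prod. rewrite (in_setof _ (prodP X Y)). split.
  - intros (a' & b' & H & K & E). apply pair_inj in E as [-> ->]; auto.
  - intros []; eauto 6.
Qed.
Lemma in_prod_ex X Y p : p ∊ prod X Y <-> exists a b, a ∊ X /\ b ∊ Y /\ p = pair a b.
Proof. apply (in_setof _ (prodP X Y)). Qed.
Lemma F2_prod : F2 prod. Proof. change (Dt (fun e => prod (e 0) (e 1))); unfold prod; dn. Qed.

Definition graph X Y (R : uni -> uni -> Prop) :=
  setof (fun p => exists a b, a ∊ X /\ b ∊ Y /\ R a b /\ p = pair a b).

Lemma graphP X Y R : D2 R -> small (fun p => exists a b, a ∊ X /\ b ∊ Y /\ R a b /\ p = pair a b).
Proof.
  intros HR. apply (small_bound _ (prod X Y)); [dn|].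
  intros p (a & b & Ha & Hb & _ & ->). apply in_prod; auto.
Qed.
Lemma in_graph X Y R a b : D2 R -> pair a b ∊ graph X Y R <-> a ∊ X /\ b ∊ Y /\ R a b.
Proof.
  intros HR. unfold graph. rewrite (in_setof _ (graphP X Y R HR)). split.
  - intros (a' & b' & H & K & L & E). apply pair_inj in E as [-> ->]; auto.
  - intros (? & ? & ?); eauto 8.
Qed.
Lemma in_graph_ex X Y R p : D2 R ->
  p ∊ graph X Y R <-> exists a b, a ∊ X /\ b ∊ Y /\ R a b /\ p = pair a b.
Proof. intros HR. apply (in_setof _ (graphP X Y R HR)). Qed.
Lemma set_graph X Y R : D2 R -> set (graph X Y R).
Proof. intros HR. apply (set_setof _ (graphP X Y R HR)). Qed.

(** [isfun] in terms of [pair], without the existential quantifiers hidden in [ispair] and [app]. *)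
Record fn (f X Y : uni) : Prop := {
  fn_set : set f;
  fn_pairs : forall p, p ∊ f -> exists a b, p = pair a b;
  fn_dom : forall a b, pair a b ∊ f -> a ∊ X;
  fn_cod : forall a b, pair a b ∊ f -> b ∊ Y;
  fn_tot : forall a, a ∊ X -> exists b, pair a b ∊ f;
  fn_fun : forall a b c, pair a b ∊ f -> pair a c ∊ f -> b = c
}.

Lemma isfun_iff f X Y : isfun uni f X Y <-> fn f X Y.
Proof.
  split.
  - intros [[H K] L].
    assert (K' : forall a b, pair a b ∊ f -> a ∊ X /\ b ∊ Y).
    { intros a b Hp. destruct (K _ Hp) as (a' & b' & Ha & Hb & E).
      apply ispair_iff in E. apply pair_inj in E as [-> ->]; auto. }
    split; auto; try (intros; eapply K'; eauto; fail).
    + intros p Hp. destruct (K _ Hp) as (a & b & _ & _ & E). apply ispair_iff in E; eauto.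
    + intros a Ha. destruct (L a Ha) as [[b Hb] _]. exists b; apply app_iff, Hb.
    + intros a b c Hb Hc. destruct (L a (proj1 (K' _ _ Hb))) as [_ U].
      apply U; apply app_iff; auto.
  - intros [H1 H2 H3 H4 H5 H6]. split; [split|]; auto.
    + intros p Hp. destruct (H2 p Hp) as (a & b & ->). exists a, b. rewrite ispair_iff; eauto.
    + intros a Ha. split.
      * destruct (H5 a Ha) as [b Hb]; exists b; apply app_iff, Hb.
      * intros b c Hb Hc. rewrite app_iff in *; eauto.
Qed.

Definition injective (f : uni) := forall a b c, pair a c ∊ f -> pair b c ∊ f -> a = b.

Lemma isinj_iff f X Y : isinj uni f X Y <-> fn f X Y /\ injective f.
Proof.
  unfold isinj; rewrite isfun_iff. apply iff_and; [tauto|]. unfold injective.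
  split; intros H a b c; specialize (H a b c); rewrite !app_iff in *; auto.
Qed.
Lemma isbij_iff f X Y : isbij uni f X Y <->
  fn f X Y /\ injective f /\ (forall c, c ∊ Y -> exists a, pair a c ∊ f).
Proof.
  unfold isbij; rewrite isinj_iff.
  split.
  - intros [[H K] L]; repeat split; auto; try apply H.
    intros c Hc; destruct (L c Hc) as [a Ha]; exists a; apply app_iff, Ha.
  - intros (H & K & L); repeat split; auto; try apply H.
    intros c Hc; destruct (L c Hc) as [a Ha]; exists a; apply app_iff, Ha.
Qed.

Lemma D1_injective : D1 injective. Proof. unfold injective; dn. Qed.

Lemma fn_graph X Y R : D2 R -> (forall a, a ∊ X -> exists b, b ∊ Y /\ R a b) ->
  (forall a b c, a ∊ X -> R a b -> R a c -> b = c) -> fn (graph X Y R) X Y.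
Proof.
  intros HR H K. split.
  - apply set_graph; auto.
  - intros p Hp. apply in_graph_ex in Hp as (a & b & _ & _ & _ & ->); eauto.
  - intros a b Hp. apply in_graph in Hp; tauto.
  - intros a b Hp. apply in_graph in Hp; tauto.
  - intros a Ha. destruct (H a Ha) as (b & Hb & L). exists b; apply in_graph; auto.
  - intros a b c Hb Hc. apply in_graph in Hb, Hc; auto. apply (K a); tauto.
Qed.

Lemma bij_graph X Y R : D2 R -> (forall a, a ∊ X -> exists b, b ∊ Y /\ R a b) ->
  (forall a b c, a ∊ X -> R a b -> R a c -> b = c) ->
  (forall a b c, a ∊ X -> b ∊ X -> R a c -> R b c -> a = b) ->
  (forall b, b ∊ Y -> exists a, a ∊ X /\ R a b) -> isbij uni (graph X Y R) X Y.
Proof.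
  intros HR H K L S. apply isbij_iff. split; [apply fn_graph; auto|]. split.
  - intros a b c Ha Hb. apply in_graph in Ha, Hb; auto. apply (L a b c); tauto.
  - intros b Hb. destruct (S b Hb) as (a & Ha & E). exists a. apply in_graph; auto.
Qed.

Definition ap f a := iota (fun b => pair a b ∊ f).
Lemma F2_ap : F2 ap. Proof. change (Dt (fun e => ap (e 0) (e 1))); unfold ap; dn. Qed.
Lemma ap_eq f X Y a b : fn f X Y -> pair a b ∊ f -> ap f a = b.
Proof. intros Hf H. apply iota_eq; auto. intros c Hc. eapply fn_fun; eauto. Qed.
Lemma ap_pair f X Y a : fn f X Y -> a ∊ X -> pair a (ap f a) ∊ f.
Proof.
  intros Hf H. destruct (fn_tot _ _ _ Hf a H) as [b Hb].
  rewrite (ap_eq f X Y a b); auto.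
Qed.
Lemma ap_cod f X Y a : fn f X Y -> a ∊ X -> ap f a ∊ Y.
Proof. intros Hf H. eapply fn_cod; eauto. eapply ap_pair; eauto. Qed.

Lemma fn_ext f g X Y : fn f X Y -> fn g X Y ->
  (forall a b, pair a b ∊ f -> pair a b ∊ g) -> f = g.
Proof.
  intros Hf Hg H. apply set_ext; eauto using fn_set.
  intros p; split; intros Hp.
  - destruct (fn_pairs _ _ _ Hf p Hp) as (a & b & ->). auto.
  - destruct (fn_pairs _ _ _ Hg p Hp) as (a & b & ->).
    destruct (fn_tot _ _ _ Hf a (fn_dom _ _ _ Hg _ _ Hp)) as [c Hc].
    rewrite (fn_fun _ _ _ Hg a b c); auto.
Qed.

End Functions.
#[export] Hint Resolve F2_prod D1_injective F2_ap : dn.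

(** ** Natural numbers *)

Section Omega.
Context {Z : zfa_model}.

Lemma inductive_iff w : inductive uni w <-> set w /\ emp ∊ w /\ forall x, x ∊ w -> adj x x ∊ w.
Proof.
  split.
  - intros (H & (z & Hz & K) & L). apply empty_emp in Hz; subst z. repeat split; auto.
    intros x Hx; destruct (L x Hx) as (y & Hy & M). apply issucc_iff in Hy; subst; auto.
  - intros (H & K & L). repeat split; auto.
    + exists emp; rewrite empty_emp; auto.
    + intros x Hx; exists (adj x x); rewrite issucc_iff; auto.
Qed.

Definition omega := setof (fun x => forall w, inductive uni w -> x ∊ w).
Lemma omegaP : small (fun x => forall w, inductive uni w -> x ∊ w).
Proof.
  destruct (zfa_sat _ ZFA_infinity (fun _ => dflt)) as (w & Hw).
  apply (small_bound _ w); [dn|]. intros z H; apply H, Hw.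
Qed.
Lemma in_omega x : x ∊ omega <-> forall w, inductive uni w -> x ∊ w.
Proof. apply (in_setof _ omegaP). Qed.
Lemma set_omega : set omega.
Proof. apply (set_setof _ omegaP). Qed.
Definition succ x := adj x x.
Lemma F1_succ : F1 succ. Proof. change (Dt (fun e => succ (e 0))); unfold succ; dn. Qed.
Lemma omega_emp : emp ∊ omega.
Proof. apply in_omega. intros w Hw; apply inductive_iff in Hw; tauto. Qed.
Lemma omega_succ n : n ∊ omega -> succ n ∊ omega.
Proof.
  intros H; apply in_omega. intros w Hw. rewrite in_omega in H. specialize (H w Hw).
  apply inductive_iff in Hw. apply Hw; auto.
Qed.
Lemma inductive_omega : inductive uni omega.
Proof.
  apply inductive_iff. split; [apply set_omega|]. split; [apply omega_emp | exact omega_succ].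
Qed.
Lemma isomega_iff w : isomega uni w <-> w = omega.
Proof.
  split.
  - intros [H K]. apply sub_antisym.
    + apply H. + apply set_omega. + apply K, inductive_omega.
    + split; [apply set_omega|]. intros z Hz. rewrite in_omega in Hz; auto.
  - intros ->. split; [apply inductive_omega|].
    intros v Hv; split; [apply set_omega|]. intros z Hz. rewrite in_omega in Hz; auto.
Qed.

Lemma omega_ind (P : uni -> Prop) : D1 P -> P emp ->
  (forall n, n ∊ omega -> P n -> P (succ n)) -> forall n, n ∊ omega -> P n.
Proof.
  intros HP H0 HS n Hn.
  assert (K : n ∊ sep omega P).
  { rewrite in_omega in Hn; apply Hn. apply inductive_iff. split; [apply set_sep; auto|]. split.
    - apply in_sep; auto using omega_emp.
    - intros x Hx. apply in_sep in Hx as [? ?]; auto.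
      apply in_sep; auto. split; [apply omega_succ | apply HS]; auto. }
  apply in_sep in K; tauto.
Qed.

Lemma in_succ n z : z ∊ succ n <-> z ∊ n \/ z = n.
Proof. apply in_adj. Qed.
Lemma set_succ n : set (succ n).
Proof. apply set_adj. Qed.

Lemma omega_trans n m : n ∊ omega -> m ∊ n -> m ∊ omega.
Proof.
  intros Hn. revert m. apply (omega_ind (fun n => forall m, m ∊ n -> m ∊ omega)); auto.
  - pose proof F1_succ. dn.
  - intros m Hm; destruct (in_emp m Hm).
  - intros k Hk IH m Hm. apply in_succ in Hm as [Hm| ->]; auto.
Qed.
Lemma nat_trans n m k : n ∊ omega -> m ∊ n -> k ∊ m -> k ∊ n.
Proof.
  intros Hn. revert m k. apply (omega_ind (fun n => forall m k, m ∊ n -> k ∊ m -> k ∊ n)); auto.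
  - dn.
  - intros m k Hm; destruct (in_emp m Hm).
  - intros j Hj IH m k Hm Hk. apply in_succ. apply in_succ in Hm as [Hm| ->]; eauto.
Qed.
Lemma nat_set n : n ∊ omega -> set n.
Proof.
  apply (omega_ind (fun n => set n)); [dn | apply set_emp | intros; apply set_succ].
Qed.
Lemma nat_irrefl n : n ∊ omega -> ~ n ∊ n.
Proof.
  apply (omega_ind (fun n => ~ n ∊ n)); [dn | apply in_emp |].
  intros k Hk IH H. apply IH. apply in_succ in H as [H|H].
  - apply (nat_trans k (succ k) k); auto. apply in_succ; auto.
  - rewrite <- H at 2. apply in_succ; auto.
Qed.
Lemma emp_in_succ n : n ∊ omega -> emp ∊ succ n.
Proof.
  pose proof F1_succ.
  apply (omega_ind (fun n => emp ∊ succ n)); [dn | apply in_succ; auto |].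
  intros k _ IH; apply in_succ; auto.
Qed.
Lemma succ_mono n m : n ∊ omega -> m ∊ n -> succ m ∊ succ n.
Proof.
  pose proof F1_succ.
  intros Hn. revert m. apply (omega_ind (fun n => forall m, m ∊ n -> succ m ∊ succ n)); auto; [dn| |].
  - intros m Hm; destruct (in_emp m Hm).
  - intros k Hk IH m Hm. apply in_succ. apply in_succ in Hm as [Hm| ->]; auto.
Qed.
Lemma nat_total n m : n ∊ omega -> m ∊ omega -> n ∊ m \/ n = m \/ m ∊ n.
Proof.
  pose proof F1_succ.
  intros Hn. revert m. apply (omega_ind (fun n => forall m, m ∊ omega -> n ∊ m \/ n = m \/ m ∊ n)); auto;
    [dn| |].
  - apply (omega_ind (fun m => emp ∊ m \/ emp = m \/ m ∊ emp)); [dn | auto |].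
    intros k Hk _. left. apply emp_in_succ; auto.
  - intros k Hk IH.
    apply (omega_ind (fun m => succ k ∊ m \/ succ k = m \/ m ∊ succ k)); [dn | |].
    + right; right. apply emp_in_succ; auto.
    + intros m Hm _. destruct (IH m Hm) as [L|[->|L]].
      * left. apply succ_mono; auto.
      * auto.
      * right; right. apply succ_mono; auto.
Qed.
Lemma succ_inj n m : n ∊ omega -> m ∊ omega -> succ n = succ m -> n = m.
Proof.
  intros Hn Hm E.
  assert (H1 : n ∊ succ m) by (rewrite <- E; apply in_succ; auto).
  assert (H2 : m ∊ succ n) by (rewrite E; apply in_succ; auto).
  apply in_succ in H1 as [H1|H1]; apply in_succ in H2 as [H2|H2]; auto.
  destruct (nat_irrefl n); auto. apply (nat_trans n m n); auto.
Qed.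
Lemma emp_succ n : emp <> succ n.
Proof. intros E. apply (in_emp n). rewrite E; apply in_succ; auto. Qed.

(** *** Recursion on [omega] *)

(** A justified set of pairs is included in the graph of the function to be defined, because each
    of its members is an initial value or follows from another member. *)
Definition justified (a : uni) (Φ : uni -> uni -> uni) (f : uni) :=
  forall k v, pair k v ∊ f ->
    (k = emp /\ v = a) \/
    (exists j u, j ∊ omega /\ k = succ j /\ v = Φ j u /\ pair j u ∊ f).
Definition rec (a : uni) (Φ : uni -> uni -> uni) (n : uni) : uni :=
  iota (fun v => exists f, justified a Φ f /\ pair n v ∊ f).

(** Two justified sets may differ, but each pair at a successor is forced by a pair at its
    predecessor, so by induction they agree wherever both have a value. *)
Lemma rec_unique a Φ f g n v w : F2 Φ -> n ∊ omega ->
  justified a Φ f -> justified a Φ g -> pair n v ∊ f -> pair n w ∊ g -> v = w.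
Proof.
  intros HΦ Hn Hf Hg. revert v w. pose proof F1_succ.
  apply (omega_ind (fun n => forall v w, pair n v ∊ f -> pair n w ∊ g -> v = w)); auto.
  - dn.
  - intros v w Hv Hw. apply Hf in Hv as [[_ ->]|(j & u & _ & E & _)];
      [|destruct (emp_succ _ E)].
    apply Hg in Hw as [[_ ->]|(j & u & _ & E & _)]; [auto|destruct (emp_succ _ E)].
  - intros k Hk IH v w Hv Hw.
    apply Hf in Hv as [[E _]|(j & u & Hj & E & -> & Hv)]; [destruct (emp_succ k); auto|].
    apply Hg in Hw as [[E' _]|(j' & u' & Hj' & E' & -> & Hw)]; [destruct (emp_succ k); auto|].
    apply succ_inj in E, E'; auto. subst j j'. f_equal; auto.
Qed.

Lemma rec_spec a Φ n : F2 Φ -> n ∊ omega ->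
  exists f, justified a Φ f /\ pair n (rec a Φ n) ∊ f.
Proof.
  intros HΦ Hn.
  assert (H : exists v f, justified a Φ f /\ pair n v ∊ f).
  { pose proof F1_succ.
    apply (omega_ind (fun n => exists v f, justified a Φ f /\ pair n v ∊ f)); auto.
    - unfold justified; dn.
    - exists a, (adj emp (pair emp a)). split.
      + intros k v Hp. apply in_adj in Hp as [Hp|Hp]; [destruct (in_emp _ Hp)|].
        apply pair_inj in Hp; auto.
      + apply in_adj; auto.
    - intros k Hk (v & f & Hf & Hv). exists (Φ k v), (adj f (pair (succ k) (Φ k v))). split.
      + intros k' v' Hp. apply in_adj in Hp as [Hp|Hp].
        * apply Hf in Hp as [?|(j & u & ? & ? & ? & ?)]; auto.
          right; exists j, u; rewrite in_adj; auto.
        * apply pair_inj in Hp as [-> ->]. right; exists k, v; rewrite in_adj; auto.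
      + apply in_adj; auto. }
  destruct H as (v & f & Hf & Hv).
  assert (E : rec a Φ n = v).
  { apply iota_eq; eauto. intros w (g & Hg & Hw). apply (rec_unique a Φ g f n w v); auto. }
  exists f; rewrite E; auto.
Qed.

Lemma rec_0 a Φ : F2 Φ -> rec a Φ emp = a.
Proof.
  intros HΦ. destruct (rec_spec a Φ emp HΦ omega_emp) as (f & Hf & H).
  apply Hf in H as [[_ H]|(j & u & _ & E & _)]; auto. destruct (emp_succ _ E).
Qed.

Lemma rec_S a Φ n : F2 Φ -> n ∊ omega -> rec a Φ (succ n) = Φ n (rec a Φ n).
Proof.
  intros HΦ Hn. destruct (rec_spec a Φ (succ n) HΦ (omega_succ n Hn)) as (f & Hf & H).
  apply Hf in H as [[E _]|(j & u & Hj & E & H & Hu)]; [destruct (emp_succ n); auto|].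
  apply succ_inj in E; auto. subst j. rewrite H. f_equal.
  destruct (rec_spec a Φ n HΦ Hn) as (g & Hg & K).
  apply (rec_unique a Φ f g n); auto.
Qed.

End Omega.

#[export] Hint Resolve F1_succ : dn.

Ltac dn_unfold ::=
  match goal with
  | |- Dt (fun e => graph _ _ _) => unfold graph at 1; dn
  | |- Dt (fun e => rec _ _ _) => unfold rec at 1, justified; dn
  end.

(** ** Transitive closure and induction on membership *)

Section Closure.
Context {Z : zfa_model}.

(** The iterates [x], [union x], [union (union x)], ... are gathered by Replacement along the
    [omega] of the model. *)
Definition tc x := union (repl omega (rec x (fun _ v => union v))).

Lemma F1_tc_step x : F1 (rec x (fun _ v => union v)).
Proof. change (Dt (fun e => rec x (fun _ v => union v) (e 0))); dn. Qed.

Lemma in_tc x z : z ∊ tc x <-> exists n, n ∊ omega /\ z ∊ rec x (fun _ v => union v) n.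
Proof.
  unfold tc. rewrite in_union. split.
  - intros (t & Ht & Hz). apply in_repl in Ht as (n & Hn & ->); eauto using F1_tc_step.
  - intros (n & Hn & Hz). exists (rec x (fun _ v => union v) n); split; auto.
    apply in_repl; eauto using F1_tc_step.
Qed.

Lemma F2_tc_step : F2 (fun _ v => union v).
Proof. change (Dt (fun e => union (e 1))); dn. Qed.

Lemma tc_istc x : set x -> istc uni x (tc x).
Proof.
  intros Hx. split; [|split].
  - split; auto. intros z Hz. apply in_tc. exists emp. rewrite rec_0; auto using omega_emp, F2_tc_step.
  - intros t y Ht Hy. apply in_tc in Ht as (n & Hn & Ht). apply in_tc.
    exists (succ n); split; [apply omega_succ; auto|].
    rewrite rec_S; auto using F2_tc_step. apply in_union; eauto.
  - intros T HT HxT. split; [apply set_union|]. intros z Hz. apply in_tc in Hz as (n & Hn & Hz).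
    revert z Hz. apply (omega_ind (fun n => forall z, z ∊ rec x (fun _ v => union v) n -> z ∊ T)); auto.
    + dn.
    + rewrite rec_0; auto using F2_tc_step. apply HxT.
    + intros k Hk IH z Hz. rewrite rec_S in Hz; auto using F2_tc_step.
      apply in_union in Hz as (t & Ht & Hz). eapply HT; eauto.
Qed.

Lemma istc_iff x T : set x -> istc uni x T <-> T = tc x.
Proof.
  intros Hx. split; [|intros ->; auto using tc_istc].
  intros H. destruct (tc_istc x Hx) as (H1 & H2 & H3). destruct H as (K1 & K2 & K3).
  destruct (H3 T K2 K1) as [L1 L2]. destruct (K3 _ H2 H1) as [L3 L4].
  apply set_ext; auto. intros z; split; auto.
Qed.

(** Foundation is applied to the counterexamples in the transitive closure of [{x}]; they form a set
    because [P] is definable. *)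
Lemma eps_ind (P : uni -> Prop) : D1 P -> (forall x, (forall y, y ∊ x -> P y) -> P x) -> forall x, P x.
Proof.
  intros HP H x. apply NNPP; intros Hx.
  pose (s := upair x x).
  destruct (tc_istc s (set_upair _ _)) as (H1 & H2 & _).
  assert (HnP : D1 (fun z => ~ P z)) by dn.
  destruct (zfa_sat _ ZFA_foundation (fun _ => x) (sep (tc s) (fun z => ~ P z))) as (y & Hy & Hd).
  - exists x. apply in_sep; auto. split; auto. apply H1. apply in_upair; auto.
  - apply in_sep in Hy as [Hy Hy']; auto. apply Hy', H. intros z Hz. apply NNPP; intros Hz'.
    apply (Hd z). split; auto. apply in_sep; auto. split; auto. eapply H2; eauto.
Qed.

End Closure.

(** ** Finite sets *)

Section Finite.
Context {Z : zfa_model}.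

(** An atom has no members and so is in bijection with [emp] in the sense of [isbij]; hence sethood
    is demanded separately. *)
Definition fin x := set x /\ finite uni x.

Lemma D1_fin : D1 fin. Proof. unfold fin; dn. Qed.
Hint Resolve D1_fin : dn.

Lemma finite_iff x : finite uni x <-> exists n f, n ∊ omega /\ isbij uni f n x.
Proof.
  split.
  - intros (w & n & f & Hw & Hn & Hf). apply isomega_iff in Hw; subst; eauto.
  - intros (n & f & Hn & Hf). exists omega, n, f. rewrite isomega_iff; auto.
Qed.

Lemma infinite_iff x : infinite uni x <-> set x /\ ~ fin x.
Proof. unfold infinite, fin; tauto. Qed.

Lemma bij_emp x : set x -> (exists f, isbij uni f emp x) <-> x = emp.
Proof.
  intros Hx. split.
  - intros (f & Hf). apply isbij_iff in Hf as (Hf & _ & Hs). apply empty_emp. split; auto.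
    intros z Hz. destruct (Hs z Hz) as [a Ha]. apply (in_emp a). eapply fn_dom; eauto.
  - intros ->. exists (graph emp emp eq). apply bij_graph; try dn;
      intros; exfalso; eapply in_emp; eauto.
Qed.

Lemma bij_adj n x a : n ∊ omega -> ~ a ∊ x ->
  (exists f, isbij uni f n x) -> exists f, isbij uni f (succ n) (adj x a).
Proof.
  intros Hn Ha (f & Hf). apply isbij_iff in Hf as (Hf & Hi & Hs).
  exists (graph (succ n) (adj x a) (fun u v => (u ∊ n /\ pair u v ∊ f) \/ (u = n /\ v = a))).
  assert (Hnn := nat_irrefl n Hn).
  apply bij_graph.
  - dn.
  - intros u Hu. apply in_succ in Hu as [Hu| ->].
    + destruct (fn_tot _ _ _ Hf u Hu) as [v Hv]. exists v. rewrite in_adj.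
      pose proof (fn_cod _ _ _ Hf _ _ Hv); auto.
    + exists a; rewrite in_adj; auto.
  - intros u v w _ [[H K]|[-> ->]] [[H' K']|[E ->]]; auto;
      try (subst; contradiction). eapply fn_fun; eauto.
  - intros u v w _ _ [[H K]|[-> ->]] [[H' K']|[-> E]]; auto.
    + eapply Hi; eauto.
    + subst w. destruct Ha. eapply fn_cod; eauto.
    + destruct Ha. eapply fn_cod; eauto.
  - intros v Hv. apply in_adj in Hv as [Hv| ->].
    + destruct (Hs v Hv) as [u Hu]. exists u. pose proof (fn_dom _ _ _ Hf _ _ Hu).
      rewrite in_succ; auto.
    + exists n; rewrite in_succ; auto.
Qed.

Definition del x a := sep x (fun z => z <> a).
Lemma D1_neq (a : uni) : D1 (fun z : uni => z <> a). Proof. dn. Qed.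
Lemma in_del x a z : z ∊ del x a <-> z ∊ x /\ z <> a.
Proof. apply (in_sep x (fun z => z <> a)), D1_neq. Qed.
Lemma set_del x a : set (del x a).
Proof. apply (set_sep x (fun z => z <> a)), D1_neq. Qed.
Lemma adj_del x a : a ∊ x -> adj (del x a) a = x.
Proof.
  intros H. apply set_ext; auto using set_adj; [eapply mem_set; eauto|].
  intros z. rewrite in_adj, in_del. split; [intros [[]| ->]; auto|].
  intros Hz; destruct (classic (z = a)); auto.
Qed.
Lemma F2_del : F2 del. Proof. change (Dt (fun e => del (e 0) (e 1))); unfold del; dn. Qed.
(** When [a] is not the image of [n], the preimage of [a] is redirected to that image. *)
Lemma bij_del n x a : n ∊ omega -> a ∊ x ->
  (exists f, isbij uni f (succ n) x) -> exists f, isbij uni f n (del x a).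
Proof.
  intros Hn Ha (f & Hf). apply isbij_iff in Hf as (Hf & Hi & Hs).
  assert (Hnn := nat_irrefl n Hn).
  assert (Hns : n ∊ succ n) by (apply in_succ; auto).
  exists (graph n (del x a) (fun u v =>
    (~ pair u a ∊ f /\ pair u v ∊ f) \/ (pair u a ∊ f /\ pair n v ∊ f))).
  apply bij_graph.
  - dn.
  - intros u Hu. destruct (classic (pair u a ∊ f)) as [E|E].
    + destruct (fn_tot _ _ _ Hf n Hns) as [v Hv]. exists v; split; auto.
      apply in_del. split; [eapply fn_cod; eauto|]. intros ->.
      rewrite (Hi u n a) in Hu; auto.
    + destruct (fn_tot _ _ _ Hf u) as [v Hv]; [apply in_succ; auto|].
      exists v; split; auto. apply in_del. split; [eapply fn_cod; eauto|]. intros ->; auto.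
  - intros u v w _ [[H K]|[H K]] [[H' K']|[H' K']]; try contradiction; eapply fn_fun; eauto.
  - intros u v w Hu Hv [[H K]|[H K]] [[H' K']|[H' K']].
    + eapply Hi; eauto.
    + rewrite (Hi u n w) in Hu; auto; contradiction.
    + rewrite (Hi v n w) in Hv; auto; contradiction.
    + eapply Hi; eauto.
  - intros v Hv. apply in_del in Hv as [Hv Hva].
    destruct (Hs v Hv) as [u Hu]. destruct (Hs a Ha) as [j Hj].
    pose proof (fn_dom _ _ _ Hf _ _ Hu) as Hu'. pose proof (fn_dom _ _ _ Hf _ _ Hj) as Hj'.
    apply in_succ in Hu', Hj'. destruct Hu' as [Hu'| ->].
    + exists u; split; auto. left; split; auto. intros K. apply Hva. eapply fn_fun; eauto.
    + destruct Hj' as [Hj'| ->].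
      * exists j; auto.
      * destruct Hva. eapply fn_fun; eauto.
Qed.

Lemma fin_bij x n : set x -> n ∊ omega -> (exists f, isbij uni f n x) -> fin x.
Proof. intros Hx Hn (f & Hf). split; auto. apply finite_iff; eauto. Qed.
Lemma fin_ex x : fin x -> set x /\ exists n, n ∊ omega /\ exists f, isbij uni f n x.
Proof. intros [Hx H]. split; auto. apply finite_iff in H as (n & f & Hn & Hf); eauto. Qed.

Lemma fin_set x : fin x -> set x.
Proof. intros [H _]; auto. Qed.
Lemma fin_emp : fin emp.
Proof. apply (fin_bij emp emp); auto using set_emp, omega_emp. apply bij_emp; auto using set_emp. Qed.
Lemma fin_adj x a : fin x -> fin (adj x a).
Proof.
  intros H. destruct (classic (a ∊ x)) as [K|K]; [rewrite adj_mem; auto|].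
  apply fin_ex in H as (Hx & n & Hn & H).
  apply (fin_bij _ (succ n)); auto using set_adj, omega_succ. apply bij_adj; auto.
Qed.

Lemma fin_upair a b : fin (upair a b).
Proof.
  replace (upair a b) with (adj (adj emp a) b); [auto using fin_adj, fin_emp|].
  apply set_ext; auto using set_adj, set_upair. intros z. rewrite !in_adj, in_upair.
  split; [intros [[H|H]|H]; auto; destruct (in_emp z H) | tauto].
Qed.

(** Induction on the number of elements, removing a point by [bij_del]. This number lies in the
    [omega] of the model and may be nonstandard, so lists of the metatheory would not do. *)
Lemma fin_ind (P : uni -> Prop) : D1 P -> P emp ->
  (forall x a, fin x -> P x -> ~ a ∊ x -> P (adj x a)) -> forall x, fin x -> P x.
Proof.
  intros HP H0 HS x Hx. apply fin_ex in Hx as (Hx & n & Hn & H). revert x Hx H.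
  apply (omega_ind (fun n => forall x, set x -> (exists f, isbij uni f n x) -> P x)); auto.
  - dn.
  - intros x Hx H. apply bij_emp in H; subst; auto.
  - intros k Hk IH x Hx H.
    assert (exists a, a ∊ x) as [a Ha].
    { destruct H as [f Hf]. apply isbij_iff in Hf as (Hf & _).
      destruct (fn_tot _ _ _ Hf k) as [a Ha]; [apply in_succ; auto|].
      exists a; eapply fn_cod; eauto. }
    pose proof (bij_del k x a Hk Ha H) as K.
    rewrite <- (adj_del x a Ha). apply HS.
    + apply (fin_bij _ k); auto using set_del.
    + apply IH; auto using set_del.
    + rewrite in_del; tauto.
Qed.

Lemma fin_sub x y : fin x -> sub uni y x -> fin y.
Proof.
  intros Hx. revert y. apply (fin_ind (fun x => forall y, sub uni y x -> fin y)); auto.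
  - dn.
  - intros y [Hy H]. replace y with emp; [apply fin_emp|].
    symmetry; apply empty_emp; split; auto. intros z Hz; apply (in_emp z); auto.
  - intros u a Hu IH Ha y [Hy H].
    assert (K : fin (del y a)).
    { apply IH. split; [apply set_del|]. intros z Hz. apply in_del in Hz as [Hz Hza].
      apply H in Hz. apply in_adj in Hz as [Hz|Hz]; auto; contradiction. }
    destruct (classic (a ∊ y)) as [L|L].
    + rewrite <- (adj_del y a L). apply fin_adj; auto.
    + apply IH. split; auto. intros z Hz. specialize (H z Hz). apply in_adj in H as [H| ->]; auto.
      contradiction.
Qed.

(** [R] is only a partial function, which covers images as well as preimages under injections. *)
Lemma fin_image (R : uni -> uni -> Prop) x : D2 R ->
  (forall u v v', R u v -> R u v' -> v = v') -> fin x ->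
  forall y, set y -> (forall v, v ∊ y -> exists u, u ∊ x /\ R u v) -> fin y.
Proof.
  intros HR HF Hx.
  apply (fin_ind (fun x => forall y, set y -> (forall v, v ∊ y -> exists u, u ∊ x /\ R u v) -> fin y)); auto.
  - dn.
  - intros y Hy H. replace y with emp; [apply fin_emp|].
    symmetry; apply empty_emp; split; auto. intros z Hz.
    destruct (H z Hz) as (u & Hu & _). apply (in_emp u Hu).
  - intros u a Hu IH Ha y Hy H.
    assert (HD : D1 (fun v => exists t, t ∊ u /\ R t v)) by dn.
    assert (K : fin (sep y (fun v => exists t, t ∊ u /\ R t v))).
    { apply IH; [apply set_sep; auto|]. intros v Hv. apply in_sep in Hv; tauto. }
    destruct (classic (exists b, R a b)) as [[b Hb]|N].
    + apply (fin_sub (adj (sep y (fun v => exists t, t ∊ u /\ R t v)) b)); [apply fin_adj; auto|].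
      split; auto. intros v Hv. apply in_adj. rewrite in_sep; auto.
      destruct (H v Hv) as (t & Ht & L). apply in_adj in Ht as [Ht| ->]; eauto.
    + apply (fin_sub _ y K). split; auto. intros v Hv. rewrite in_sep; auto.
      destruct (H v Hv) as (t & Ht & L). apply in_adj in Ht as [Ht| ->]; eauto.
      destruct N; eauto.
Qed.

Lemma fin_cup x y : fin x -> fin y -> fin (cup x y).
Proof.
  intros Hx Hy. apply (fin_ind (fun x => fin (cup x y))); auto.
  - dn.
  - replace (cup emp y) with y; auto. apply set_ext; auto using fin_set, set_cup.
    intros z; rewrite in_cup. split; auto. intros [H|H]; auto. destruct (in_emp z H).
  - intros u a Hu IH _. replace (cup (adj u a) y) with (adj (cup u y) a); [apply fin_adj; auto|].
    apply set_ext; auto using set_adj, set_cup.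
    intros z; rewrite in_adj, !in_cup, in_adj; tauto.
Qed.

Lemma fin_union x : fin x -> (forall t, t ∊ x -> fin t) -> fin (union x).
Proof.
  intros Hx. apply (fin_ind (fun x => (forall t, t ∊ x -> fin t) -> fin (union x))); auto.
  - dn.
  - intros _. replace (union emp) with emp; [apply fin_emp|].
    symmetry; apply empty_emp; split; auto using set_union. intros z Hz.
    apply in_union in Hz as (t & Ht & _). apply (in_emp t Ht).
  - intros u a Hu IH _ H. apply (fin_sub (cup (union u) a)).
    + apply fin_cup; [apply IH | apply H]; intros; try apply H; apply in_adj; auto.
    + split; [apply set_union|]. intros z Hz. apply in_union in Hz as (t & Ht & Hz).
      apply in_cup. rewrite in_union. apply in_adj in Ht as [Ht| ->]; eauto.
Qed.

Lemma fin_pow x : fin x -> fin (pow x).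
Proof.
  intros Hx. apply (fin_ind (fun x => fin (pow x))); auto.
  - dn.
  - apply (fin_sub (adj emp emp)); [apply fin_adj, fin_emp|]. split; [apply set_pow|].
    intros z Hz. apply in_pow in Hz as [Hz H]. apply in_adj. right. apply empty_emp. split; auto.
    intros t Ht. apply (in_emp t); auto.
  - intros u a Hu IH Ha.
    assert (HR : D2 (fun s t => t = adj s a)) by dn.
    apply (fin_sub (cup (pow u) (repl (pow u) (fun s => adj s a)))).
    + apply fin_cup; auto. eapply (fin_image (fun s t => t = adj s a)); eauto.
      * congruence.
      * apply set_repl. dn.
      * intros v Hv. apply in_repl in Hv; auto. dn.
    + split; [apply set_pow|]. intros y Hy. apply in_pow in Hy as [Hy H].
      apply in_cup. rewrite in_repl by dn. destruct (classic (a ∊ y)) as [L|L].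
      * right. exists (del y a). split; [|symmetry; apply adj_del; auto].
        apply in_pow. split; [apply set_del|]. intros z Hz. apply in_del in Hz as [Hz Hza].
        specialize (H z Hz). apply in_adj in H as [H|H]; auto; contradiction.
      * left. apply in_pow. split; auto. intros z Hz.
        specialize (H z Hz). apply in_adj in H as [H| ->]; auto; contradiction.
Qed.

Definition set_of_list (l : list uni) : uni := fold_right (fun a x => adj x a) emp l.
Lemma in_set_of_list l z : z ∊ set_of_list l <-> In z l.
Proof.
  induction l; simpl; [split; [apply in_emp | tauto]|]. rewrite in_adj, IHl. intuition.
Qed.
Lemma fin_set_of_list l : fin (set_of_list l).
Proof. induction l; simpl; auto using fin_emp, fin_adj. Qed.

(** Since [k] is standard, the elements can be listed in the metatheory, and counting is left to the
    library on lists without repetition. *)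
Lemma cardeq_list k : forall s, cardeq uni k s <->
  set s /\ exists l, NoDup l /\ length l = k /\ forall z, z ∊ s <-> In z l.
Proof.
  induction k; intros s; simpl.
  - split.
    + intros [H K]. split; auto. exists []. repeat split; auto using NoDup_nil; simpl; [apply K | tauto].
    + intros [H (l & _ & L & K)]. split; auto. intros z Hz. apply K in Hz.
      destruct l; [destruct Hz | discriminate].
  - split.
    + intros [H (x & t & Ht & Hx & K)]. split; auto. apply IHk in Ht as [Ht (l & Hl & L & M)].
      exists (x :: l). split; [|split].
      * constructor; auto. rewrite <- M; auto.
      * simpl; auto.
      * intros z; rewrite K, M; simpl; intuition.
    + intros [H (l & Hl & L & K)]. split; auto. destruct l as [|x l]; [discriminate|].
      inversion Hl; subst. exists x, (set_of_list l). split; [|split].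
      * apply IHk. split; [apply fin_set, fin_set_of_list|].
        exists l. repeat split; auto; apply in_set_of_list.
      * rewrite in_set_of_list; auto.
      * intros z; rewrite K, in_set_of_list; simpl; intuition.
Qed.

Lemma cardeq_fin k s : cardeq uni k s -> fin s.
Proof.
  intros H. apply cardeq_list in H as [H (l & _ & _ & K)].
  apply (fin_sub (set_of_list l)); [apply fin_set_of_list|].
  split; auto. intros z; rewrite K, in_set_of_list; auto.
Qed.

Lemma infinite_diff X E : infinite uni X -> fin E -> exists x, x ∊ X /\ ~ x ∊ E.
Proof.
  intros HX HE. apply NNPP; intros N. apply infinite_iff in HX as [HX K]. apply K.
  apply (fin_sub E); auto. split; auto. intros x Hx. apply NNPP; intros L; apply N; eauto.
Qed.

Lemma fin_omega_bounded x : fin x -> sub uni x omega -> exists k, k ∊ omega /\ forall y, y ∊ x -> y ∊ k.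
Proof.
  intros Hx. apply (fin_ind (fun x => sub uni x omega -> exists k, k ∊ omega /\ forall y, y ∊ x -> y ∊ k)); auto.
  - dn.
  - intros _. exists emp; split; auto using omega_emp.
  - intros u a Hu IH _ [_ H]. destruct IH as (k & Hk & K).
    { split; auto using fin_set. intros z Hz; apply H, in_adj; auto. }
    assert (Ha : a ∊ omega) by (apply H, in_adj; auto).
    destruct (nat_total a k Ha Hk) as [L|[->|L]].
    + exists k; split; auto. intros y Hy. apply in_adj in Hy as [Hy| ->]; auto.
    + exists (succ k); split; auto using omega_succ. intros y Hy. apply in_succ.
      apply in_adj in Hy as [Hy| ->]; auto.
    + exists (succ a); split; auto using omega_succ. intros y Hy. apply in_succ.
      apply in_adj in Hy as [Hy| ->]; auto. left. apply (nat_trans a k y); auto.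
Qed.

Lemma infinite_omega : infinite uni omega.
Proof.
  apply infinite_iff. split; [apply set_omega|]. intros H.
  destruct (fin_omega_bounded omega H) as (k & Hk & K).
  - apply sub_refl, set_omega.
  - apply (nat_irrefl k); auto.
Qed.

Lemma cinfinite_iff x : cinfinite uni x <-> set x /\ exists f, isbij uni f omega x.
Proof.
  unfold cinfinite. apply iff_and; [tauto|]. split.
  - intros (w & f & Hw & Hf). apply isomega_iff in Hw; subst; eauto.
  - intros (f & Hf). exists omega, f. rewrite isomega_iff; auto.
Qed.

Lemma infinite_image f X Y : fn f X Y -> injective f -> infinite uni X -> set Y -> infinite uni Y.
Proof.
  intros Hf Hi HX HY. apply infinite_iff. split; auto. intros K.
  apply infinite_iff in HX as [HX N]. apply N.
  apply (fin_image (fun u v => pair v u ∊ f) Y); auto.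
  - dn.
  - intros u v v' H H'. eapply Hi; eauto.
  - intros v Hv. destruct (fn_tot _ _ _ Hf v Hv) as [u Hu]. exists u; split; auto. eapply fn_cod; eauto.
Qed.

Lemma cinfinite_infinite x : cinfinite uni x -> infinite uni x.
Proof.
  intros H. apply cinfinite_iff in H as (Hx & f & Hf). apply isbij_iff in Hf as (Hf & Hi & _).
  eapply infinite_image; eauto using infinite_omega.
Qed.

End Finite.
#[export] Hint Resolve D1_fin F2_del : dn.

(** * Consequences of the axiom of choice *)

Class has_choice {Z : zfa_model} : Prop := choice_ax : holds uni AxChoice.

Section Choice.
Context {Z : zfa_model} {AC : has_choice}.

Lemma choice_fn X : (forall x, x ∊ X -> exists y, y ∊ x) ->
  exists f U, isfun uni f X U /\ forall x y, app uni f x y -> y ∊ x.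
Proof. exact (choice_ax (fun _ => X) X). Qed.

(** [AxChoice] is applied to the sets [sep Y (R x)]. Different [x] may give the same set, so the
    choice function is composed with the map from [x] to this set. *)
Lemma ac (R : uni -> uni -> Prop) X Y : D2 R ->
  (forall x, x ∊ X -> exists y, y ∊ Y /\ R x y) ->
  exists f, fn f X Y /\ forall x y, pair x y ∊ f -> R x y.
Proof.
  intros HR H.
  assert (HS : forall x, D1 (R x)) by (intros; dn).
  assert (HF : F1 (fun x => sep Y (R x))).
  { change (Dt (fun e => sep Y (R (e 0)))). unfold sep. dn. }
  destruct (choice_fn (repl X (fun x => sep Y (R x)))) as (c & U & Hc & K).
  { intros s Hs. apply in_repl in Hs as (x & Hx & ->); auto.
    destruct (H x Hx) as (y & Hy & L). exists y. apply in_sep; auto. }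
  assert (Hc' : fn c (repl X (fun x => sep Y (R x))) U) by (apply isfun_iff; exact Hc).
  assert (K' : forall s y, pair s y ∊ c -> y ∊ s).
  { intros s y Hp. apply (K s y). apply app_iff; exact Hp. }
  assert (HG : D2 (fun x y => pair (sep Y (R x)) y ∊ c)).
  { apply (Dn_D2 (fun u v => u ∊ v)); [dn| |dn].
    apply Dt_F2; [dn| |dn]. apply (Dt_F1 _ (fun e => e 0) HF); dn. }
  exists (graph X Y (fun x y => pair (sep Y (R x)) y ∊ c)). split.
  - apply fn_graph; auto.
    + intros x Hx. destruct (fn_tot _ _ _ Hc' (sep Y (R x))) as [y Hy].
      { apply in_repl; eauto. }
      exists y; split; auto. apply K' in Hy. apply in_sep in Hy; [tauto | auto].
    + intros a b c' _ Hb Hc''. eapply fn_fun; eauto.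
  - intros x y Hp. apply in_graph in Hp as (_ & _ & Hp); auto. apply K' in Hp. apply in_sep in Hp; [tauto | auto].
Qed.

Definition chain C := forall c d, c ∊ C -> d ∊ C -> sub uni c d \/ sub uni d c.
Lemma D1_chain : D1 chain. Proof. unfold chain; dn. Qed.
Hint Resolve D1_chain : dn.

(** The Bourbaki-Witt argument: the least family containing [z0] and closed under [g] and under
    unions of chains is a chain, so its union is a fixed point of [g]. *)
Section Tower.
Variables (ZZ g z0 : uni).
Hypothesis Hset : forall z, z ∊ ZZ -> set z.
Hypothesis Hg : fn g ZZ ZZ.
Hypothesis Hinc : forall z, z ∊ ZZ -> sub uni z (ap g z).
Hypothesis Hz0 : z0 ∊ ZZ.
Hypothesis Hleast : forall z, z ∊ ZZ -> sub uni z0 z.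
Hypothesis Hchain : forall C, sub uni C ZZ -> (exists c, c ∊ C) -> chain C -> union C ∊ ZZ.

Definition closed T :=
  sub uni T ZZ /\ z0 ∊ T /\ (forall t, t ∊ T -> ap g t ∊ T) /\
  (forall C, sub uni C T -> (exists c, c ∊ C) -> chain C -> union C ∊ T).
Definition tower := sep ZZ (fun z => forall T, closed T -> z ∊ T).

Lemma D1_closed : D1 closed. Proof. unfold closed; dn. Qed.
Hint Resolve D1_closed : dn.
Lemma D1_tower : D1 (fun z => forall T, closed T -> z ∊ T). Proof. dn. Qed.

Lemma in_tower z : z ∊ tower <-> z ∊ ZZ /\ forall T, closed T -> z ∊ T.
Proof. apply (in_sep ZZ _ z D1_tower). Qed.
Lemma set_tower : set tower.
Proof. apply (set_sep ZZ _ D1_tower). Qed.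

Lemma closed_tower : closed tower.
Proof.
  split; [|split; [|split]].
  - split; [apply set_tower|]. intros z Hz; apply in_tower in Hz; tauto.
  - apply in_tower; split; auto. intros T HT; apply HT.
  - intros t Ht. apply in_tower in Ht as [Ht K]. apply in_tower. split; [eapply ap_cod; eauto|].
    intros T HT. apply HT; auto.
  - intros C [HC H] He Hc. apply in_tower. split.
    + apply Hchain; auto. split; auto. intros z Hz; apply H, in_tower in Hz; tauto.
    + intros T HT. apply HT; auto. split; auto. intros z Hz; apply H, in_tower in Hz as [_ K]; auto.
Qed.

Lemma tower_ind (P : uni -> Prop) : D1 P -> P z0 -> (forall t, t ∊ tower -> P t -> P (ap g t)) ->
  (forall C, sub uni C tower -> (exists c, c ∊ C) -> chain C -> (forall c, c ∊ C -> P c) -> P (union C)) ->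
  forall t, t ∊ tower -> P t.
Proof.
  intros HP H0 HS HU t Ht. destruct closed_tower as (T1 & T2 & T3 & T4).
  assert (K : closed (sep tower P)).
  { split; [|split; [|split]].
    - split; [apply set_sep; auto|]. intros z Hz; apply in_sep in Hz as [Hz _]; auto. apply T1; auto.
    - apply in_sep; auto.
    - intros u Hu. apply in_sep in Hu as [Hu K]; auto. apply in_sep; auto.
    - intros C [HC H] He Hc. apply in_sep; auto.
      assert (H' : forall c, c ∊ C -> c ∊ tower /\ P c) by (intros c K; apply in_sep; auto).
      assert (sub uni C tower) by (split; [auto | intros c K; apply H'; auto]).
      split; [apply T4; auto|]. apply HU; auto. intros c K; apply H'; auto. }
  apply in_tower in Ht as [_ Ht]. specialize (Ht _ K). apply in_sep in Ht; tauto.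
Qed.

Lemma tower_ZZ t : t ∊ tower -> t ∊ ZZ.
Proof. intros H; apply in_tower in H; tauto. Qed.

(** [g] moves no member strictly below [c] past [c]. An extreme member turns out to be comparable
    with every member of the tower. *)
Definition extreme c := forall x, x ∊ tower -> sub uni x c -> x <> c -> sub uni (ap g x) c.

Lemma extreme_compare c : extreme c ->
  forall x, x ∊ tower -> c ∊ tower -> sub uni x c \/ sub uni (ap g c) x.
Proof.
  intros Hc x Hx Hct. apply (tower_ind (fun x => sub uni x c \/ sub uni (ap g c) x)); auto.
  - dn.
  - left. apply Hleast, tower_ZZ; auto.
  - intros t Ht [K|K].
    + destruct (classic (t = c)) as [->|N]; auto.
      right. apply sub_refl. apply Hset. eapply ap_cod; eauto. apply tower_ZZ; auto.
    + right. apply (sub_trans _ t); auto. apply Hinc, tower_ZZ; auto.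
  - intros C HC He _ IH. destruct (classic (exists d, d ∊ C /\ sub uni (ap g c) d)) as [(d & Hd & K)|N].
    + right. apply (sub_trans _ d); auto. split; [apply Hset, tower_ZZ, HC; auto|].
      intros z Hz. apply in_union; eauto.
    + left. split; [apply set_union|]. intros z Hz. apply in_union in Hz as (d & Hd & Hz).
      destruct (IH d Hd) as [K|K]; [apply K; auto | destruct N; eauto].
Qed.

(** Induction along the tower. Below [ap g t], comparison with [t] puts a smaller [x] below [t]. A
    member [x] strictly below a union fails to include some [d] of the chain, hence lies strictly
    below [d], and the claim for [d] applies. *)
Lemma all_extreme c : c ∊ tower -> extreme c.
Proof.
  assert (HT : D1 (fun x => x ∊ tower)) by dn.
  apply (tower_ind extreme).
  - unfold extreme; dn.
  - intros x Hx K N. destruct N. apply sub_antisym; auto using tower_ZZ.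
  - intros t Ht IH x Hx K N. destruct (extreme_compare t IH x Hx Ht) as [L|L].
    + destruct (classic (x = t)) as [->|M].
      * apply sub_refl. apply Hset. eapply ap_cod; eauto using tower_ZZ.
      * apply (sub_trans _ t); auto using tower_ZZ.
    + destruct N. apply sub_antisym; auto using tower_ZZ.
      apply Hset. eapply ap_cod; eauto using tower_ZZ.
  - intros C HC He Hch IH x Hx K N.
    assert (exists d, d ∊ C /\ ~ sub uni d x) as (d & Hd & M).
    { apply NNPP; intros L. apply N. apply sub_antisym; auto using tower_ZZ, set_union.
      split; [apply set_union|]. intros z Hz. apply in_union in Hz as (d & Hd & Hz).
      apply NNPP; intros Hzx. apply L. exists d; split; auto. intros [_ S]; auto. }
    assert (Hdt : d ∊ tower) by (apply HC; auto).
    assert (HdC : sub uni d (union C)).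
    { split; auto using tower_ZZ. intros z Hz. apply in_union; eauto. }
    destruct (extreme_compare d (IH d Hd) x Hx Hdt) as [L|L].
    + apply (sub_trans _ d); auto. apply IH; auto. intros ->. apply M, sub_refl; auto using tower_ZZ.
    + destruct M. apply (sub_trans _ (ap g d)); auto using tower_ZZ.
Qed.

(** The tower is a chain, so its union belongs to it and is its largest member; [g] cannot enlarge
    it. *)
Lemma tower_fixpoint : exists m, m ∊ ZZ /\ ap g m = m.
Proof.
  destruct closed_tower as (T1 & T2 & T3 & T4).
  assert (Hch : chain tower).
  { intros c d Hc Hd. destruct (extreme_compare c (all_extreme c Hc) d Hd Hc) as [K|K]; auto.
    left. apply (sub_trans _ (ap g c)); auto using tower_ZZ. }
  assert (Hu : union tower ∊ tower).
  { apply T4; auto; [apply sub_refl, set_tower | eauto]. }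
  exists (union tower). split; auto using tower_ZZ.
  apply sub_antisym.
  - apply Hset. eapply ap_cod; eauto using tower_ZZ.
  - apply set_union.
  - split; [apply Hset; eapply ap_cod; eauto using tower_ZZ|].
    intros z Hz. apply in_union. exists (ap g (union tower)); auto.
  - apply Hinc; auto using tower_ZZ.
Qed.
End Tower.

(** If there were no maximal set above [z0], choice would give a map sending each set with [P] above
    [z0] to a strictly larger one, against [tower_fixpoint]. *)
Lemma zorn (P : uni -> Prop) S z0 : D1 P -> P z0 -> (forall z, P z -> sub uni z S) ->
  (forall C, set C -> (exists c, c ∊ C) -> (forall c, c ∊ C -> P c) -> chain C -> P (union C)) ->
  exists m, P m /\ sub uni z0 m /\ forall z, P z -> sub uni m z -> z = m.
Proof.
  intros HP H0 HS HU. apply NNPP; intros N.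
  set (ZZ := sep (pow S) (fun z => P z /\ sub uni z0 z)).
  assert (HZ : forall z, z ∊ ZZ <-> P z /\ sub uni z0 z).
  { intros z. unfold ZZ. rewrite in_sep by dn. rewrite in_pow. split; [tauto|]. intros [H K]; auto. }
  destruct (ac (fun m z => sub uni m z /\ z <> m) ZZ ZZ) as (g & Hg & K).
  - dn.
  - intros m Hm. apply NNPP; intros L. apply N. apply HZ in Hm as [Hm Hm'].
    exists m; repeat split; auto; try apply Hm'. intros z Hz Hmz. apply NNPP; intros M. apply L.
    exists z; split; auto. apply HZ; split; auto. eapply sub_trans; eauto.
  - destruct (tower_fixpoint ZZ g z0) as (m & Hm & E); auto.
    + intros z Hz. apply HZ in Hz as [Hz _]. apply HS in Hz. apply Hz.
    + intros z Hz. apply (K z (ap g z)). eapply ap_pair; eauto.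
    + apply HZ; split; auto. apply sub_refl. apply HS in H0; apply H0.
    + intros z Hz. apply HZ in Hz; tauto.
    + intros C [HC H] (c & Hc) Hch. apply HZ. split.
      * apply HU; eauto. intros d Hd; apply H, HZ in Hd; tauto.
      * assert (Hc' := H c Hc). apply HZ in Hc' as [_ [L Hc']]. split; auto.
        intros z Hz. apply in_union; eauto.
    + apply (K m (ap g m)); [eapply ap_pair; eauto | exact E].
Qed.

End Choice.

(** * Ramsey's theorem and rainbow Ramsey theorem under choice *)

Section Ultra.
Context {Z : zfa_model} {AC : has_choice}.
Hint Resolve D1_chain : dn.

Definition cap x y := sep x (fun z => z ∊ y).
Definition diff x y := sep x (fun z => ~ z ∊ y).
Lemma in_cap x y z : z ∊ cap x y <-> z ∊ x /\ z ∊ y.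
Proof. apply (in_sep x (fun z => z ∊ y)); dn. Qed.
Lemma in_diff x y z : z ∊ diff x y <-> z ∊ x /\ ~ z ∊ y.
Proof. apply (in_sep x (fun z => ~ z ∊ y)); dn. Qed.
Lemma set_cap x y : set (cap x y).
Proof. apply (set_sep x (fun z => z ∊ y)); dn. Qed.
Lemma set_diff x y : set (diff x y).
Proof. apply (set_sep x (fun z => ~ z ∊ y)); dn. Qed.
Lemma F2_cap : F2 cap. Proof. change (Dt (fun e => cap (e 0) (e 1))); unfold cap; dn. Qed.
Lemma F2_diff : F2 diff. Proof. change (Dt (fun e => diff (e 0) (e 1))); unfold diff; dn. Qed.
Hint Resolve F2_cap F2_diff : dn.

Lemma infinite_sup x y : infinite uni x -> sub uni x y -> set y -> infinite uni y.
Proof.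
  intros Hx H Hy. apply infinite_iff in Hx as [Hx N]. apply infinite_iff; split; auto.
  intros K; apply N. eapply fin_sub; eauto.
Qed.

(** Properness is strengthened to infinitude of all members, so that maximal filters of this kind
    are nonprincipal ultrafilters. *)
Definition proper_filter X U :=
  sub uni U (pow X) /\ X ∊ U /\ (forall B, B ∊ U -> infinite uni B) /\
  (forall B C, B ∊ U -> C ∊ U -> cap B C ∊ U) /\
  (forall B C, B ∊ U -> sub uni B C -> sub uni C X -> C ∊ U).

Lemma ultrafilter_exists X : infinite uni X -> exists U, proper_filter X U /\
  forall B, sub uni B X -> B ∊ U \/ diff X B ∊ U.
Proof.
  intros HX. assert (HXs : set X) by apply HX.
  destruct (zorn (proper_filter X) (pow X) (adj emp X)) as (U & HU & _ & Hmax).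
  - unfold proper_filter; dn.
  - assert (K : forall B, B ∊ adj emp X <-> B = X).
    { intros B; rewrite in_adj. split; auto. intros [H|H]; auto; destruct (in_emp _ H). }
    split; [|split; [|split; [|split]]].
    + split; [apply set_adj|]. intros B HB. apply K in HB; subst. apply in_pow, sub_refl; auto.
    + apply K; auto.
    + intros B HB. apply K in HB; subst; auto.
    + intros B C HB HC. apply K in HB, HC; subst. apply K.
      apply set_ext; auto using set_cap. intros z; rewrite in_cap; tauto.
    + intros B C HB H1 H2. apply K in HB; subst. apply K.
      apply sub_antisym; auto. apply H2.
  - intros z Hz; apply Hz.
  - intros C HC (c & Hc) H Hch. split; [|split; [|split; [|split]]].
    + split; [apply set_union|]. intros z Hz. apply in_union in Hz as (d & Hd & Hz).
      apply (H d Hd); auto.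
    + apply in_union. exists c; split; auto. apply (H c Hc).
    + intros B HB. apply in_union in HB as (d & Hd & HB). apply (H d Hd); auto.
    + intros B B' HB HB'. apply in_union in HB as (d & Hd & HB). apply in_union in HB' as (d' & Hd' & HB').
      apply in_union. destruct (Hch d d' Hd Hd') as [[_ S]|[_ S]].
      * exists d'; split; auto. apply (H d' Hd'); auto.
      * exists d; split; auto. apply (H d Hd); auto.
    + intros B B' HB H1 H2. apply in_union in HB as (d & Hd & HB). apply in_union.
      exists d; split; auto. apply (H d Hd) with B; auto.
  - exists U; split; auto. destruct HU as (U1 & U2 & U3 & U4 & U5).
    (* If no [cap D B] with [D] in [U] is finite, the filter [V] generated by [U] and [B] is proper,
       hence equal to [U] by maximality. Were neither [B] nor its complement in [U], two members of
       [U] would have a finite intersection. *)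
    assert (key : forall B, sub uni B X -> ~ B ∊ U -> exists D, D ∊ U /\ fin (cap D B)).
    { intros B HB HBU. apply NNPP; intros N. apply HBU.
      set (V := sep (pow X) (fun C => exists D, D ∊ U /\ sub uni (cap D B) C)).
      assert (HV : forall C, C ∊ V <-> sub uni C X /\ exists D, D ∊ U /\ sub uni (cap D B) C).
      { intros C. unfold V. rewrite in_sep, in_pow by dn; tauto. }
      assert (E : V = U).
      { apply Hmax.
        - split; [|split; [|split; [|split]]].
          + split; [apply set_sep; dn|]. intros C HC. apply HV in HC as [HC _]. apply in_pow; auto.
          + apply HV. split; [apply sub_refl; auto|]. exists X; split; auto.
            split; [apply set_cap|]. intros z Hz; apply in_cap in Hz; tauto.
          + intros C HC. apply HV in HC as [HC (D & HD & K)].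
            apply (infinite_sup (cap D B)); [|auto|apply HC].
            apply infinite_iff; split; [apply set_cap|]. intros L; apply N; eauto.
          + intros C C' HC HC'. apply HV in HC as [HC (D & HD & K)].
            apply HV in HC' as [HC' (D' & HD' & K')]. apply HV. split.
            * split; [apply set_cap|]. intros z Hz. apply in_cap in Hz as [Hz _]. apply HC; auto.
            * exists (cap D D'); split; auto. split; [apply set_cap|]. intros z Hz.
              rewrite !in_cap in Hz. apply in_cap. split; [apply K | apply K']; apply in_cap; tauto.
          + intros C C' HC H1 H2. apply HV in HC as [HC (D & HD & K)]. apply HV; split; auto.
            exists D; split; auto. eapply sub_trans; eauto.
        - split; [apply U1|]. intros C HC. apply HV. split; [apply in_pow, U1; auto|].
          exists C; split; auto. split; [apply set_cap|]. intros z Hz; apply in_cap in Hz; tauto. }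
      rewrite <- E. apply HV; split; auto. exists X; split; auto.
      split; [apply set_cap|]. intros z Hz; apply in_cap in Hz; tauto. }
    intros B HB. apply NNPP; intros N.
    destruct (key B HB) as (D & HD & K); [tauto|].
    destruct (key (diff X B)) as (D' & HD' & K').
    { split; [apply set_diff|]. intros z Hz; apply in_diff in Hz; tauto. }
    { tauto. }
    apply (proj2 (U3 _ (U4 _ _ HD HD'))).
    apply (fin_sub (cup (cap D B) (cap D' (diff X B)))); [apply fin_cup; auto|].
    split; [apply set_cap|]. intros z Hz. apply in_cap in Hz as [Hz Hz'].
    apply in_cup. rewrite !in_cap, in_diff.
    assert (z ∊ X). { apply U1, in_pow in HD. apply HD; auto. }
    tauto.
Qed.

Section Largeness.
Variables X U : uni.
Hypothesis HU : proper_filter X U.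
Hypothesis HUU : forall B, sub uni B X -> B ∊ U \/ diff X B ∊ U.

(** The quantifier over almost all elements of [X]. It is monotone, commutes with finite
    conjunctions and, [U] being an ultrafilter, with negation. *)
Definition large (Q : uni -> Prop) := sep X Q ∊ U.

Lemma large_mono (Q Q' : uni -> Prop) : D1 Q -> D1 Q' -> (forall x, x ∊ X -> Q x -> Q' x) ->
  large Q -> large Q'.
Proof.
  intros H H' K L. destruct HU as (U1 & U2 & U3 & U4 & U5). apply (U5 _ _ L).
  - split; [apply set_sep; auto|]. intros z Hz. rewrite in_sep in *; auto. intuition.
  - apply sub_sep; auto.
Qed.
Lemma large_and (Q Q' : uni -> Prop) : D1 Q -> D1 Q' -> large Q -> large Q' ->
  large (fun x => Q x /\ Q' x).
Proof.
  intros H H' K L. destruct HU as (U1 & U2 & U3 & U4 & U5). unfold large.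
  assert (D1 (fun x => Q x /\ Q' x)) by dn.
  replace (sep X (fun x => Q x /\ Q' x)) with (cap (sep X Q) (sep X Q')); auto.
  apply set_ext; auto using set_cap, set_sep. intros z; rewrite in_cap, !in_sep by auto; tauto.
Qed.
Lemma large_not (Q : uni -> Prop) : D1 Q -> (~ large Q <-> large (fun x => ~ Q x)).
Proof.
  intros H. destruct HU as (U1 & U2 & U3 & U4 & U5). assert (D1 (fun x => ~ Q x)) by dn.
  split.
  - intros K. destruct (HUU (sep X Q)) as [L|L]; [apply sub_sep; auto | contradiction |].
    unfold large. replace (sep X (fun x => ~ Q x)) with (diff X (sep X Q)); auto.
    apply set_ext; auto using set_diff, set_sep. intros z; rewrite in_diff, !in_sep by auto; tauto.
  - intros K L. apply (proj2 (U3 _ (U4 _ _ K L))). replace (cap _ _) with emp; [apply fin_emp|].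
    symmetry; apply empty_emp; split; [apply set_cap|]. intros z Hz.
    rewrite in_cap, !in_sep in Hz by auto; tauto.
Qed.
Lemma large_true : large (fun _ => True).
Proof.
  destruct HU as (U1 & U2 & U3 & U4 & U5). unfold large.
  replace (sep X (fun _ => True)) with X; auto.
  assert (D1 (fun _ : uni => True)) by dn.
  apply set_ext; [apply (U3 X); auto|apply set_sep; auto|].
  intros z; rewrite in_sep by auto; tauto.
Qed.
Lemma large_fin (Q : uni -> uni -> Prop) H : D2 Q -> fin H -> (forall a, a ∊ H -> large (Q a)) ->
  large (fun x => forall a, a ∊ H -> Q a x).
Proof.
  intros HQ HH.
  apply (fin_ind (fun H => (forall a, a ∊ H -> large (Q a)) -> large (fun x => forall a, a ∊ H -> Q a x))); auto.
  - unfold large. dn.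
  - intros _. apply (large_mono (fun _ => True)); try dn; [|apply large_true].
    intros x _ _ a Ha; destruct (in_emp a Ha).
  - intros y b Hy IH _ K.
    apply (large_mono (fun x => (forall a, a ∊ y -> Q a x) /\ Q b x)); try dn.
    + intros x _ [L1 L2] a Ha. apply in_adj in Ha as [Ha| ->]; auto.
    + apply large_and; try dn.
      * apply IH. intros a Ha; apply K, in_adj; auto.
      * apply K, in_adj; auto.
Qed.

Section Homogeneous.
Variable P : uni -> Prop.
Hypothesis HP : D1 P.

(** [typical j s]: for almost all [x1], ..., for almost all [xj], [P (s ∪ {x1, ..., xj})] *)
Fixpoint typical (j : nat) (s : uni) : Prop :=
  match j with
  | 0 => P s
  | S j => large (fun x => typical j (adj s x))
  end.

Lemma D1_typical j : D1 (typical j).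
Proof. induction j; simpl; auto. unfold large. dn. Qed.

Lemma chain_list C l : chain C -> (exists c, c ∊ C) -> (forall c, c ∊ C -> set c) ->
  (forall z, In z l -> z ∊ union C) -> exists c, c ∊ C /\ forall z, In z l -> z ∊ c.
Proof.
  intros HC [c0 Hc0] Hs. induction l as [|a l IH]; intros H.
  - exists c0; split; auto. intros z [].
  - destruct IH as (c & Hc & K); [intros; apply H; simpl; auto|].
    assert (Ha := H a (or_introl eq_refl)). apply in_union in Ha as (d & Hd & Ha).
    destruct (HC c d Hc Hd) as [[_ S]|[_ S]].
    + exists d; split; auto. intros z [->|Hz]; auto.
    + exists c; split; auto. intros z [->|Hz]; auto.
Qed.

Lemma large_lt (Q : nat -> uni -> Prop) n : (forall k, D1 (Q k)) ->
  (forall k, k < n -> large (Q k)) -> large (fun x => forall k, k < n -> Q k x).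
Proof.
  intros HQ H.
  assert (HD : forall j, D1 (fun x => forall k, k < j -> Q k x)).
  { intros j. apply (Dn_lt (fun k e => Q k (e 0))). exact HQ. }
  induction n.
  - apply (large_mono (fun _ => True)); auto; [dn | lia | apply large_true].
  - apply (large_mono (fun x => (forall k, k < n -> Q k x) /\ Q n x)); auto;
      [apply (Dn_and (fun e => forall k, k < n -> Q k (e 0)) (fun e => Q n (e 0)));
       [exact (HD n) | exact (HQ n)] | |].
    + intros x _ [K L] k Hk. destruct (Nat.eq_dec k n) as [->|]; auto. apply K; lia.
    + apply large_and; auto.
Qed.

Lemma cardeq_S k s x : cardeq uni (S k) s -> x ∊ s -> cardeq uni k (del s x).
Proof.
  intros H Hx. apply cardeq_list in H as [H (l & Hl & L & K)].
  apply cardeq_list. split; [apply set_del|].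
  apply K in Hx. destruct (in_split x l Hx) as (l1 & l2 & ->).
  apply NoDup_remove in Hl as [Hl Hn]. exists (l1 ++ l2). split; auto. split.
  - rewrite length_app in *; simpl in L; lia.
  - intros z. rewrite in_del, K, !in_app_iff; simpl. split; [intuition congruence|].
    intros Hz; split; [tauto|]. intros ->. apply Hn, in_app_iff; auto.
Qed.

Lemma homogeneous_exists m : typical m emp ->
  exists H, sub uni H X /\ infinite uni H /\ forall s, sub uni s H -> cardeq uni m s -> P s.
Proof.
  intros H0. pose proof D1_typical as HT.
  (* Every [k]-subset of [H] must still be extendable by [m - k] generic points. The case [k = 0] is
     the hypothesis, and [k = m] is homogeneity. *)
  set (good := fun H => sub uni H X /\ forall k, k < S m -> forall s,
    sub uni s H -> cardeq uni k s -> typical (m - k) s).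
  assert (Hgood : D1 good).
  { apply Dn_and; [dn|].
    apply (Dn_lt (fun k e => forall s, sub uni s (e 0) -> cardeq uni k s -> typical (m - k) s)).
    intros k; dn. }
  assert (HXs : set X) by (apply HU; apply HU).
  destruct (zorn good X emp Hgood) as (H & HH & _ & Hmax).
  - split; [split; [apply set_emp|]; intros z Hz; destruct (in_emp z Hz)|].
    intros k Hk s [Hs Hs'] Hc.
    assert (s = emp) as ->.
    { apply empty_emp; split; auto. intros z Hz; apply (in_emp z); auto. }
    apply cardeq_list in Hc as (_ & [|x l] & _ & L & K).
    + simpl in L; subst k. rewrite Nat.sub_0_r; auto.
    + destruct (in_emp x). apply K; simpl; auto.
  - intros z Hz; apply Hz.
  - intros C HC He HCg Hch. split.
    + split; [apply set_union|]. intros z Hz. apply in_union in Hz as (c & Hc & Hz).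
      destruct (HCg c Hc) as [[_ K] _]; auto.
    + intros k Hk s [Hs Hs'] Hc. pose proof Hc as Hc'.
      apply cardeq_list in Hc' as (_ & l & _ & _ & K).
      destruct (chain_list C l Hch He) as (c & Hcc & L).
      { intros c Hcc; apply (HCg c Hcc). }
      { intros z Hz; apply Hs', K; auto. }
      destruct (HCg c Hcc) as [_ M]. apply M; auto. split; auto.
      intros z Hz; apply L, K; auto.
  - exists H. split; [apply HH|]. split.
    + apply infinite_iff. split; [apply HH|]. intros HF.
      assert (HLd : forall k, D1 (fun x => forall s, s ∊ sep (pow H) (cardeq uni k) ->
                      typical (m - S k) (adj s x))).
      { intros k. pose proof (HT (m - S k)). dn. }
      (* A finite [H] has finitely many subsets with fewer than [m] elements, so almost every [x]
         satisfies all conditions for being adjoined. Large sets are infinite, hence such an [x]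
         exists outside [H], against maximality. *)
      assert (HL : large (fun x => forall k, k < m -> forall s, s ∊ sep (pow H) (cardeq uni k) ->
                      typical (m - S k) (adj s x))).
      { apply (large_lt (fun k x => forall s, s ∊ sep (pow H) (cardeq uni k) ->
                      typical (m - S k) (adj s x))); auto.
        intros k Hk. apply (large_fin (fun s x => typical (m - S k) (adj s x))).
        - pose proof (HT (m - S k)). dn.
        - apply (fin_sub (pow H)); [apply fin_pow; auto | apply sub_sep; dn].
        - intros s Hs. apply in_sep in Hs as [Hs Hc]; [|dn]. apply in_pow in Hs.
          destruct HH as [_ HH]. specialize (HH k ltac:(lia) s Hs Hc).
          replace (m - k) with (S (m - S k)) in HH by lia. exact HH. }
      assert (HD : D1 (fun x => forall k, k < m -> forall s, s ∊ sep (pow H) (cardeq uni k) ->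
                      typical (m - S k) (adj s x))).
      { apply (Dn_lt (fun k e => forall s, s ∊ sep (pow H) (cardeq uni k) ->
                      typical (m - S k) (adj s (e 0)))). exact HLd. }
      destruct HU as (_ & _ & U3 & _). apply U3 in HL.
      destruct (infinite_diff _ H HL HF) as (x & Hx & HxH).
      apply in_sep in Hx as [HxX Hx]; auto.
      apply HxH. rewrite <- (Hmax (adj H x)); [apply in_adj; auto| |].
      * split.
        { split; [apply set_adj|]. intros z Hz. apply in_adj in Hz as [Hz| ->]; auto. apply HH; auto. }
        intros k Hk s [Hs Hs'] Hc. destruct (classic (x ∊ s)) as [Hxs|Hxs].
        -- destruct k as [|k]; [destruct Hc as [_ Hc]; destruct (Hc x Hxs)|].
           rewrite <- (adj_del s x Hxs). apply Hx; [lia|]. apply in_sep; [dn|]. split.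
           ++ apply in_pow. split; [apply set_del|]. intros z Hz. apply in_del in Hz as [Hz Hzx].
              apply Hs', in_adj in Hz as [Hz|Hz]; auto; contradiction.
           ++ apply cardeq_S; auto.
        -- apply HH; auto. split; auto. intros z Hz. pose proof (Hs' z Hz) as K.
           apply in_adj in K as [K| ->]; auto; contradiction.
      * split; [apply HH|]. intros z Hz; apply in_adj; auto.
    + intros s Hs Hc. destruct HH as [_ HH]. specialize (HH m ltac:(lia) s Hs Hc).
      rewrite Nat.sub_diag in HH. exact HH.
Qed.
End Homogeneous.

(** For an ultrafilter, negation passes through each of the [m] nested quantifiers. *)
Lemma typical_not P m : D1 P -> forall s, ~ typical P m s -> typical (fun s => ~ P s) m s.
Proof.
  intros HP. induction m; intros s H; simpl in *; auto.
  pose proof (D1_typical P HP m) as H1. assert (HnP : D1 (fun s => ~ P s)) by dn.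
  pose proof (D1_typical _ HnP m) as H2.
  apply large_not in H; [|dn].
  apply (large_mono (fun x => ~ typical P m (adj s x))); auto; dn.
Qed.
End Largeness.

Lemma ramsey m X P : infinite uni X -> D1 P ->
  exists H, sub uni H X /\ infinite uni H /\
    ((forall s, sub uni s H -> cardeq uni m s -> P s) \/
     (forall s, sub uni s H -> cardeq uni m s -> ~ P s)).
Proof.
  intros HX HP. destruct (ultrafilter_exists X HX) as (U & HU & HUU).
  assert (HnP : D1 (fun s => ~ P s)) by dn.
  destruct (classic (typical X U P m emp)) as [K|K].
  - destruct (homogeneous_exists X U HU P HP m K) as (H & ? & ? & ?); eauto.
  - apply typical_not in K; auto.
    destruct (homogeneous_exists X U HU _ HnP m K) as (H & ? & ? & ?); eauto 6.
Qed.

(** Every colour class has at most [n] elements; by induction on [n], Ramsey's theorem is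
    applied to a set of representatives of the classes. *)
Lemma rainbow_ramsey m n : forall X χ, infinite uni X ->
  (forall s c d, pair s c ∊ χ -> pair s d ∊ χ -> c = d) ->
  (forall c l, NoDup l ->
     (forall s, In s l -> sub uni s X /\ cardeq uni m s /\ pair s c ∊ χ) -> length l <= n) ->
  exists Y, sub uni Y X /\ infinite uni Y /\
    forall s t c, sub uni s Y -> cardeq uni m s -> sub uni t Y -> cardeq uni m t ->
      pair s c ∊ χ -> pair t c ∊ χ -> s = t.
Proof.
  induction n; intros X χ HX Hf Hb.
  - exists X. split; [apply sub_refl, HX|]. split; auto. intros s t c Hs Hcs _ _ Hc _.
    specialize (Hb c [s]). simpl in Hb. exfalso. enough (1 <= 0) by lia. apply Hb.
    + constructor; auto. constructor.
    + intros u [<-|[]]; auto.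
  - set (cls := fun c => sep (pow X) (fun s => cardeq uni m s /\ pair s c ∊ χ)).
    assert (Hcls : forall c s, s ∊ cls c <-> sub uni s X /\ cardeq uni m s /\ pair s c ∊ χ).
    { intros c s. unfold cls. rewrite in_sep, in_pow by dn; tauto. }
    assert (Hcls1 : F1 cls).
    { change (Dt (fun e => cls (e 0))). unfold cls. dn. }
    assert (HR : D2 (fun c s => s ∊ cls c)) by dn.
    set (CC := sep (union (union χ)) (fun c => exists s, s ∊ cls c)).
    assert (HCC : forall c, c ∊ CC <-> exists s, s ∊ cls c).
    { intros c. unfold CC. rewrite in_sep by dn. split; [tauto|]. intros (s & Hs); split; eauto.
      apply Hcls in Hs as (_ & _ & Hs). apply in_union. exists (upair s c).
      rewrite in_upair; split; auto. apply in_union. exists (pair s c); split; auto.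
      apply in_upair; auto. }
    destruct (ac (fun c s => s ∊ cls c) CC (pow X)) as (f & Hfn & HfR); auto.
    { intros c Hc. apply HCC in Hc as (s & Hs). exists s; split; auto. apply in_pow. apply Hcls in Hs; tauto. }
    (* Either every [m]-subset of [H] is the chosen representative of its class, and then [H] is
       polychromatic; or none is, and every class restricted to [H] has lost a member, so that the
       bound drops to [n]. *)
    destruct (ramsey m X (fun s => exists c, pair c s ∊ f)) as (H & HHX & HHi & [K|K]); auto; [dn| |].
    + exists H; split; auto; split; auto. intros s t c Hs Hcs Ht Hct H1 H2.
      destruct (K s Hs Hcs) as (c1 & Hc1). destruct (K t Ht Hct) as (c2 & Hc2).
      assert (c1 = c).
      { pose proof (HfR _ _ Hc1) as L. apply Hcls in L. apply (Hf s); tauto. }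
      assert (c2 = c).
      { pose proof (HfR _ _ Hc2) as L. apply Hcls in L. apply (Hf t); tauto. }
      subst. eapply fn_fun; eauto.
    + destruct (IHn H χ HHi Hf) as (Y & HY1 & HY2 & HY3).
      * intros c l Hl L. destruct l as [|s0 l0]; [simpl; lia|]. set (l := s0 :: l0) in *.
        assert (Hc : c ∊ CC).
        { apply HCC. exists s0. destruct (L s0) as (L1 & L2 & L3); [simpl; auto|].
          apply Hcls. split; auto. eapply sub_trans; eauto. }
        destruct (fn_tot _ _ _ Hfn c Hc) as (r & Hr).
        pose proof (HfR _ _ Hr) as Hr'. apply Hcls in Hr'.
        assert (Hrl : ~ In r l).
        { intros M. destruct (L r M) as (L1 & L2 & _). apply (K r L1 L2); eauto. }
        enough (length (r :: l) <= S n) by (simpl in *; lia).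
        apply (Hb c). { constructor; auto. }
        intros s [<-|Hs]; auto. destruct (L s Hs) as (L1 & L2 & L3).
        split; auto. eapply sub_trans; eauto.
      * exists Y; split; auto. eapply sub_trans; eauto.
Qed.

End Ultra.
#[export] Hint Resolve F2_cap F2_diff D1_chain : dn.

(** * Arithmetic on [omega] *)

Section Arithmetic.
Context {Z : zfa_model}.

Definition add a b := rec a (fun _ v => succ v) b.
Lemma F2_add : F2 add. Proof. change (Dt (fun e => add (e 0) (e 1))); unfold add; dn. Qed.
Hint Resolve F2_add : dn.
Definition mul a b := rec emp (fun _ v => add v a) b.
Lemma F2_mul : F2 mul. Proof. change (Dt (fun e => mul (e 0) (e 1))); unfold mul; dn. Qed.
Hint Resolve F2_mul : dn.

Lemma F2_add_step : F2 (fun _ v => succ v). Proof. change (Dt (fun e => succ (e 1))); dn. Qed.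
Lemma F2_mul_step a : F2 (fun _ v => add v a). Proof. change (Dt (fun e => add (e 1) a)); dn. Qed.

Lemma add_0_r a : add a emp = a.
Proof. apply rec_0, F2_add_step. Qed.
Lemma add_S_r a b : b ∊ omega -> add a (succ b) = succ (add a b).
Proof. intros H; unfold add; rewrite rec_S; auto using F2_add_step. Qed.
Lemma mul_0_r a : mul a emp = emp.
Proof. apply rec_0, F2_mul_step. Qed.
Lemma mul_S_r a b : b ∊ omega -> mul a (succ b) = add (mul a b) a.
Proof. intros H; unfold mul; rewrite rec_S; auto using F2_mul_step. Qed.

Lemma add_omega a b : a ∊ omega -> b ∊ omega -> add a b ∊ omega.
Proof.
  intros Ha. apply (omega_ind (fun b => add a b ∊ omega)); [dn | rewrite add_0_r; auto |].
  intros n Hn IH. rewrite add_S_r; auto using omega_succ.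
Qed.
Lemma mul_omega a b : a ∊ omega -> b ∊ omega -> mul a b ∊ omega.
Proof.
  intros Ha. apply (omega_ind (fun b => mul a b ∊ omega)); [dn | rewrite mul_0_r; apply omega_emp |].
  intros n Hn IH. rewrite mul_S_r; auto using add_omega.
Qed.
Hint Resolve add_omega mul_omega omega_succ omega_emp : core.

Lemma add_0_l b : b ∊ omega -> add emp b = b.
Proof.
  apply (omega_ind (fun b => add emp b = b)); [dn | apply add_0_r |].
  intros n Hn IH. rewrite add_S_r, IH; auto.
Qed.
Lemma add_S_l a b : a ∊ omega -> b ∊ omega -> add (succ a) b = succ (add a b).
Proof.
  intros Ha. apply (omega_ind (fun b => add (succ a) b = succ (add a b)));
    [dn | rewrite !add_0_r; auto |].
  intros n Hn IH. rewrite !add_S_r, IH; auto.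
Qed.
Lemma add_comm a b : a ∊ omega -> b ∊ omega -> add a b = add b a.
Proof.
  intros Ha. apply (omega_ind (fun b => add a b = add b a)); [dn | rewrite add_0_r, add_0_l; auto |].
  intros n Hn IH. rewrite add_S_r, add_S_l, IH; auto.
Qed.
Lemma add_assoc a b c : a ∊ omega -> b ∊ omega -> c ∊ omega -> add a (add b c) = add (add a b) c.
Proof.
  intros Ha Hb. apply (omega_ind (fun c => add a (add b c) = add (add a b) c));
    [dn | rewrite !add_0_r; auto |].
  intros n Hn IH. rewrite !add_S_r, IH; auto.
Qed.
Lemma mul_0_l b : b ∊ omega -> mul emp b = emp.
Proof.
  apply (omega_ind (fun b => mul emp b = emp)); [dn | apply mul_0_r |].
  intros n Hn IH. rewrite mul_S_r, IH, add_0_r; auto.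
Qed.
Lemma mul_S_l a b : a ∊ omega -> b ∊ omega -> mul (succ a) b = add (mul a b) b.
Proof.
  intros Ha. apply (omega_ind (fun b => mul (succ a) b = add (mul a b) b));
    [dn | rewrite !mul_0_r, add_0_r; auto |].
  intros n Hn IH. rewrite !mul_S_r, IH, !add_S_r; auto.
  rewrite <- !add_assoc, (add_comm n a); auto.
Qed.
Lemma mul_comm a b : a ∊ omega -> b ∊ omega -> mul a b = mul b a.
Proof.
  intros Ha. apply (omega_ind (fun b => mul a b = mul b a)); [dn | rewrite mul_0_r, mul_0_l; auto |].
  intros n Hn IH. rewrite mul_S_r, mul_S_l, IH; auto.
Qed.
Lemma mul_add_l a b c : a ∊ omega -> b ∊ omega -> c ∊ omega ->
  mul (add a b) c = add (mul a c) (mul b c).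
Proof.
  intros Ha Hb. apply (omega_ind (fun c => mul (add a b) c = add (mul a c) (mul b c)));
    [dn | rewrite !mul_0_r, add_0_r; auto |].
  intros n Hn IH. rewrite !mul_S_r, IH; auto.
  rewrite <- !add_assoc; auto. f_equal.
  rewrite !add_assoc, (add_comm (mul b n) a); auto.
Qed.
Lemma mul_assoc a b c : a ∊ omega -> b ∊ omega -> c ∊ omega -> mul a (mul b c) = mul (mul a b) c.
Proof.
  intros Ha Hb. apply (omega_ind (fun c => mul a (mul b c) = mul (mul a b) c));
    [dn | rewrite !mul_0_r; auto |].
  intros n Hn IH. rewrite !mul_S_r, <- IH; auto.
  rewrite (mul_comm a (add _ _)), mul_add_l, !(mul_comm _ a); auto.
Qed.

(** [omega] as a type of the metatheory, so that [ring] can compute with possibly nonstandard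
    numbers. *)
Definition nat_in := {x : uni | x ∊ omega}.
Definition mkn (a : uni) (H : a ∊ omega) : nat_in := exist (fun x => x ∊ omega) a H.
Definition nz : nat_in := mkn emp omega_emp.
Definition ns (a : nat_in) : nat_in := mkn _ (omega_succ _ (proj2_sig a)).
Definition n1 : nat_in := ns nz.
Definition na (a b : nat_in) : nat_in := mkn _ (add_omega _ _ (proj2_sig a) (proj2_sig b)).
Definition nm (a b : nat_in) : nat_in := mkn _ (mul_omega _ _ (proj2_sig a) (proj2_sig b)).
Local Notation "^ a" := (proj1_sig a) (at level 5, a at level 5).

Lemma nat_in_eq (a b : nat_in) : ^a = ^b -> a = b.
Proof. destruct a, b; simpl; intros ->; f_equal; apply proof_irrelevance. Qed.

Lemma nat_in_semiring : semi_ring_theory nz n1 na nm eq.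
Proof.
  split; intros; apply nat_in_eq; simpl;
    repeat match goal with a : nat_in |- _ => destruct a; simpl end;
    auto using add_0_l, add_comm, add_assoc, mul_0_l, mul_comm, mul_assoc, mul_add_l.
  rewrite mul_S_l, mul_0_l, add_0_l; auto.
Qed.
Add Ring nat_in_ring : nat_in_semiring.

Lemma ns_add a : ns a = na a n1.
Proof. apply nat_in_eq; simpl. rewrite add_S_r, add_0_r; auto. Qed.

(** The order as an equation with a witness, so that inequalities too are reduced to [ring]. *)
Definition nlt (a b : nat_in) := exists k, b = na (na a k) n1.

Lemma mem_nlt (a b : nat_in) : ^a ∊ ^b <-> nlt a b.
Proof.
  split.
  - destruct a as [a Ha], b as [b Hb]; simpl. intros H.
    assert (exists k, k ∊ omega /\ b = succ (add a k)) as (k & Hk & E).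
    { revert H. revert b Hb.
      apply (omega_ind (fun b => a ∊ b -> exists k, k ∊ omega /\ b = succ (add a k))); [dn| |].
      - intros H; destruct (in_emp a H).
      - intros n Hn IH H. apply in_succ in H as [H| ->].
        + destruct (IH H) as (k & Hk & ->). exists (succ k). rewrite add_S_r; auto.
        + exists emp. rewrite add_0_r; auto. }
    exists (mkn k Hk). rewrite <- ns_add. apply nat_in_eq; simpl. auto.
  - intros [k ->]. rewrite <- ns_add. destruct a as [a Ha], k as [k Hk]; simpl.
    apply (omega_ind (fun k => a ∊ succ (add a k))); auto; [dn| |].
    + rewrite add_0_r; apply in_succ; auto.
    + intros n Hn IH. rewrite add_S_r; auto. apply in_succ; auto.
Qed.

Lemma nlt_irrefl a : ~ nlt a a.
Proof. rewrite <- mem_nlt. apply nat_irrefl, (proj2_sig a). Qed.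
Lemma nlt_total a b : nlt a b \/ a = b \/ nlt b a.
Proof.
  destruct (nat_total ^a ^b (proj2_sig a) (proj2_sig b)) as [H|[H|H]].
  - left; apply mem_nlt; auto.
  - right; left; apply nat_in_eq; auto.
  - right; right; apply mem_nlt; auto.
Qed.
Lemma nlt_trans a b c : nlt a b -> nlt b c -> nlt a c.
Proof. intros [k ->] [j ->]. exists (na (na k j) n1). ring. Qed.
Lemma nlt_add a b c : nlt a b -> nlt (na a c) (na b c).
Proof. intros [k ->]. exists k. ring. Qed.
Lemma nlt_mul a b c : nlt a b -> nlt (nm a (na c n1)) (nm b (na c n1)).
Proof. intros [k ->]. exists (na (na (nm k c) k) c). ring. Qed.
Lemma nlt_add_cancel a b c : nlt (na a c) (na b c) -> nlt a b.
Proof.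
  intros H. destruct (nlt_total a b) as [K|[->|K]]; auto.
  - destruct (nlt_irrefl _ H).
  - destruct (nlt_irrefl (na a c)). apply (nlt_trans _ (na b c)); auto. apply nlt_add; auto.
Qed.
Lemma nlt_mul_cancel a b c : nlt (nm a (na c n1)) (nm b (na c n1)) -> nlt a b.
Proof.
  intros H. destruct (nlt_total a b) as [K|[->|K]]; auto.
  - destruct (nlt_irrefl _ H).
  - destruct (nlt_irrefl (nm a (na c n1))). apply (nlt_trans _ (nm b (na c n1))); auto.
    apply nlt_mul; auto.
Qed.
Lemma na_cancel a b c : na a c = na b c -> a = b.
Proof.
  intros H. destruct (nlt_total a b) as [K|[K|K]]; auto;
    apply (nlt_add _ _ c) in K; rewrite H in K; destruct (nlt_irrefl _ K).
Qed.
Lemma nm_cancel a b c : nm a (na c n1) = nm b (na c n1) -> a = b.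
Proof.
  intros H. destruct (nlt_total a b) as [K|[K|K]]; auto;
    apply (nlt_mul _ _ c) in K; rewrite H in K; destruct (nlt_irrefl _ K).
Qed.

(** A quadratic pairing: with s = a + b, the value lies between the square of s and the square of s
    + 1, so it determines s, then [a], then [b]. *)
Definition code (a b : nat_in) := na (nm (na a b) (na a b)) a.

Lemma code_lt a b a' b' : nlt (na a b) (na a' b') -> nlt (code a b) (code a' b').
Proof.
  intros [k E]. unfold code. rewrite E.
  (* With s = a + b and a' + b' = s + k + 1, this is the difference of the codes minus one: b + s(2k
     + 1) + (kk + 2k) + a'. *)
  exists (na (na b (nm (na a b) (na (na k k) n1))) (na (na (nm k k) (na k k)) a')). ring.
Qed.
Lemma code_inj a b a' b' : code a b = code a' b' -> a = a' /\ b = b'.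
Proof.
  intros H. destruct (nlt_total (na a b) (na a' b')) as [K|[K|K]].
  - apply code_lt in K. rewrite H in K; destruct (nlt_irrefl _ K).
  - assert (a = a') as ->.
    { unfold code in H. rewrite K in H. apply (na_cancel _ _ (nm (na a' b') (na a' b'))).
      etransitivity; [|etransitivity; [exact H|]]; ring. }
    split; auto. apply (na_cancel _ _ a'). etransitivity; [|etransitivity; [exact K|]]; ring.
  - apply code_lt in K. rewrite H in K; destruct (nlt_irrefl _ K).
Qed.

Lemma code_inj_omega a b a' b' : a ∊ omega -> b ∊ omega -> a' ∊ omega -> b' ∊ omega ->
  add (mul (add a b) (add a b)) a = add (mul (add a' b') (add a' b')) a' -> a = a' /\ b = b'.
Proof.
  intros Ha Hb Ha' Hb' H.
  destruct (code_inj (mkn a Ha) (mkn b Hb) (mkn a' Ha') (mkn b' Hb')) as [E1 E2].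
  - apply nat_in_eq; exact H.
  - split; [exact (f_equal (@proj1_sig _ _) E1) | exact (f_equal (@proj1_sig _ _) E2)].
Qed.

End Arithmetic.
#[export] Hint Resolve F2_add F2_mul : dn.

(** * Countable sets and the Delta-system lemma under choice *)

Section Countable.
Context {Z : zfa_model} {AC : has_choice}.

Definition countable x := exists f, isinj uni f x omega.
Lemma D1_countable : D1 countable. Proof. unfold countable; dn. Qed.
Hint Resolve D1_countable : dn.

Lemma countable_of_rel (R : uni -> uni -> Prop) S T : D2 R -> countable T ->
  (forall x, x ∊ S -> exists n, n ∊ T /\ R x n) ->
  (forall x x' n, x ∊ S -> x' ∊ S -> R x n -> R x' n -> x = x') -> countable S.
Proof.
  intros HR (t & Ht) H K. apply isinj_iff in Ht as [Ht Hti].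
  destruct (ac R S T HR H) as (g & Hg & L).
  assert (HD : D2 (fun x n => exists y, pair x y ∊ g /\ pair y n ∊ t)) by dn.
  exists (graph S omega (fun x n => exists y, pair x y ∊ g /\ pair y n ∊ t)).
  apply isinj_iff. split.
  - apply fn_graph; auto.
    + intros x Hx. destruct (fn_tot _ _ _ Hg x Hx) as [y Hy].
      destruct (fn_tot _ _ _ Ht y) as [n Hn]; [eapply fn_cod; eauto|].
      exists n; split; eauto. eapply fn_cod; eauto.
    + intros x n n' _ (y & Hy & Hn) (y' & Hy' & Hn').
      rewrite (fn_fun _ _ _ Hg _ _ _ Hy' Hy) in Hn'. apply (fn_fun _ _ _ Ht y); auto.
  - intros x x' n Hp Hp'. apply in_graph in Hp as (Hx & _ & y & Hy & Hn); auto.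
    apply in_graph in Hp' as (Hx' & _ & y' & Hy' & Hn'); auto.
    rewrite (Hti _ _ _ Hn' Hn) in Hy'. apply (K x x' y); auto.
Qed.

Lemma countable_sub S T : countable T -> (forall x, x ∊ S -> x ∊ T) -> countable S.
Proof. intros HT H. apply (countable_of_rel eq S T); auto; [dn | eauto | congruence]. Qed.

Lemma countable_omega : countable omega.
Proof.
  exists (graph omega omega eq). apply isinj_iff. split.
  - apply fn_graph; [dn | eauto | congruence].
  - intros a b c Ha Hb. apply in_graph in Ha as (_ & _ & ->); [|dn].
    apply in_graph in Hb as (_ & _ & ->); [auto|dn].
Qed.

Lemma countable_fin x : fin x -> countable x.
Proof.
  intros H. apply fin_ex in H as (_ & n & Hn & f & Hf). apply isbij_iff in Hf as (Hf & _ & Hs).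
  apply (countable_of_rel (fun v u => pair u v ∊ f) x omega); [dn | apply countable_omega | |].
  - intros v Hv. destruct (Hs v Hv) as [u Hu]. exists u; split; auto.
    apply (omega_trans n); auto. eapply fn_dom; eauto.
  - intros v v' u _ _ H H'. eapply fn_fun; eauto.
Qed.

(** A countable union of countable sets: choice selects an injection for every fibre, and the index
    of the fibre and the place inside it are combined by the quadratic pairing. *)
Lemma countable_fibers g S T : fn g S T -> countable T ->
  (forall y, y ∊ T -> countable (sep S (fun x => pair x y ∊ g))) -> countable S.
Proof.
  intros Hg (t & Ht) H. apply isinj_iff in Ht as [Ht Hti].
  assert (HD1 : forall y, D1 (fun x => pair x y ∊ g)) by (intros; dn).
  destruct (ac (fun y i => isinj uni i (sep S (fun x => pair x y ∊ g)) omega)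
              T (pow (prod S omega))) as (J & HJ & HJR).
  - dn.
  - intros y Hy. destruct (H y Hy) as [i Hi]. exists i; split; auto.
    apply isinj_iff in Hi as [Hi _]. apply in_pow. split; [eapply fn_set; eauto|].
    intros p Hp. destruct (fn_pairs _ _ _ Hi p Hp) as (a & b & ->). apply in_prod.
    split; [|eapply fn_cod; eauto]. apply (fn_dom _ _ _ Hi) in Hp. apply in_sep in Hp; [tauto|auto].
  - assert (HJR' : forall y j, pair y j ∊ J -> fn j (sep S (fun x => pair x y ∊ g)) omega /\ injective j).
    { intros y j Hp. apply isinj_iff. apply HJR; auto. }
    apply (countable_of_rel (fun x n => exists y j a b, pair x y ∊ g /\ pair y a ∊ t /\
      pair y j ∊ J /\ pair x b ∊ j /\ n = add (mul (add a b) (add a b)) a) S omega);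
      [dn | apply countable_omega | |].
    + intros x Hx. destruct (fn_tot _ _ _ Hg x Hx) as [y Hy].
      assert (HyT := fn_cod _ _ _ Hg _ _ Hy).
      destruct (fn_tot _ _ _ Ht y HyT) as [a Ha]. destruct (fn_tot _ _ _ HJ y HyT) as [j Hj].
      destruct (HJR' y j Hj) as [Hj' _].
      destruct (fn_tot _ _ _ Hj' x) as [b Hb]; [apply in_sep; auto|].
      exists (add (mul (add a b) (add a b)) a). split; [|exists y, j, a, b; auto 10].
      assert (a ∊ omega) by (eapply (fn_cod _ _ _ Ht); eauto).
      assert (b ∊ omega) by (eapply (fn_cod _ _ _ Hj'); eauto).
      auto using add_omega, mul_omega.
    + intros x x' n _ _ (y & j & a & b & Hy & Ha & Hj & Hb & ->)
        (y' & j' & a' & b' & Hy' & Ha' & Hj' & Hb' & E).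
      destruct (HJR' y j Hj) as [K1 K2]. destruct (HJR' y' j' Hj') as [K1' _].
      apply code_inj_omega in E as [<- <-];
        [| eapply (fn_cod _ _ _ Ht); eauto | eapply (fn_cod _ _ _ K1); eauto
         | eapply (fn_cod _ _ _ Ht); eauto | eapply (fn_cod _ _ _ K1'); eauto].
      assert (y' = y) as -> by apply (Hti _ _ _ Ha' Ha).
      assert (j' = j) as -> by (apply (fn_fun _ _ _ HJ y); auto).
      apply (K2 x x' b); auto.
Qed.

Definition delta r B :=
  set r /\ forall x y, x ∊ B -> y ∊ B -> ~ x = y -> forall z, z ∊ r <-> z ∊ x /\ z ∊ y.
Lemma D2_delta : D2 delta. Proof. unfold delta; dn. Qed.
Hint Resolve D2_delta : dn.

(** [C] is a maximal subfamily whose members are pairwise disjoint outside [r]. By maximality every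
    [x] in [A] meets some member of [C] outside [r]; a member of [C] meets itself there because
    [diff x r] has [succ k] elements. If [C] is countable, [A] is then covered by countably many
    families, each the members through one point outside [r], and these are countable by
    hypothesis. *)
Lemma delta_of_sparse A r k : set A -> set r ->
  (forall x, x ∊ A -> sub uni r x /\ exists f, isbij uni f (succ k) (diff x r)) -> k ∊ omega ->
  (forall p, ~ p ∊ r -> countable (sep A (fun x => p ∊ x))) ->
  exists C, sub uni C A /\ delta r C /\ (countable C -> countable A).
Proof.
  intros HA Hr HAr Hk Hp.
  assert (HApt : forall x, x ∊ A -> fin (diff x r) /\ exists p, p ∊ diff x r).
  { intros x Hx. destruct (HAr x Hx) as (_ & f & Hf). split.
    - apply (fin_bij _ (succ k)); eauto using set_diff, omega_succ.
    - apply isbij_iff in Hf as (Hf & _). destruct (fn_tot _ _ _ Hf k) as [p Hp'].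
      + apply in_succ; auto.
      + exists p; eapply fn_cod; eauto. }
  destruct (zorn (fun C => sub uni C A /\ forall x y, x ∊ C -> y ∊ C -> x <> y ->
              forall z, z ∊ x -> z ∊ y -> z ∊ r) A emp) as (C & (HC & HCd) & _ & Hmax).
  - dn.
  - split; [split; [apply set_emp|]|]; intros x; intros; destruct (in_emp x); auto.
  - tauto.
  - intros D HD _ HDP Hch. split.
    + split; [apply set_union|]. intros x Hx. apply in_union in Hx as (d & Hd & Hx).
      apply (HDP d Hd); auto.
    + intros x y Hx Hy. apply in_union in Hx as (d & Hd & Hx). apply in_union in Hy as (d' & Hd' & Hy).
      destruct (Hch d d' Hd Hd') as [[_ S]|[_ S]].
      * apply (HDP d' Hd'); auto.
      * apply (HDP d Hd); auto.
  - exists C; split; auto. split.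
    + split; auto. intros x y Hx Hy N z. split; [|intros []; apply (HCd x y); auto].
      intros Hz. assert (L : forall w, w ∊ C -> z ∊ w).
      { intros w Hw. destruct (HAr w) as [[_ L] _]; auto. apply HC; auto. }
      auto.
    + intros Hcount.
      (* [g] assigns to each [x] a member of [C] that it meets outside [r]. *)
      destruct (ac (fun x c => exists p, p ∊ c /\ p ∊ x /\ ~ p ∊ r) A C) as (g & Hg & HgR).
      { dn. }
      { intros x Hx. apply NNPP; intros N.
        destruct (HApt x Hx) as (_ & p & Hpx). apply in_diff in Hpx as [Hpx Hpr].
        assert (HxC : x ∊ C).
        { rewrite <- (Hmax (adj C x)).
          - apply in_adj; auto.
          - split.
            + split; [apply set_adj|]. intros z Hz. apply in_adj in Hz as [Hz| ->]; auto. apply HC; auto.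
            + intros y y' Hy Hy' Ny z Hz Hz'. apply NNPP; intros Nz. apply N.
              apply in_adj in Hy as [Hy| ->]; apply in_adj in Hy' as [Hy'| ->].
              * destruct Nz; apply (HCd y y'); auto.
              * exists y; split; eauto.
              * exists y'; split; eauto.
              * contradiction.
          - split; [apply HC|]. intros z Hz; apply in_adj; auto. }
        apply N. exists x; split; eauto. }
      apply (countable_fibers g A C Hg Hcount).
      intros c Hc. assert (HcA : c ∊ A) by (apply HC; auto).
      assert (HDc : D1 (fun x => pair x c ∊ g)) by dn.
      (* Each fibre of [g] over [c] is split once more, by [h], according to a common point in the
         finite set [diff c r]. *)
      destruct (ac (fun x p => p ∊ x) (sep A (fun x => pair x c ∊ g)) (diff c r)) as (h & Hh & HhR).
      { dn. }
      { intros x Hx. apply in_sep in Hx as [_ Hx]; auto. destruct (HgR _ _ Hx) as (p & H1 & H2 & H3).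
        exists p. rewrite in_diff; auto. }
      apply (countable_fibers h _ _ Hh); [apply countable_fin, HApt; auto|].
      intros p Hpc. apply in_diff in Hpc as [_ Hpr]. assert (HDp : D1 (fun x => pair x p ∊ h)) by dn.
      assert (HDp' : D1 (fun x => p ∊ x)) by dn.
      apply (countable_sub _ _ (Hp p Hpr)). intros x Hx.
      apply in_sep in Hx as [Hx Hxp]; auto. apply in_sep in Hx as [Hx _]; auto.
      apply in_sep; auto.
Qed.

(** Induction on the number [n] of points outside the provisional root [r]. A point outside [r] that
    lies in uncountably many members is added to [r]; if there is none, the sparse case applies. For
    [n] empty all members equal [r]. *)
Lemma delta_system_of_size n : n ∊ omega -> forall A r, set A -> ~ countable A -> set r ->
  (forall x, x ∊ A -> set x /\ sub uni r x /\ exists f, isbij uni f n (diff x r)) ->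
  exists C, sub uni C A /\ ~ countable C /\ exists r', delta r' C.
Proof.
  apply (omega_ind (fun n => forall A r, set A -> ~ countable A -> set r ->
    (forall x, x ∊ A -> set x /\ sub uni r x /\ exists f, isbij uni f n (diff x r)) ->
    exists C, sub uni C A /\ ~ countable C /\ exists r', delta r' C)); [dn| |].
  - intros A r HA HAu Hr H. destruct HAu. apply (countable_sub A (adj emp r)).
    + apply countable_fin, fin_adj, fin_emp.
    + intros x Hx. apply in_adj. right. destruct (H x Hx) as (Hsx & Hrx & Hf).
      apply bij_emp in Hf; [|apply set_diff]. apply sub_antisym; auto.
      split; auto. intros z Hz. apply NNPP; intros K. apply (in_emp z). rewrite <- Hf.
      apply in_diff; auto.
  - intros k Hk IH A r HA HAu Hr H.
    destruct (classic (exists p, ~ p ∊ r /\ ~ countable (sep A (fun x => p ∊ x)))) as [(p & Hp & N)|N].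
    + destruct (IH (sep A (fun x => p ∊ x)) (adj r p)) as (C & HC & HCu & HCd); auto.
      * apply set_sep; dn.
      * apply set_adj.
      * intros x Hx. apply in_sep in Hx as [Hx Hpx]; [|dn]. destruct (H x Hx) as (Hsx & Hrx & Hf). split; [auto|split].
        -- split; [apply set_adj|]. intros z Hz. apply in_adj in Hz as [Hz| ->]; auto. apply Hrx; auto.
        -- replace (diff x (adj r p)) with (del (diff x r) p).
           ++ apply bij_del; auto. apply in_diff; auto.
           ++ apply set_ext; auto using set_del, set_diff. intros z.
              rewrite in_del, !in_diff, in_adj; tauto.
      * exists C; split; auto. apply (sub_trans _ _ _ HC). apply sub_sep; dn.
    + destruct (delta_of_sparse A r k) as (C & HC & HCd & HCc); auto.
      * intros x Hx. apply H; auto.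
      * intros p Hp. apply NNPP; intros K; apply N; eauto.
      * exists C; split; auto. split; eauto.
Qed.

(** There are only countably many sizes, so uncountably many members share one. *)
Lemma delta_system_choice A : set A -> ~ countable A -> (forall x, x ∊ A -> fin x) ->
  exists C, sub uni C A /\ ~ countable C /\ exists r, delta r C.
Proof.
  intros HA HAu H.
  destruct (ac (fun x n => exists f, isbij uni f n x) A omega) as (g & Hg & HgR).
  - dn.
  - intros x Hx. apply H, fin_ex in Hx as (_ & n & Hn & Hf); eauto.
  - assert (exists n, n ∊ omega /\ ~ countable (sep A (fun x => pair x n ∊ g))) as (n & Hn & N).
    { apply NNPP; intros N. apply HAu. apply (countable_fibers g A omega Hg countable_omega).
      intros n Hn. apply NNPP; intros K; apply N; eauto. }
    assert (HD : D1 (fun x => pair x n ∊ g)) by dn.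
    destruct (delta_system_of_size n Hn (sep A (fun x => pair x n ∊ g)) emp) as (C & HC & HC').
    + apply set_sep; auto.
    + auto.
    + apply set_emp.
    + intros x Hx. apply in_sep in Hx as [Hx Hxn]; auto. assert (set x) by (apply H; auto). split; [auto|split].
      * split; [apply set_emp|]. intros z Hz; destruct (in_emp z Hz).
      * replace (diff x emp) with x; [apply HgR; auto|].
        apply set_ext; auto using set_diff. intros z; rewrite in_diff. split; [|tauto].
        intros Hz; split; auto; apply in_emp.
    + exists C; split; auto. apply (sub_trans _ _ _ HC). apply sub_sep; auto.
Qed.

End Countable.
#[export] Hint Resolve D1_countable D2_delta : dn.

(** * The action of a permutation of the atoms on the universe *)

Section Action.
Context {Z : zfa_model}.

(** One unfolding of the recursion defining the action. It needs no approximating function at [x]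
    itself, so it can be used to build one. *)
Definition val (g x y : uni) :=
  (ratm uni x /\ pair x y ∊ g) \/
  (set x /\ set y /\ forall v, v ∊ y <-> exists s, s ∊ x /\ acts uni g s v).
Lemma D3_val : D3 val. Proof. unfold val; dn. Qed.
Hint Resolve D3_val : dn.

Definition act (g x : uni) : uni := iota (fun y => acts uni g x y).
Lemma F2_act : F2 act. Proof. change (Dt (fun e => act (e 0) (e 1))); unfold act; dn. Qed.
Hint Resolve F2_act : dn.

Lemma acts_iff g x y : acts uni g x y <->
  exists T U f, transitive uni T /\ x ∊ T /\ fn f T U /\
    (forall t u, pair t u ∊ f -> ratm uni t -> pair t u ∊ g) /\
    (forall t u, pair t u ∊ f -> set t -> set u /\ forall v, v ∊ u <-> exists s, s ∊ t /\ pair s v ∊ f) /\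
    pair x y ∊ f.
Proof.
  unfold acts. apply iff_ex; intros T; apply iff_ex; intros U; apply iff_ex; intros f.
  rewrite isfun_iff, app_iff.
  repeat (apply iff_and; [tauto|]). apply iff_and; [|apply iff_and; [|tauto]];
    apply iff_all; intros t; apply iff_all; intros u; rewrite ?app_iff; [tauto|].
  apply iff_imp; [tauto|]. apply iff_imp; [tauto|]. apply iff_and; [tauto|].
  apply iff_all; intros v.
  assert (E : (exists s, s ∊ t /\ app uni f s v) <-> (exists s, s ∊ t /\ pair s v ∊ f)).
  { apply iff_ex; intros s; rewrite app_iff; tauto. }
  rewrite E; tauto.
Qed.

Section OnePermutation.
Variables A g : uni.
Hypothesis HA : isatomset uni A.
Hypothesis Hg : fn g A A.

Lemma acts_unique x y y' : acts uni g x y -> acts uni g x y' -> y = y'.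
Proof.
  intros H H'. apply acts_iff in H as (T & U & f & T1 & T2 & T3 & T4 & T5 & T6).
  apply acts_iff in H' as (T' & U' & f' & T1' & T2' & T3' & T4' & T5' & T6').
  revert y y' T6 T6'. apply (eps_ind (fun x => forall y y', pair x y ∊ f -> pair x y' ∊ f' -> y = y')).
  - dn.
  - clear x T2 T2'. intros t IH u u' Hu Hu'. destruct (classic (ratm uni t)) as [K|K].
    + apply (fn_fun _ _ _ Hg t); auto.
    + destruct (T5 _ _ Hu K) as [L1 L2]. destruct (T5' _ _ Hu' K) as [L1' L2'].
      assert (Ht : t ∊ T) by (eapply fn_dom; eauto). assert (Ht' : t ∊ T') by (eapply fn_dom; eauto).
      apply set_ext; auto. intros v. rewrite L2, L2'. apply iff_ex; intros s.
      split; intros [Hs Hv]; split; auto.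
      * destruct (fn_tot _ _ _ T3' s) as [w Hw]; [eapply T1'; eauto|].
        rewrite (IH s Hs v w); auto.
      * destruct (fn_tot _ _ _ T3 s) as [w Hw]; [eapply T1; eauto|].
        rewrite <- (IH s Hs w v); auto.
Qed.

Lemma acts_val x y : acts uni g x y -> val g x y.
Proof.
  intros H. apply acts_iff in H as (T & U & f & T1 & T2 & T3 & T4 & T5 & T6).
  destruct (classic (ratm uni x)) as [K|K]; [left; auto | right].
  split; auto. destruct (T5 _ _ T6 K) as [L M]. split; auto.
  assert (W : forall s w, pair s w ∊ f -> acts uni g s w).
  { intros s w Hw. apply acts_iff. exists T, U, f. repeat (split; auto). eapply fn_dom; eauto. }
  intros v. rewrite M. apply iff_ex; intros s. split; intros [Hs Hv]; split; auto.
  destruct (fn_tot _ _ _ T3 s) as [w Hw]; [eapply T1; eauto|].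
  rewrite (acts_unique s v w); auto.
Qed.

Lemma acts_members x y s : acts uni g x y -> s ∊ x -> exists v, acts uni g s v.
Proof.
  intros H Hs. apply acts_iff in H as (T & U & f & T1 & T2 & T3 & T4 & T5 & T6).
  destruct (fn_tot _ _ _ T3 s) as [w Hw]; [eapply T1; eauto|]. exists w.
  apply acts_iff. exists T, U, f. repeat (split; auto). eapply T1; eauto.
Qed.

Lemma val_unique x y y' : val g x y -> val g x y' -> y = y'.
Proof.
  intros [[H1 H2]|(H1 & H2 & H3)] [[K1 K2]|(K1 & K2 & K3)]; try contradiction.
  - apply (fn_fun _ _ _ Hg x); auto.
  - apply set_ext; auto. intros v; rewrite H3, K3; tauto.
Qed.

Lemma val_exists x : (forall s, s ∊ x -> exists v, acts uni g s v) -> exists y, val g x y.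
Proof.
  intros H. destruct (classic (ratm uni x)) as [K|K].
  - destruct (fn_tot _ _ _ Hg x) as [y Hy]; [apply HA; auto|]. exists y; left; auto.
  - destruct (small_repl (acts uni g) x) as (y & Hy & L); [dn | intros; eapply acts_unique; eauto |].
    exists y; right; auto.
Qed.

Lemma acts_exists x : exists y, acts uni g x y.
Proof.
  apply (eps_ind (fun x => exists y, acts uni g x y)); [dn|]. clear x. intros x IH.
  set (T := tc (upair x x)). destruct (tc_istc (upair x x) (set_upair _ _)) as (T1 & T2 & T3).
  assert (HxT : x ∊ T) by (apply T1, in_upair; auto).
  assert (HD : D1 (fun t => t = x \/ exists y, acts uni g t y)) by dn.
  (* The elements of [T] that are [x] or already have an image form a transitive set containing [x],
     hence are all of [T]; so every member of an element of [T] has an image. *)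
  assert (HT : forall t, t ∊ T -> forall s, s ∊ t -> exists y, acts uni g s y).
  { destruct (T3 (sep T (fun t => t = x \/ exists y, acts uni g t y))) as [_ K].
    - intros t s Ht Hs. apply in_sep in Ht as [Ht Hc]; auto. apply in_sep; auto.
      split; [eapply T2; eauto|]. right. destruct Hc as [->|(y & Hy)]; auto.
      eapply acts_members; eauto.
    - split; [apply set_upair|]. intros z Hz. apply in_sep; auto. split; [apply T1; auto|].
      left. apply in_upair in Hz; tauto.
    - intros t Ht s Hs. apply K, in_sep in Ht as [Ht Hc]; auto.
      destruct Hc as [->|(y & Hy)]; auto. eapply acts_members; eauto. }
  assert (HV : D2 (val g)) by dn.
  destruct (small_repl (val g) T HV) as (U & _ & HU).
  { intros; eapply val_unique; eauto. }
  assert (Hf : fn (graph T U (val g)) T U).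
  { apply fn_graph; auto.
    - intros t Ht. destruct (val_exists t (HT t Ht)) as [y Hy]. exists y; split; auto. apply HU; eauto.
    - intros a b c _ Hb Hc. eapply val_unique; eauto. }
  destruct (val_exists x IH) as [y Hy]. exists y. apply acts_iff. exists T, U, (graph T U (val g)).
  split; [exact T2|]. split; [auto|]. split; [auto|]. split; [|split].
  - intros t u Hp Hta. apply in_graph in Hp as (_ & _ & [[_ K]|[K _]]); auto. contradiction.
  - intros t u Hp Hts. apply in_graph in Hp as (Ht & _ & [[K _]|(_ & Hu & K)]); auto; [contradiction|].
    split; auto. intros v. rewrite K. apply iff_ex; intros s. split; intros [Hs Hv]; split; auto.
    + apply in_graph; auto. assert (s ∊ T) by (eapply T2; eauto).
      apply acts_val in Hv. split; auto. split; auto. apply HU; eauto.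
    + apply in_graph in Hv as (_ & _ & Hv); auto. destruct (HT t Ht s Hs) as [w Hw].
      rewrite (val_unique s v w); auto. apply acts_val; auto.
  - apply in_graph; auto. split; auto. split; auto. apply HU; eauto.
Qed.

Lemma acts_act x y : acts uni g x y <-> y = act g x.
Proof.
  destruct (acts_exists x) as [z Hz].
  assert (E : act g x = z) by (apply iota_eq; auto; intros; eapply acts_unique; eauto).
  rewrite E. split; [intros; eapply acts_unique; eauto | intros ->; auto].
Qed.

Lemma act_atom a : a ∊ A -> pair a (act g a) ∊ g.
Proof.
  intros Ha. assert (H : acts uni g a (act g a)) by (apply acts_act; auto).
  apply acts_val in H as [[_ H]|[H _]]; auto. destruct H. apply HA; auto.
Qed.
Lemma act_atom_A a : a ∊ A -> act g a ∊ A.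
Proof. intros H. eapply (fn_cod _ _ _ Hg). apply act_atom; auto. Qed.
Lemma act_atom_eq a b : pair a b ∊ g -> act g a = b.
Proof.
  intros H. apply (fn_fun _ _ _ Hg a); auto. apply act_atom. eapply (fn_dom _ _ _ Hg); eauto.
Qed.

Lemma act_set x : set x -> set (act g x) /\ forall v, v ∊ act g x <-> exists s, s ∊ x /\ v = act g s.
Proof.
  intros Hx. assert (H : acts uni g x (act g x)) by (apply acts_act; auto).
  apply acts_val in H as [[H _]|(_ & H & K)]; [contradiction|]. split; auto.
  intros v; rewrite K. apply iff_ex; intros s. rewrite acts_act; tauto.
Qed.
Lemma in_act x v : set x -> v ∊ act g x <-> exists s, s ∊ x /\ v = act g s.
Proof. intros H; apply act_set; auto. Qed.
Lemma set_act x : set x -> set (act g x).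
Proof. intros H; apply act_set; auto. Qed.
Lemma set_act_iff x : set (act g x) <-> set x.
Proof.
  split; [|apply set_act]. intros H K. apply H. apply HA. apply act_atom_A. apply HA; auto.
Qed.
Lemma act_mem x y : x ∊ y -> act g x ∊ act g y.
Proof. intros H. apply in_act; eauto. eapply mem_set; eauto. Qed.

Lemma act_upair x y : act g (upair x y) = upair (act g x) (act g y).
Proof.
  apply set_ext; auto using set_upair, set_act.
  intros z. rewrite in_act, in_upair by apply set_upair. split.
  - intros (s & Hs & ->). apply in_upair in Hs as [->| ->]; auto.
  - intros [->| ->]; [exists x | exists y]; rewrite in_upair; auto.
Qed.
Lemma act_pair x y : act g (pair x y) = pair (act g x) (act g y).
Proof. unfold pair; rewrite !act_upair; auto. Qed.
Lemma act_emp : act g emp = emp.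
Proof.
  apply empty_emp. split; [apply set_act, set_emp|]. intros z Hz.
  apply in_act in Hz as (s & Hs & _); [|apply set_emp]. apply (in_emp s Hs).
Qed.
Lemma act_adj x y : set x -> act g (adj x y) = adj (act g x) (act g y).
Proof.
  intros Hx. apply set_ext; auto using set_adj, set_act.
  intros z. rewrite in_act, in_adj, in_act by auto using set_adj. split.
  - intros (s & Hs & ->). apply in_adj in Hs as [H| ->]; eauto.
  - intros [(s & Hs & ->)| ->]; [exists s | exists y]; rewrite in_adj; auto.
Qed.
Lemma act_nat n : n ∊ omega -> act g n = n.
Proof.
  apply (omega_ind (fun n => act g n = n)); [dn | apply act_emp |].
  intros k Hk IH. unfold succ. rewrite act_adj, IH; auto. apply nat_set; auto.
Qed.
Lemma act_omega : act g omega = omega.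
Proof.
  apply set_ext; auto using set_omega, set_act.
  intros z. rewrite in_act by apply set_omega. split.
  - intros (s & Hs & ->). rewrite act_nat; auto.
  - intros H. exists z. rewrite act_nat; auto.
Qed.
Lemma act_fixed_members x : set x -> (forall y, y ∊ x -> act g y = y) -> act g x = x.
Proof.
  intros Hx H. apply set_ext; auto using set_act. intros z. rewrite in_act by auto. split.
  - intros (s & Hs & ->). rewrite H; auto.
  - intros Hz; exists z; rewrite H; auto.
Qed.

Hypothesis Hinj : injective g.

Lemma act_inj x y : act g x = act g y -> x = y.
Proof.
  revert y. apply (eps_ind (fun x => forall y, act g x = act g y -> x = y)); [dn|].
  clear x. intros x IH y E. destruct (classic (set x)) as [Hx|Hx].
  - assert (Hy : set y) by (apply set_act_iff; rewrite <- E; apply set_act; auto).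
    apply set_ext; auto. intros z. split; intros Hz.
    + assert (K : act g z ∊ act g y) by (rewrite <- E; apply act_mem; auto).
      apply in_act in K as (w & Hw & K); auto. rewrite (IH z Hz w); auto.
    + assert (K : act g z ∊ act g x) by (rewrite E; apply act_mem; auto).
      apply in_act in K as (w & Hw & K); auto. rewrite <- (IH w Hw z); auto.
  - assert (Hy : ~ set y).
    { intros Hy. apply Hx, set_act_iff. rewrite E. apply set_act; auto. }
    apply NNPP in Hx, Hy. apply HA in Hx, Hy. apply (Hinj _ _ (act g x)).
    + apply act_atom; auto.
    + rewrite E; apply act_atom; auto.
Qed.
Lemma act_mem_iff x y : act g x ∊ act g y <-> x ∊ y.
Proof.
  split; [|apply act_mem]. intros H.
  assert (Hy : set y) by (apply set_act_iff; eapply mem_set; eauto).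
  apply in_act in H as (s & Hs & E); auto. rewrite (act_inj x s); auto.
Qed.
End OnePermutation.

Definition idp A := graph A A eq.
Definition comp A f g := graph A A (fun x z => exists y, pair x y ∊ g /\ pair y z ∊ f).
Definition inv A g := graph A A (fun x y => pair y x ∊ g).
Lemma D2_comp f g : D2 (fun x z => exists y, pair x y ∊ g /\ pair y z ∊ f). Proof. dn. Qed.
Lemma D2_inv g : D2 (fun x y => pair y x ∊ g). Proof. dn. Qed.

(** * Identity, composition and inversion of permutations *)

Section Group.
Variable A : uni.
Hypothesis HA : isatomset uni A.
Let bij g := isbij uni g A A.

Lemma bij_fn g : bij g -> fn g A A. Proof. intros H; apply isbij_iff in H; tauto. Qed.
Lemma bij_inj g : bij g -> injective g. Proof. intros H; apply isbij_iff in H; tauto. Qed.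
Lemma bij_surj g c : bij g -> c ∊ A -> exists a, pair a c ∊ g.
Proof. intros H; apply isbij_iff in H as (_ & _ & H); auto. Qed.

Lemma in_idp a b : pair a b ∊ idp A <-> a ∊ A /\ a = b.
Proof. unfold idp. rewrite in_graph by dn. split; [tauto|]. intros [? <-]; auto. Qed.
Lemma in_comp f g a c : bij f -> bij g ->
  pair a c ∊ comp A f g <-> exists b, pair a b ∊ g /\ pair b c ∊ f.
Proof.
  intros Hf Hg. unfold comp. rewrite in_graph by apply D2_comp. split; [tauto|].
  intros (b & H & K). split; [|split]; eauto.
  - apply (fn_dom _ _ _ (bij_fn g Hg) _ _ H).
  - apply (fn_cod _ _ _ (bij_fn f Hf) _ _ K).
Qed.
Lemma in_inv g a b : bij g -> pair a b ∊ inv A g <-> pair b a ∊ g.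
Proof.
  intros Hg. unfold inv. rewrite in_graph by apply D2_inv. split; [tauto|]. intros H.
  pose proof (fn_dom _ _ _ (bij_fn g Hg) _ _ H). pose proof (fn_cod _ _ _ (bij_fn g Hg) _ _ H). auto.
Qed.
Lemma bij_idp : bij (idp A).
Proof. apply bij_graph; try dn; eauto; congruence. Qed.
Lemma bij_comp f g : bij f -> bij g -> bij (comp A f g).
Proof.
  intros Hf Hg. pose proof (bij_fn f Hf) as Ff. pose proof (bij_fn g Hg) as Fg.
  apply bij_graph; [apply D2_comp | | | |].
  - intros a Ha. destruct (fn_tot _ _ _ Fg a Ha) as [b Hb].
    destruct (fn_tot _ _ _ Ff b) as [c Hc]; [apply (fn_cod _ _ _ Fg _ _ Hb)|].
    exists c; split; eauto. apply (fn_cod _ _ _ Ff _ _ Hc).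
  - intros a b c _ (x & H1 & H2) (y & K1 & K2). rewrite (fn_fun _ _ _ Fg _ _ _ K1 H1) in K2.
    apply (fn_fun _ _ _ Ff x); auto.
  - intros a b c _ _ (x & H1 & H2) (y & K1 & K2). rewrite (bij_inj f Hf _ _ _ K2 H2) in K1.
    apply (bij_inj g Hg _ _ x); auto.
  - intros c Hc. destruct (bij_surj f c Hf Hc) as [b Hb].
    destruct (bij_surj g b Hg) as [a Ha]; [apply (fn_dom _ _ _ Ff _ _ Hb)|].
    exists a; split; eauto. apply (fn_dom _ _ _ Fg _ _ Ha).
Qed.
Lemma bij_inv g : bij g -> bij (inv A g).
Proof.
  intros Hg. pose proof (bij_fn g Hg) as Fg. apply bij_graph; [apply D2_inv | | | |].
  - intros a Ha. destruct (bij_surj g a Hg Ha) as [b Hb]. exists b; split; auto.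
    apply (fn_dom _ _ _ Fg _ _ Hb).
  - intros a b c _ H K. apply (bij_inj g Hg _ _ a); auto.
  - intros a b c _ _ H K. apply (fn_fun _ _ _ Fg c); auto.
  - intros b Hb. destruct (fn_tot _ _ _ Fg b Hb) as [a Ha]. exists a; split; auto.
    apply (fn_cod _ _ _ Fg _ _ Ha).
Qed.

Lemma isid_iff e : isid uni e A <-> e = idp A.
Proof.
  assert (K : forall p, p ∊ idp A <-> exists x, x ∊ A /\ p = pair x x).
  { intros p. unfold idp. rewrite in_graph_ex by dn. split.
    - intros (a & b & Ha & _ & <- & ->); eauto.
    - intros (x & Hx & ->); eauto 8. }
  assert (Hs : set (idp A)) by (apply set_graph; dn).
  split.
  - intros [H L]. apply set_ext; auto. intros p. rewrite L, K.
    apply iff_ex; intros x; rewrite ispair_iff; tauto.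
  - intros ->. split; auto. intros p. rewrite K. apply iff_ex; intros x; rewrite ispair_iff; tauto.
Qed.
Lemma iscomp_iff f g h : bij f -> bij g -> iscomp uni f g h <-> h = comp A f g.
Proof.
  intros Hf Hg.
  assert (K : forall p, p ∊ comp A f g <-> exists x y z, ispair uni p x z /\ app uni g x y /\ app uni f y z).
  { intros p. split.
    - intros H. pose proof H as H'. apply in_graph_ex in H' as (a & c & _ & _ & (b & H1 & H2) & ->); [|apply D2_comp].
      exists a, b, c. rewrite ispair_iff, !app_iff; auto.
    - intros (x & y & z & E & H1 & H2). apply ispair_iff in E; subst. rewrite app_iff in *.
      apply in_comp; eauto. }
  assert (Hs : set (comp A f g)) by apply set_graph, D2_comp.
  split.
  - intros [H L]. apply set_ext; auto. intros p. rewrite L, K; tauto.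
  - intros ->. split; auto.
Qed.
Lemma isinv_iff g h : bij g -> isinv uni g h <-> h = inv A g.
Proof.
  intros Hg.
  assert (K : forall p, p ∊ inv A g <-> exists x y, ispair uni p y x /\ app uni g x y).
  { intros p. split.
    - intros H. pose proof H as H'. apply in_graph_ex in H' as (a & b & _ & _ & H1 & ->); [|apply D2_inv].
      exists b, a. rewrite ispair_iff, !app_iff; auto.
    - intros (x & y & E & H1). apply ispair_iff in E; subst. rewrite app_iff in *.
      apply in_inv; auto. }
  assert (Hs : set (inv A g)) by apply set_graph, D2_inv.
  split.
  - intros [H L]. apply set_ext; auto. intros p. rewrite L, K; tauto.
  - intros ->. split; auto.
Qed.

Lemma act_idp x : act (idp A) x = x.
Proof.
  apply (eps_ind (fun x => act (idp A) x = x)); [dn|]. clear x. intros x IH.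
  pose proof (bij_fn _ bij_idp) as F. destruct (classic (set x)) as [H|H].
  - apply (act_fixed_members A); auto.
  - apply NNPP in H. apply HA in H. apply (act_atom_eq A); auto. apply in_idp; auto.
Qed.
Lemma act_comp f g x : bij f -> bij g -> act (comp A f g) x = act f (act g x).
Proof.
  intros Hf Hg. pose proof (bij_fn f Hf) as Ff. pose proof (bij_fn g Hg) as Fg.
  pose proof (bij_fn _ (bij_comp f g Hf Hg)) as Fc.
  apply (eps_ind (fun x => act (comp A f g) x = act f (act g x))); [dn|]. clear x. intros x IH.
  destruct (classic (set x)) as [H|H].
  - assert (Hgx : set (act g x)) by (apply (set_act A); auto).
    apply set_ext; try (apply (set_act A); auto). intros z.
    rewrite (in_act A _ HA Fc x z H), (in_act A _ HA Ff (act g x) z Hgx). split.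
    + intros (s & Hs & ->). exists (act g s); split; [apply (act_mem A); auto | auto].
    + intros (t & Ht & ->). apply (in_act A _ HA Fg) in Ht as (s & Hs & ->); auto.
      exists s; split; auto. symmetry; auto.
  - apply NNPP in H. apply HA in H. apply (act_atom_eq A); auto. apply in_comp; auto.
    exists (act g x). split; apply (act_atom A); auto. apply (act_atom_A A); auto.
Qed.
Lemma act_inv_l g x : bij g -> act (inv A g) (act g x) = x.
Proof.
  intros Hg. rewrite <- act_comp by auto using bij_inv.
  replace (comp A (inv A g) g) with (idp A); [apply act_idp|].
  apply (fn_ext _ _ A A); auto using bij_fn, bij_idp, bij_comp, bij_inv.
  intros a b H. apply in_idp in H as [Ha <-]. apply in_comp; auto using bij_inv.
  destruct (fn_tot _ _ _ (bij_fn g Hg) a Ha) as [b Hb]. exists b; rewrite in_inv; auto.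
Qed.
Lemma act_inv_r g x : bij g -> act g (act (inv A g) x) = x.
Proof.
  intros Hg. rewrite <- act_comp by auto using bij_inv.
  replace (comp A g (inv A g)) with (idp A); [apply act_idp|].
  apply (fn_ext _ _ A A); auto using bij_fn, bij_idp, bij_comp, bij_inv.
  intros a b H. apply in_idp in H as [Ha <-]. apply in_comp; auto using bij_inv.
  destruct (bij_surj g a Hg Ha) as [b Hb]. exists b; rewrite in_inv; auto.
Qed.
End Group.
End Action.
#[export] Hint Resolve F2_act : dn.

(** * Permutation models with finite supports *)

Section Filter.
Context {Z : zfa_model}.

Definition fixes (g E : uni) := forall a, a ∊ E -> act g a = a.
Lemma D2_fixes : D2 fixes. Proof. unfold fixes; dn. Qed.
Hint Resolve D2_fixes : dn.

Record perm_group (A G : uni) : Prop := {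
  pg_atoms : isatomset uni A;
  pg_set : set G;
  pg_bij : forall g, g ∊ G -> isbij uni g A A;
  pg_id : idp A ∊ G;
  pg_comp : forall f g, f ∊ G -> g ∊ G -> comp A f g ∊ G;
  pg_inv : forall g, g ∊ G -> inv A g ∊ G
}.

(** Explicit form of the generated filter: the subgroups that include fix([E]) for some finite set
    [E] of atoms. *)
Definition finite_support_filter (A G F : uni) := forall H, H ∊ F <->
  issubgroup uni H G A /\ exists E, sub uni E A /\ fin E /\ forall g, g ∊ G -> fixes g E -> g ∊ H.

Section Characterization.
Variables A G : uni.
Hypothesis HG : perm_group A G.
Let HA := pg_atoms A G HG.

Lemma pg_fn g : g ∊ G -> fn g A A.
Proof. intros H. apply bij_fn, (pg_bij A G HG), H. Qed.
Lemma pg_inj g : g ∊ G -> injective g.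
Proof. intros H. apply (bij_inj A), (pg_bij A G HG), H. Qed.

Lemma issubgroup_iff H : issubgroup uni H G A <->
  sub uni H G /\ idp A ∊ H /\ (forall f g, f ∊ H -> g ∊ H -> comp A f g ∊ H) /\
  (forall f, f ∊ H -> inv A f ∊ H).
Proof.
  pose proof (pg_bij A G HG) as HB.
  unfold issubgroup. split.
  - intros (H1 & H2 & H3 & H4). split; auto. destruct H1 as [H0 H1]. split; [|split].
    + apply H2, (proj2 (isid_iff A _)); auto.
    + intros f g Hf Hg. apply (H3 f g); auto. apply (proj2 (iscomp_iff A f g _ (HB f (H1 f Hf)) (HB g (H1 g Hg)))); auto.
    + intros f Hf. apply (H4 f); auto. apply (proj2 (isinv_iff A f _ (HB f (H1 f Hf)))); auto.
  - intros (H1 & H2 & H3 & H4). split; auto. destruct H1 as [H0 H1]. split; [|split].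
    + intros e He. apply (proj1 (isid_iff A _)) in He; subst; auto.
    + intros f g h Hf Hg Hh. apply (proj1 (iscomp_iff A f g _ (HB f (H1 f Hf)) (HB g (H1 g Hg)))) in Hh; subst; auto.
    + intros f h Hf Hh. apply (proj1 (isinv_iff A f _ (HB f (H1 f Hf)))) in Hh; subst; auto.
Qed.

Lemma acts_iff_act g x y : g ∊ G -> acts uni g x y <-> y = act g x.
Proof. intros Hg. apply (acts_act A); auto. apply pg_fn; auto. Qed.

Lemma act_comp_G f g x : f ∊ G -> g ∊ G -> act (comp A f g) x = act f (act g x).
Proof. intros; apply act_comp; auto; apply (pg_bij A G HG); auto. Qed.
Lemma act_inv_l_G g x : g ∊ G -> act (inv A g) (act g x) = x.
Proof. intros; apply act_inv_l; auto; apply (pg_bij A G HG); auto. Qed.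
Lemma act_inv_r_G g x : g ∊ G -> act g (act (inv A g) x) = x.
Proof. intros; apply act_inv_r; auto; apply (pg_bij A G HG); auto. Qed.
Lemma act_inv_fix g x : g ∊ G -> act g x = x -> act (inv A g) x = x.
Proof. intros Hg H. rewrite <- H at 1. apply act_inv_l_G; auto. Qed.

Lemma stabilizer_subgroup (P : uni -> Prop) : D1 P ->
  (forall g, g ∊ G -> P g -> P (inv A g)) -> P (idp A) ->
  (forall f g, f ∊ G -> g ∊ G -> P f -> P g -> P (comp A f g)) ->
  issubgroup uni (sep G P) G A.
Proof.
  intros HP Hinv Hid Hcomp. pose proof HG as [_ _ _ G1 G2 G3]. apply issubgroup_iff.
  split; [apply sub_sep; auto|]. split; [|split].
  - apply in_sep; auto.
  - intros f g Hf Hg. apply in_sep in Hf as [? ?], Hg as [? ?]; auto. apply in_sep; auto.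
  - intros g Hg. apply in_sep in Hg as [? ?]; auto. apply in_sep; auto.
Qed.

Lemma subgroup_G : issubgroup uni G G A.
Proof.
  pose proof HG as [_ H0 _ G1 G2 G3]. apply issubgroup_iff. repeat split; auto.
Qed.

Definition supported_subgroup H :=
  issubgroup uni H G A /\ exists E, sub uni E A /\ fin E /\ forall g, g ∊ G -> fixes g E -> g ∊ H.
Lemma D1_supported_subgroup : D1 supported_subgroup.
Proof.
  apply (Dn_ext (fun e => (sub uni (e 0) G /\ idp A ∊ (e 0) /\
      (forall f g, f ∊ (e 0) -> g ∊ (e 0) -> comp A f g ∊ (e 0)) /\
      (forall f, f ∊ (e 0) -> inv A f ∊ (e 0))) /\
      exists E, sub uni E A /\ fin E /\ forall g, g ∊ G -> fixes g E -> g ∊ e 0)).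
  - intros e. unfold supported_subgroup. rewrite issubgroup_iff. tauto.
  - assert (F2 (comp A)) by (change (Dt (fun e => comp A (e 0) (e 1))); unfold comp; dn).
    assert (F1 (inv A)) by (change (Dt (fun e => inv A (e 0))); unfold inv; dn).
    dn.
Qed.

Lemma supported_in_pow H : supported_subgroup H -> H ∊ pow G.
Proof. intros [H1 _]. apply in_pow, H1. Qed.

Lemma filter_exists : exists F, finite_support_filter A G F.
Proof.
  pose proof D1_supported_subgroup. exists (sep (pow G) supported_subgroup).
  intros H'. rewrite in_sep by auto. split; [intros [_ K]; exact K|].
  intros K; split; auto. apply supported_in_pow; exact K.
Qed.

(** The explicit family [F'] is itself a filter containing all fix([E]), so minimality puts [F]
    inside it. Conversely [F] contains fix([E]) and is closed upwards. *)
Lemma isfsfilter_char F : isfsfilter uni F G A -> finite_support_filter A G F.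
Proof.
  intros (HF & Hc & Hmin). pose proof D1_supported_subgroup as HD.
  set (F' := sep (pow G) supported_subgroup).
  assert (HF' : forall H, H ∊ F' <-> supported_subgroup H).
  { intros H. unfold F'. rewrite in_sep by auto. split; [tauto|]. split; auto using supported_in_pow. }
  assert (K1 : isfilter uni F' G A).
  { split; [apply set_sep; auto|]. split; [intros H K; apply HF' in K; apply K|]. split; [|split].
    - apply HF'. split; [apply subgroup_G|]. exists emp. split; [|split; [apply fin_emp | auto]].
      split; [apply set_emp|]. intros z Hz; destruct (in_emp z Hz).
    - intros H K HH HK [_ S]. apply HF' in HH as [_ (E & E1 & E2 & E3)]. apply HF'.
      split; auto. exists E; auto.
    - intros H K L HH HK HL HLHK. apply HF' in HH as [S (E & E1 & E2 & E3)].
      apply HF' in HK as [S' (E' & E1' & E2' & E3')]. apply HF'. split.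
      + apply issubgroup_iff in S as ([S0 S1] & S2 & S3 & S4).
        apply issubgroup_iff in S' as (S1' & S2' & S3' & S4').
        apply issubgroup_iff. split; [split; auto; intros z Hz; apply HLHK in Hz as []; auto|].
        split; [apply HLHK; auto|]. split.
        * intros f g Hf Hg. apply HLHK in Hf as [], Hg as []. apply HLHK; auto.
        * intros f Hf. apply HLHK in Hf as []. apply HLHK; auto.
      + exists (cup E E'). split; [|split].
        * split; [apply set_cup|]. intros z Hz. apply in_cup in Hz as [Hz|Hz]; [apply E1 | apply E1']; auto.
        * apply fin_cup; auto.
        * intros g Hg Hgf. apply HLHK. split; [apply E3 | apply E3']; auto;
            intros a Ha; apply Hgf, in_cup; auto. }
  assert (fixsub : forall E, issubgroup uni (sep G (fun g => fixes g E)) G A).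
  { intros E. apply stabilizer_subgroup; [dn| | |].
    - intros g Hg Hf a Ha. apply act_inv_fix; auto.
    - intros a _. apply act_idp; auto.
    - intros f g Hf Hg Ff Fg a Ha. rewrite act_comp_G, (Fg a), (Ff a); auto. }
  assert (isfix_iff : forall E S, isfix uni G E S <-> S = sep G (fun g => fixes g E)).
  { intros E S. assert (L : D1 (fun g => fixes g E)) by dn. split.
    - intros [H K]. apply set_ext; [auto | apply set_sep; auto |]. intros g. rewrite K, in_sep by auto.
      split; intros [Hg Hg']; split; auto; intros a Ha; [symmetry|]; apply acts_iff_act; auto.
      symmetry; auto.
    - intros ->. split; [apply set_sep; auto|]. intros g. rewrite in_sep by auto.
      split; intros [Hg Hg']; split; auto; intros a Ha; [|symmetry]; apply acts_iff_act; auto.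
      symmetry; auto. }
  assert (K2 : containsfixes uni F' G A).
  { intros E S HE HEf HS. apply isfix_iff in HS; subst S. apply HF'. split; auto.
    exists E. split; auto. split; [split; auto; apply HE|]. intros g Hg Hgf. apply in_sep; [dn | auto]. }
  intros H. split.
  - intros HH. apply HF'. apply (Hmin F' K1 K2); auto.
  - intros [S (E & E1 & E2 & E3)]. destruct HF as (_ & _ & _ & Hup & _).
    apply (Hup (sep G (fun g => fixes g E))); auto.
    + apply (Hc E); [auto | apply E2 | apply isfix_iff; auto].
    + split; [apply set_sep; dn|]. intros g Hg. apply in_sep in Hg as []; [auto | dn].
Qed.
End Characterization.
End Filter.
#[export] Hint Resolve D2_fixes : dn.

Section Supports.
Context {Z : zfa_model}.
Variables A G F : uni.
Hypothesis HG : perm_group A G.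
Hypothesis HF : finite_support_filter A G F.
Let HA := pg_atoms A G HG.
Let Gfn := pg_fn A G HG.
Let Ginj := pg_inj A G HG.

Definition supp E x := forall g, g ∊ G -> fixes g E -> act g x = x.
Definition fsupp x := exists E, sub uni E A /\ fin E /\ supp E x.
Definition HS := hersym uni G F.
Lemma D2_supp : D2 supp. Proof. unfold supp; dn. Qed.
Hint Resolve D2_supp : dn.
Lemma D1_HS : D1 HS.
Proof.
  assert (D3 (issym uni)) by (unfold issym; dn). unfold HS, hersym; dn.
Qed.
Hint Resolve D1_HS : dn.

Lemma symmetric_iff x : (exists S, issym uni G x S /\ S ∊ F) <-> fsupp x.
Proof.
  assert (HD : D1 (fun g => act g x = x)) by dn. split.
  - intros (S & [HS HS'] & HSF). apply HF in HSF as [_ (E & E1 & E2 & E3)].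
    exists E; split; auto; split; auto. intros g Hg Hgf. symmetry.
    apply (acts_iff_act A G); auto. apply HS'; auto.
  - intros (E & E1 & E2 & E3). exists (sep G (fun g => act g x = x)). split.
    + split; [apply set_sep; auto|]. intros g. rewrite in_sep by auto.
      split; intros [Hg K]; split; auto; [apply (acts_iff_act A G); auto |].
      symmetry; apply (acts_iff_act A G); auto.
    + apply HF. split.
      * apply stabilizer_subgroup; auto.
        -- intros g Hg K. apply (act_inv_fix A G); auto.
        -- apply act_idp; auto.
        -- intros f g Hf Hg Ff Fg. rewrite (act_comp_G A G), Fg, Ff; auto.
      * exists E; split; auto; split; auto. intros g Hg Hgf. apply in_sep; auto.
Qed.

Lemma HS_tc x : HS x <-> forall t, t ∊ tc (upair x x) -> fsupp t.
Proof.
  unfold HS, hersym. split.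
  - intros (u & T & Hu & HT & H). apply isupair_iff in Hu; subst u.
    apply istc_iff in HT; [|apply set_upair]. subst T. intros t Ht. apply symmetric_iff; auto.
  - intros H. exists (upair x x), (tc (upair x x)). rewrite isupair_iff.
    split; auto. split; [apply tc_istc, set_upair|]. intros t Ht. apply symmetric_iff; auto.
Qed.

(** Recursive form of hereditary symmetry, replacing the transitive closure from here on. For the
    converse, the elements of [tc {x}] that are [x] or hereditarily symmetric form a transitive set
    containing [x]. *)
Lemma HS_iff x : HS x <-> fsupp x /\ forall y, y ∊ x -> HS y.
Proof.
  rewrite HS_tc. destruct (tc_istc (upair x x) (set_upair _ _)) as (T1 & T2 & T3).
  assert (Hx : x ∊ tc (upair x x)) by (apply T1, in_upair; auto).
  split.
  - intros H. split; auto. intros y Hy. apply HS_tc. intros t Ht. apply H.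
    destruct (tc_istc (upair y y) (set_upair _ _)) as (_ & _ & K).
    apply (K _ T2); auto. split; [apply set_upair|]. intros z Hz.
    assert (z = y) as -> by (apply in_upair in Hz; tauto). apply (T2 x); auto.
  - intros [H K] t Ht.
    assert (HD : D1 (fun t => t = x \/ HS t)) by dn.
    destruct (T3 (sep (tc (upair x x)) (fun t => t = x \/ HS t))) as [_ L].
    + intros a b Ha Hb. apply in_sep in Ha as [Ha Ha']; auto. apply in_sep; auto.
      split; [apply (T2 a); auto|]. right. destruct Ha' as [->|Ha']; auto.
      apply HS_tc. intros s Hs. rewrite HS_tc in Ha'. apply Ha'.
      destruct (tc_istc (upair a a) (set_upair _ _)) as (S1 & S2 & _).
      destruct (tc_istc (upair b b) (set_upair _ _)) as (_ & _ & S3).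
      apply (S3 _ S2); auto. split; [apply set_upair|]. intros z Hz.
      assert (z = b) as -> by (apply in_upair in Hz; tauto). apply (S2 a); auto.
      apply S1, in_upair; auto.
    + split; [apply set_upair|]. intros z Hz.
      assert (z = x) as -> by (apply in_upair in Hz; tauto). apply in_sep; auto.
    + apply L, in_sep in Ht as [Ht [->|Ht']]; auto.
      rewrite HS_tc in Ht'. apply Ht'.
      destruct (tc_istc (upair t t) (set_upair _ _)) as (S1 & _ & _). apply S1, in_upair; auto.
Qed.

Lemma HS_mem x y : HS x -> y ∊ x -> HS y.
Proof. intros H. apply HS_iff in H; apply H. Qed.
Lemma HS_fsupp x : HS x -> fsupp x.
Proof. intros H. apply HS_iff in H; tauto. Qed.

Lemma fixes_sub g E E' : fixes g E -> (forall a, a ∊ E' -> a ∊ E) -> fixes g E'.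
Proof. intros H K a Ha; auto. Qed.
Lemma supp_sub E E' x : supp E' x -> (forall a, a ∊ E' -> a ∊ E) -> supp E x.
Proof. intros H K g Hg Hf. apply H; auto. eapply fixes_sub; eauto. Qed.

Lemma sub_cup x y z : sub uni x z -> sub uni y z -> sub uni (cup x y) z.
Proof.
  intros [_ H] [_ K]. split; [apply set_cup|]. intros w Hw. apply in_cup in Hw as [Hw|Hw]; auto.
Qed.
Lemma sub_adj x a z : sub uni x z -> a ∊ z -> sub uni (adj x a) z.
Proof.
  intros [_ H] K. split; [apply set_adj|]. intros w Hw. apply in_adj in Hw as [Hw| ->]; auto.
Qed.
Lemma sub_emp z : sub uni emp z.
Proof. split; [apply set_emp|]. intros w Hw. destruct (in_emp w Hw). Qed.

Lemma fsupp2 x y : fsupp x -> fsupp y -> exists E, sub uni E A /\ fin E /\ supp E x /\ supp E y.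
Proof.
  intros (E & E1 & E2 & E3) (E' & E1' & E2' & E3'). exists (cup E E').
  split; [apply sub_cup; auto|]. split; [apply fin_cup; auto|].
  split; eapply supp_sub; eauto; intros a Ha; apply in_cup; auto.
Qed.

Lemma HS_pure x : set x -> (forall g, g ∊ G -> act g x = x) -> (forall y, y ∊ x -> HS y) -> HS x.
Proof.
  intros Hx H K. apply HS_iff; split; auto. exists emp. split; [apply sub_emp|].
  split; [apply fin_emp|]. intros g Hg _; auto.
Qed.
Lemma HS_emp : HS emp.
Proof.
  apply HS_pure; [apply set_emp | |].
  - intros; apply (act_emp A); auto.
  - intros y Hy; destruct (in_emp y Hy).
Qed.
Lemma HS_upair x y : HS x -> HS y -> HS (upair x y).
Proof.
  intros Hx Hy. apply HS_iff. split.
  - destruct (fsupp2 x y) as (E & E1 & E2 & E3 & E4); auto using HS_fsupp.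
    exists E; split; auto; split; auto. intros g Hg Hf. rewrite (act_upair A), E3, E4; auto.
  - intros z Hz. apply in_upair in Hz as [->| ->]; auto.
Qed.
Lemma HS_pair x y : HS x -> HS y -> HS (pair x y).
Proof. intros; apply HS_upair; apply HS_upair; auto. Qed.
Lemma HS_pair_inv x y : HS (pair x y) -> HS x /\ HS y.
Proof.
  intros H. assert (K : HS (upair x y)) by (apply (HS_mem (pair x y)); auto; apply in_upair; auto).
  split; apply (HS_mem (upair x y)); auto; apply in_upair; auto.
Qed.
Lemma HS_adj x y : set x -> HS x -> HS y -> HS (adj x y).
Proof.
  intros Hs Hx Hy. apply HS_iff. split.
  - destruct (fsupp2 x y) as (E & E1 & E2 & E3 & E4); auto using HS_fsupp.
    exists E; split; auto; split; auto. intros g Hg Hf. rewrite (act_adj A), E3, E4; auto.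
  - intros z Hz. apply in_adj in Hz as [Hz| ->]; auto. apply (HS_mem x); auto.
Qed.
Lemma HS_nat n : n ∊ omega -> HS n.
Proof.
  apply (omega_ind HS); [dn | apply HS_emp |].
  intros k Hk IH. apply HS_adj; auto. apply nat_set; auto.
Qed.
Lemma HS_omega : HS omega.
Proof.
  apply HS_pure; [apply set_omega | | apply HS_nat].
  intros g Hg; apply (act_omega A); auto.
Qed.
(** Brings finite bijections, [m]-subsets and roots of Delta-systems into the permutation model. *)
Lemma HS_fin x : fin x -> (forall y, y ∊ x -> HS y) -> HS x.
Proof.
  apply (fin_ind (fun x => (forall y, y ∊ x -> HS y) -> HS x)); [dn | intros _; apply HS_emp |].
  intros y a Hy IH _ H. apply HS_adj; auto using fin_set.
  - apply IH. intros z Hz; apply H, in_adj; auto.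
  - apply H, in_adj; auto.
Qed.
Lemma HS_atom a : a ∊ A -> HS a.
Proof.
  intros Ha. apply HS_iff. split.
  - exists (adj emp a). split; [apply sub_adj; auto using sub_emp|].
    split; [apply fin_adj, fin_emp|]. intros g Hg Hf. apply Hf, in_adj; auto.
  - intros y Hy. apply HA in Ha. destruct (atom_empty _ _ Ha Hy).
Qed.
Lemma HS_A : HS A.
Proof.
  apply HS_pure; [apply HA | | apply HS_atom].
  intros g Hg. apply set_ext; [apply (set_act A); auto; apply HA | apply HA |].
  intros z. rewrite (in_act A) by (auto; apply HA). split.
  - intros (s & Hs & ->). apply (act_atom_A A); auto.
  - intros Hz. destruct (bij_surj A g z) as [a Ha]; auto; [apply (pg_bij A G HG); auto|].
    exists a. rewrite (act_atom_eq A g HA (Gfn g Hg) a z Ha). split; auto.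
    apply (fn_dom _ _ _ (Gfn g Hg) _ _ Ha).
Qed.

(** If [E] supports [x], then [act g E] supports [act g x]: conjugating by [g] an element that fixes
    the latter set gives one that fixes [E]. *)
Lemma HS_act g x : g ∊ G -> HS x -> HS (act g x).
Proof.
  intros Hg. apply (eps_ind (fun x => HS x -> HS (act g x))); [dn|]. clear x. intros x IH Hx.
  apply HS_iff. split.
  - destruct (HS_fsupp x Hx) as (E & E1 & E2 & E3). exists (act g E). split; [|split].
    + split; [apply (set_act A); auto; apply E1|]. intros z Hz.
      apply (in_act A) in Hz as (s & Hs & ->); auto; [|apply E1]. apply (act_atom_A A); auto. apply E1; auto.
    + apply (fin_image (fun u v => v = act g u) E); auto; [dn | congruence | apply (set_act A); auto; apply E1|].
      intros v Hv. apply (in_act A) in Hv; auto. apply E1.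
    + intros h Hh Hf. pose proof (pg_comp A G HG). pose proof (pg_inv A G HG).
      assert (K : act (inv A g) (act h (act g x)) = x).
      { rewrite <- (act_comp_G A G HG h g) by auto.
        rewrite <- (act_comp_G A G HG) by auto.
        apply E3; [auto|].
        intros a Ha. rewrite !(act_comp_G A G HG) by auto.
        rewrite (Hf (act g a)); [apply (act_inv_l_G A G); auto|].
        apply (act_mem A); auto. }
      rewrite <- K at 2. symmetry. apply (act_inv_r_G A G); auto.
  - intros y Hy. destruct (classic (set x)) as [Hs|Hs].
    + apply (in_act A) in Hy as (s & Hs' & ->); auto. apply IH; auto. apply (HS_mem x); auto.
    + exfalso. apply Hs. apply (set_act_iff A g); auto. eapply mem_set; eauto.
Qed.

(** ** Absoluteness *)

Local Notation N := (PermModel uni G F).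
Local Notation "^ x" := (proj1_sig x) (at level 5, x at level 5).
Definition mk (x : uni) (H : HS x) : N := exist _ x H.

Lemma N_HS (x : N) : HS ^x.
Proof. exact (proj2_sig x). Qed.
Lemma N_eq (x y : N) : ^x = ^y -> x = y.
Proof. destruct x, y; simpl; intros ->; f_equal; apply proof_irrelevance. Qed.
(** The permutation model is transitive in the ground model, so bounded quantifiers mean the same in
    both; this is the source of all absoluteness statements below. *)
Lemma N_all_mem (x : N) (P : uni -> Prop) :
  (forall z : N, ^z ∊ ^x -> P ^z) <-> (forall z, z ∊ ^x -> P z).
Proof.
  split; intros H z Hz; auto. apply (H (mk z (HS_mem _ _ (N_HS x) Hz)) Hz).
Qed.
Lemma N_sub (x y : N) : sub N x y <-> sub uni ^x ^y.
Proof. apply iff_and; [apply iff_refl|]. apply (N_all_mem x (fun z => z ∊ ^y)). Qed.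
Lemma N_upair (u a b : N) : isupair N u a b <-> ^u = upair ^a ^b.
Proof.
  rewrite <- isupair_iff. apply iff_and; [apply iff_refl|]. split.
  - intros H z. split.
    + intros Hz. destruct (proj1 (H (mk z (HS_mem _ _ (N_HS u) Hz))) Hz) as [E|E];
        apply (f_equal (@proj1_sig _ _)) in E; auto.
    + intros [->| ->]; apply H; auto.
  - intros H z. split.
    + intros Hz. apply H in Hz as [E|E]; apply N_eq in E; auto.
    + intros [->| ->]; apply H; auto.
Qed.
Lemma N_pair (p a b : N) : ispair N p a b <-> ^p = pair ^a ^b.
Proof.
  split.
  - intros (u & v & H1 & H2 & H3). apply N_upair in H1, H2, H3. rewrite H3, H1, H2; auto.
  - intros H. exists (mk _ (HS_upair _ _ (N_HS a) (N_HS a))), (mk _ (HS_upair _ _ (N_HS a) (N_HS b))).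
    rewrite !N_upair; auto.
Qed.
Lemma N_app (R a b : N) : app N R a b <-> pair ^a ^b ∊ ^R.
Proof.
  split.
  - intros (p & H & K). apply N_pair in H. rewrite <- H; exact K.
  - intros H. exists (mk _ (HS_pair _ _ (N_HS a) (N_HS b))). rewrite N_pair; auto.
Qed.
Lemma N_fn (f X Y : N) : isfun N f X Y <-> fn ^f ^X ^Y.
Proof.
  split.
  - intros [[H K] L].
    assert (K' : forall p, p ∊ ^f -> exists a b : N, ^a ∊ ^X /\ ^b ∊ ^Y /\ p = pair ^a ^b).
    { intros p Hp. destruct (K (mk p (HS_mem _ _ (N_HS f) Hp)) Hp) as (a & b & Ha & Hb & E).
      apply N_pair in E. exists a, b. repeat (split; auto). }
    assert (K2 : forall a b, pair a b ∊ ^f -> a ∊ ^X /\ b ∊ ^Y).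
    { intros a b Hp. destruct (K' _ Hp) as (a' & b' & Ha & Hb & E).
      apply pair_inj in E as [-> ->]; auto. }
    split; auto; try (intros a b Hp; apply (K2 a b Hp)).
    + intros p Hp. destruct (K' _ Hp) as (a & b & _ & _ & E); eauto.
    + intros a Ha. destruct (L (mk a (HS_mem _ _ (N_HS X) Ha)) Ha) as [[b Hb] _].
      apply N_app in Hb. exists ^b; exact Hb.
    + intros a b c Hb Hc.
      assert (Ha : a ∊ ^X) by apply (K2 _ _ Hb).
      destruct (HS_pair_inv _ _ (HS_mem _ _ (N_HS f) Hb)) as [_ Sb].
      destruct (HS_pair_inv _ _ (HS_mem _ _ (N_HS f) Hc)) as [_ Sc].
      destruct (L (mk a (HS_mem _ _ (N_HS X) Ha)) Ha) as [_ M].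
      specialize (M (mk b Sb) (mk c Sc)). rewrite !N_app in M.
      exact (f_equal (@proj1_sig _ _) (M Hb Hc)).
  - intros [H1 H2 H3 H4 H5 H6]. split; [split; auto|].
    + intros p Hp. destruct (H2 _ Hp) as (a & b & E).
      assert (Hp' : pair a b ∊ ^f) by (rewrite <- E; exact Hp).
      destruct (HS_pair_inv _ _ (HS_mem _ _ (N_HS f) Hp')) as [Sa Sb].
      exists (mk a Sa), (mk b Sb). split; [apply (H3 _ _ Hp')|]. split; [apply (H4 _ _ Hp')|].
      apply N_pair; auto.
    + intros a Ha. split.
      * destruct (H5 _ Ha) as [b Hb]. destruct (HS_pair_inv _ _ (HS_mem _ _ (N_HS f) Hb)) as [_ Sb].
        exists (mk b Sb). apply N_app; auto.
      * intros b c Hb Hc. apply N_app in Hb, Hc. apply N_eq. apply (H6 ^a); auto.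
Qed.
Lemma N_injective (f : N) : (forall a b c, app N f a c -> app N f b c -> a = b) <-> injective ^f.
Proof.
  split.
  - intros H a b c Ha Hb.
    destruct (HS_pair_inv _ _ (HS_mem _ _ (N_HS f) Ha)) as [Sa Sc].
    destruct (HS_pair_inv _ _ (HS_mem _ _ (N_HS f) Hb)) as [Sb _].
    specialize (H (mk a Sa) (mk b Sb) (mk c Sc)). rewrite !N_app in H.
    exact (f_equal (@proj1_sig _ _) (H Ha Hb)).
  - intros H a b c Ha Hb. apply N_app in Ha, Hb. apply N_eq. apply (H _ _ ^c); auto.
Qed.
Lemma N_inj (f X Y : N) : isinj N f X Y <-> isinj uni ^f ^X ^Y.
Proof. rewrite isinj_iff. unfold isinj. rewrite N_fn, N_injective. tauto. Qed.
Lemma N_bij (f X Y : N) : isbij N f X Y <-> isbij uni ^f ^X ^Y.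
Proof.
  unfold isbij. rewrite N_inj. apply iff_and; [tauto|].
  rewrite <- (N_all_mem Y (fun c => exists a, app uni ^f a c)).
  apply iff_all; intros c. apply iff_imp; [apply iff_refl|]. split.
  - intros [a Ha]. apply N_app in Ha. exists ^a. apply app_iff; auto.
  - intros [a Ha]. apply app_iff in Ha.
    destruct (HS_pair_inv _ _ (HS_mem _ _ (N_HS f) Ha)) as [Sa _].
    exists (mk a Sa). apply N_app; auto.
Qed.
Lemma N_empty (x : N) : empty N x <-> ^x = emp.
Proof.
  rewrite <- empty_emp. apply iff_and; [apply iff_refl|]. apply (N_all_mem x (fun _ => False)).
Qed.
Lemma N_succ (x y : N) : issucc N x y <-> ^y = adj ^x ^x.
Proof.
  rewrite <- issucc_iff. apply iff_and; [apply iff_refl|]. split; intros H z; split.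
  - intros Hz. destruct (proj1 (H (mk z (HS_mem _ _ (N_HS y) Hz))) Hz) as [E|E]; auto.
    right. exact (f_equal (@proj1_sig _ _) E).
  - intros [Hz| ->]; [|apply (H x); auto]. apply (H (mk z (HS_mem _ _ (N_HS x) Hz))); auto.
  - intros Hz. apply H in Hz as [Hz|E]; auto. right; apply N_eq; auto.
  - intros [Hz| ->]; apply H; auto.
Qed.
Lemma N_inductive (w : N) : inductive N w <-> inductive uni ^w.
Proof.
  rewrite inductive_iff. unfold inductive. split.
  - intros (H & (z & Hz & K) & L). split; [exact H|]. split.
    + apply N_empty in Hz. rewrite <- Hz; exact K.
    + intros x Hx. destruct (L (mk x (HS_mem _ _ (N_HS w) Hx)) Hx) as (y & Hy & M).
      apply N_succ in Hy. simpl in Hy. rewrite <- Hy; exact M.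
  - intros (H & K & L). split; [exact H|]. split.
    + exists (mk emp HS_emp). rewrite N_empty; auto.
    + intros x Hx. exists (mk _ (HS_mem _ _ (N_HS w) (L _ Hx))). rewrite N_succ; split; auto.
      apply (L _ Hx).
Qed.
Lemma N_omega (w : N) : isomega N w <-> ^w = omega.
Proof.
  rewrite <- isomega_iff. unfold isomega. rewrite N_inductive. split.
  - intros [H K]. split; auto. intros v Hv.
    assert (L : sub uni ^w omega).
    { apply (proj1 (N_sub w (mk omega HS_omega))), K, N_inductive, inductive_omega. }
    apply (sub_trans _ omega); auto.
    split; [apply set_omega|]. intros z Hz. rewrite in_omega in Hz; auto.
  - intros [H K]. split; auto. intros v Hv. apply N_sub, K, N_inductive, Hv.
Qed.
(** A bijection from a natural number is a finite set of pairs from the permutation model, hence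
    belongs to it. No such argument is available for uncountability. *)
Lemma N_finite (x : N) : set ^x -> (finite N x <-> finite uni ^x).
Proof.
  intros Hx. rewrite finite_iff. split.
  - intros (w & n & f & Hw & Hn & Hf). apply N_omega in Hw. apply N_bij in Hf.
    exists ^n, ^f. rewrite <- Hw; auto.
  - intros (n & f & Hn & Hf).
    assert (Hff : HS f).
    { apply HS_fin.
      - pose proof Hf as Hf'. apply isbij_iff in Hf' as (Hfn & Hfi & Hfs).
        apply (fin_image (fun v p => exists u, pair u v ∊ f /\ p = pair u v) ^x); [dn | | | |].
        + intros u v v' (a & Ha & ->) (b & Hb & ->). rewrite (Hfi _ _ _ Hb Ha); auto.
        + apply (fin_bij _ n); eauto.
        + eapply fn_set; eauto.
        + intros p Hp. destruct (fn_pairs _ _ _ Hfn p Hp) as (a & b & ->). exists b.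
          split; eauto. eapply fn_cod; eauto.
      - intros p Hp. apply isbij_iff in Hf as (Hfn & _).
        destruct (fn_pairs _ _ _ Hfn p Hp) as (a & b & ->). apply HS_pair.
        + apply HS_nat. apply (omega_trans n); auto. eapply fn_dom; eauto.
        + apply (HS_mem ^x); [apply N_HS|]. eapply fn_cod; eauto. }
    exists (mk omega HS_omega), (mk n (HS_nat n Hn)), (mk f Hff).
    rewrite N_omega, N_bij; auto.
Qed.
Lemma N_infinite (x : N) : infinite N x <-> infinite uni ^x.
Proof.
  unfold infinite. split; intros [H K]; split; auto; intros L; apply K, N_finite; auto.
Qed.
Lemma N_cardeq k : forall s : N, cardeq N k s <-> cardeq uni k ^s.
Proof.
  induction k; intros s; simpl.
  - rewrite N_empty, empty_emp; tauto.
  - apply iff_and; [apply iff_refl|]. split.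
    + intros (x & t & Ht & Hx & K). exists ^x, ^t. split; [apply IHk; auto|]. split; auto.
      intros z; split.
      * intros Hz. destruct (proj1 (K (mk z (HS_mem _ _ (N_HS s) Hz))) Hz) as [E|E]; auto.
        right. exact (f_equal (@proj1_sig _ _) E).
      * intros [Hz| ->]; [|apply (K x); auto]. apply (K (mk z (HS_mem _ _ (N_HS t) Hz))); auto.
    + intros (x & t & Ht & Hx & K).
      assert (Hx' : HS x) by (apply (HS_mem ^s); [apply N_HS | apply K; auto]).
      assert (Ht' : HS t).
      { apply HS_fin; [eapply cardeq_fin; eauto|]. intros y Hy.
        apply (HS_mem ^s); [apply N_HS | apply K; auto]. }
      exists (mk x Hx'), (mk t Ht'). split; [apply IHk; auto|]. split; auto.
      intros z. split.
      * intros Hz. apply K in Hz as [Hz|E]; auto. right; apply N_eq; auto.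
      * intros [Hz| ->]; apply K; auto.
Qed.
Lemma N_cardle k (s : N) : cardle N k s <-> cardle uni k ^s.
Proof.
  induction k; [apply (N_cardeq 0)|].
  change (cardle N k s \/ cardeq N (S k) s <-> cardle uni k ^s \/ cardeq uni (S k) ^s).
  rewrite IHk, N_cardeq; tauto.
Qed.
End Supports.

(** * Orbits in permutation models *)

Section Orbits.
Context {Z : zfa_model}.
Variables A G F : uni.
Hypothesis HG : perm_group A G.
Hypothesis HF : finite_support_filter A G F.
Let HA := pg_atoms A G HG.
Let Gfn := pg_fn A G HG.
Let Ginj := pg_inj A G HG.
Let Gcomp := pg_comp A G HG.
Let Ginv := pg_inv A G HG.
Local Notation supp := (supp G).
Local Notation HS := (HS G F).
Hint Resolve D2_supp D1_HS : dn.

(** Equivalently, the orbit of [a] under [fix E] is infinite. *)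
Definition moving := forall E a L, sub uni E A -> fin E -> a ∊ A -> ~ a ∊ E -> fin L ->
  exists g, g ∊ G /\ fixes g E /\ ~ act g a ∊ L.
(** [fix (E ∪ {a})] is a maximal subgroup of [fix E]. *)
Definition primitive := forall E a (H : uni -> Prop), sub uni E A -> fin E -> a ∊ A -> ~ a ∊ E ->
  (forall g, g ∊ G -> fixes g E -> act g a = a -> H g) ->
  (forall f g, f ∊ G -> g ∊ G -> H f -> H g -> H (comp A f g)) ->
  (forall g, g ∊ G -> H g -> H (inv A g)) ->
  (exists g, g ∊ G /\ fixes g E /\ act g a <> a /\ H g) ->
  forall g, g ∊ G -> fixes g E -> H g.

Hypothesis Hmov : moving.
Hypothesis Hprim : primitive.

Lemma fixes_comp f g E : f ∊ G -> g ∊ G -> fixes f E -> fixes g E -> fixes (comp A f g) E.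
Proof. intros Hf Hg Ff Fg a Ha. rewrite (act_comp_G A G HG), (Fg a), (Ff a); auto. Qed.
Lemma fixes_inv g E : g ∊ G -> fixes g E -> fixes (inv A g) E.
Proof. intros Hg Fg a Ha. apply (act_inv_fix A G HG); auto. Qed.
Lemma fixes_adj g E a : fixes g (adj E a) <-> fixes g E /\ act g a = a.
Proof.
  split.
  - intros H; split; [intros b Hb|]; apply H, in_adj; auto.
  - intros [H K] b Hb. apply in_adj in Hb as [Hb| ->]; auto.
Qed.

(** The other inclusion comes from applying the hypothesis to the inverse of [g]. *)
Lemma supp_stable E S : set S ->
  (forall g s, g ∊ G -> fixes g E -> s ∊ S -> act g s ∊ S) -> supp E S.
Proof.
  intros HS H g Hg Hf. apply set_ext; auto; [apply (set_act A); auto|]. intros z.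
  rewrite (in_act A) by auto. split.
  - intros (s & Hs & ->). auto.
  - intros Hz. exists (act (inv A g) z). rewrite (act_inv_r_G A G HG); auto.
    split; auto. apply H; auto using fixes_inv.
Qed.

(** A common support of the members makes any set of the ground model consisting of them symmetric.
    This is how sets obtained by choice enter the permutation model. *)
Lemma HS_supported E S : sub uni E A -> fin E -> set S -> (forall s, s ∊ S -> HS s /\ supp E s) -> HS S.
Proof.
  intros HEA HEf HSs H. apply (HS_iff A G F); auto. split; [|intros y Hy; apply H; auto].
  exists E; split; auto; split; auto. apply supp_stable; auto. intros g s Hg Hf Hs.
  destruct (H s Hs) as [_ K]. rewrite K; auto.
Qed.

Lemma min_support E x : sub uni E A -> fin E -> fsupp A G x -> ~ supp E x ->
  exists E' a, sub uni E' A /\ fin E' /\ (forall b, b ∊ E -> b ∊ E') /\ a ∊ A /\ ~ a ∊ E' /\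
    supp (adj E' a) x /\ ~ supp E' x.
Proof.
  intros HEA HEf (S & S1 & S2 & S3) HE.
  assert (K : supp (cup E S) x).
  { eapply supp_sub; eauto. intros a Ha; apply in_cup; auto. }
  clear S3. revert S1 K.
  apply (fin_ind (fun S => sub uni S A -> supp (cup E S) x -> exists E' a, sub uni E' A /\ fin E' /\
    (forall b, b ∊ E -> b ∊ E') /\ a ∊ A /\ ~ a ∊ E' /\ supp (adj E' a) x /\ ~ supp E' x)); auto.
  - dn.
  - intros _ K. destruct HE. eapply supp_sub; eauto. intros a Ha.
    apply in_cup in Ha as [Ha|Ha]; auto. destruct (in_emp a Ha).
  - intros T b HT IH _ [_ HbA] K.
    assert (HTA : sub uni T A) by (split; [apply fin_set; auto | intros z Hz; apply HbA, in_adj; auto]).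
    destruct (classic (supp (cup E T) x)) as [L|L]; auto.
    exists (cup E T), b. split; [apply sub_cup; auto|]. split; [apply fin_cup; auto|].
    split; [intros c Hc; apply in_cup; auto|]. split; [apply HbA, in_adj; auto|].
    assert (M : supp (adj (cup E T) b) x).
    { eapply supp_sub; eauto. intros c Hc. rewrite in_adj, in_cup. rewrite in_cup, in_adj in Hc. tauto. }
    split; [|split; auto]. intros Hb. apply L. rewrite adj_mem in M; auto.
Qed.

Section Orbit.
Variables E a x : uni.
Hypothesis HEA : sub uni E A.
Hypothesis HEf : fin E.
Hypothesis Ha : a ∊ A.
Hypothesis HaE : ~ a ∊ E.
Hypothesis Hx : supp (adj E a) x.
Hypothesis HxE : ~ supp E x.
Hypothesis HxS : HS x.

(** The inverse of [h] composed with [g] fixes [E] and [a], hence [x]. *)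
Lemma orbit_eq g h : g ∊ G -> h ∊ G -> fixes g E -> fixes h E -> act g a = act h a -> act g x = act h x.
Proof.
  intros Hg Hh Fg Fh K.
  assert (L : act (comp A (inv A h) g) x = x).
  { apply Hx; auto. apply fixes_adj. split; [apply fixes_comp; auto using fixes_inv|].
    rewrite (act_comp_G A G HG), K by auto. apply (act_inv_l_G A G HG); auto. }
  rewrite (act_comp_G A G HG) in L by auto.
  rewrite <- L, (act_inv_r_G A G HG); auto. f_equal.
  rewrite L. auto.
Qed.

(** Otherwise the inverse of [h] composed with [g] fixes [x] and moves [a]; by primitivity the
    stabilizer of [x] would then include fix([E]), against [HxE]. *)
Lemma orbit_inj g h : g ∊ G -> h ∊ G -> fixes g E -> fixes h E -> act g x = act h x -> act g a = act h a.
Proof.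
  intros Hg Hh Fg Fh K. apply NNPP; intros N. apply HxE. intros f Hf Ff.
  apply (Hprim E a (fun g => act g x = x)); auto.
  - intros k Hk Fk Ka. apply Hx; auto. apply fixes_adj; auto.
  - intros f' g' H1 H2 K1 K2. rewrite (act_comp_G A G HG), K2, K1; auto.
  - intros k Hk Kk. apply (act_inv_fix A G HG); auto.
  - exists (comp A (inv A h) g). split; auto. split; [apply fixes_comp; auto using fixes_inv|].
    rewrite !(act_comp_G A G HG) by auto. rewrite K, (act_inv_l_G A G HG) by auto. split; auto.
    intros L. apply N. rewrite <- (act_inv_r_G A G HG h (act g a)), L; auto.
Qed.

Definition orbit := repl (sep G (fun g => fixes g E)) (fun g => act g x).
Lemma in_orbit y : y ∊ orbit <-> exists g, g ∊ G /\ fixes g E /\ y = act g x.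
Proof.
  unfold orbit. rewrite in_repl by dn. apply iff_ex; intros g. rewrite in_sep by dn. tauto.
Qed.
Lemma set_orbit : set orbit.
Proof. apply set_repl. dn. Qed.

(** the bijection from the orbit of [x] to the orbit of [a] *)
Definition base v b := exists g, g ∊ G /\ fixes g E /\ v = act g x /\ b = act g a.
Lemma D2_base : D2 base. Proof. unfold base; dn. Qed.
Lemma base_fun v b b' : base v b -> base v b' -> b = b'.
Proof.
  intros (g & Hg & Fg & -> & ->) (h & Hh & Fh & K & ->). apply orbit_inj; auto.
Qed.

Lemma fin_base L : fin L -> fin (sep A (fun b => exists v, v ∊ L /\ base v b)).
Proof.
  intros HL. pose proof D2_base. assert (D1 (fun b => exists v, v ∊ L /\ base v b)) by dn.
  apply (fin_image base L); auto; [apply base_fun | apply set_sep; auto |].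
  intros b Hb. apply in_sep in Hb; auto. tauto.
Qed.

(** [moving] for the atom [act g a], transported along the bijection of orbits: the elements of [L]
    correspond to finitely many atoms that have to be avoided. *)
Lemma orbit_moving E' g L : sub uni E' A -> fin E' -> (forall b, b ∊ E -> b ∊ E') ->
  g ∊ G -> fixes g E -> ~ act g a ∊ E' -> fin L ->
  exists f, f ∊ G /\ fixes f E' /\ ~ act f (act g x) ∊ L.
Proof.
  intros H1 H2 H3 Hg Fg H4 HL. pose proof D2_base. assert (D1 (fun b => exists v, v ∊ L /\ base v b)) by dn.
  destruct (Hmov E' (act g a) _ H1 H2 (act_atom_A A g HA (Gfn g Hg) a Ha) H4 (fin_base L HL)) as (f & Hf & Ff & K).
  exists f; split; auto; split; auto. intros M. apply K. apply in_sep; auto.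
  split; [apply (act_atom_A A); auto; apply (act_atom_A A); auto|].
  exists (act f (act g x)); split; auto. exists (comp A f g). rewrite !(act_comp_G A G HG); auto.
  repeat (split; auto). apply fixes_comp; auto. intros b Hb; apply Ff, H3; auto.
Qed.

Lemma orbit_base_notin g : g ∊ G -> fixes g E -> ~ act g a ∊ E.
Proof.
  intros Hg Fg K. apply HaE. pose proof (Fg _ K) as L.
  apply (act_inj A g HA (Gfn g Hg) (Ginj g Hg)) in L. rewrite <- L; auto.
Qed.

Lemma infinite_orbit : infinite uni orbit.
Proof.
  apply infinite_iff. split; [apply set_orbit|]. intros K.
  destruct (orbit_moving E (idp A) orbit) as (f & Hf & Ff & L); auto.
  - apply (pg_id A G HG).
  - intros b _. apply act_idp; auto.
  - rewrite (act_idp A HA); auto.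
  - apply L, in_orbit. exists f. rewrite (act_idp A HA). auto.
Qed.

Lemma supp_orbit : supp E orbit.
Proof.
  apply supp_stable; [apply set_orbit|]. intros g s Hg Fg Hs.
  apply in_orbit in Hs as (h & Hh & Fh & ->). apply in_orbit. exists (comp A g h).
  rewrite (act_comp_G A G HG); auto using fixes_comp.
Qed.

Lemma HS_orbit : HS orbit.
Proof.
  apply (HS_iff A G F); auto. split; [exists E; auto using supp_orbit|].
  intros y Hy. apply in_orbit in Hy as (g & Hg & _ & ->). apply (HS_act A G F); auto.
Qed.

Lemma supp_orbit_member y g : g ∊ G -> fixes g E -> supp (adj E a) y ->
  supp (adj E (act g a)) (act g y).
Proof.
  intros Hg Fg Hy f Hf Ff. apply fixes_adj in Ff as [Ff Fa].
  assert (K : act (comp A (inv A g) (comp A f g)) y = y).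
  { apply Hy; auto. apply fixes_adj. split; [auto using fixes_comp, fixes_inv|].
    rewrite !(act_comp_G A G HG), Fa, (act_inv_l_G A G HG); auto. }
  rewrite !(act_comp_G A G HG) in K by auto.
  rewrite <- K at 2. rewrite (act_inv_r_G A G HG); auto.
Qed.

(** A member [act h x] of the orbit is supported by [E] and [act h a]. It differs from [act g x], so
    [act h a] differs from [act g a], and the latter stays free to move. *)
Lemma list_support g l : g ∊ G -> fixes g E -> (forall s, In s l -> s ∊ orbit /\ s <> act g x) ->
  exists E', sub uni E' A /\ fin E' /\ (forall b, b ∊ E -> b ∊ E') /\ ~ act g a ∊ E' /\
    forall s, In s l -> supp E' s.
Proof.
  intros Hg Fg. induction l as [|s l IH]; intros H.
  - exists E. split; auto. split; auto. split; auto. split; [apply orbit_base_notin; auto|].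
    intros s [].
  - destruct IH as (E' & H1 & H2 & H3 & H4 & H5); [intros; apply H; simpl; auto|].
    destruct (H s (or_introl eq_refl)) as [Hs N]. apply in_orbit in Hs as (h & Hh & Fh & ->).
    exists (adj E' (act h a)). split; [apply sub_adj; auto; apply (act_atom_A A); auto|].
    split; [apply fin_adj; auto|]. split; [intros b Hb; apply in_adj; auto|]. split.
    + intros K. apply in_adj in K as [K|K]; auto. apply N, orbit_eq; auto.
    + intros s [<-|Hs].
      * apply (supp_sub G _ (adj E (act h a))); [apply supp_orbit_member; auto|].
        intros b Hb. rewrite in_adj in *. intuition.
      * apply (supp_sub G _ E'); auto. intros b Hb; apply in_adj; auto.
Qed.
End Orbit.

(** A member not supported by [E] would have an infinite orbit under fix([E']) for some larger [E'],
    and this orbit would be included in [x]. *)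
Lemma finite_members_supp E x : sub uni E A -> fin E -> supp E x -> HS x -> fin x ->
  forall y, y ∊ x -> supp E y.
Proof.
  intros H1 H2 Hx HxS Hxf y Hy. apply NNPP; intros N.
  assert (HyS : HS y) by (eapply HS_mem; eauto).
  destruct (min_support E y H1 H2 (HS_fsupp _ _ _ HG HF _ HyS) N) as (E' & a & K1 & K2 & K3 & K4 & K5 & K6 & K7).
  apply (proj2 (infinite_orbit E' a y K1 K2 K4 K5 K6 K7)).
  apply (fin_sub x); auto. split; [apply set_orbit|].
  intros z Hz. apply in_orbit in Hz as (g & Hg & Fg & ->).
  rewrite <- (Hx g Hg); [apply (act_mem A); auto|]. intros b Hb; auto.
Qed.

Local Notation N := (PermModel uni G F).
Local Notation "^ x" := (proj1_sig x) (at level 5, x at level 5).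

Section WithChoice.
Context {AC : has_choice}.

Theorem N_rrt m n : rrt N m n.
Proof.
  intros X C D χ HX _ HD Hχ Hb.
  apply (N_infinite A G F HG HF) in HX. apply (N_fn A G F HG HF) in Hχ.
  assert (HDs : forall s, s ∊ ^D <-> sub uni s ^X /\ cardeq uni m s).
  { destruct HD as [_ HD]. intros s. split.
    - intros Hs. specialize (HD (mk _ _ s (HS_mem _ _ _ HG HF _ _ (N_HS _ _ D) Hs))).
      rewrite (N_sub A G F HG HF), (N_cardeq A G F HG HF) in HD. apply HD; auto.
    - intros [Hs Hc].
      assert (HsS : HS s).
      { apply (HS_fin A); auto; [eapply cardeq_fin; eauto|].
        intros y Hy. apply (HS_mem A G F HG HF ^X); [apply N_HS | apply Hs; auto]. }
      specialize (HD (mk _ _ s HsS)).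
      rewrite (N_sub A G F HG HF), (N_cardeq A G F HG HF) in HD. apply HD; auto. }
  clear HD. set (fibre := fun c => sep ^D (fun s => pair s c ∊ ^χ)).
  assert (Hfib : forall c s, s ∊ fibre c <-> pair s c ∊ ^χ).
  { intros c s. unfold fibre. rewrite in_sep by dn. split; [tauto|]. split; auto.
    apply (fn_dom _ _ _ Hχ _ _ H). }
  assert (Hcard : forall c, c ∊ ^C -> cardle uni n (fibre c)).
  { intros c Hc. assert (HcS : HS c) by (apply (HS_mem A G F HG HF ^C); [apply N_HS | auto]).
    assert (HfS : HS (fibre c)).
    { apply (HS_iff A G F); auto. split.
      - destruct (fsupp2 A G ^χ c) as (E & E1 & E2 & E3 & E4);
          [apply (HS_fsupp A G F); auto; apply N_HS | apply (HS_fsupp A G F); auto |].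
        exists E; split; auto; split; auto. apply supp_stable; [apply set_sep; dn|].
        intros g s Hg Fg Hs. rewrite Hfib in *.
        rewrite <- (E3 g Hg Fg), <- (E4 g Hg Fg), <- (act_pair A) by auto. apply (act_mem A); auto.
      - intros s Hs. apply in_sep in Hs as [Hs _]; [|dn].
        apply (HS_mem A G F HG HF ^D); [apply N_HS | auto]. }
    specialize (Hb (mk _ _ c HcS) (mk _ _ (fibre c) HfS)). rewrite (N_cardle A G F HG HF) in Hb.
    apply Hb; auto.
    - apply set_sep; dn.
    - intros s. rewrite (N_app A G F HG HF). apply Hfib. }
  (* [n] is standard, so a fibre is enumerated by a list of the metatheory. *)
  assert (Hlist : forall c, c ∊ ^C -> exists l, length l <= n /\ forall s, s ∊ fibre c <-> In s l).
  { intros c Hc. specialize (Hcard c Hc). clear -Hcard. induction n.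
    - apply (cardeq_list 0) in Hcard as (_ & l & _ & L & K). exists l; split; auto; lia.
    - destruct Hcard as [H|H].
      + destruct (IHn H) as (l & L & K). exists l; split; auto.
      + apply cardeq_list in H as (_ & l & _ & L & K). exists l; split; auto; lia. }
  destruct (classic (exists E, sub uni E A /\ fin E /\ forall x, x ∊ ^X -> supp E x)) as [(E & E1 & E2 & E3)|NE].
  (* With a common support for all elements of [X], the set found in the ground model lies in the
     permutation model. *)
  - destruct (rainbow_ramsey m n ^X ^χ HX) as (Y & HY1 & HY2 & HY3).
    + intros s c d. apply (fn_fun _ _ _ Hχ).
    + intros c l Hl Hs. destruct l as [|s0 l0]; [simpl; lia|].
      destruct (Hlist c) as (l' & L & K).
      { destruct (Hs s0 (or_introl eq_refl)) as (_ & _ & M). apply (fn_cod _ _ _ Hχ _ _ M). }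
      etransitivity; [|exact L]. apply NoDup_incl_length; auto.
      intros s Hsl. apply K, Hfib. apply Hs; auto.
    + assert (HYS : HS Y).
      { apply (HS_supported E); auto; [apply HY1|]. intros s Hs. apply HY1 in Hs.
        split; auto. apply (HS_mem A G F HG HF ^X); [apply N_HS | auto]. }
      exists (mk _ _ Y HYS). split; [apply (N_sub A G F HG HF); auto|].
      split; [apply (N_infinite A G F HG HF); auto|].
      intros s t c Hs Hcs Ht Hct Hst [H1 H2].
      apply (N_sub A G F HG HF) in Hs, Ht. apply (N_cardeq A G F HG HF) in Hcs, Hct.
      apply (N_app A G F HG HF) in H1, H2. apply Hst, N_eq. apply (HY3 _ _ ^c); auto.
  - destruct (fsupp2 A G ^X ^χ) as (E0 & E1 & E2 & E3 & E4); try (apply (HS_fsupp A G F); auto; apply N_HS).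
    assert (exists x, x ∊ ^X /\ ~ supp E0 x) as (x & Hx & Hxs).
    { apply NNPP; intros K. apply NE. exists E0; split; auto; split; auto. intros x Hx.
      apply NNPP; intros L; apply K; eauto. }
    assert (HxS : HS x) by (apply (HS_mem A G F HG HF ^X); [apply N_HS | auto]).
    destruct (min_support E0 x E1 E2 (HS_fsupp _ _ _ HG HF _ HxS) Hxs)
      as (E & a & K1 & K2 & K3 & K4 & K5 & K6 & K7).
    pose proof (HS_orbit E x K1 K2 HxS) as HYS.
    pose proof (infinite_orbit E a x K1 K2 K4 K5 K6 K7) as HYi.
    set (Y := orbit E x) in *.
    exists (mk _ _ Y HYS). split; [|split; [apply (N_infinite A G F HG HF); auto|]].
    { apply (N_sub A G F HG HF). split; [apply set_orbit|]. intros y Hy.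
      apply in_orbit in Hy as (g & Hg & Fg & ->). rewrite <- (E3 g Hg).
      - apply (act_mem A); auto.
      - intros b Hbb; auto. }
    intros s t c Hs Hcs Ht Hct Hst [H1 H2].
    apply (N_sub A G F HG HF) in Hs, Ht. apply (N_cardeq A G F HG HF) in Hcs, Hct.
    apply (N_app A G F HG HF) in H1, H2.
    assert (Hne : ^s <> ^t) by (intros K; apply Hst, N_eq; auto).
    apply cardeq_list in Hcs as (Hss & ls & Ns & Ls & Ms).
    pose proof Hct as Hctf. apply cardeq_fin in Hctf.
    apply cardeq_list in Hct as (Hts & lt & Nt & Lt & Mt).
    (* Both sets have [m] elements, so being different, [t] is not included in [s]. *)
    assert (exists y, In y lt /\ ~ In y ls) as (y & Hyt & Hys).
    { apply NNPP; intros K. apply Hne. apply set_ext; auto.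
      assert (I : incl lt ls) by (intros y Hy; apply NNPP; intros L; apply K; eauto).
      assert (I' : incl ls lt) by (apply NoDup_length_incl; auto; lia).
      intros z; rewrite Ms, Mt; split; auto. }
    assert (HyY : y ∊ Y) by (apply Ht, Mt; auto).
    apply in_orbit in HyY as (g & Hg & Fg & Ey).
    destruct (list_support E a x K1 K2 K4 K5 K6 g ls Hg Fg) as (E' & J1 & J2 & J3 & J4 & J5).
    { intros u Hu. split; [apply Hs, Ms; auto|]. intros ->. apply Hys. rewrite Ey; auto. }
    assert (Hcc : ^c ∊ ^C) by (apply (fn_cod _ _ _ Hχ _ _ H1)).
    (* Only finitely many points occur in sets of the colour [c]. The contradiction is an [f] that
       fixes [s] pointwise and moves [y] away from all of them. *)
    assert (HL : fin (union (fibre ^c))).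
    { apply fin_union.
      - destruct (Hlist _ Hcc) as (l & _ & K). apply (fin_sub (set_of_list l)); [apply fin_set_of_list|].
        split; [apply set_sep; dn|]. intros z Hz. apply in_set_of_list, K; auto.
      - intros u Hu. apply Hfib in Hu. apply (fn_dom _ _ _ Hχ), HDs in Hu as [_ Hu].
        eapply cardeq_fin; eauto. }
    destruct (orbit_moving E a x K1 K2 K4 K5 K6 K7 E' g _ J1 J2 J3 Hg Fg J4 HL) as (f & Hf & Ff & Nf).
    apply Nf. rewrite <- Ey. apply in_union. exists (act f ^t). split.
    (* [f] fixes [χ] and [s], hence the colour of [s]; so [act f t] has this colour as well. *)
    + apply Hfib. assert (Ef : act f ^χ = ^χ) by (apply E4; auto; intros b Hbb; auto).
      assert (Es : act f ^s = ^s).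
      { apply (act_fixed_members A); auto. intros u Hu. apply J5; auto. apply Ms; auto. }
      assert (Ec : act f ^c = ^c).
      { apply (fn_fun _ _ _ Hχ ^s); auto. rewrite <- Es at 1. rewrite <- Ef, <- (act_pair A) by auto.
        apply (act_mem A); auto. }
      rewrite <- Ec, <- Ef, <- (act_pair A) by auto. apply (act_mem A); auto.
    + apply (act_mem A); auto. apply Mt; auto.
Qed.

Lemma N_uncountable_elim (x : N) : uncountable N x -> forall f, HS f -> ~ isinj uni f ^x omega.
Proof.
  intros [_ H] f Hf K. apply H. exists (mk _ _ omega (HS_omega A G F HG HF)), (mk _ _ f Hf).
  split; [apply (N_omega A G F HG HF); auto|]. apply (N_inj A G F HG HF); auto.
Qed.
Lemma N_uncountable_intro (x : N) : set ^x -> (forall f, HS f -> ~ isinj uni f ^x omega) -> uncountable N x.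
Proof.
  intros Hx H. split; auto. intros (w & f & Hw & Hf). apply (N_omega A G F HG HF) in Hw.
  apply (N_inj A G F HG HF) in Hf. rewrite Hw in Hf. apply (H ^f); auto. apply N_HS.
Qed.

Lemma N_deltasystem (B : N) r : HS r -> delta r ^B -> deltasystem N B.
Proof.
  intros Hr [Hrs H]. exists (mk _ _ r Hr). split; auto. intros x y Hx Hy Hxy z.
  apply (H ^x ^y); auto. intros K; apply Hxy, N_eq; auto.
Qed.

Theorem N_deltasl : deltasl N.
Proof.
  intros X HX Hfin.
  assert (HXs : set ^X) by apply HX.
  assert (Hfin' : forall x, x ∊ ^X -> HS x /\ fin x).
  { intros x Hx. assert (HxS : HS x) by (apply (HS_mem A G F HG HF ^X); [apply N_HS | auto]).
    split; auto. destruct (Hfin (mk _ _ x HxS) Hx) as [K1 K2]. split; [exact K1|].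
    apply (N_finite A G F HG HF) in K2; auto. }
  clear Hfin. pose proof (N_uncountable_elim X HX) as HX'.
  destruct (classic (exists E, sub uni E A /\ fin E /\ forall x, x ∊ ^X -> supp E x)) as [(E & E1 & E2 & E3)|NE].
  (* Members of the family have a common support and natural numbers are fixed, so an injection into
     [omega] found in the ground model would belong to the permutation model. *)
  - assert (Hc : ~ countable ^X).
    { intros [f Hf]. apply (HX' f); auto. apply isinj_iff in Hf as [Hf _].
      apply (HS_supported E); auto; [eapply fn_set; eauto|]. intros p Hp.
      destruct (fn_pairs _ _ _ Hf p Hp) as (u & k & ->).
      pose proof (fn_dom _ _ _ Hf _ _ Hp) as Hu. pose proof (fn_cod _ _ _ Hf _ _ Hp) as Hk.
      split; [apply (HS_pair A); auto; [apply Hfin'; auto | apply (HS_nat A); auto]|].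
      intros g Hg Fg. rewrite (act_pair A), (act_nat A g HA (Gfn g Hg) k Hk), (E3 u Hu g Hg Fg); auto. }
    destruct (delta_system_choice ^X HXs Hc) as (Y & HYX & HYc & r & Hr).
    { intros x Hx; apply Hfin'; auto. }
    assert (HYS : HS Y).
    { apply (HS_supported E); auto; [apply HYX|]. intros s Hs. apply HYX in Hs. split; auto; apply Hfin'; auto. }
    exists (mk _ _ Y HYS). split; [apply (N_sub A G F HG HF); auto|]. split.
    + apply N_uncountable_intro; [apply HYX|]. intros f _ Hf. apply HYc. exists f; exact Hf.
    (* The root belongs to the model because it is a subset of a finite member, which needs two
       distinct members to intersect. Otherwise the condition is vacuous and [emp] serves as
       root. *)
    + destruct (classic (exists x y, x ∊ Y /\ y ∊ Y /\ x <> y)) as [(x & y & Hx & Hy & Hxy)|NY].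
      * apply (N_deltasystem _ r); auto. destruct Hr as [Hrs Hr].
        assert (HrX : forall z, z ∊ r -> z ∊ x) by (intros z Hz; apply (Hr x y) in Hz; tauto).
        destruct (Hfin' x) as [H1 H2]; [apply HYX; auto|].
        apply (HS_fin A); auto.
        -- apply (fin_sub x); auto. split; auto.
        -- intros z Hz. apply (HS_mem A G F HG HF x); auto.
      * apply (N_deltasystem _ emp); [apply (HS_emp A); auto|]. split; [apply set_emp|].
        intros x y Hx Hy Hxy. destruct NY. exists x, y; auto.
  - destruct (HS_fsupp A G F HG HF ^X (N_HS _ _ X)) as (E0 & E1 & E2 & E3).
    assert (exists x, x ∊ ^X /\ ~ supp E0 x) as (x & Hx & Hxs).
    { apply NNPP; intros K. apply NE. exists E0; split; auto; split; auto. intros x Hx.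
      apply NNPP; intros L; apply K; eauto. }
    destruct (Hfin' x Hx) as [HxS Hxf].
    destruct (min_support E0 x E1 E2 (HS_fsupp _ _ _ HG HF _ HxS) Hxs)
      as (E & a & K1 & K2 & K3 & K4 & K5 & K6 & K7).
    pose proof (HS_orbit E x K1 K2 HxS) as HYS.
    exists (mk _ _ (orbit E x) HYS). split; [|split].
    + apply (N_sub A G F HG HF). split; [apply set_orbit|]. intros y Hy.
      apply in_orbit in Hy as (g & Hg & Fg & ->). rewrite <- (E3 g Hg).
      * apply (act_mem A); auto.
      * intros b Hb; auto.
    + apply N_uncountable_intro; [apply set_orbit|]. intros f Hf Hfi. simpl in Hfi.
      apply isinj_iff in Hfi as [Hfn Hfi].
      (* An injection [f] supported by [E'] and its values in [omega] are fixed by any [h] fixing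
         [E']. Moving [a] off [cup E E'] by [g] leaves room for such an [h] that moves [act g x], so
         [f] would take a value twice. *)
      destruct (HS_fsupp A G F HG HF f Hf) as (E' & J1 & J2 & J3).
      assert (Q1 : sub uni (cup E E') A) by (apply sub_cup; auto).
      assert (Q2 : fin (cup E E')) by (apply fin_cup; auto).
      destruct (Hmov E a (cup E E') K1 K2 K4 K5 Q2) as (g & Hg & Fg & Ng).
      destruct (orbit_moving E a x K1 K2 K4 K5 K6 K7 (cup E E') g (adj emp (act g x)) Q1 Q2) as (h & Hh & Fh & Nh); auto.
      { intros b Hb; apply in_cup; auto. }
      { apply fin_adj, fin_emp. }
      apply Nh, in_adj. right.
      destruct (fn_tot _ _ _ Hfn (act g x)) as [k Hk]; [apply in_orbit; eauto|].
      apply (Hfi _ _ k); auto.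
      assert (Ek : act h k = k) by (apply (act_nat A); auto; eapply fn_cod; eauto).
      assert (Ef : act h f = f) by (apply J3; auto; intros b Hb; apply Fh, in_cup; auto).
      rewrite <- Ek, <- Ef, <- (act_pair A) by auto. apply (act_mem A); auto.
    + assert (HD : D1 (fun y => supp E y)) by dn.
      (* [x] is finite, so a support of [x] supports its members one by one. *)
      assert (Hmem : forall y, y ∊ x -> HS y /\ supp (adj E a) y).
      { intros y Hy. split; [apply (HS_mem A G F HG HF x); auto|].
        apply (finite_members_supp (adj E a) x); auto; [apply sub_adj; auto | apply fin_adj; auto]. }
      apply (N_deltasystem _ (sep x (fun y => supp E y))).
      * apply (HS_fin A); auto; [apply (fin_sub x); auto; apply sub_sep; auto|].
        intros y Hy. apply in_sep in Hy as [Hy _]; auto. apply Hmem; auto.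
      * split; [apply set_sep; auto|]. intros u v Hu Hv Huv.
        apply in_orbit in Hu as (g & Hg & Fg & ->). apply in_orbit in Hv as (h & Hh & Fh & ->).
        assert (Hab : act g a <> act h a) by (intros K; apply Huv; eapply orbit_eq; eauto).
        assert (Hxset : set x) by (apply fin_set; auto).
        intros z. rewrite in_sep by auto. split.
        -- intros [Hz Hzs]. split; [rewrite <- (Hzs g) | rewrite <- (Hzs h)]; auto; apply (act_mem A); auto.
        -- intros [Hz Hz']. apply (in_act A) in Hz as (y & Hy & Ez); auto.
           apply (in_act A) in Hz' as (y' & Hy' & Ez'); auto.
           assert (S1 : supp (adj E (act g a)) z).
           { rewrite Ez. apply supp_orbit_member; auto. apply Hmem; auto. }
           assert (S2 : supp (adj E (act h a)) z).
           { rewrite Ez'. apply supp_orbit_member; auto. apply Hmem; auto. }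
           (* A common member [z] of [act g x] and [act h x] is fixed by fix([E ∪ {act g a}]) and by
              fix([E ∪ {act h a}]). The latter contains an element moving [act g a], so by
              primitivity the stabilizer of [z] includes all of fix([E]). *)
           assert (S : supp E z).
           { intros f Hf Ff.
             apply (Hprim E (act g a) (fun f => act f z = z)); auto.
             - apply (act_atom_A A); auto.
             - apply (orbit_base_notin E a); auto.
             - intros k Hk Fk Ka. apply S1; auto. apply fixes_adj; auto.
             - intros f' g' H1 H2 L1 L2. rewrite (act_comp_G A G HG), L2, L1; auto.
             - intros k Hk Kk. apply (act_inv_fix A G HG); auto.
             - destruct (Hmov (adj E (act h a)) (act g a) (adj emp (act g a))) as (k & Hk & Fk & Nk).
               + apply sub_adj; auto. apply (act_atom_A A); auto.
               + apply fin_adj; auto.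
               + apply (act_atom_A A); auto.
               + intros K. apply in_adj in K as [K|K]; auto. revert K. apply (orbit_base_notin E a); auto.
               + apply fin_adj, fin_emp.
               + exists k; split; auto. pose proof Fk as Fk'. apply fixes_adj in Fk' as [Fk' _].
                 split; auto. split; [|apply S2; auto].
                 intros L. apply Nk, in_adj; auto. }
           (* Since [z] equals [act g y] and is supported by [E], undoing [g] gives [y = z]; hence
              [z] is a member of [x] itself. *)
           assert (y = z) as ->; auto.
           assert (L : act (inv A g) z = z) by (apply S; auto using fixes_inv).
           rewrite Ez in L. rewrite (act_inv_l_G A G HG) in L by auto. rewrite Ez; auto.
Qed.
End WithChoice.
End Orbits.

(** * Groups containing enough transpositions *)

Section GroupFacts.
Context {Z : zfa_model}.
Variables A G : uni.
Hypothesis HG : perm_group A G.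

Lemma comp_inv_cancel f g : f ∊ G -> g ∊ G -> comp A f (comp A (inv A f) g) = g.
Proof.
  intros Hf Hg. pose proof (pg_bij A G HG) as HB. pose proof (pg_comp A G HG) as HC.
  pose proof (pg_inv A G HG) as HI. pose proof (pg_atoms A G HG) as HA.
  apply (fn_ext _ _ A A); try (apply bij_fn; auto).
  intros a b Hp.
  rewrite <- (act_atom_eq A _ HA (bij_fn A _ (HB _ (HC _ _ Hf (HC _ _ (HI _ Hf) Hg)))) a b Hp).
  rewrite !(act_comp_G A G HG), (act_inv_r_G A G HG); auto.
  apply (act_atom A); auto; [apply bij_fn; auto|].
  apply (fn_dom _ _ _ (bij_fn A _ (HB _ (HC _ _ Hf (HC _ _ (HI _ Hf) Hg)))) _ _ Hp).
Qed.

(** To prove that [H] contains [fix E] it is enough to reach every point of the orbit of [a] by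
    an element of [H]. *)
Lemma primitive_of_transitive E a (H : uni -> Prop) : a ∊ A ->
  (forall g, g ∊ G -> fixes g E -> act g a = a -> H g) ->
  (forall f g, f ∊ G -> g ∊ G -> H f -> H g -> H (comp A f g)) ->
  (forall g, g ∊ G -> fixes g E -> act g a <> a ->
     exists h, h ∊ G /\ fixes h E /\ H h /\ act h a = act g a) ->
  forall g, g ∊ G -> fixes g E -> H g.
Proof.
  intros Ha H1 H2 H3 g Hg Fg. destruct (classic (act g a = a)) as [K|K]; auto.
  destruct (H3 g Hg Fg K) as (h & Hh & Fh & HHh & E1).
  pose proof (pg_comp A G HG) as HC. pose proof (pg_inv A G HG) as HI.
  rewrite <- (comp_inv_cancel h g Hh Hg). apply H2; auto. apply H1; auto.
  - apply (fixes_comp A G HG); auto. apply (fixes_inv A G HG); auto.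
  - rewrite (act_comp_G A G HG), <- E1 by auto. apply (act_inv_l_G A G HG); auto.
Qed.
End GroupFacts.

Section Transpositions.
Context {Z : zfa_model}.
Variable A : uni.
Hypothesis HA : isatomset uni A.

Definition swap b d u v := (u = b /\ v = d) \/ (u = d /\ v = b) \/ (u <> b /\ u <> d /\ v = u :> uni).
Definition tr b d := graph A A (swap b d).
Lemma D2_swap b d : D2 (swap b d). Proof. unfold swap; dn. Qed.
Lemma swap_total b d u : exists v, swap b d u v.
Proof.
  unfold swap. destruct (classic (u = b)); [eauto|]. destruct (classic (u = d)); eauto 6.
Qed.
Lemma swap_fun b d u v w : swap b d u v -> swap b d u w -> v = w.
Proof. unfold swap. intuition congruence. Qed.
Lemma swap_sym b d u v : swap b d u v -> swap b d v u.
Proof. unfold swap. intuition congruence. Qed.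
Lemma swap_A b d u v : b ∊ A -> d ∊ A -> u ∊ A -> swap b d u v -> v ∊ A.
Proof. unfold swap. intros ? ? ? H. intuition congruence. Qed.
Lemma in_tr b d u v : b ∊ A -> d ∊ A -> pair u v ∊ tr b d <-> u ∊ A /\ swap b d u v.
Proof.
  intros Hb Hd. unfold tr. rewrite in_graph by apply D2_swap.
  split; [tauto|]. intros [H K]; split; auto. split; auto. apply (swap_A b d u v); auto.
Qed.
Lemma bij_tr b d : b ∊ A -> d ∊ A -> isbij uni (tr b d) A A.
Proof.
  intros Hb Hd. apply bij_graph; [apply D2_swap | | | |].
  - intros a Ha. destruct (swap_total b d a) as [v Hv]. exists v; split; auto. apply (swap_A b d a v); auto.
  - intros u v w _. apply swap_fun.
  - intros u v w _ _ H K. apply (swap_fun b d w); apply swap_sym; auto.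
  - intros v Hv. destruct (swap_total b d v) as [u Hu]. exists u. split; [|apply swap_sym; auto].
    apply (swap_A b d v u); auto.
Qed.
Lemma act_tr b d u v : b ∊ A -> d ∊ A -> u ∊ A -> swap b d u v -> act (tr b d) u = v.
Proof.
  intros Hb Hd Hu H. apply (act_atom_eq A); auto; [apply bij_fn, bij_tr; auto|].
  apply in_tr; auto.
Qed.
Lemma act_tr_l b d : b ∊ A -> d ∊ A -> act (tr b d) b = d.
Proof. intros; apply act_tr; auto. unfold swap; auto. Qed.
Lemma fixes_tr b d E : b ∊ A -> d ∊ A -> sub uni E A -> ~ b ∊ E -> ~ d ∊ E -> fixes (tr b d) E.
Proof.
  intros Hb Hd [_ HE] Nb Nd e He. apply act_tr; auto. right; right.
  repeat split; auto; intros ->; contradiction.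
Qed.

Variable G : uni.
Hypothesis HG : perm_group A G.
(** Lying in the same piece: all atoms are similar in the basic Fraenkel model, and atoms of the
    same [P_i] in the Brunner/Pincus model. *)
Variable sim : uni -> uni -> Prop.
Hypothesis sim_sym : forall a b, sim a b -> sim b a.
Hypothesis sim_trans : forall a b c, sim a b -> sim b c -> sim a c.
Hypothesis sim_act : forall g a, g ∊ G -> a ∊ A -> sim a (act g a).
Hypothesis sim_tr : forall a b, a ∊ A -> b ∊ A -> sim a b -> tr a b ∊ G.
Hypothesis sim_inf : forall a L, a ∊ A -> fin L -> exists b, b ∊ A /\ sim a b /\ ~ b ∊ L.

Lemma transpositions_moving : moving A G.
Proof.
  intros E a L HE HEf Ha HaE HL.
  destruct (sim_inf a (cup E L) Ha (fin_cup _ _ HEf HL)) as (b & Hb & Hab & Nb).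
  rewrite in_cup in Nb. exists (tr a b). split; auto.
  rewrite act_tr_l by auto. split; [apply fixes_tr|]; auto.
Qed.

(** The transposition of [act f a] and [act g a] fixes [E] and [a], because neither image is [a]; so
    it lies in [H]. Composed with [f] it sends [a] to [act g a]. *)
Lemma transpositions_primitive : primitive A G.
Proof.
  intros E a H HE HEf Ha HaE H1 H2 H3 (f & Hf & Ff & Nf & HHf).
  apply (primitive_of_transitive A G HG E a H Ha H1 H2). intros g Hg Fg Ng.
  pose proof (pg_fn A G HG) as Gfn. pose proof (pg_inj A G HG) as Ginj.
  assert (Hb : act f a ∊ A) by (apply (act_atom_A A); auto).
  assert (Hd : act g a ∊ A) by (apply (act_atom_A A); auto).
  assert (notE : forall k, k ∊ G -> fixes k E -> ~ act k a ∊ E).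
  { intros k Hk Fk K. apply HaE. pose proof (Fk _ K) as M.
    apply (act_inj A k HA (Gfn k Hk) (Ginj k Hk)) in M. rewrite <- M; auto. }
  assert (Ht : tr (act f a) (act g a) ∊ G).
  { apply sim_tr; auto. apply (sim_trans _ a); auto. }
  assert (Ft : fixes (tr (act f a) (act g a)) (adj E a)).
  { apply fixes_tr; auto; [apply sub_adj; auto | |]; rewrite in_adj; intros [K|K]; auto; revert K; apply notE; auto. }
  apply fixes_adj in Ft as [Ft Fta].
  exists (comp A (tr (act f a) (act g a)) f). split; [apply (pg_comp A G HG); auto|].
  split; [apply (fixes_comp A G HG); auto|]. split; [apply H2; auto|].
  rewrite (act_comp_G A G HG) by auto. apply act_tr_l; auto.
Qed.
End Transpositions.

(** What the positive results use of a permutation model, besides choice in the ground model. *)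
Definition good_model {Z : zfa_model} (A G F : uni) :=
  perm_group A G /\ finite_support_filter A G F /\ moving A G /\ primitive A G.

(** * The basic Fraenkel model *)

Section N1.
Context {Z : zfa_model}.

Lemma symmetric_group A G : isatomset uni A -> set G -> (forall g, g ∊ G <-> isbij uni g A A) ->
  perm_group A G.
Proof.
  intros HA HGs HG. split; auto.
  - intros g Hg; apply HG; auto.
  - apply HG, bij_idp.
  - intros f g Hf Hg. apply HG, bij_comp; apply HG; auto.
  - intros g Hg. apply HG, bij_inv, HG, Hg.
Qed.

Lemma symmetric_group_good A G : isatomset uni A -> infinite uni A -> set G ->
  (forall g, g ∊ G <-> isbij uni g A A) -> moving A G /\ primitive A G.
Proof.
  intros HA Hinf HGs HG. pose proof (symmetric_group A G HA HGs HG) as HP.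
  assert (Htr : forall a b, a ∊ A -> b ∊ A -> True -> tr A a b ∊ G) by (intros; apply HG, bij_tr; auto).
  assert (Hex : forall a L, a ∊ A -> fin L -> exists b, b ∊ A /\ True /\ ~ b ∊ L).
  { intros a L _ HL. destruct (infinite_diff A L Hinf HL) as (b & Hb & Nb); eauto. }
  split.
  - apply (transpositions_moving A HA G (fun _ _ => True)); auto.
  - apply (transpositions_primitive A HA G HP (fun _ _ => True)); auto.
Qed.

Lemma isN1_good G F : isN1 uni G F -> exists A, good_model A G F.
Proof.
  intros (A & HA & Hc & HGs & HG & HF). exists A.
  pose proof (symmetric_group A G HA HGs HG) as HP.
  destruct (symmetric_group_good A G HA (cinfinite_infinite A Hc) HGs HG) as [K1 K2].
  split; auto. split; auto. apply isfsfilter_char; auto.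
Qed.
End N1.

(** * The Brunner/Pincus model *)

Section N26.
Context {Z : zfa_model}.

Lemma mapsonto_iff A g p : isbij uni g A A -> sub uni p A ->
  (mapsonto uni g p <-> forall x y, pair x y ∊ g -> (x ∊ p <-> y ∊ p)).
Proof.
  intros Hg [_ Hp]. unfold mapsonto. split.
  - intros H x y Hxy. split.
    + intros Hx. apply H. exists x. rewrite app_iff; auto.
    + intros Hy. apply H in Hy as (x' & Hx' & K). apply app_iff in K.
      rewrite (bij_inj A g Hg _ _ _ Hxy K); auto.
  - intros H y. split.
    + intros Hy. destruct (bij_surj A g y Hg (Hp y Hy)) as [x Hx]. exists x.
      rewrite app_iff. split; auto. apply (H x y); auto.
    + intros (x & Hx & K). apply app_iff in K. apply (H x y); auto.
Qed.

Lemma isN26_good G F : isN26 uni G F -> exists A, good_model A G F.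
Proof.
  intros (A & w & P & V & HA & Hw & HP & Hinf & Hdis & Hcov & HGs & HG & HF). exists A.
  assert (HpA : forall i p, app uni P i p -> sub uni p A).
  { intros i p Hp. split; [apply (Hinf i p Hp)|]. intros a Ha. apply Hcov; eauto. }
  assert (HG' : forall g, g ∊ G <-> isbij uni g A A /\ forall i p, app uni P i p ->
                  forall x y, pair x y ∊ g -> (x ∊ p <-> y ∊ p)).
  { intros g. rewrite HG. split; intros [H K]; split; auto; intros i p Hp;
      apply (mapsonto_iff A g p H (HpA i p Hp)); eauto. }
  apply isfun_iff in HP.
  assert (Heq : forall i j p q a, app uni P i p -> app uni P j q -> a ∊ p -> a ∊ q -> p = q).
  { intros i j p q a Hp Hq Ha Ha'. destruct (classic (i = j)) as [->|N].
    - apply app_iff in Hp, Hq. apply (fn_fun _ _ _ HP j); auto.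
    - destruct (Hdis i j p q Hp Hq N a); auto. }
  assert (HPG : perm_group A G).
  { split; auto.
    - intros g Hg; apply HG'; auto.
    - apply HG'. split; [apply bij_idp|]. intros i p Hp x y H. apply in_idp in H as [_ ->]; tauto.
    - intros f g Hf Hg. apply HG' in Hf as [Hf Kf], Hg as [Hg Kg]. apply HG'.
      split; [apply bij_comp; auto|]. intros i p Hp x y H. apply in_comp in H as (z & H1 & H2); auto.
      rewrite (Kg i p Hp x z H1). apply (Kf i p Hp z y H2).
    - intros g Hg. apply HG' in Hg as [Hg Kg]. apply HG'.
      split; [apply bij_inv; auto|]. intros i p Hp x y H. apply in_inv in H; auto.
      symmetry. apply (Kg i p Hp); auto. }
  (* Transitivity holds because the pieces are pairwise disjoint, and [sim_act] because group
     elements preserve every piece. *)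
  set (sim := fun a b => exists i p, app uni P i p /\ a ∊ p /\ b ∊ p).
  assert (S1 : forall a b, sim a b -> sim b a).
  { intros a b (i & p & H & K & L). exists i, p; auto. }
  assert (S2 : forall a b c, sim a b -> sim b c -> sim a c).
  { intros a b c (i & p & H & K & L) (j & q & H' & K' & L'). exists i, p. split; auto. split; auto.
    rewrite (Heq i j p q b); auto. }
  assert (S3 : forall g a, g ∊ G -> a ∊ A -> sim a (act g a)).
  { intros g a Hg Ha. destruct (proj1 (Hcov a) Ha) as (i & p & Hp & Hap). exists i, p.
    split; auto. split; auto. pose proof (pg_fn A G HPG g Hg) as Fg. apply HG' in Hg as [Hg K].
    apply (K i p Hp a); auto. apply (act_atom A); auto. }
  assert (S4 : forall a b, a ∊ A -> b ∊ A -> sim a b -> tr A a b ∊ G).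
  { intros a b Ha Hb (i & p & Hp & Hap & Hbp). apply HG'. split; [apply bij_tr; auto|].
    intros j q Hq x y H. apply in_tr in H as [Hx H]; auto.
    destruct H as [[-> ->]|[[-> ->]|(_ & _ & ->)]]; [| |tauto].
    - split; intros K; [rewrite (Heq j i q p a) | rewrite (Heq j i q p b)]; auto.
    - split; intros K; [rewrite (Heq j i q p b) | rewrite (Heq j i q p a)]; auto. }
  assert (S5 : forall a L, a ∊ A -> fin L -> exists b, b ∊ A /\ sim a b /\ ~ b ∊ L).
  { intros a L Ha HL. destruct (proj1 (Hcov a) Ha) as (i & p & Hp & Hap).
    destruct (infinite_diff p L (cinfinite_infinite p (Hinf i p Hp)) HL) as (b & Hb & Nb).
    exists b. split; [apply Hcov; eauto|]. split; auto. exists i, p; auto. }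
  split; [auto|]. split; [apply isfsfilter_char; auto|]. split.
  - apply (transpositions_moving A HA G sim); auto.
  - apply (transpositions_primitive A HA G HPG sim); auto.
Qed.
End N26.

(** * Automorphisms of a countable dense linear order *)

Section DenseOrder.
Context {Z : zfa_model}.

Record dense_order (A L : uni) : Prop := {
  do_dom : forall a b, pair a b ∊ L -> a ∊ A /\ b ∊ A;
  do_irrefl : forall a, ~ pair a a ∊ L;
  do_trans : forall a b c, pair a b ∊ L -> pair b c ∊ L -> pair a c ∊ L;
  do_total : forall a b, a ∊ A -> b ∊ A -> pair a b ∊ L \/ a = b \/ pair b a ∊ L;
  do_dense : forall a b, pair a b ∊ L -> exists c, pair a c ∊ L /\ pair c b ∊ L;
  do_max : forall a, a ∊ A -> exists b, pair a b ∊ L;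
  do_min : forall a, a ∊ A -> exists b, pair b a ∊ L;
  do_ne : exists a, a ∊ A
}.

Variables A L : uni.
Hypothesis HL : dense_order A L.
Local Notation lt a b := (pair a b ∊ L).

Lemma do_asym a b : lt a b -> lt b a -> False.
Proof. intros H K. apply (do_irrefl A L HL a). apply (do_trans A L HL a b a); auto. Qed.

(** Stated for a relation [R] so as to serve for the order and for its converse. *)
Lemma fin_extremal (R : uni -> uni -> Prop) S : D2 R ->
  (forall a b c, R a b -> R b c -> R a c) ->
  (forall a b, a ∊ A -> b ∊ A -> R a b \/ a = b \/ R b a) -> fin S -> sub uni S A ->
  S = emp \/ exists m, m ∊ S /\ forall s, s ∊ S -> s = m \/ R s m.
Proof.
  intros HD Htr Htot HS. apply (fin_ind (fun S => sub uni S A ->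
    S = emp \/ exists m, m ∊ S /\ forall s, s ∊ S -> s = m \/ R s m)); auto; [dn|].
  intros T a HT IH _ [_ H]. right.
  assert (HTA : sub uni T A) by (split; [apply fin_set; auto | intros z Hz; apply H, in_adj; auto]).
  assert (Ha : a ∊ A) by (apply H, in_adj; auto).
  destruct (IH HTA) as [->|(m & Hm & K)].
  - exists a. split; [apply in_adj; auto|]. intros s Hs. apply in_adj in Hs as [Hs| ->]; auto.
    destruct (in_emp s Hs).
  - destruct (classic (R m a)) as [M|M].
    + exists a. split; [apply in_adj; auto|]. intros s Hs. apply in_adj in Hs as [Hs| ->]; auto.
      right. destruct (K s Hs) as [->|K']; eauto.
    + exists m. split; [apply in_adj; auto|]. intros s Hs. apply in_adj in Hs as [Hs| ->]; auto.
      destruct (Htot m a) as [M'|[M'|M']]; auto; [apply HTA; auto | contradiction].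
Qed.

Lemma fin_greatest S : fin S -> sub uni S A ->
  S = emp \/ exists m, m ∊ S /\ forall s, s ∊ S -> s = m \/ lt s m.
Proof.
  apply fin_extremal; [dn | apply (do_trans A L HL) | apply (do_total A L HL)].
Qed.

Lemma fin_least S : fin S -> sub uni S A ->
  S = emp \/ exists m, m ∊ S /\ forall s, s ∊ S -> s = m \/ lt m s.
Proof.
  apply (fin_extremal (fun s m => lt m s)); [dn | |].
  - intros a b c H K. apply (do_trans A L HL c b a); auto.
  - intros a b Ha Hb. destruct (do_total A L HL a b) as [H|[H|H]]; auto.
Qed.

Lemma between_finite S T : fin S -> fin T -> sub uni S A -> sub uni T A ->
  (forall s t, s ∊ S -> t ∊ T -> lt s t) ->
  exists d, d ∊ A /\ (forall s, s ∊ S -> lt s d) /\ (forall t, t ∊ T -> lt d t).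
Proof.
  intros HS HT HSA HTA H.
  destruct (fin_greatest S HS HSA) as [->|(m & Hm & K)];
  destruct (fin_least T HT HTA) as [->|(m' & Hm' & K')].
  - destruct (do_ne A L HL) as [d Hd]. exists d. split; auto.
    split; intros s Hs; destruct (in_emp s Hs).
  - destruct (do_min A L HL m') as [d Hd]; [apply HTA; auto|]. exists d.
    split; [apply (do_dom A L HL _ _ Hd)|]. split; [intros s Hs; destruct (in_emp s Hs)|].
    intros t Ht. destruct (K' t Ht) as [->|M]; auto. apply (do_trans A L HL d m' t); auto.
  - destruct (do_max A L HL m) as [d Hd]; [apply HSA; auto|]. exists d.
    split; [apply (do_dom A L HL _ _ Hd)|]. split; [|intros s Hs; destruct (in_emp s Hs)].
    intros t Ht. destruct (K t Ht) as [->|M]; auto. apply (do_trans A L HL t m d); auto.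
  - destruct (do_dense A L HL m m') as (d & Hd & Hd'); auto. exists d.
    split; [apply (do_dom A L HL _ _ Hd)|]. split.
    + intros t Ht. destruct (K t Ht) as [->|M]; auto. apply (do_trans A L HL t m d); auto.
    + intros t Ht. destruct (K' t Ht) as [->|M]; auto. apply (do_trans A L HL d m' t); auto.
Qed.

Definition monotone (R : uni -> uni -> Prop) :=
  forall a b a' b', R a b -> R a' b' -> (lt a a' <-> lt b b').

(** If [c] is not yet matched, [d] is placed between the finitely many partners of points below [c]
    and those of points above [c]. Stated for a relation, so that it can be used in both directions
    of the back-and-forth. *)
Lemma one_point_extension (R : uni -> uni -> Prop) S c : D2 R -> fin S -> c ∊ A ->
  (forall a b, R a b -> a ∊ A /\ b ∊ A /\ a ∊ S /\ b ∊ S) -> monotone R ->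
  exists d, d ∊ A /\ forall a b, R a b -> (lt a c <-> lt b d) /\ (lt c a <-> lt d b).
Proof.
  intros HR HS Hc HRS Hm.
  destruct (classic (exists d, R c d)) as [[d Hd]|N].
  - exists d. split; [apply (HRS c d Hd)|]. intros a b Hab. split; apply Hm; auto.
  - assert (N1 : D1 (fun b => b ∊ A /\ exists a, R a b /\ lt a c)) by dn.
    assert (N2 : D1 (fun b => b ∊ A /\ exists a, R a b /\ lt c a)) by dn.
    destruct (between_finite (sep S (fun b => b ∊ A /\ exists a, R a b /\ lt a c))
                (sep S (fun b => b ∊ A /\ exists a, R a b /\ lt c a))) as (d & Hd & K1 & K2).
    + apply (fin_sub S); auto; apply sub_sep; auto.
    + apply (fin_sub S); auto; apply sub_sep; auto.
    + split; [apply set_sep; auto|]. intros z Hz. apply in_sep in Hz; tauto.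
    + split; [apply set_sep; auto|]. intros z Hz. apply in_sep in Hz; tauto.
    + intros s t Hs Ht. apply in_sep in Hs as (_ & _ & a & Ha & Ha'); auto.
      apply in_sep in Ht as (_ & _ & b & Hb & Hb'); auto.
      apply (Hm a s b t); auto. apply (do_trans A L HL a c b); auto.
    + exists d; split; auto. intros a b Hab. destruct (HRS a b Hab) as (H1 & H2 & H3 & H4).
      assert (Q1 : lt a c -> lt b d) by (intros Q; apply K1, in_sep; eauto 6).
      assert (Q2 : lt c a -> lt d b) by (intros Q; apply K2, in_sep; eauto 6).
      assert (Q3 : a <> c) by (intros ->; apply N; eauto).
      destruct (do_total A L HL a c H1 Hc) as [Q|[Q|Q]]; [|contradiction|].
      * split; split; auto; intros W; exfalso; eapply do_asym; eauto.
      * split; split; auto; intros W; exfalso; eapply do_asym; eauto.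
Qed.

(** Order preservation in both directions is enough to make such a set of pairs single-valued and
    injective, as the order is total and irreflexive. *)
Definition partial_iso f :=
  fin f /\ (forall p, p ∊ f -> exists a b, a ∊ A /\ b ∊ A /\ p = pair a b) /\
  (forall a b a' b', pair a b ∊ f -> pair a' b' ∊ f -> (lt a a' <-> lt b b')).
Lemma D1_partial_iso : D1 partial_iso.
Proof. unfold partial_iso; dn. Qed.
Hint Resolve D1_partial_iso : dn.

Lemma partial_iso_A f a b : partial_iso f -> pair a b ∊ f -> a ∊ A /\ b ∊ A.
Proof.
  intros (_ & H & _) Hp. destruct (H _ Hp) as (a' & b' & Ha & Hb & E).
  apply pair_inj in E as [-> ->]; auto.
Qed.

Lemma partial_iso_adj f c d : partial_iso f -> c ∊ A -> d ∊ A ->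
  (forall a b, pair a b ∊ f -> (lt a c <-> lt b d) /\ (lt c a <-> lt d b)) ->
  partial_iso (adj f (pair c d)).
Proof.
  intros (H1 & H2 & H3) Hc Hd H. split; [apply fin_adj; auto|]. split.
  - intros p Hp. apply in_adj in Hp as [Hp| ->]; eauto.
  - intros a b a' b' Hp Hp'. apply in_adj in Hp as [Hp|Hp]; apply in_adj in Hp' as [Hp'|Hp'].
    + apply H3; auto.
    + apply pair_inj in Hp' as [-> ->]. apply H; auto.
    + apply pair_inj in Hp as [-> ->]. apply H; auto.
    + apply pair_inj in Hp as [-> ->]. apply pair_inj in Hp' as [-> ->].
      split; intros K; destruct (do_irrefl A L HL _ K).
Qed.

(** With Kuratowski pairs the double union contains the domain and the range. *)
Lemma partial_iso_field f : partial_iso f -> fin (union (union f)) /\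
  forall a b, pair a b ∊ f -> a ∊ union (union f) /\ b ∊ union (union f).
Proof.
  intros (H1 & H2 & H3). split.
  - apply fin_union; [apply fin_union; auto|]; intros u Hu.
    + destruct (H2 u Hu) as (a & b & _ & _ & ->). apply fin_upair.
    + apply in_union in Hu as (p & Hp & Hu). destruct (H2 p Hp) as (a & b & _ & _ & ->).
      apply in_upair in Hu as [->| ->]; apply fin_upair.
  - intros a b Hp. assert (M : upair a b ∊ union f).
    { apply in_union. exists (pair a b); split; auto. apply in_upair; auto. }
    split; apply in_union; exists (upair a b); split; auto; apply in_upair; auto.
Qed.

Lemma partial_iso_extend f c : partial_iso f -> c ∊ A ->
  exists f', partial_iso f' /\ sub uni f f' /\ (exists d, pair c d ∊ f') /\ (exists d, pair d c ∊ f').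
Proof.
  assert (step1 : forall f, partial_iso f -> c ∊ A ->
    exists f', partial_iso f' /\ sub uni f f' /\ exists d, pair c d ∊ f').
  { clear f. intros f Hf Hc. destruct (partial_iso_field f Hf) as [Ff Ff'].
    destruct (one_point_extension (fun a b => pair a b ∊ f) (union (union f)) c) as (d & Hd & K);
      [dn | auto | auto | | exact (proj2 (proj2 Hf)) |].
    - intros a b Hp. destruct (partial_iso_A f a b Hf Hp), (Ff' a b Hp). auto.
    - exists (adj f (pair c d)). split; [apply partial_iso_adj; auto|].
      split; [split; [apply Hf|]; intros z Hz; apply in_adj; auto|].
      exists d; apply in_adj; auto. }
  assert (step2 : forall f, partial_iso f -> c ∊ A ->
    exists f', partial_iso f' /\ sub uni f f' /\ exists d, pair d c ∊ f').
  { clear f. intros f Hf Hc. destruct (partial_iso_field f Hf) as [Ff Ff'].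
    destruct (one_point_extension (fun a b => pair b a ∊ f) (union (union f)) c) as (d & Hd & K);
      [dn | auto | auto | | |].
    - intros b a Hp. destruct (partial_iso_A f a b Hf Hp), (Ff' a b Hp). auto.
    - intros a b a' b' Ha Hb. symmetry. apply (proj2 (proj2 Hf)); auto.
    - exists (adj f (pair d c)). split.
      + apply partial_iso_adj; auto. intros a b Hp. destruct (K b a Hp). split; symmetry; auto.
      + split; [split; [apply Hf|]; intros z Hz; apply in_adj; auto|].
        exists d; apply in_adj; auto. }
  intros Hf Hc. destruct (step1 f Hf Hc) as (f1 & K1 & K2 & d & Hd).
  destruct (step2 f1 K1 Hc) as (f2 & M1 & M2 & M3). exists f2. split; auto.
  split; [apply (sub_trans _ f1); auto|]. split; auto. exists d. apply M2; auto.
Qed.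

Context {AC : has_choice}.
Hypothesis HAc : exists ι, fn ι omega A /\ forall a, a ∊ A -> exists n, pair n a ∊ ι.

(** At stage [n] the current finite isomorphism is extended so that the [n]-th element of [A] gets
    an image and a preimage. Choice fixes the extensions as a function [J], which [rec] iterates
    inside the model. *)
Lemma back_and_forth f0 : partial_iso f0 -> exists g, isorderaut uni g A L /\ sub uni f0 g.
Proof.
  intros Hf0. destruct HAc as (ι & Hιf & Hιs).
  set (PP := sep (pow (prod A A)) partial_iso).
  assert (HPP : forall f, f ∊ PP <-> partial_iso f).
  { intros f. unfold PP. rewrite in_sep by dn. split; [tauto|]. intros Hf; split; auto.
    apply in_pow. split; [apply Hf|]. intros p Hp.
    destruct Hf as (_ & K & _). destruct (K p Hp) as (a & b & Ha & Hb & ->). apply in_prod; auto. }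
  destruct (ac (fun p f' => exists n f c, p = pair n f /\ pair n c ∊ ι /\ sub uni f f' /\
     (exists d, pair c d ∊ f') /\ (exists d, pair d c ∊ f')) (prod omega PP) PP) as (J & HJ & HJR).
  { dn. }
  { intros p Hp. apply in_prod_ex in Hp as (n & f & Hn & Hf & ->). apply HPP in Hf.
    destruct (fn_tot _ _ _ Hιf n Hn) as [c Hc].
    destruct (partial_iso_extend f c Hf) as (f' & K1 & K2 & K3 & K4); [apply (fn_cod _ _ _ Hιf _ _ Hc)|].
    exists f'. split; [apply HPP; auto|]. exists n, f, c. auto. }
  assert (HΦ : F2 (fun n f => ap J (pair n f))).
  { change (Dt (fun e => ap J (pair (e 0) (e 1)))). dn. }
  set (S := rec f0 (fun n f => ap J (pair n f))).
  assert (HS1 : F1 S) by (change (Dt (fun e => S (e 0))); unfold S; dn).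
  assert (S0 : S emp = f0) by (apply rec_0; auto).
  assert (SS : forall n, n ∊ omega -> S (succ n) = ap J (pair n (S n))) by (intros; unfold S; rewrite rec_S; auto).
  assert (SPP : forall n, n ∊ omega -> S n ∊ PP).
  { apply (omega_ind (fun n => S n ∊ PP)); [dn | rewrite S0; apply HPP; auto |].
    intros n Hn IH. rewrite SS by auto. apply (ap_cod _ _ _ _ HJ). apply in_prod; auto. }
  assert (Sstep : forall n, n ∊ omega -> exists c, pair n c ∊ ι /\ sub uni (S n) (S (succ n)) /\
     (exists d, pair c d ∊ S (succ n)) /\ (exists d, pair d c ∊ S (succ n))).
  { intros n Hn. assert (Hp : pair n (S n) ∊ prod omega PP) by (apply in_prod; auto).
    pose proof (HJR _ _ (ap_pair _ _ _ _ HJ Hp)) as (n' & f' & c & E & K). rewrite <- SS in K by auto.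
    apply pair_inj in E as [<- <-]. exists c; auto. }
  assert (Smono : forall n, n ∊ omega -> forall m, m ∊ n -> sub uni (S m) (S n)).
  { apply (omega_ind (fun n => forall m, m ∊ n -> sub uni (S m) (S n))); [dn| |].
    - intros m Hm; destruct (in_emp m Hm).
    - intros n Hn IH m Hm. destruct (Sstep n Hn) as (_ & _ & K & _).
      apply in_succ in Hm as [Hm| ->]; auto. apply (sub_trans _ (S n)); auto. }
  assert (Sdir : forall n m p q, n ∊ omega -> m ∊ omega -> p ∊ S n -> q ∊ S m ->
            exists k, k ∊ omega /\ p ∊ S k /\ q ∊ S k).
  { intros n m p q Hn Hm Hp Hq. destruct (nat_total n m Hn Hm) as [K|[->|K]].
    - exists m. split; auto. split; auto. apply (Smono m Hm n K); auto.
    - exists m; auto.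
    - exists n. split; auto. split; auto. apply (Smono n Hn m K); auto. }
  set (g := union (repl omega S)).
  assert (Hg : forall p, p ∊ g <-> exists n, n ∊ omega /\ p ∊ S n).
  { intros p. unfold g. rewrite in_union. split.
    - intros (t & Ht & Hp). apply in_repl in Ht as (n & Hn & ->); eauto.
    - intros (n & Hn & Hp). exists (S n); split; auto. apply in_repl; eauto. }
  assert (Spi : forall n, n ∊ omega -> partial_iso (S n)) by (intros; apply HPP; auto).
  assert (Hmono : forall a b a' b', pair a b ∊ g -> pair a' b' ∊ g -> (lt a a' <-> lt b b')).
  { intros a b a' b' Hp Hp'. apply Hg in Hp as (n & Hn & Hp). apply Hg in Hp' as (m & Hm & Hp').
    destruct (Sdir n m _ _ Hn Hm Hp Hp') as (k & Hk & K1 & K2).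
    destruct (Spi k Hk) as (_ & _ & K). apply K; auto. }
  assert (HgA : forall a b, pair a b ∊ g -> a ∊ A /\ b ∊ A).
  { intros a b Hp. apply Hg in Hp as (n & Hn & Hp). apply (partial_iso_A (S n)); auto. }
  exists g. split.
  - split.
    + apply isbij_iff. split; [split|split].
      * apply set_union.
      * intros p Hp. apply Hg in Hp as (n & Hn & Hp). destruct (Spi n Hn) as (_ & K & _).
        destruct (K p Hp) as (a & b & _ & _ & E); eauto.
      * intros a b Hp; apply (HgA _ _ Hp).
      * intros a b Hp; apply (HgA _ _ Hp).
      * intros a Ha. destruct (Hιs a Ha) as [n Hn]. pose proof (fn_dom _ _ _ Hιf _ _ Hn) as Hn'.
        destruct (Sstep n Hn') as (c & Hc & _ & (d & Hd) & _).
        rewrite (fn_fun _ _ _ Hιf _ _ _ Hn Hc). exists d. apply Hg. exists (succ n); auto using omega_succ.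
      (* Two images [b] and [c] of [a] with [b] below [c] would put [a] below itself. *)
      * intros a b c Hb Hc. destruct (HgA _ _ Hb) as [_ Hb']. destruct (HgA _ _ Hc) as [_ Hc'].
        destruct (do_total A L HL b c Hb' Hc') as [K|[K|K]]; auto; exfalso;
          apply (do_irrefl A L HL a).
        -- apply (Hmono a b a c); auto.
        -- apply (Hmono a c a b); auto.
      * intros a b c Ha Hb. destruct (HgA _ _ Ha) as [Ha' _]. destruct (HgA _ _ Hb) as [Hb' _].
      destruct (do_total A L HL a b Ha' Hb') as [K|[K|K]]; auto; exfalso;
        apply (do_irrefl A L HL c).
        -- apply (Hmono a c b c); auto.
        -- apply (Hmono b c a c); auto.
      * intros a Ha. destruct (Hιs a Ha) as [n Hn]. pose proof (fn_dom _ _ _ Hιf _ _ Hn) as Hn'.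
      destruct (Sstep n Hn') as (c & Hc & _ & _ & (d & Hd)).
      rewrite (fn_fun _ _ _ Hιf _ _ _ Hn Hc). exists d. apply Hg. exists (succ n); auto using omega_succ.
    + intros a b a' b' Ha Hb. rewrite !app_iff in *. apply Hmono; auto.
  - split; [apply Hf0|]. intros p Hp. apply Hg. exists emp. rewrite S0. auto using omega_emp.
Qed.

Hypothesis HA : isatomset uni A.
Variable G : uni.
Hypothesis HGs : set G.
Hypothesis HGa : forall g, g ∊ G <-> isorderaut uni g A L.

Lemma order_perm_group : perm_group A G.
Proof.
  assert (HG' : forall g, g ∊ G <-> isbij uni g A A /\
    forall a b a' b', pair a a' ∊ g -> pair b b' ∊ g -> (lt a b <-> lt a' b')).
  { intros g. rewrite HGa. unfold isorderaut. apply iff_and; [tauto|].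
    split; intros H a b a' b' H1 H2; specialize (H a b a' b'); rewrite !app_iff in *; auto. }
  split; auto.
  - intros g Hg; apply HG'; auto.
  - apply HG'. split; [apply bij_idp|]. intros a b a' b' H1 H2.
    apply in_idp in H1 as [_ <-], H2 as [_ <-]. tauto.
  - intros f g Hf Hg. apply HG' in Hf as [Hf Kf], Hg as [Hg Kg]. apply HG'.
    split; [apply bij_comp; auto|]. intros a b a' b' H1 H2.
    apply in_comp in H1 as (x & H1 & H1'), H2 as (y & H2 & H2'); auto.
    rewrite (Kg a b x y H1 H2). apply Kf; auto.
  - intros g Hg. apply HG' in Hg as [Hg Kg]. apply HG'.
    split; [apply bij_inv; auto|]. intros a b a' b' H1 H2. apply in_inv in H1, H2; auto.
    symmetry; apply Kg; auto.
Qed.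

Let HPG := order_perm_group.
Let Gfn := pg_fn A G HPG.
Let Ginj := pg_inj A G HPG.

Lemma order_act g a b : g ∊ G -> a ∊ A -> b ∊ A -> (lt (act g a) (act g b) <-> lt a b).
Proof.
  intros Hg Ha Hb. pose proof Hg as Hg'. apply HGa in Hg' as [_ K].
  specialize (K a b (act g a) (act g b)). rewrite !app_iff in K. symmetry. apply K;
    apply (act_atom A); auto.
Qed.

Definition same_cut E a d := forall e, e ∊ E -> (lt e a <-> lt e d) /\ (lt a e <-> lt d e).

(** The identity on [E] together with the pair of [a] and [d] is a finite isomorphism exactly
    because the cuts agree; an extension of it to an automorphism is the required element. *)
Lemma cut_transitive E a d : fin E -> sub uni E A -> a ∊ A -> d ∊ A -> same_cut E a d ->
  exists g, g ∊ G /\ fixes g E /\ act g a = d.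
Proof.
  intros HE [_ HEA] Ha Hd Hcut.
  assert (HF : F1 (fun e => pair e e)) by (change (Dt (fun e => pair (e 0) (e 0))); dn).
  assert (Hid : forall a b, pair a b ∊ repl E (fun e => pair e e) <-> a ∊ E /\ a = b).
  { intros x y. rewrite in_repl by auto. split.
    - intros (u & Hu & E1). apply pair_inj in E1 as [-> ->]; auto.
    - intros [H <-]; eauto. }
  assert (P0 : partial_iso (repl E (fun e => pair e e))).
  { split; [|split].
    - apply (fin_image (fun e p => p = pair e e) E); auto; [dn | congruence | apply set_repl; auto |].
      intros v Hv. apply in_repl in Hv; auto.
    - intros p Hp. apply in_repl in Hp as (u & Hu & ->); auto. exists u, u; auto.
    - intros a1 b1 a2 b2 H1 H2. apply Hid in H1 as [_ <-], H2 as [_ <-]. tauto. }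
  destruct (back_and_forth (adj (repl E (fun e => pair e e)) (pair a d))) as (g & Hg & [_ K]).
  - apply partial_iso_adj; auto. intros x y Hp. apply Hid in Hp as [Hx <-]. apply Hcut; auto.
  - assert (HgG : g ∊ G) by (apply HGa; auto). exists g. split; auto. split.
    + intros e He. apply (act_atom_eq A); auto. apply K, in_adj. left. apply Hid; auto.
    + apply (act_atom_eq A); auto. apply K, in_adj; auto.
Qed.

Lemma same_cut_act E g a : sub uni E A -> a ∊ A -> g ∊ G -> fixes g E -> same_cut E a (act g a).
Proof.
  intros [_ HE] Ha Hg Fg e He.
  split; rewrite <- (Fg e He) at 2; symmetry; apply order_act; auto.
Qed.

(** [d] is taken between [a] and all elements of [E] and [T] above [a], so no element of [E]
    separates it from [a]. *)
Lemma point_above E a T : fin E -> sub uni E A -> a ∊ A -> ~ a ∊ E -> fin T ->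
  exists d, d ∊ A /\ ~ d ∊ T /\ same_cut E a d /\ lt a d.
Proof.
  intros HE HEA Ha HaE HT.
  assert (HD : D1 (fun b => b ∊ A /\ lt a b)) by dn.
  destruct (between_finite (adj emp a) (sep (cup E T) (fun b => b ∊ A /\ lt a b))) as (d & Hd & K1 & K2).
  - auto using fin_adj, fin_emp.
  - apply (fin_sub (cup E T)); [apply fin_cup; auto | apply sub_sep; auto].
  - apply sub_adj; auto using sub_emp.
  - split; [apply set_sep; auto|]. intros z Hz. apply in_sep in Hz; tauto.
  - intros s t Hs Ht. apply in_sep in Ht as (_ & _ & Ht); auto.
    apply in_adj in Hs as [Hs| ->]; auto. destruct (in_emp s Hs).
  - assert (Had : lt a d) by (apply K1, in_adj; auto).
    assert (K3 : forall b, b ∊ E \/ b ∊ T -> b ∊ A -> lt a b -> lt d b).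
    { intros b Hb HbA H. apply K2, in_sep; auto. split; auto. apply in_cup; auto. }
    exists d. split; auto. split; [|split; auto].
    + intros H. apply (do_irrefl A L HL d). apply K3; auto.
    + intros e He. assert (HeA : e ∊ A) by (apply HEA; auto). split; split; intros H.
      * apply (do_trans A L HL e a d); auto.
      * destruct (do_total A L HL e a HeA Ha) as [M|[->|M]]; auto; [contradiction|].
        exfalso. apply (do_asym e d); auto.
      * auto.
      * apply (do_trans A L HL a d e); auto.
Qed.

Lemma order_moving : moving A G.
Proof.
  intros E a T HEA HE Ha HaE HT.
  destruct (point_above E a T HE HEA Ha HaE HT) as (d & Hd & HdT & Hcut & _).
  destruct (cut_transitive E a d HE HEA Ha Hd Hcut) as (g & Hg & Fg & K).
  exists g; rewrite K; auto.
Qed.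

(** An element of [H] that moves [a] moves it to one side, its inverse to the other. Elements fixing
    [E] and [a] lie in [H] and carry the image of [a] anywhere within its cut on the same side of
    [a]. *)
Lemma order_primitive : primitive A G.
Proof.
  intros E a H HEA HE Ha HaE H1 H2 H3 (f & Hf & Ff & Nf & HHf).
  pose proof (pg_comp A G HPG) as HC. pose proof (pg_inv A G HPG) as HI.
  apply (primitive_of_transitive A G HPG E a H Ha H1 H2). intros g Hg Fg Ng.
  assert (HactA : forall k, k ∊ G -> act k a ∊ A) by (intros; apply (act_atom_A A); auto).
  assert (both : (exists h, h ∊ G /\ fixes h E /\ H h /\ lt a (act h a)) /\
                 (exists h, h ∊ G /\ fixes h E /\ H h /\ lt (act h a) a)).
  { assert (Finv : fixes (inv A f) E) by (apply (fixes_inv A G HPG); auto).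
    assert (E1 : lt (act (inv A f) a) a <-> lt a (act f a)).
    { rewrite <- (order_act f) by auto. rewrite (act_inv_r_G A G HPG); tauto. }
    assert (E2 : lt a (act (inv A f) a) <-> lt (act f a) a).
    { rewrite <- (order_act f) by auto. rewrite (act_inv_r_G A G HPG); tauto. }
    destruct (do_total A L HL a (act f a)) as [M|[M|M]]; auto; [|congruence|].
    - split; [exists f; auto | exists (inv A f); tauto || (repeat split; auto; apply E1; auto)].
    - split; [exists (inv A f); repeat split; auto; apply E2; auto | exists f; auto]. }
  (* [act h a] and [act g a] lie in the same cut of [adj E a]: both stay in the cut of [a] over [E],
     and they are on the same side of [a]. *)
  assert (reach : forall h, h ∊ G -> fixes h E -> H h ->
    (lt a (act h a) /\ lt a (act g a)) \/ (lt (act h a) a /\ lt (act g a) a) ->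
    exists k, k ∊ G /\ fixes k E /\ H k /\ act k a = act g a).
  { intros h Hh Fh HHh Hside.
    destruct (cut_transitive (adj E a) (act h a) (act g a)) as (s & Hs & Fs & Es); auto.
    - apply fin_adj; auto.
    - apply sub_adj; auto.
    - intros e He. apply in_adj in He as [He| ->].
      + destruct (same_cut_act E h a HEA Ha Hh Fh e He) as [Q1 Q2].
        destruct (same_cut_act E g a HEA Ha Hg Fg e He) as [Q3 Q4]. tauto.
      + destruct Hside as [[M1 M2]|[M1 M2]]; split; split; intros W; auto; exfalso; eapply do_asym; eauto.
    - apply fixes_adj in Fs as [Fs Fsa]. exists (comp A s h). split; auto.
      split; [apply (fixes_comp A G HPG); auto|]. split; [apply H2; auto|].
      rewrite (act_comp_G A G HPG); auto. }
  destruct both as [(h & Hh & Fh & HHh & M) (h' & Hh' & Fh' & HHh' & M')].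
  destruct (do_total A L HL a (act g a)) as [W|[W|W]]; auto; [|congruence|].
  - apply (reach h); auto.
  - apply (reach h'); auto.
Qed.

End DenseOrder.

(** * The order of the rationals is dense *)

Section Fractions.
Context {Z : zfa_model}.
Local Notation "^ a" := (proj1_sig a) (at level 5, a at level 5).
Add Ring nat_in_ring : nat_in_semiring.

Lemma natadd_iff a b c : natadd uni a b c <-> a ∊ omega /\ b ∊ omega /\ c = add a b.
Proof.
  split.
  - intros (w & f & Hw & Ha & Hf & H0 & HS & Hbc). apply isomega_iff in Hw; subst w.
    apply isfun_iff in Hf. apply app_iff in Hbc. split; auto.
    assert (Hb : b ∊ omega) by (eapply fn_dom; eauto). split; auto.
    revert c Hbc. apply (omega_ind (fun b => forall c, pair b c ∊ f -> c = add a b)); auto; [dn| |].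
    + intros c Hc. rewrite add_0_r. apply (fn_fun _ _ _ Hf emp); auto.
      apply app_iff, H0, empty_emp; auto.
    + intros n Hn IH c Hc. destruct (fn_tot _ _ _ Hf n Hn) as [v Hv].
      rewrite add_S_r, <- (IH v Hv) by auto. apply (fn_fun _ _ _ Hf (succ n)); auto.
      apply app_iff, (HS n (succ n) v); [apply app_iff; auto | apply issucc_iff; auto | apply issucc_iff; auto].
  - intros (Ha & Hb & ->).
    assert (HD : D2 (fun b c => c = add a b)) by dn.
    assert (Hf : fn (graph omega omega (fun b c => c = add a b)) omega omega).
    { apply fn_graph; auto; [|congruence]. intros x Hx. exists (add a x); auto using add_omega. }
    exists omega, (graph omega omega (fun b c => c = add a b)).
    rewrite isomega_iff, isfun_iff. split; auto. split; auto. split; auto. split; [|split].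
    + intros z Hz. apply empty_emp in Hz; subst. apply app_iff, in_graph; auto.
      rewrite add_0_r; auto using omega_emp.
    + intros k k' v v' Hk Hs Hs'. apply app_iff, in_graph in Hk as (K1 & K2 & ->); auto.
      apply issucc_iff in Hs, Hs'; subst. apply app_iff, in_graph; auto.
      fold (succ k) (succ (add a k)). rewrite add_S_r; auto using omega_succ.
    + apply app_iff, in_graph; auto using add_omega.
Qed.

Lemma natmul_iff a b c : natmul uni a b c <-> a ∊ omega /\ b ∊ omega /\ c = mul a b.
Proof.
  split.
  - intros (w & f & Hw & Ha & Hf & H0 & HS & Hbc). apply isomega_iff in Hw; subst w.
    apply isfun_iff in Hf. apply app_iff in Hbc. split; auto.
    assert (Hb : b ∊ omega) by (eapply fn_dom; eauto). split; auto.
    revert c Hbc. apply (omega_ind (fun b => forall c, pair b c ∊ f -> c = mul a b)); auto; [dn| |].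
    + intros c Hc. rewrite mul_0_r. apply (fn_fun _ _ _ Hf emp); auto.
      apply app_iff, H0, empty_emp; auto.
    + intros n Hn IH c Hc. destruct (fn_tot _ _ _ Hf n Hn) as [v Hv].
      rewrite mul_S_r by auto. apply (fn_fun _ _ _ Hf (succ n)); auto.
      apply app_iff, (HS n (succ n) v); [apply app_iff; auto | apply issucc_iff; auto |].
      apply natadd_iff. rewrite <- (IH v Hv). pose proof (fn_cod _ _ _ Hf _ _ Hv); auto.
  - intros (Ha & Hb & ->).
    assert (HD : D2 (fun b c => c = mul a b)) by dn.
    assert (Hf : fn (graph omega omega (fun b c => c = mul a b)) omega omega).
    { apply fn_graph; auto; [|congruence]. intros x Hx. exists (mul a x); auto using mul_omega. }
    exists omega, (graph omega omega (fun b c => c = mul a b)).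
    rewrite isomega_iff, isfun_iff. split; auto. split; auto. split; auto. split; [|split].
    + intros z Hz. apply empty_emp in Hz; subst. apply app_iff, in_graph; auto.
      rewrite mul_0_r; auto using omega_emp.
    + intros k k' v v' Hk Hs Hs'. apply app_iff, in_graph in Hk as (K1 & K2 & ->); auto.
      apply issucc_iff in Hs; subst. apply natadd_iff in Hs' as (_ & _ & ->). apply app_iff, in_graph; auto.
      fold (succ k). rewrite mul_S_r; auto using omega_succ, add_omega.
    + apply app_iff, in_graph; auto using mul_omega.
Qed.

(** The fraction [(p - q) / (d + 1)]. *)
Record frac := Frac { fp : nat_in; fq : nat_in; fd : nat_in }.
Definition den (r : frac) := na (fd r) n1.
(** One side of the cross-multiplied comparison of two fractions, with the subtracted terms moved
    across; the other side is [lhs r' r]. *)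
Definition lhs (r r' : frac) := na (nm (fp r) (den r')) (nm (fq r') (den r)).
Definition flt r r' := nlt (lhs r r') (lhs r' r).
Definition feq r r' := lhs r r' = lhs r' r.
Definition fcode (r : frac) : uni := pair (pair ^(fp r) ^(fq r)) ^(den r).

Lemma nat_in_zero_or_succ (a : nat_in) : ^a = emp \/ exists b, a = na b n1.
Proof.
  destruct (nlt_total nz a) as [H|[<-|H]].
  - right. destruct H as [k ->]. exists k. ring.
  - left; auto.
  - apply mem_nlt in H. destruct (in_emp _ H).
Qed.

Lemma den_ne r : ^(den r) <> emp.
Proof. unfold den. rewrite <- ns_add. intros E. apply (emp_succ _ (eq_sym E)). Qed.

Lemma nat_in_mem (a : nat_in) : ^a ∊ omega.
Proof. exact (proj2_sig a). Qed.
Lemma isfrac_rep r : isfrac uni ^(fp r) ^(fq r) ^(den r).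
Proof.
  exists omega. rewrite isomega_iff. split; auto. repeat (split; [apply nat_in_mem|]).
  intros H. apply empty_emp in H. apply (den_ne r H).
Qed.

Lemma isfrac_fcode t :
  (exists p q d, isfrac uni p q d /\ fraccode uni t p q d) <-> exists r, t = fcode r.
Proof.
  split.
  - intros (p & q & d & (w & Hw & Hp & Hq & Hd & Hne) & (u & Hu & Ht)).
    apply isomega_iff in Hw; subst w. apply ispair_iff in Hu, Ht. subst u t.
    destruct (nat_in_zero_or_succ (mkn d Hd)) as [E|[b E]].
    + destruct Hne. apply empty_emp; auto.
    + exists (Frac (mkn p Hp) (mkn q Hq) b). unfold fcode, den; simpl fd. rewrite <- E; auto.
  - intros [r ->]. exists ^(fp r), ^(fq r), ^(den r). split.
    + apply isfrac_rep.
    + exists (pair ^(fp r) ^(fq r)). rewrite !ispair_iff; auto.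
Qed.

Lemma fcode_inj r r' : fcode r = fcode r' -> r = r'.
Proof.
  intros H. apply pair_inj in H as [H H3]. apply pair_inj in H as [H1 H2].
  apply nat_in_eq in H1, H2, H3. apply na_cancel in H3.
  destruct r, r'; simpl in *; congruence.
Qed.

Lemma crosssums_iff r r' l m :
  crosssums uni ^(fp r) ^(fq r) ^(den r) ^(fp r') ^(fq r') ^(den r') l m <->
  l = ^(lhs r r') /\ m = ^(lhs r' r).
Proof.
  unfold crosssums. split.
  - intros (a & b & a' & b' & H1 & H2 & H3 & H4 & H5 & H6).
    apply natmul_iff in H1 as (_ & _ & ->), H2 as (_ & _ & ->), H4 as (_ & _ & ->), H5 as (_ & _ & ->).
    apply natadd_iff in H3 as (_ & _ & ->), H6 as (_ & _ & ->). auto.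
  - intros [-> ->].
    exists ^(nm (fp r) (den r')), ^(nm (fq r') (den r)), ^(nm (fp r') (den r)), ^(nm (fq r) (den r')).
    rewrite !natmul_iff, !natadd_iff. repeat split; apply nat_in_mem.
Qed.

Lemma fraceq_iff r r' :
  fraceq uni ^(fp r) ^(fq r) ^(den r) ^(fp r') ^(fq r') ^(den r') <-> feq r r'.
Proof.
  unfold fraceq, feq. split.
  - intros (l & H). apply crosssums_iff in H as [H1 H2]. apply nat_in_eq; congruence.
  - intros H. exists ^(lhs r r'). apply crosssums_iff. split; auto. rewrite H; auto.
Qed.
Lemma fraclt_iff r r' :
  fraclt uni ^(fp r) ^(fq r) ^(den r) ^(fp r') ^(fq r') ^(den r') <-> flt r r'.
Proof.
  unfold fraclt, flt. rewrite <- mem_nlt. split.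
  - intros (l & m & H & K). apply crosssums_iff in H as [-> ->]; auto.
  - intros H. exists ^(lhs r r'), ^(lhs r' r). split; auto. apply crosssums_iff; auto.
Qed.

Lemma fcode_inv p q d r : fraccode uni (fcode r) p q d -> p = ^(fp r) /\ q = ^(fq r) /\ d = ^(den r).
Proof.
  intros (u & Hu & Ht). apply ispair_iff in Hu, Ht. subst u. apply pair_inj in Ht as [E ->].
  apply pair_inj in E as [-> ->]; auto.
Qed.
Lemma fraccode_fcode r : fraccode uni (fcode r) ^(fp r) ^(fq r) ^(den r).
Proof. exists (pair ^(fp r) ^(fq r)). rewrite !ispair_iff; auto. Qed.

Lemma isrational_iff x : isrational uni x <->
  exists r, set x /\ forall t, t ∊ x <-> exists r', t = fcode r' /\ feq r r'.
Proof.
  unfold isrational. split.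
  - intros (p & q & d & Hf & Hx & H).
    destruct (proj1 (isfrac_fcode (pair (pair p q) d))) as [r E].
    { exists p, q, d. split; auto. exists (pair p q). rewrite !ispair_iff; auto. }
    apply pair_inj in E as [E ->]. apply pair_inj in E as [-> ->].
    exists r. split; auto. intros t. rewrite H. split.
    + intros (p' & q' & d' & Hf' & Ht & K).
      destruct (proj1 (isfrac_fcode t)) as [r' ->]; [eauto 6|].
      apply fcode_inv in Ht as (-> & -> & ->). exists r'. rewrite <- fraceq_iff; auto.
    + intros (r' & -> & K). exists ^(fp r'), ^(fq r'), ^(den r'). split; [|split].
      * apply isfrac_rep.
      * apply fraccode_fcode.
      * apply fraceq_iff; auto.
  - intros (r & Hx & H). exists ^(fp r), ^(fq r), ^(den r). split; [|split; auto].
    + apply isfrac_rep.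
    + intros t. rewrite H. split.
      * intros (r' & -> & K). exists ^(fp r'), ^(fq r'), ^(den r'). split; [|split].
        -- apply isfrac_rep.
        -- apply fraccode_fcode.
        -- apply fraceq_iff; auto.
      * intros (p' & q' & d' & Hf' & Ht & K).
        destruct (proj1 (isfrac_fcode t)) as [r' ->]; [eauto 6|].
        apply fcode_inv in Ht as (-> & -> & ->). exists r'. rewrite <- fraceq_iff; auto.
Qed.

Lemma ratlt_iff x y : isrational uni x -> isrational uni y ->
  (ratlt uni x y <-> exists r r', fcode r ∊ x /\ fcode r' ∊ y /\ flt r r').
Proof.
  intros Hx Hy. apply isrational_iff in Hx as (rx & _ & Hx). apply isrational_iff in Hy as (ry & _ & Hy).
  unfold ratlt. split.
  - intros (p & q & d & p' & q' & d' & s & t & H1 & H2 & H3 & H4 & H5).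
    destruct (proj1 (Hx s) H2) as (r & -> & _). destruct (proj1 (Hy t) H4) as (r' & -> & _).
    apply fcode_inv in H1 as (-> & -> & ->). apply fcode_inv in H3 as (-> & -> & ->).
    exists r, r'. rewrite <- fraclt_iff; auto.
  - intros (r & r' & H1 & H2 & H3).
    exists ^(fp r), ^(fq r), ^(den r), ^(fp r'), ^(fq r'), ^(den r'), (fcode r), (fcode r').
    rewrite fraclt_iff. auto 10 using fraccode_fcode.
Qed.

Lemma nlt_mul_den a b r : nlt a b -> nlt (nm a (den r)) (nm b (den r)).
Proof. apply nlt_mul. Qed.
Lemma nlt_add2 a b c d : nlt a b -> nlt c d -> nlt (na a c) (na b d).
Proof.
  intros H K. apply (nlt_trans _ (na b c)); [apply nlt_add; auto|].
  apply (nlt_add _ _ b) in K.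
  assert (E1 : na c b = na b c) by ring. assert (E2 : na d b = na b d) by ring.
  rewrite E1, E2 in K; auto.
Qed.

Lemma feq_refl r : feq r r.
Proof. reflexivity. Qed.
Lemma feq_sym r r' : feq r r' -> feq r' r.
Proof. unfold feq; auto. Qed.
(** The inequalities are scaled by the denominators of [t] and [r] and added. What remains of [s] is
    the same sum on both sides and a factor [den s]; both are cancelled, since [omega] has no
    subtraction. *)
Lemma flt_trans r s t : flt r s -> flt s t -> flt r t.
Proof.
  unfold flt. intros H K. apply (nlt_mul_cancel _ _ (fd s)). fold (den s).
  apply (nlt_add_cancel _ _ (na (nm (nm (fq s) (den r)) (den t)) (nm (nm (fp s) (den r)) (den t)))).
  pose proof (nlt_add2 _ _ _ _ (nlt_mul_den _ _ t H) (nlt_mul_den _ _ r K)) as M.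
  unfold lhs in *.
  match goal with |- nlt ?x ?y => match type of M with nlt ?x' ?y' =>
    replace x with x' by ring; replace y with y' by ring; exact M end end.
Qed.
Lemma flt_feq r s t : flt r s -> feq s t -> flt r t.
Proof.
  unfold flt, feq. intros H K. apply (nlt_mul_cancel _ _ (fd s)). fold (den s).
  apply (nlt_add_cancel _ _ (na (nm (nm (fq s) (den r)) (den t)) (nm (nm (fp s) (den r)) (den t)))).
  assert (M : nlt (na (nm (lhs r s) (den t)) (nm (lhs s t) (den r)))
                  (na (nm (lhs s r) (den t)) (nm (lhs t s) (den r)))).
  { rewrite <- K. apply nlt_add, nlt_mul_den, H. }
  unfold lhs in *.
  match goal with |- nlt ?x ?y => match type of M with nlt ?x' ?y' =>
    replace x with x' by ring; replace y with y' by ring; exact M end end.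
Qed.
Lemma feq_flt r s t : feq r s -> flt s t -> flt r t.
Proof.
  unfold flt, feq. intros K H. apply (nlt_mul_cancel _ _ (fd s)). fold (den s).
  apply (nlt_add_cancel _ _ (na (nm (nm (fq s) (den r)) (den t)) (nm (nm (fp s) (den r)) (den t)))).
  assert (M : nlt (na (nm (lhs s t) (den r)) (nm (lhs r s) (den t)))
                  (na (nm (lhs t s) (den r)) (nm (lhs s r) (den t)))).
  { rewrite <- K. apply nlt_add, nlt_mul_den, H. }
  unfold lhs in *.
  match goal with |- nlt ?x ?y => match type of M with nlt ?x' ?y' =>
    replace x with x' by ring; replace y with y' by ring; exact M end end.
Qed.
Lemma feq_trans r s t : feq r s -> feq s t -> feq r t.
Proof.
  unfold feq. intros H K. apply (nm_cancel _ _ (fd s)). fold (den s).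
  apply (na_cancel _ _ (na (nm (nm (fq s) (den r)) (den t)) (nm (nm (fp s) (den r)) (den t)))).
  assert (M : na (nm (lhs r s) (den t)) (nm (lhs s t) (den r)) =
              na (nm (lhs s r) (den t)) (nm (lhs t s) (den r))) by (rewrite H, K; auto).
  unfold lhs in *.
  match goal with |- ?x = ?y => match type of M with ?x' = ?y' =>
    replace x with x' by ring; replace y with y' by ring; exact M end end.
Qed.
Lemma flt_irrefl r : ~ flt r r.
Proof. apply nlt_irrefl. Qed.
Lemma flt_total r s : flt r s \/ feq r s \/ flt s r.
Proof. apply nlt_total. Qed.

(** [fd] is one less than the denominator, so the extra [n1] makes the denominators add up. *)
Lemma flt_mediant r s : flt r s -> exists t, flt r t /\ flt t s.
Proof.
  intros H. exists (Frac (na (fp r) (fp s)) (na (fq r) (fq s)) (na (na (fd r) (fd s)) n1)).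
  unfold flt, lhs, den in *; simpl. split.
  - apply (nlt_add _ _ (na (nm (fp r) (na (fd r) n1)) (nm (fq r) (na (fd r) n1)))) in H.
    match goal with |- nlt ?x ?y => match type of H with nlt ?x' ?y' =>
      replace x with x' by ring; replace y with y' by ring; exact H end end.
  - apply (nlt_add _ _ (na (nm (fp s) (na (fd s) n1)) (nm (fq s) (na (fd s) n1)))) in H.
    match goal with |- nlt ?x ?y => match type of H with nlt ?x' ?y' =>
      replace x with x' by ring; replace y with y' by ring; exact H end end.
Qed.
(** The cross-multiplied sides differ by [den r], which is one more than the witness [fd r]. *)
Lemma flt_above r : exists s, flt r s.
Proof. exists (Frac (na (fp r) n1) (fq r) (fd r)), (fd r). unfold lhs, den; simpl. ring. Qed.
Lemma flt_below r : exists s, flt s r.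
Proof. exists (Frac (fp r) (na (fq r) n1) (fd r)), (fd r). unfold lhs, den; simpl. ring. Qed.

Lemma rational_exists r : exists x, isrational uni x /\ fcode r ∊ x.
Proof.
  (* [nat_in] is a type of the metatheory, so the class of equal fractions is written with elements
     of [omega] in order to be definable. *)
  set (P := fun t => exists p q d, p ∊ omega /\ q ∊ omega /\ d ∊ omega /\ t = pair (pair p q) (succ d) /\
    add (mul ^(fp r) (succ d)) (mul q ^(den r)) = add (mul p ^(den r)) (mul ^(fq r) (succ d))).
  assert (HP : D1 P) by (unfold P; dn).
  assert (HPi : forall t, P t <-> exists r', t = fcode r' /\ feq r r').
  { intros t. split.
    - intros (p & q & d & Hp & Hq & Hd & -> & E).
      exists (Frac (mkn p Hp) (mkn q Hq) (mkn d Hd)). split.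
      + unfold fcode, den. simpl fd. rewrite <- ns_add. reflexivity.
      + apply nat_in_eq. unfold lhs, den at 1 4. simpl fd. rewrite <- ns_add. exact E.
    - intros (r' & -> & E). exists ^(fp r'), ^(fq r'), ^(fd r').
      repeat (split; [apply nat_in_mem|]).
      assert (E1 : ^(den r') = succ ^(fd r')) by (unfold den; rewrite <- ns_add; reflexivity).
      rewrite <- E1. split; [reflexivity|].
      unfold feq in E. apply (f_equal (@proj1_sig _ _)) in E. exact E. }
  assert (HS : forall t, t ∊ sep (prod (prod omega omega) omega) P <-> P t).
  { intros t. rewrite in_sep by auto. split; [tauto|]. intros H; split; auto.
    destruct H as (p & q & d & Hp & Hq & Hd & -> & _). rewrite !in_prod; auto using omega_succ. }
  exists (sep (prod (prod omega omega) omega) P). split.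
  - apply isrational_iff. exists r. split; [apply set_sep; auto|].
    intros t. rewrite HS; apply HPi.
  - apply HS, HPi. exists r; split; auto using feq_refl.
Qed.

Lemma isorationals_dense A L : isorationals uni A L -> dense_order A L.
Proof.
  intros (HL & Q & h & HQs & HQ & Hh & Hiso).
  apply isbij_iff in Hh as (Hh & Hhi & Hhs).
  (* The fractions in the rational assigned to [a]. They are unique up to [feq], and the order
     axioms are pulled back along this relation. *)
  set (rep := fun a r => exists x, pair a x ∊ h /\ fcode r ∊ x).
  assert (HhQ : forall a x, pair a x ∊ h -> isrational uni x).
  { intros a x H. apply HQ. apply (fn_cod _ _ _ Hh _ _ H). }
  assert (rep_ex : forall a, a ∊ A -> exists r, rep a r).
  { intros a Ha. destruct (fn_tot _ _ _ Hh a Ha) as [x Hx].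
    destruct (proj1 (isrational_iff x) (HhQ a x Hx)) as (r & _ & H). exists r, x. split; auto.
    apply H. exists r; auto using feq_refl. }
  assert (rep_eq : forall a r s, rep a r -> rep a s -> feq r s).
  { intros a r s (x & Hx & Hr) (y & Hy & Hs). rewrite (fn_fun _ _ _ Hh _ _ _ Hy Hx) in Hs.
    destruct (proj1 (isrational_iff x) (HhQ a x Hx)) as (r0 & _ & H).
    apply H in Hr as (r' & Er & Hr), Hs as (s' & Es & Hs). apply fcode_inj in Er, Es; subst r' s'.
    apply (feq_trans _ r0); auto using feq_sym. }
  assert (rep_feq : forall a r s, rep a r -> feq r s -> rep a s).
  { intros a r s (x & Hx & Hr) E. exists x; split; auto.
    destruct (proj1 (isrational_iff x) (HhQ a x Hx)) as (r0 & _ & H).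
    apply H in Hr as (r' & Er & Hr). apply fcode_inj in Er; subst r'.
    apply H. exists s; split; auto. apply (feq_trans _ r); auto. }
  assert (rep_surj : forall r, exists a, a ∊ A /\ rep a r).
  { intros r. destruct (rational_exists r) as (x & Hx & Hr). apply HQ in Hx.
    destruct (Hhs x Hx) as [a Ha]. exists a. split; [apply (fn_dom _ _ _ Hh _ _ Ha)|]. exists x; auto. }
  assert (rep_inj : forall a b r, rep a r -> rep b r -> a = b).
  { intros a b r (x & Hx & Hr) (y & Hy & Hs).
    enough (x = y) by (subst; eapply Hhi; eauto).
    destruct (proj1 (isrational_iff x) (HhQ a x Hx)) as (r1 & Sx & H1).
    destruct (proj1 (isrational_iff y) (HhQ b y Hy)) as (r2 & Sy & H2).
    apply H1 in Hr as (r' & Er & Hr). apply H2 in Hs as (s' & Es & Hs).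
    apply fcode_inj in Er, Es; subst r' s'.
    apply set_ext; auto. intros t. rewrite H1, H2. split; intros (u & -> & Hu); exists u; split; auto.
    - apply (feq_trans _ r); auto. apply (feq_trans _ r1); auto using feq_sym.
    - apply (feq_trans _ r); auto. apply (feq_trans _ r2); auto using feq_sym. }
  assert (HLA : forall a b, pair a b ∊ L -> a ∊ A /\ b ∊ A).
  { intros a b H. destruct HL as [_ HL]. destruct (HL _ H) as (a' & b' & Ha & Hb & E).
    apply ispair_iff in E. apply pair_inj in E as [-> ->]; auto. }
  assert (Hlt : forall a b, pair a b ∊ L <-> exists r s, rep a r /\ rep b s /\ flt r s).
  { intros a b. split.
    - intros H. destruct (HLA a b H) as [Ha Hb].
      destruct (fn_tot _ _ _ Hh a Ha) as [x Hx]. destruct (fn_tot _ _ _ Hh b Hb) as [y Hy].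
      specialize (Hiso a b x y). rewrite !app_iff in Hiso. apply Hiso in H; auto.
      apply ratlt_iff in H; eauto. destruct H as (r & s & H1 & H2 & H3). exists r, s.
      split; [exists x; auto|]. split; [exists y; auto | auto].
    - intros (r & s & (x & Hx & Hr) & (y & Hy & Hs) & H).
      specialize (Hiso a b x y). rewrite !app_iff in Hiso. apply Hiso; auto.
      apply ratlt_iff; eauto. }
  split.
  - auto.
  - intros a H. apply Hlt in H as (r & s & H1 & H2 & H3). apply (flt_irrefl r).
    apply (flt_feq r s r); auto. apply (rep_eq a); auto.
  - intros a b c H K. apply Hlt in H as (r & s & H1 & H2 & H3). apply Hlt in K as (t & u & K1 & K2 & K3).
    apply Hlt. exists r, u. split; auto. split; auto. apply (flt_trans r s u); auto.
    apply (feq_flt s t u); auto. apply (rep_eq b); auto.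
  - intros a b Ha Hb. destruct (rep_ex a Ha) as [r Hr]. destruct (rep_ex b Hb) as [s Hs].
    destruct (flt_total r s) as [H|[H|H]].
    + left. apply Hlt; eauto.
    + right; left. apply (rep_inj a b s); auto. apply (rep_feq a r s); auto.
    + right; right. apply Hlt; eauto.
  - intros a b H. apply Hlt in H as (r & s & H1 & H2 & H3).
    destruct (flt_mediant r s H3) as (t & T1 & T2). destruct (rep_surj t) as (c & _ & Hc).
    exists c. rewrite !Hlt. eauto 10.
  - intros a Ha. destruct (rep_ex a Ha) as [r Hr]. destruct (flt_above r) as [s Hs].
    destruct (rep_surj s) as (b & _ & Hb). exists b. apply Hlt; eauto.
  - intros a Ha. destruct (rep_ex a Ha) as [r Hr]. destruct (flt_below r) as [s Hs].
    destruct (rep_surj s) as (b & _ & Hb). exists b. apply Hlt; eauto.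
  - destruct (rep_surj (Frac nz nz nz)) as (a & Ha & _); eauto.
Qed.

End Fractions.

(** * The Mostowski model *)

Section N3.
Context {Z : zfa_model} {AC : has_choice}.

Lemma isN3_good G F : isN3 uni G F -> exists A, good_model A G F.
Proof.
  intros (A & L & HA & Hc & HQ & HGs & HG & HF). exists A.
  pose proof (isorationals_dense A L HQ) as HL.
  pose proof (order_perm_group A L HA G HGs HG) as HP.
  assert (Hc' : exists ι, fn ι omega A /\ forall a, a ∊ A -> exists n, pair n a ∊ ι).
  { apply cinfinite_iff in Hc as (_ & ι & Hι). apply isbij_iff in Hι as (H1 & _ & H2); eauto. }
  split; auto. split; [apply isfsfilter_char; auto|]. split.
  - apply (order_moving A L HL Hc' HA G HGs HG).
  - apply (order_primitive A L HL Hc' HA G HGs HG).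
Qed.
End N3.

(** * Permutation models satisfy ZFA *)

Lemma sat_separation (M : structure) :
  (forall p (e : nat -> M) x, exists y, isset M y /\
     forall z, rmem M z y <-> rmem M z x /\ sat M (z .: x .: e) p) ->
  forall p (e : nat -> M), sat M e (AxSeparation p).
Proof.
  intros H p e x. destruct (H p e x) as (y & Hy & K). exists y. split; [exact Hy|].
  intros z. specialize (K z).
  change (rmem M z y <-> rmem M z x /\ sat M (z .: y .: x .: e) (ren (0 .: fun k => k + 2) p)).
  rewrite K. apply iff_and; [tauto|]. rewrite sat_ren. apply sat_env_ext.
  intros [|k]; [reflexivity|]. cbn. rewrite Nat.add_comm; reflexivity.
Qed.

Lemma sat_replacement (M : structure) :
  (forall p (e : nat -> M) x,
     (forall u v v', rmem M u x -> sat M (v .: u .: x .: e) p -> sat M (v' .: u .: x .: e) p -> v = v') ->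
     exists y, isset M y /\
       forall v, rmem M v y <-> exists u, rmem M u x /\ sat M (v .: u .: x .: e) p) ->
  forall p (e : nat -> M), sat M e (AxReplacement p).
Proof.
  intros H p e x Hf.
  destruct (H p e x) as (y & Hy & K).
  - intros u v v' Hu K K'. apply (Hf u Hu v v').
    + change (sat M (v' .: v .: u .: x .: e) (ren (1 .: 2 .: fun k => k + 3) p)).
      rewrite sat_ren. eapply sat_env_ext; [|exact K].
      intros [|[|k]]; try reflexivity. cbn. rewrite Nat.add_comm; reflexivity.
    + change (sat M (v' .: v .: u .: x .: e) (ren (0 .: 2 .: fun k => k + 3) p)).
      rewrite sat_ren. eapply sat_env_ext; [|exact K'].
      intros [|[|k]]; try reflexivity. cbn. rewrite Nat.add_comm; reflexivity.
  - exists y. split; [exact Hy|]. intros v. specialize (K v).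
    change (rmem M v y <-> exists u, rmem M u x /\
      sat M (u .: v .: y .: x .: e) (ren (1 .: 0 .: fun k => k + 3) p)).
    rewrite K. apply iff_ex; intros u. apply iff_and; [tauto|]. rewrite sat_ren. apply sat_env_ext.
    intros [|[|k]]; try reflexivity. cbn. rewrite Nat.add_comm; reflexivity.
Qed.

Section PermutationModel.
Context {Z : zfa_model}.
Variables A G F : uni.
Hypothesis HG : perm_group A G.
Hypothesis HF : finite_support_filter A G F.
Let HA := pg_atoms A G HG.
Let Gfn := pg_fn A G HG.
Let Ginj := pg_inj A G HG.
Let Ginv := pg_inv A G HG.
Local Notation supp := (supp G).
Local Notation HS := (HS G F).
Local Notation N := (PermModel uni G F).
Local Notation "^ x" := (proj1_sig x) (at level 5, x at level 5).
Local Notation mkN := (mk G F).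

Lemma N_iso g : g ∊ G -> exists h : N -> N, (forall x, ^(h x) = act g ^x) /\
  forall p e, sat N (fun k => h (e k)) p <-> sat N e p.
Proof.
  intros Hg.
  pose (h := fun x : N => mkN (act g ^x) (HS_act A G F HG HF g ^x Hg (N_HS G F x)) : N).
  pose (h' := fun x : N =>
    mkN (act (inv A g) ^x) (HS_act A G F HG HF (inv A g) ^x (Ginv g Hg) (N_HS G F x)) : N).
  exists h. split; [reflexivity|]. apply (sat_iso N h h').
  - intros x. apply N_eq. apply (act_inv_r_G A G HG); auto.
  - intros x y H. apply N_eq. apply (f_equal (@proj1_sig _ _)) in H.
    apply (act_inj A g HA (Gfn g Hg) (Ginj g Hg)) in H; auto.
  - intros x y. apply (act_mem_iff A g HA (Gfn g Hg) (Ginj g Hg)).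
  - intros x. pose proof (set_act_iff A g HA (Gfn g Hg) ^x) as K.
    change (ratm uni (act g ^x) <-> ratm uni ^x). unfold isset in K.
    split; intros H; apply NNPP; tauto.
Qed.

Lemma env_support (e : nat -> N) k :
  exists E, sub uni E A /\ fin E /\ forall i, i < k -> supp E ^(e i).
Proof.
  induction k.
  - exists emp. split; [apply sub_emp|]. split; [apply fin_emp | lia].
  - destruct IHk as (E & E1 & E2 & E3).
    destruct (HS_fsupp A G F HG HF _ (N_HS G F (e k))) as (E' & E1' & E2' & E3').
    exists (cup E E'). split; [apply sub_cup; auto|]. split; [apply fin_cup; auto|].
    intros i Hi. destruct (Nat.eq_dec i k) as [->|].
    + apply (supp_sub G _ E'); auto. intros a Ha; apply in_cup; auto.
    + apply (supp_sub G _ E); [apply E3; lia|]. intros a Ha; apply in_cup; auto.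
Qed.

Lemma sat_supported p (e e' : nat -> N) E g (h : N -> N) :
  (forall x, ^(h x) = act g ^x) -> (forall p e, sat N (fun k => h (e k)) p <-> sat N e p) ->
  g ∊ G -> fixes g E ->
  (forall i, i < var_bound p -> e' i = h (e i)) -> sat N e p -> sat N e' p.
Proof.
  intros H1 H2 Hg Fg H3 H. apply (sat_var_bound N p e' (fun k => h (e k))); auto. apply H2; auto.
Qed.

(** Both schemes are assumed for all predicates of the metatheory, so that truth in the permutation
    model can occur in them without being relativized to a formula of the ground model. *)
Hypothesis full_separation : forall (P : uni -> Prop) x, small (fun z => z ∊ x /\ P z).
Hypothesis full_replacement : forall (R : uni -> uni -> Prop) x,
  (forall u v v', u ∊ x -> R u v -> R u v' -> v = v') -> small (fun v => exists u, u ∊ x /\ R u v).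

(** An element of [G] fixing supports of [x] and of the parameters acts as an automorphism under
    which the defining formula is invariant, so it preserves the subset. *)
Lemma N_separation p (e : nat -> N) x : exists y, isset N y /\
  forall z, rmem N z y <-> rmem N z x /\ sat N (z .: x .: e) p.
Proof.
  destruct (full_separation (fun z => exists Hz : HS z, sat N (mkN z Hz .: x .: e) p) ^x) as (y & Hy & K).
  destruct (env_support (x .: e) (var_bound p)) as (E & E1 & E2 & E3).
  assert (HyS : HS y).
  { destruct (HS_fsupp A G F HG HF _ (N_HS G F x)) as (E' & E1' & E2' & E3').
    apply (HS_iff A G F HG HF). split.
    - exists (cup E E'). split; [apply sub_cup; auto|]. split; [apply fin_cup; auto|].
      apply (supp_stable A G HG); auto. intros g s Hg Fg Hs. apply K in Hs as (Hs & HsS & L).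
      assert (FE : fixes g E) by (intros a Ha; apply Fg, in_cup; auto).
      assert (FE' : fixes g E') by (intros a Ha; apply Fg, in_cup; auto).
      apply K. split.
      + rewrite <- (E3' g Hg FE'). apply (act_mem A); auto.
      + exists (HS_act A G F HG HF g s Hg HsS). destruct (N_iso g Hg) as (h & H1 & H2).
        apply (sat_supported p (mkN s HsS .: x .: e) _ E g h); auto.
        intros [|i] Hi; apply N_eq; rewrite H1; [reflexivity|].
        symmetry. apply (E3 i); auto. lia.
    - intros z Hz. apply K in Hz as (_ & Hz & _); auto. }
  exists (mkN y HyS). split; [exact Hy|]. intros z.
  change (^z ∊ y <-> ^z ∊ ^x /\ sat N (z .: x .: e) p). rewrite K. apply iff_and; [tauto|].
  split.
  - intros [Hz L]. replace z with (mkN ^z Hz); auto. apply N_eq; reflexivity.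
  - intros L. exists (N_HS G F z). replace (mkN ^z _) with z; auto. apply N_eq; reflexivity.
Qed.

Lemma N_replacement p (e : nat -> N) x :
  (forall u v v', rmem N u x -> sat N (v .: u .: x .: e) p -> sat N (v' .: u .: x .: e) p -> v = v') ->
  exists y, isset N y /\
    forall v, rmem N v y <-> exists u, rmem N u x /\ sat N (v .: u .: x .: e) p.
Proof.
  intros Hf.
  destruct (full_replacement (fun u v => exists u' v' : N, u = ^u' /\ v = ^v' /\
     sat N (v' .: u' .: x .: e) p) ^x) as (y & Hy & K).
  { intros u v v' Hu (u1 & v1 & E1 & E2 & H1) (u2 & v2 & E3 & E4 & H2).
    assert (u2 = u1) as -> by (apply N_eq; congruence). subst v v'. f_equal.
    apply (Hf u1); auto. change (^u1 ∊ ^x). rewrite <- E1; auto. }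
  destruct (env_support (x .: e) (var_bound p)) as (E & E1 & E2 & E3).
  assert (HyS : HS y).
  { destruct (HS_fsupp A G F HG HF _ (N_HS G F x)) as (E' & E1' & E2' & E3').
    apply (HS_iff A G F HG HF). split.
    - exists (cup E E'). split; [apply sub_cup; auto|]. split; [apply fin_cup; auto|].
      apply (supp_stable A G HG); auto. intros g s Hg Fg Hs.
      apply K in Hs as (u & Hu & u' & v' & -> & -> & L).
      assert (FE : fixes g E) by (intros a Ha; apply Fg, in_cup; auto).
      assert (FE' : fixes g E') by (intros a Ha; apply Fg, in_cup; auto).
      destruct (N_iso g Hg) as (h & H1 & H2).
      apply K. exists (act g ^u'). split.
      + rewrite <- (E3' g Hg FE'). apply (act_mem A); auto.
      + exists (h u'), (h v'). rewrite !H1. split; auto. split; auto.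
        apply (sat_supported p (v' .: u' .: x .: e) _ E g h); auto.
        intros [|[|i]] Hi; try reflexivity. apply N_eq; rewrite H1.
        symmetry. apply (E3 i); auto. lia.
    - intros z Hz. apply K in Hz as (_ & _ & _ & v' & _ & -> & _). apply N_HS. }
  exists (mkN y HyS). split; [exact Hy|]. intros v.
  change (^v ∊ y <-> exists u, rmem N u x /\ sat N (v .: u .: x .: e) p). rewrite K. split.
  - intros (u & Hu & u' & v' & -> & E4 & L). exists u'. split; auto.
    replace v with v'; auto. apply N_eq; auto.
  - intros (u & Hu & L). exists ^u. split; auto. exists u, v; auto.
Qed.

Theorem N_ZFA : forall p, ZFA p -> forall e, sat N e p.
Proof.
  intros p [].
  - intros e x Hx y Hy. exact (atom_empty ^x ^y Hx Hy).
  - intros e. exists (mkN A (HS_A A G F HG HF)). split; [apply HA|].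
    intros x. apply (proj2 HA ^x).
  - intros e x y Hx Hy H. apply N_eq, set_ext; auto. intros z. split; intros Hz.
    + exact (proj1 (H (mkN z (HS_mem A G F HG HF _ _ (N_HS G F x) Hz))) Hz).
    + exact (proj2 (H (mkN z (HS_mem A G F HG HF _ _ (N_HS G F y) Hz))) Hz).
  - intros e a b. exists (mkN _ (HS_upair A G F HG HF _ _ (N_HS G F a) (N_HS G F b))).
    exact (proj2 (N_upair A G F HG HF (mkN _ (HS_upair A G F HG HF _ _ (N_HS G F a) (N_HS G F b))) a b) eq_refl).
  - intros e x.
    assert (H : HS (union ^x)).
    { destruct (HS_fsupp A G F HG HF _ (N_HS G F x)) as (E & E1 & E2 & E3).
      apply (HS_iff A G F HG HF). split.
      - exists E; split; auto; split; auto. apply (supp_stable A G HG); [apply set_union|].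
        intros g s Hg Fg Hs. apply in_union in Hs as (t & Ht & Hs). apply in_union.
        exists (act g t). split; [rewrite <- (E3 g Hg Fg)|]; apply (act_mem A); auto.
      - intros z Hz. apply in_union in Hz as (t & Ht & Hz).
        apply (HS_mem A G F HG HF t); auto. apply (HS_mem A G F HG HF ^x); auto. apply N_HS. }
    exists (mkN _ H). split; [apply set_union|]. intros z.
    change (^z ∊ union ^x <-> exists t : N, ^t ∊ ^x /\ ^z ∊ ^t). rewrite in_union. split.
    + intros (t & Ht & Hz). exists (mkN t (HS_mem A G F HG HF _ _ (N_HS G F x) Ht)). auto.
    + intros (t & Ht & Hz). eauto.
  - intros e x.
    assert (HD : D1 HS) by apply D1_HS.
    (* The power set in the permutation model keeps only the hereditarily symmetric subsets. *)
    assert (H : HS (sep (pow ^x) HS)).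
    { destruct (HS_fsupp A G F HG HF _ (N_HS G F x)) as (E & E1 & E2 & E3).
      apply (HS_iff A G F HG HF). split.
      - exists E; split; auto; split; auto. apply (supp_stable A G HG); [apply set_sep; auto|].
        intros g s Hg Fg Hs. apply in_sep in Hs as [Hs HsS]; auto. apply in_pow in Hs as [Hs Hs'].
        apply in_sep; auto. split; [|apply (HS_act A G F); auto].
        apply in_pow. split; [apply (set_act A); auto|]. intros z Hz.
        apply (in_act A) in Hz as (t & Ht & ->); auto. rewrite <- (E3 g Hg Fg). apply (act_mem A); auto.
      - intros z Hz. apply in_sep in Hz; tauto. }
    exists (mkN _ H). split; [apply set_sep; auto|]. intros z.
    change (^z ∊ sep (pow ^x) HS <-> sub N z x).
    rewrite (N_sub A G F HG HF), in_sep, in_pow by auto. split; [tauto|]. intros K; split; auto. apply N_HS.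
  - intros e. exists (mkN omega (HS_omega A G F HG HF)).
    exact (proj2 (N_inductive A G F HG HF (mkN omega (HS_omega A G F HG HF))) inductive_omega).
  - intros e x [y0 Hy0].
    destruct (zfa_sat _ ZFA_foundation (fun _ => dflt) ^x) as (y & Hy & Hd).
    { exists ^y0. exact Hy0. }
    exists (mkN y (HS_mem A G F HG HF _ _ (N_HS G F x) Hy)). split; [exact Hy|].
    intros z Hz. apply (Hd ^z). exact Hz.
  - apply sat_separation. exact N_separation.
  - apply sat_replacement. exact N_replacement.
Qed.
End PermutationModel.

(** * A model of ZFA with choice over a given type of atoms *)

Section Trees.
Variable At : Type.

(** Aczel's sets as well-founded trees, with atoms as leaves; [bisim] is extensional equality. *)
Inductive tree : Type := leaf (a : At) | node (I : Type) (f : I -> tree).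

Fixpoint bisim (x y : tree) : Prop :=
  match x, y with
  | leaf a, leaf b => a = b
  | node B f, node C g =>
      (forall i, exists j, bisim (f i) (g j)) /\ (forall j, exists i, bisim (f i) (g j))
  | _, _ => False
  end.

Lemma bisim_refl x : bisim x x.
Proof. induction x; simpl; eauto. Qed.
Lemma bisim_sym x : forall y, bisim x y -> bisim y x.
Proof.
  induction x as [a|I f IH]; intros [b|J g]; simpl; auto.
  intros [H K]; split.
  - intros j. destruct (K j) as [i Hi]; eauto.
  - intros i. destruct (H i) as [j Hj]; eauto.
Qed.
Lemma bisim_trans x : forall y z, bisim x y -> bisim y z -> bisim x z.
Proof.
  induction x as [a|I f IH]; intros [b|J g] [c|L h]; simpl; try tauto; try congruence.
  intros [H K] [H' K']; split.
  - intros i. destruct (H i) as [j Hj]. destruct (H' j) as [l Hl]; eauto.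
  - intros l. destruct (K' l) as [j Hj]. destruct (K j) as [i Hi]; eauto.
Qed.

(** The quotient of trees by [bisim], as a type of classes, because [sat] interprets equality by
    Leibniz equality. *)
Definition obj := {P : tree -> Prop | exists x, P = bisim x}.
Definition cls (x : tree) : obj := exist _ (bisim x) (ex_intro _ x eq_refl).
Definition repr (x : obj) : tree := proj1_sig (constructive_indefinite_description _ (proj2_sig x)).

Lemma cls_repr x : cls (repr x) = x.
Proof.
  unfold repr, cls. destruct (constructive_indefinite_description _ _) as [t Ht]; simpl.
  destruct x as [P HP]; simpl in *. subst P. f_equal. apply proof_irrelevance.
Qed.
Lemma cls_eq x y : cls x = cls y <-> bisim x y.
Proof.
  split.
  - intros H. apply (f_equal (@proj1_sig _ _)) in H. simpl in H. rewrite H. apply bisim_refl.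
  - intros H. assert (E : bisim x = bisim y).
    { apply functional_extensionality; intros z. apply propositional_extensionality.
      split; intros K; [apply (bisim_trans y x) | apply (bisim_trans x y)]; auto using bisim_sym. }
    unfold cls. apply eq_sig_hprop; [intros; apply proof_irrelevance | exact E].
Qed.
Lemma repr_cls x : bisim (repr (cls x)) x.
Proof. apply cls_eq, cls_repr. Qed.

Definition obj_mem (x y : obj) : Prop :=
  match repr y with leaf _ => False | node B f => exists i, x = cls (f i) end.
Definition obj_atom (x : obj) : Prop := match repr x with leaf _ => True | node _ _ => False end.
Definition W : structure := Structure obj obj_mem obj_atom.

Definition atom (a : At) : W := cls (leaf a).
Definition collect (I : Type) (f : I -> W) : W := cls (node I (fun i => repr (f i))).

Lemma in_collect I f x : rmem W x (collect I f) <-> exists i, x = f i.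
Proof.
  pose proof (repr_cls (node I (fun i => repr (f i)))) as H.
  change (obj_mem x (collect I f) <-> exists i, x = f i). unfold obj_mem, collect.
  destruct (repr (cls _)) as [b|J g]; simpl in H; [destruct H|]. destruct H as [H K]. split.
  - intros [j ->]. destruct (H j) as [i Hi]. exists i. apply cls_eq in Hi. rewrite cls_repr in Hi. auto.
  - intros [i ->]. destruct (K i) as [j Hj]. exists j. apply cls_eq in Hj. rewrite cls_repr in Hj. auto.
Qed.
Lemma set_collect I f : isset W (collect I f).
Proof.
  pose proof (repr_cls (node I (fun i => repr (f i)))) as H.
  change (~ obj_atom (collect I f)). unfold obj_atom, collect.
  destruct (repr (cls _)) as [b|J g]; simpl in H; [destruct H | auto].
Qed.
Lemma atom_iff x : ratm W x <-> exists a, x = atom a.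
Proof.
  change (obj_atom x <-> exists a, x = atom a). unfold obj_atom. split.
  - intros H. destruct (repr x) as [a|] eqn:E; [|destruct H]. exists a.
    rewrite <- (cls_repr x), E; reflexivity.
  - intros [a ->]. pose proof (repr_cls (leaf a)) as H. unfold atom.
    destruct (repr (cls (leaf a))); simpl in H; auto.
Qed.
Lemma atom_inj a b : atom a = atom b -> a = b.
Proof. intros H. apply cls_eq in H. exact H. Qed.
Lemma W_atom_empty x y : ratm W x -> ~ rmem W y x.
Proof.
  change (obj_atom x -> ~ obj_mem y x). unfold obj_atom, obj_mem. destruct (repr x); auto.
Qed.
Lemma obj_cases (x : W) : (exists a, x = atom a) \/ exists I f, x = collect I f.
Proof.
  rewrite <- (cls_repr x). destruct (repr x) as [a|I f]; [left; exists a; reflexivity|].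
  right. exists I, (fun i => cls (f i)). apply cls_eq. simpl. split; intros i; exists i.
  - apply bisim_sym, repr_cls.
  - apply bisim_sym, repr_cls.
Qed.

(** Presents every object by an index type, the empty one for atoms, so that separation, union and
    power become constructions on types. *)
Lemma elements_exist (x : W) : exists c : {I : Type & I -> W}, forall z, rmem W z x <-> exists i, z = projT2 c i.
Proof.
  destruct (obj_cases x) as [[a ->]|(I & f & ->)].
  - exists (existT (fun I : Type => I -> W) Empty_set (fun e => match e with end)).
    intros z. split; [|intros [[]]]. intros H. destruct (W_atom_empty (atom a) z); auto.
    apply atom_iff; eauto.
  - exists (existT (fun I : Type => I -> W) I f). intros z. apply in_collect.
Qed.
Definition elements (x : W) := proj1_sig (constructive_indefinite_description _ (elements_exist x)).
Definition idx (x : W) : Type := projT1 (elements x).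
Definition elt (x : W) : idx x -> W := projT2 (elements x).
Lemma in_elt x z : rmem W z x <-> exists i, z = elt x i.
Proof. unfold elt, idx, elements. destruct (constructive_indefinite_description _ _) as [c H]; apply H. Qed.

Lemma W_ext (x y : W) : isset W x -> isset W y -> (forall z, rmem W z x <-> rmem W z y) -> x = y.
Proof.
  intros Hx Hy H.
  destruct (obj_cases x) as [Ha|(I & f & ->)]; [destruct Hx; apply atom_iff, Ha|].
  destruct (obj_cases y) as [Ha|(J & g & ->)]; [destruct Hy; apply atom_iff, Ha|].
  apply cls_eq. simpl. split.
  - intros i. destruct (proj1 (in_collect J g (f i))) as [j E].
    + apply H, in_collect; eauto.
    + exists j. rewrite E; apply bisim_refl.
  - intros j. destruct (proj1 (in_collect I f (g j))) as [i E].
    + apply H, in_collect; eauto.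
    + exists i. rewrite E; apply bisim_refl.
Qed.

Lemma W_ind (P : W -> Prop) : (forall x, (forall y, rmem W y x -> P y) -> P x) -> forall x, P x.
Proof.
  intros H x. rewrite <- (cls_repr x). induction (repr x) as [a|I f IH].
  - apply H. intros y Hy. destruct (W_atom_empty (atom a) y); auto. apply atom_iff; eauto.
  - apply H. intros y Hy.
    change (obj_mem y (cls (node I f))) in Hy. unfold obj_mem in Hy.
    pose proof (repr_cls (node I f)) as K. destruct (repr (cls (node I f))) as [b|J g]; [destruct Hy|].
    destruct K as [K _]. destruct Hy as [j ->]. destruct (K j) as [i Hi].
    apply cls_eq in Hi. rewrite Hi. apply IH.
Qed.

Lemma W_separation (P : W -> Prop) x : exists y, isset W y /\ forall z, rmem W z y <-> rmem W z x /\ P z.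
Proof.
  exists (collect {i : idx x | P (elt x i)} (fun s => elt x (proj1_sig s))).
  split; [apply set_collect|]. intros z. rewrite in_collect, in_elt. split.
  - intros [[i Hi] ->]; simpl; eauto.
  - intros [[i ->] Hi]. exists (exist _ i Hi); auto.
Qed.
Lemma W_replacement (R : W -> W -> Prop) x :
  (forall u v v', rmem W u x -> R u v -> R u v' -> v = v') ->
  exists y, isset W y /\ forall v, rmem W v y <-> exists u, rmem W u x /\ R u v.
Proof.
  intros HR.
  exists (collect {i : idx x | exists v, R (elt x i) v}
    (fun s => proj1_sig (constructive_indefinite_description _ (proj2_sig s)))).
  split; [apply set_collect|]. intros v. rewrite in_collect. split.
  - intros [s ->]. exists (elt x (proj1_sig s)). split; [apply in_elt; eauto|].
    apply proj2_sig.
  - intros (u & Hu & Huv). pose proof Hu as Hu'. apply in_elt in Hu as [i ->].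
    exists (exist _ i (ex_intro _ v Huv)). apply (HR (elt x i)); auto. apply proj2_sig.
Qed.
Lemma W_upair a b : exists u, isupair W u a b.
Proof.
  exists (collect bool (fun c => if c then a else b)). split; [apply set_collect|].
  intros z. rewrite in_collect. split.
  - intros [[|] ->]; auto.
  - intros [->| ->]; [exists true | exists false]; auto.
Qed.
Lemma W_union x : exists y, isset W y /\ forall z, rmem W z y <-> exists t, rmem W t x /\ rmem W z t.
Proof.
  exists (collect {i : idx x & idx (elt x i)} (fun s => elt _ (projT2 s))).
  split; [apply set_collect|]. intros z. rewrite in_collect. split.
  - intros [[i j] ->]. exists (elt x i). rewrite !in_elt; simpl; eauto.
  - intros (t & Ht & Hz). apply in_elt in Ht as [i ->]. apply in_elt in Hz as [j ->].
    exists (existT _ i j); auto.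
Qed.
Lemma W_power x : exists y, isset W y /\ forall z, rmem W z y <-> sub W z x.
Proof.
  exists (collect (idx x -> Prop) (fun S => collect {i : idx x | S i} (fun s => elt x (proj1_sig s)))).
  split; [apply set_collect|]. intros z. rewrite in_collect. split.
  - intros [S ->]. split; [apply set_collect|]. intros w Hw.
    apply in_collect in Hw as [[i Hi] ->]. apply in_elt; eauto.
  - intros [Hz H]. exists (fun i => rmem W (elt x i) z). apply W_ext; auto; [apply set_collect|].
    intros w. rewrite in_collect. split.
    + intros Hw. pose proof (H w Hw) as K. apply in_elt in K as [i ->]. exists (exist _ i Hw); auto.
    + intros [[i Hi] ->]; auto.
Qed.
Lemma W_succ x : exists y, issucc W x y.
Proof.
  exists (collect (option (idx x)) (fun o => match o with Some i => elt x i | None => x end)).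
  split; [apply set_collect|]. intros z. rewrite in_collect, in_elt. split.
  - intros [[i|] ->]; eauto.
  - intros [[i ->]| ->]; [exists (Some i) | exists None]; auto.
Qed.
Fixpoint numeral (n : nat) : W :=
  match n with
  | 0 => collect Empty_set (fun e => match e with end)
  | S n => proj1_sig (constructive_indefinite_description _ (W_succ (numeral n)))
  end.
Lemma numeral_0 : empty W (numeral 0).
Proof. split; [apply set_collect|]. intros z H. apply in_collect in H as [[]]. Qed.
Lemma numeral_S n : issucc W (numeral n) (numeral (S n)).
Proof. exact (proj2_sig (constructive_indefinite_description _ (W_succ (numeral n)))). Qed.
Lemma W_infinity : exists w, inductive W w.
Proof.
  exists (collect nat numeral). split; [apply set_collect|]. split.
  - exists (numeral 0). split; [apply numeral_0|]. apply in_collect; eauto.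
  - intros x Hx. apply in_collect in Hx as [n ->]. exists (numeral (S n)).
    split; [apply numeral_S|]. apply in_collect; eauto.
Qed.
Lemma W_foundation x : (exists y, rmem W y x) -> exists y, rmem W y x /\ disjoint W y x.
Proof.
  intros [y Hy]. apply NNPP; intros N. revert y Hy. apply (W_ind (fun y => ~ rmem W y x)).
  intros y IH Hy. apply N. exists y. split; auto. intros z [Hz Hzx]. exact (IH z Hz Hzx).
Qed.
Lemma W_atomset : exists A, isatomset W A.
Proof.
  exists (collect At atom). split; [apply set_collect|]. intros x. rewrite in_collect, atom_iff; tauto.
Qed.

Theorem W_ZFA : forall p, ZFA p -> forall e, sat W e p.
Proof.
  intros p [].
  - intros e x Hx y. exact (W_atom_empty x y Hx).
  - intros e. exact W_atomset.
  - intros e. exact W_ext.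
  - intros e. exact W_upair.
  - intros e. exact W_union.
  - intros e. exact W_power.
  - intros e. exact W_infinity.
  - intros e. exact W_foundation.
  - apply sat_separation. intros q e x. apply W_separation.
  - apply sat_replacement. intros q e x H. apply W_replacement. exact H.
Qed.

#[local] Instance W_model : zfa_model := {| uni := W; dflt := numeral 0; zfa_sat := W_ZFA |}.
#[local] Canonical W_model.

Lemma W_full_separation (P : uni -> Prop) x : small (fun z => z ∊ x /\ P z).
Proof. destruct (W_separation P x) as (y & Hy & H). exists y; split; auto. Qed.
Lemma W_full_replacement (R : uni -> uni -> Prop) x :
  (forall u v v', u ∊ x -> R u v -> R u v' -> v = v') -> small (fun v => exists u, u ∊ x /\ R u v).
Proof. intros HR. destruct (W_replacement R x HR) as (y & Hy & H). exists y; split; auto. Qed.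

Definition pairs (I : Type) (f g : I -> W) : W := collect I (fun i => pair (f i) (g i)).
Lemma in_pairs I f g a b : pair a b ∊ pairs I f g <-> exists i, a = f i /\ b = g i.
Proof.
  unfold pairs. rewrite (in_collect I (fun i => pair (f i) (g i)) (pair a b)). split.
  - intros [i E]. apply pair_inj in E. eauto.
  - intros (i & -> & ->). eauto.
Qed.
Lemma set_pairs I f g : set (pairs I f g).
Proof. apply set_collect. Qed.
Lemma in_pairs_ex I f g p : p ∊ pairs I f g <-> exists i, p = pair (f i) (g i).
Proof. apply in_collect. Qed.

#[local] Instance W_choice : has_choice.
Proof.
  intros e X HX.
  assert (HX' : forall i : idx X, exists y, y ∊ elt X i).
  { assert (K : forall x, x ∊ X -> exists y, y ∊ x) by exact HX.
    intros i. apply K. change (rmem W (elt X i) X). apply in_elt. exists i; reflexivity. }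
  (* The choice depends on the set and not on its index, so an element listed under two indices
     still receives one value. *)
  set (c := fun x => epsilon (inhabits x) (fun y => y ∊ x)).
  assert (Hc : forall i, c (elt X i) ∊ elt X i).
  { intros i. apply epsilon_spec, HX'. }
  exists (pairs (idx X) (elt X) (fun i => c (elt X i))), (union X).
  assert (Hin : forall a b, pair a b ∊ pairs (idx X) (elt X) (fun i => c (elt X i)) -> b = c a /\ a ∊ X /\ b ∊ a).
  { intros a b H. apply in_pairs in H as (i & -> & ->). split; auto. split; auto. change (rmem W (elt X i) X). apply in_elt; eauto. }
  split.
  - change (isfun uni (pairs (idx X) (elt X) (fun i => c (elt X i))) X (union X)).
    apply isfun_iff. split.
    + apply set_pairs.
    + intros p Hp. apply in_pairs_ex in Hp as [i ->]; eauto.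
    + intros a b H. apply Hin in H; tauto.
    + intros a b H. apply Hin in H as (-> & Ha & Hb). apply in_union; eauto.
    + intros a Ha. change (rmem W a X) in Ha. apply in_elt in Ha as [i ->]. exists (c (elt X i)). apply in_pairs; eauto.
    + intros a b d H K. apply Hin in H as [-> _], K as [-> _]; auto.
  - intros x y H. change (app uni (pairs (idx X) (elt X) (fun i => c (elt X i))) x y) in H.
    apply app_iff, Hin in H as (_ & _ & H). exact H.
Qed.

Definition atoms : W := collect At atom.
Lemma in_atoms x : x ∊ atoms <-> exists a, x = atom a.
Proof. apply in_collect. Qed.
Lemma atoms_isatomset : isatomset uni atoms.
Proof.
  split; [apply set_collect|]. intros x. rewrite in_atoms. symmetry; apply atom_iff.
Qed.

Lemma numeral_omega n : numeral n ∊ omega.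
Proof.
  induction n.
  - pose proof numeral_0 as H. apply (proj1 (@empty_emp W_model (numeral 0))) in H. rewrite H. apply omega_emp.
  - pose proof (numeral_S n) as H. apply (proj1 (@issucc_iff W_model _ _)) in H. rewrite H. apply omega_succ; auto.
Qed.
Lemma omega_numeral x : x ∊ omega -> exists n, x = numeral n.
Proof.
  intros H. apply (proj1 (in_omega x)) with (w := collect nat numeral) in H.
  - apply in_collect in H; auto.
  - split; [apply set_collect|]. split.
    + exists (numeral 0). split; [apply numeral_0|]. apply in_collect; eauto.
    + intros y Hy. apply in_collect in Hy as [n ->]. exists (numeral (S n)).
      split; [apply numeral_S|]. apply in_collect; eauto.
Qed.
Lemma numeral_lt n m : n < m -> numeral n ∊ numeral m.
Proof.
  induction m; [lia|]. intros H. destruct (numeral_S m) as [_ K]. apply (K (numeral n)).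
  destruct (Nat.eq_dec n m) as [->|]; [right; auto | left; apply IHm; lia].
Qed.
Lemma numeral_inj n m : numeral n = numeral m -> n = m.
Proof.
  intros E. destruct (Nat.lt_trichotomy n m) as [H|[H|H]]; auto; apply numeral_lt in H;
    rewrite E in H; destruct (nat_irrefl (numeral m)); auto using numeral_omega.
Qed.

Lemma atoms_enumerated (enum : nat -> At) : (forall a, exists n, enum n = a) ->
  exists ι, fn ι omega atoms /\ (forall a, a ∊ atoms -> exists n, pair n a ∊ ι) /\
    ((forall n m, enum n = enum m -> n = m) -> injective ι).
Proof.
  intros Hs. exists (pairs nat numeral (fun n => atom (enum n))). split; [split|split].
  - apply set_pairs.
  - intros p Hp. apply in_pairs_ex in Hp as [i ->]; eauto.
  - intros a b H. apply in_pairs in H as (i & -> & ->). apply numeral_omega.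
  - intros a b H. apply in_pairs in H as (i & -> & ->). apply in_atoms; eauto.
  - intros a Ha. apply omega_numeral in Ha as [n ->]. exists (atom (enum n)). apply in_pairs; eauto.
  - intros a b c H K. apply in_pairs in H as (i & -> & ->), K as (j & E & ->).
    apply numeral_inj in E; subst; auto.
  - intros a Ha. apply in_atoms in Ha as [x ->]. destruct (Hs x) as [n <-].
    exists (numeral n). apply in_pairs; eauto.
  - intros Hi a b c H K. apply in_pairs in H as (i & -> & ->), K as (j & -> & E).
    apply atom_inj, Hi in E; subst; auto.
Qed.
End Trees.

(** * Failures in the permutation models *)

Section Fraenkel.
Context {Z : zfa_model}.
Variables A G F : uni.
Hypothesis HG : perm_group A G.
Hypothesis HF : finite_support_filter A G F.
Hypothesis HGall : forall g, g ∊ G <-> isbij uni g A A.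
Hypothesis HAinf : infinite uni A.
Let HA := pg_atoms A G HG.
Local Notation N := (PermModel uni G F).
Local Notation "^ x" := (proj1_sig x) (at level 5, x at level 5).

(** If [E] supports one half of a splitting, transpose an atom of each half outside [E]: the half is
    preserved, yet it acquires an atom of the other. *)
Lemma atoms_amorphous : ~ noamorphous N.
Proof.
  intros H. apply H. exists (mk G F A (HS_A A G F HG HF)). split.
  - apply (N_infinite A G F HG HF). exact HAinf.
  - intros (Y & X & HY & HX & Hd & Hcov).
    apply (N_infinite A G F HG HF) in HY, HX.
    destruct (HS_fsupp A G F HG HF _ (N_HS G F Y)) as (E & E1 & E2 & E3).
    destruct (infinite_diff _ E HY E2) as (y & Hy & HyE).
    destruct (infinite_diff _ E HX E2) as (x & Hx & HxE).
    assert (HyA : y ∊ A).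
    { apply (Hcov (mk G F y (HS_mem A G F HG HF _ _ (N_HS G F Y) Hy))). left; exact Hy. }
    assert (HxA : x ∊ A).
    { apply (Hcov (mk G F x (HS_mem A G F HG HF _ _ (N_HS G F X) Hx))). right; exact Hx. }
    assert (Ht : tr A y x ∊ G) by (apply HGall, bij_tr; auto).
    apply (Hd (mk G F x (HS_mem A G F HG HF _ _ (N_HS G F X) Hx))). split; [|exact Hx].
    assert (Ft : fixes (tr A y x) E) by (apply (fixes_tr A HA); auto).
    pose proof (act_mem A _ HA (pg_fn A G HG _ Ht) _ _ Hy) as K.
    rewrite (act_tr_l A HA y x HyA HxA), (E3 _ Ht Ft) in K. exact K.
Qed.
End Fraenkel.

(** * Failures over a dense order of atoms *)

Section Mostowski.
Context {Z : zfa_model} {AC : has_choice}.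
Variables A L G F : uni.
Hypothesis HL : dense_order A L.
Hypothesis HAc : exists ι, fn ι omega A /\ forall a, a ∊ A -> exists n, pair n a ∊ ι.
Hypothesis HA : isatomset uni A.
Hypothesis HLs : set L.
Hypothesis HLp : forall p, p ∊ L -> exists a b, p = pair a b.
Hypothesis HGs : set G.
Hypothesis HGa : forall g, g ∊ G <-> isorderaut uni g A L.
Hypothesis HF : finite_support_filter A G F.
Let HG := order_perm_group A L HA G HGs HGa.
Let Gfn := pg_fn A G HG.
Let Hmov := order_moving A L HL HAc HA G HGs HGa.
Local Notation N := (PermModel uni G F).
Local Notation "^ x" := (proj1_sig x) (at level 5, x at level 5).
Local Notation lt a b := (pair a b ∊ L).
Local Notation mkN := (mk G F).

Lemma act_lt g a b : g ∊ G -> lt a b -> lt (act g a) (act g b).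
Proof.
  intros Hg H. destruct (do_dom A L HL a b H). apply (order_act A L HA G HGs HGa); auto.
Qed.

Lemma supp_L : supp G emp L.
Proof.
  apply (supp_stable A G HG); auto. intros g p Hg _ Hp. destruct (HLp p Hp) as (a & b & ->).
  rewrite (act_pair A) by auto. apply act_lt; auto.
Qed.
Lemma HS_L : HS G F L.
Proof.
  apply (HS_iff A G F HG HF). split.
  - exists emp. split; [apply sub_emp|]. split; [apply fin_emp | apply supp_L].
  - intros p Hp. destruct (HLp p Hp) as (a & b & ->). destruct (do_dom A L HL a b Hp).
    apply (HS_pair A G F HG HF); apply (HS_atom A G F HG HF); auto.
Qed.

Lemma HS_of_supp E x : sub uni E A -> fin E -> supp G E x -> (forall y, y ∊ x -> HS G F y) -> HS G F x.
Proof. intros H1 H2 H3 H4. apply (HS_iff A G F HG HF). split; auto. exists E; auto. Qed.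

Lemma HS_sub_A Y E : sub uni E A -> fin E -> sub uni Y A -> supp G E Y -> HS G F Y.
Proof.
  intros H1 H2 H3 H4. apply (HS_of_supp E); auto. intros y Hy. apply (HS_atom A G F HG HF), H3; auto.
Qed.

Lemma infinite_A : infinite uni A.
Proof.
  apply infinite_iff. split; [apply HA|]. intros H. destruct (do_ne A L HL) as [a Ha].
  destruct (point_above A L HL emp a A) as (d & Hd & HdA & _); auto using fin_emp, sub_emp, in_emp.
Qed.

Lemma supp_cut E Y y d : sub uni E A -> fin E -> y ∊ A -> d ∊ A -> supp G E Y -> same_cut L E y d ->
  y ∊ Y -> d ∊ Y.
Proof.
  intros H1 H2 Hy Hd HY Hc HyY.
  destruct (cut_transitive A L HL HAc HA G HGs HGa E y d H2 H1 Hy Hd Hc) as (g & Hg & Fg & <-).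
  rewrite <- (HY g Hg Fg). apply (act_mem A); auto.
Qed.

Lemma not_woam : ~ woam N.
Proof.
  intros H. destruct (H (mkN A (HS_A A G F HG HF))) as [(R & HR)|(Y & HYA & HYi & HYam)].
  - apply HA.
  - destruct HR as (_ & Hirr & Htr & _ & Hleast).
    (* If [x] is the [R]-least atom outside a support of [R], then [x] precedes both its image under
       [g] and its image under the inverse. Applying [g] to the latter puts [act g x] before [x], a
       contradiction. *)
    destruct (HS_fsupp A G F HG HF _ (N_HS G F R)) as (E & E1 & E2 & E3).
    assert (HD : HS G F (diff A E)).
    { apply (HS_sub_A _ E); auto.
      - split; [apply set_diff|]. intros z Hz; apply in_diff in Hz; tauto.
      - apply (supp_stable A G HG); [apply set_diff|]. intros g s Hg Fg Hs.
        apply in_diff in Hs as [Hs HsE]. apply in_diff. split; [apply (act_atom_A A); auto|].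
        intros K. apply HsE. pose proof (Fg _ K) as M.
        apply (act_inj A g HA (Gfn g Hg) (pg_inj A G HG g Hg)) in M. rewrite <- M; auto. }
    destruct (Hleast (mkN _ HD)) as (x & Hx & Hmin).
    + apply (N_sub A G F HG HF). split; [apply set_diff|]. intros z Hz; apply in_diff in Hz; tauto.
    + destruct (infinite_diff A E infinite_A E2) as (a & Ha & HaE).
      exists (mkN a (HS_atom A G F HG HF a Ha)). apply in_diff; auto.
    + change (^x ∊ diff A E) in Hx. apply in_diff in Hx as [HxA HxE].
      destruct (Hmov E ^x (adj emp ^x)) as (g & Hg & Fg & Ng); auto using fin_adj, fin_emp.
      assert (Ng' : act g ^x <> ^x) by (intros K; apply Ng, in_adj; auto).
      assert (moved : forall h, h ∊ G -> fixes h E -> act h ^x <> ^x -> pair ^x (act h ^x) ∊ ^R).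
      { intros h Hh Fh Nh. assert (HhA : act h ^x ∊ A) by (apply (act_atom_A A); auto).
        destruct (Hmin (mkN _ (HS_atom A G F HG HF _ HhA))) as [M|M].
        - change (act h ^x ∊ diff A E). apply in_diff. split; auto. intros K. apply HxE.
          pose proof (Fh _ K) as M. apply (act_inj A h HA (Gfn h Hh) (pg_inj A G HG h Hh)) in M.
          rewrite <- M; auto.
        - destruct Nh. apply (f_equal (@proj1_sig _ _)) in M. symmetry; exact M.
        - apply (N_app A G F HG HF) in M. exact M. }
      pose proof (moved g Hg Fg Ng') as M1.
      assert (M2 : pair ^x (act (inv A g) ^x) ∊ ^R).
      { apply moved; [apply (pg_inv A G HG); auto | apply (fixes_inv A G HG); auto |].
        intros K. apply Ng'. rewrite <- K at 1. apply (act_inv_r_G A G HG); auto. }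
      apply (act_mem A g HA (Gfn g Hg)) in M2. rewrite (act_pair A), (act_inv_r_G A G HG) in M2 by auto.
      rewrite (E3 g Hg Fg) in M2.
      assert (HgA : act g ^x ∊ A) by (apply (act_atom_A A); auto).
      apply (Hirr x). apply (Htr x (mkN _ (HS_atom A G F HG HF _ HgA)) x);
        apply (N_app A G F HG HF); auto.
  - apply (N_sub A G F HG HF) in HYA. simpl in HYA. apply (N_infinite A G F HG HF) in HYi.
    destruct (HS_fsupp A G F HG HF _ (N_HS G F Y)) as (E & E1 & E2 & E3).
    destruct (infinite_diff _ E HYi E2) as (y & Hy & HyE).
    assert (HyA : y ∊ A) by (apply HYA; auto).
    (* [Y] contains with [y] every point in the same cut over its support [E]. It is split at such a
       point [d] above [y]: the lower part contains the points in the cut of [y] over [adj E d], the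
       upper part those of the cut of [d] above [d], and both are infinite. *)
    destruct (point_above A L HL E y E E2 E1 HyA HyE E2) as (d & Hd & HdE & Hcut & Hyd).
    assert (HdY : d ∊ ^Y) by (apply (supp_cut E _ y); auto).
    assert (HD1 : D1 (fun z => lt z d)) by dn. assert (HD2 : D1 (fun z => ~ lt z d)) by dn.
    assert (Ed1 : sub uni (adj E d) A) by (apply sub_adj; auto).
    assert (Ed2 : fin (adj E d)) by (apply fin_adj; auto).
    assert (Hact : forall g s, g ∊ G -> fixes g (adj E d) -> s ∊ A -> (lt (act g s) d <-> lt s d)).
    { intros g s Hg Fg Hs. apply fixes_adj in Fg as [_ Fd]. rewrite <- Fd at 1.
      apply (order_act A L HA G HGs HGa); auto. }
    assert (HSpart : forall P, D1 P -> (forall g s, g ∊ G -> fixes g (adj E d) -> s ∊ A -> P s -> P (act g s)) ->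
      HS G F (sep ^Y P)).
    { intros P HP HPs. apply (HS_sub_A _ (adj E d)); auto.
      - apply (sub_trans _ ^Y); auto. apply sub_sep; auto.
      - apply (supp_stable A G HG); [apply set_sep; auto|]. intros g s Hg Fg Hs.
        apply in_sep in Hs as [Hs Hs']; auto. apply in_sep; auto. split; [|apply HPs; auto; apply HYA; auto].
        apply fixes_adj in Fg as [Fg _]. rewrite <- (E3 g Hg Fg). apply (act_mem A); auto. }
    assert (S1 : HS G F (sep ^Y (fun z => lt z d))) by (apply HSpart; auto; intros; apply Hact; auto).
    assert (S2 : HS G F (sep ^Y (fun z => ~ lt z d))).
    { apply HSpart; auto. intros g s Hg Fg Hs K K'. apply K, (Hact g s Hg Fg Hs), K'. }
    apply HYam. exists (mkN _ S1), (mkN _ S2). split; [|split; [|split]].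
    + apply (N_infinite A G F HG HF). apply infinite_iff. split; [apply set_sep; auto|]. intros K.
      assert (HyEd : ~ y ∊ adj E d).
      { intros M. apply in_adj in M as [M|M]; auto. subst y. apply (do_irrefl A L HL d); auto. }
      destruct (point_above A L HL (adj E d) y _ Ed2 Ed1 HyA HyEd K) as (u & Hu & HuK & Hcu & _).
      apply HuK, in_sep; auto. split.
      * apply (supp_cut E _ y); auto. intros e He. apply Hcu, in_adj; auto.
      * apply (Hcu d); [apply in_adj; auto | auto].
    + apply (N_infinite A G F HG HF). apply infinite_iff. split; [apply set_sep; auto|]. intros K.
      destruct (point_above A L HL E d _ E2 E1 Hd HdE K) as (u & Hu & HuK & Hcu & Hdu).
      apply HuK, in_sep; auto. split.
      * apply (supp_cut E _ d); auto.
      * intros M. apply (do_asym A L HL u d); auto.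
    + intros z [H1 H2]. change (^z ∊ sep ^Y (fun z => lt z d)) in H1.
      change (^z ∊ sep ^Y (fun z => ~ lt z d)) in H2. rewrite in_sep in H1, H2 by auto. tauto.
    + intros z. change (^z ∊ ^Y <-> ^z ∊ sep ^Y (fun z => lt z d) \/ ^z ∊ sep ^Y (fun z => ~ lt z d)).
      rewrite !in_sep by auto. tauto.
Qed.

Lemma beyond E : sub uni E A -> fin E -> exists a, a ∊ A /\ forall e, e ∊ E -> lt e a.
Proof.
  intros H1 H2. destruct (between_finite A L HL E emp H2 fin_emp H1 (sub_emp A)) as (a & Ha & K & _).
  - intros s t _ Ht; destruct (in_emp t Ht).
  - eauto.
Qed.

Lemma same_cut_beyond E a b : (forall e, e ∊ E -> lt e a) -> (forall e, e ∊ E -> lt e b) -> same_cut L E a b.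
Proof.
  intros H K e He. split; split; auto; intros M; exfalso; eapply (do_asym A L HL); eauto.
Qed.

(** All points beyond a common finite support [E] of the two cofinal sets lie in one cut. Each
    cofinal set has a point there, hence contains all of them, and the sets intersect. *)
Lemma not_cs : ~ cs N.
Proof.
  intros H.
  assert (HD : D2 (fun a b => a = b \/ lt a b)) by dn.
  set (R := graph A A (fun a b => a = b \/ lt a b)).
  assert (HR : forall a b, pair a b ∊ R <-> a ∊ A /\ b ∊ A /\ (a = b \/ lt a b)).
  { intros. apply (in_graph A A (fun a b => a = b \/ lt a b)); auto. }
  assert (RS : HS G F R).
  { apply (HS_of_supp emp); auto using sub_emp, fin_emp.
    - apply (supp_stable A G HG); [apply set_graph; auto|]. intros g p Hg _ Hp.
      pose proof Hp as Hp'. apply in_graph_ex in Hp' as (a & b & Ha & Hb & K & ->); auto.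
      rewrite (act_pair A) by auto. apply HR. split; [apply (act_atom_A A); auto|].
      split; [apply (act_atom_A A); auto|]. destruct K as [->|K]; auto. right; apply act_lt; auto.
    - intros p Hp. apply in_graph_ex in Hp as (a & b & Ha & Hb & _ & ->); auto.
      apply (HS_pair A G F HG HF); apply (HS_atom A G F HG HF); auto. }
  assert (HRN : forall x y : N, app N (mkN R RS) x y <-> ^x ∊ A /\ ^y ∊ A /\ (^x = ^y \/ lt ^x ^y)).
  { intros x y. rewrite (N_app A G F HG HF). apply HR. }
  destruct (H (mkN A (HS_A A G F HG HF)) (mkN R RS)) as (C & D & [_ HC] & [_ HDD] & Hdis).
  - split; [apply HA|]. split; [|split; [|split]].
    + split; [apply set_graph; auto|]. intros p Hp. change (^p ∊ R) in Hp.
      apply in_graph_ex in Hp as (a & b & Ha & Hb & _ & E); auto.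
      exists (mkN a (HS_atom A G F HG HF a Ha)), (mkN b (HS_atom A G F HG HF b Hb)).
      split; [exact Ha|]. split; [exact Hb|]. apply (N_pair A G F HG HF). exact E.
    + intros x Hx. apply HRN. auto.
    + intros x y H1 H2. apply HRN in H1 as (_ & _ & H1), H2 as (_ & _ & H2). apply N_eq.
      destruct H1 as [H1|H1]; auto. destruct H2 as [H2|H2]; auto. destruct (do_asym A L HL ^x ^y); auto.
    + intros x y z H1 H2. apply HRN in H1 as (Hx & _ & H1), H2 as (_ & Hz & H2). apply HRN.
      split; auto. split; auto. destruct H1 as [->|H1]; auto. destruct H2 as [<-|H2]; auto.
      right. apply (do_trans A L HL _ ^y); auto.
  - intros (x & Hx & Hmax). destruct (do_max A L HL ^x Hx) as [b Hb].
    destruct (do_dom A L HL _ _ Hb) as [_ HbA].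
    specialize (Hmax (mkN b (HS_atom A G F HG HF b HbA))).
    assert (K : mkN b (HS_atom A G F HG HF b HbA) = x) by (apply Hmax, HRN; auto).
    apply (f_equal (@proj1_sig _ _)) in K. simpl in K. subst b. apply (do_irrefl A L HL ^x); auto.
  - destruct (fsupp2 A G ^C ^D) as (E & E1 & E2 & E3 & E4);
      try (apply (HS_fsupp A G F HG HF), N_HS).
    destruct (beyond E E1 E2) as (a & Ha & Hbey).
    destruct (HC (mkN a (HS_atom A G F HG HF a Ha)) Ha) as (c & Hc & Hac).
    destruct (HDD (mkN a (HS_atom A G F HG HF a Ha)) Ha) as (d & Hd & Had).
    apply HRN in Hac as (_ & HcA & Hac), Had as (_ & HdA & Had). simpl in Hac, Had.
    assert (Hup : forall b, a = b \/ lt a b -> forall e, e ∊ E -> lt e b).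
    { intros b [<-|Hb] e He; auto. apply (do_trans A L HL e a b); auto. }
    apply (Hdis d). split; [|exact Hd]. change (^d ∊ ^C).
    apply (supp_cut E ^C ^c); auto. apply same_cut_beyond; auto.
Qed.

(** Pairs with the same first component form a chain and other pairs are incomparable, so a maximal
    antichain is a function choosing a point above each [a]. No finite support allows this: the
    chosen point can be moved while [a] stays fixed. *)
Lemma not_antichain_principle : ~ antichain_principle N.
Proof.
  intros H.
  set (P := fun p q => exists a b c, p = pair a b /\ q = pair a c /\ (b = c \/ lt b c)).
  assert (HD : D2 P) by (unfold P; dn).
  set (R := graph L L P).
  assert (HR : forall p q, pair p q ∊ R <-> p ∊ L /\ q ∊ L /\ P p q) by (intros; apply (in_graph L L P); auto).
  assert (LS : forall p, p ∊ L -> HS G F p) by (intros p Hp; apply (HS_mem A G F HG HF L); auto using HS_L).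
  assert (RS : HS G F R).
  { apply (HS_of_supp emp); auto using sub_emp, fin_emp.
    - apply (supp_stable A G HG); [apply set_graph; auto|]. intros g s Hg Fg Hs.
      pose proof Hs as Hs'. apply in_graph_ex in Hs' as (p & q & Hp & Hq & (a & b & c & -> & -> & K) & ->); auto.
      rewrite !(act_pair A) by auto. apply HR. split; [apply act_lt; auto|]. split; [apply act_lt; auto|].
      exists (act g a), (act g b), (act g c). split; auto. split; auto.
      destruct K as [->|K]; auto. right; apply act_lt; auto.
    - intros s Hs. apply in_graph_ex in Hs as (p & q & Hp & Hq & _ & ->); auto.
      apply (HS_pair A G F HG HF); auto. }
  assert (HRN : forall x y : N, app N (mkN R RS) x y <-> ^x ∊ L /\ ^y ∊ L /\ P ^x ^y).
  { intros x y. rewrite (N_app A G F HG HF). apply HR. }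
  assert (Pex : forall p, p ∊ L -> P p p).
  { intros p Hp. destruct (HLp p Hp) as (a & b & ->). exists a, b, b; auto. }
  destruct (H (mkN L HS_L) (mkN R RS)) as (Q & [HQL HQ] & Hmax).
  - split; [exact HLs|]. split; [|split; [|split]].
    + split; [apply set_graph; auto|]. intros p Hp. change (^p ∊ R) in Hp.
      apply in_graph_ex in Hp as (a & b & Ha & Hb & _ & E); auto.
      exists (mkN a (LS a Ha)), (mkN b (LS b Hb)).
      split; [exact Ha|]. split; [exact Hb|]. apply (N_pair A G F HG HF). exact E.
    + intros x Hx. apply HRN. auto.
    + intros x y H1 H2. apply HRN in H1 as (_ & _ & a & b & c & E1 & E2 & H1).
      apply HRN in H2 as (_ & _ & a' & b' & c' & E3 & E4 & H2). apply N_eq.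
      rewrite E2 in E3. rewrite E1 in E4. apply pair_inj in E3 as [<- <-]. apply pair_inj in E4 as [_ <-].
      rewrite E1, E2. f_equal. destruct H1 as [H1|H1]; auto. destruct H2 as [H2|H2]; auto.
      destruct (do_asym A L HL b c); auto.
    + intros x y z H1 H2. apply HRN in H1 as (Hx & _ & a & b & c & E1 & E2 & H1).
      apply HRN in H2 as (_ & Hz & a' & b' & c' & E3 & E4 & H2). apply HRN. split; auto. split; auto.
      rewrite E2 in E3. apply pair_inj in E3 as [<- <-]. exists a, b, c'. split; auto. split; auto.
      destruct H1 as [->|H1]; auto. destruct H2 as [<-|H2]; auto. right. apply (do_trans A L HL b c c'); auto.
  - apply (N_sub A G F HG HF) in HQL. simpl in HQL.
    assert (HQ' : forall a b c, pair a b ∊ ^Q -> pair a c ∊ ^Q -> b = c).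
    { intros a b c Hb Hc. apply NNPP; intros Nbc.
      assert (HbL : pair a b ∊ L) by (apply HQL; auto). assert (HcL : pair a c ∊ L) by (apply HQL; auto).
      destruct (HQ (mkN _ (LS _ HbL)) (mkN _ (LS _ HcL)) Hb Hc) as [K1 K2].
      { intros E. apply (f_equal (@proj1_sig _ _)) in E. simpl in E. apply pair_inj in E; tauto. }
      rewrite HRN in K1, K2. simpl in K1, K2.
      destruct (do_dom A L HL _ _ HbL) as [_ HbA]. destruct (do_dom A L HL _ _ HcL) as [_ HcA].
      destruct (do_total A L HL b c HbA HcA) as [M|[M|M]]; auto.
      - apply K1. split; auto. split; auto. exists a, b, c; auto.
      - apply K2. split; auto. split; auto. exists a, c, b; auto. }
    destruct (HS_fsupp A G F HG HF _ (N_HS G F Q)) as (E & E1 & E2 & E3).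
    destruct (beyond E E1 E2) as (a & Ha & Hbey).
    assert (exists b, pair a b ∊ ^Q) as [b Hb].
    (* If no pair in [Q] starts with [a], any pair of [L] starting with [a] is incomparable with all
       of [Q] and can be adjoined. *)
    { apply NNPP; intros Nb. destruct (do_max A L HL a Ha) as [b Hab].
      assert (HQS : HS G F (adj ^Q (pair a b))).
      { apply (HS_adj A G F HG HF); auto; [apply HQL | apply N_HS]. }
      assert (K : mkN _ HQS = Q).
      { apply Hmax.
        - split.
          + apply (N_sub A G F HG HF). apply sub_adj; auto.
          + assert (Hsep : forall p, p ∊ ^Q -> ~ P (pair a b) p /\ ~ P p (pair a b)).
            { intros p Hp. split; intros (a' & b' & c' & F1 & F2 & _).
              - apply pair_inj in F1 as [<- <-]. apply Nb. exists c'. rewrite <- F2; auto.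
              - apply pair_inj in F2 as [<- <-]. apply Nb. exists b'. rewrite <- F1; auto. }
            intros x y Hx Hy Nxy. change (^x ∊ adj ^Q (pair a b)) in Hx. change (^y ∊ adj ^Q (pair a b)) in Hy.
            apply in_adj in Hx as [Hx|Hx]; apply in_adj in Hy as [Hy|Hy].
            * apply HQ; auto.
            * rewrite !HRN, Hy. destruct (Hsep ^x Hx). tauto.
            * rewrite !HRN, Hx. destruct (Hsep ^y Hy). tauto.
            * destruct Nxy. apply N_eq. congruence.
        - apply (N_sub A G F HG HF). split; [apply HQL|]. intros z Hz. apply in_adj; auto. }
      apply Nb. exists b. rewrite <- K. apply in_adj; auto. }
    assert (Hab : lt a b) by (apply HQL; auto).
    destruct (do_dom A L HL a b Hab) as [_ HbA].
    (* [a] was taken beyond [E], so [b], being above [a], lies outside [adj E a] and can be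
       moved. *)
    destruct (Hmov (adj E a) b (adj emp b)) as (g & Hg & Fg & Ng); auto using fin_adj, fin_emp.
    + apply sub_adj; auto.
    + intros K. apply in_adj in K as [K| ->].
      * apply (do_asym A L HL a b); auto.
      * apply (do_irrefl A L HL a); auto.
    + apply fixes_adj in Fg as [Fg Fa]. apply Ng, in_adj. right. apply (HQ' a); auto.
      rewrite <- Fa at 1. rewrite <- (act_pair A) by auto. rewrite <- (E3 g Hg Fg). apply (act_mem A); auto.
Qed.
End Mostowski.

(** * Independence results and the theorem *)

Lemma RRT_not_implies {Z : zfa_model} {AC : has_choice} (A G F : uni) (Q : fm) m n :
  (forall (P : uni -> Prop) x, small (fun z => z ∊ x /\ P z)) ->
  (forall (R : uni -> uni -> Prop) x,
     (forall u v v', u ∊ x -> R u v -> R u v' -> v = v') -> small (fun v => exists u, u ∊ x /\ R u v)) ->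
  good_model A G F ->
  (forall e : nat -> PermModel uni G F, ~ sat (PermModel uni G F) e (Q 0)) ->
  ~ provable ZFA ((fimp (RRT m n) Q) 0).
Proof.
  intros H1 H2 (HG & HF & Hm & Hp) HQ H.
  set (e := fun _ : nat => mk G F emp (HS_emp A G F HG HF) : PermModel uni G F).
  apply (HQ e).
  assert (K : sat (PermModel uni G F) e (RRT m n 0) -> sat (PermModel uni G F) e (Q 0)).
  { apply (provable_sat ZFA (PermModel uni G F) _ H (N_ZFA A G F HG HF H1 H2) e). }
  apply K, sat_RRT, (N_rrt A G F HG HF Hm Hp).
Qed.

Lemma not_implies_no_amorphous m n : does_not_imply (RRT m n) NoAmorphous.
Proof.
  intros _. pose (WZ := W_model nat). pose proof (W_choice nat : @has_choice WZ) as AC.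
  set (A := atoms nat : @uni WZ).
  assert (HA : isatomset uni A) by apply atoms_isatomset.
  assert (Hinf : infinite uni A).
  { destruct (atoms_enumerated nat (fun n => n)) as (ι & Hι & Hs & Hi); [eauto|].
    apply (infinite_image ι omega A); auto using infinite_omega. apply HA. }
  assert (HD : D1 (fun g => isbij uni g A A)) by dn.
  set (G := sep (pow (prod A A)) (fun g => isbij uni g A A)).
  assert (HGs : set G) by (apply set_sep; auto).
  assert (HGa : forall g, g ∊ G <-> isbij uni g A A).
  { intros g. unfold G. rewrite in_sep by auto. split; [tauto|]. intros Hg; split; auto.
    pose proof (bij_fn A g Hg) as Fg. apply in_pow. split; [apply (fn_set _ _ _ Fg)|].
    intros p Hp. destruct (fn_pairs _ _ _ Fg p Hp) as (a & b & ->). apply in_prod.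
    split; [apply (fn_dom _ _ _ Fg _ _ Hp) | apply (fn_cod _ _ _ Fg _ _ Hp)]. }
  pose proof (symmetric_group A G HA HGs HGa) as HG.
  destruct (filter_exists A G HG) as [F HF].
  destruct (symmetric_group_good A G HA Hinf HGs HGa) as [K1 K2].
  apply (RRT_not_implies A G F).
  - apply W_full_separation.
  - apply W_full_replacement.
  - split; auto.
  - intros e He. apply sat_NoAmorphous in He. revert He. apply (atoms_amorphous A G F HG HF HGa Hinf).
Qed.

(** Triples of naturals coded by two Cantor pairings: a difference of two naturals gives the
    numerator, a successor the denominator. *)
Definition Qc_enum (n : nat) : Qc :=
  let (a, k) := Cantor.of_nat n in let (b, c) := Cantor.of_nat k in
  Q2Qc ((Z.of_nat a - Z.of_nat b) # Pos.of_succ_nat c).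

Lemma Qc_enum_surj q : exists n, Qc_enum n = q.
Proof.
  destruct q as [[p d] Hq].
  exists (Cantor.to_nat (Z.to_nat p, Cantor.to_nat (Z.to_nat (- p), Nat.pred (Pos.to_nat d)))).
  unfold Qc_enum. rewrite !Cantor.cancel_of_to.
  apply Qc_is_canon. eapply Qeq_trans; [apply Qred_correct|].
  replace (Z.of_nat (Z.to_nat p) - Z.of_nat (Z.to_nat (- p)))%Z with p by lia.
  replace (Pos.of_succ_nat (Nat.pred (Pos.to_nat d))) with d by lia. reflexivity.
Qed.

(** The atoms are indexed by [Qc], whose elements are Leibniz equal as soon as they are equal as
    rationals, so that the order on the atoms is total. The refutation [HQ] sees only the abstract
    properties of this dense order. *)
Lemma mostowski_instance (Q : fm) m n :
  (forall (Z : zfa_model) (AC : has_choice) (A L G F : uni), dense_order A L ->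
     (exists ι, fn ι omega A /\ forall a, a ∊ A -> exists n, pair n a ∊ ι) ->
     isatomset uni A -> set L -> (forall p, p ∊ L -> exists a b, p = pair a b) -> set G ->
     (forall g, g ∊ G <-> isorderaut uni g A L) -> finite_support_filter A G F ->
     forall e : nat -> PermModel uni G F, ~ sat (PermModel uni G F) e (Q 0)) ->
  does_not_imply (RRT m n) Q.
Proof.
  intros HQ _. pose (WZ := W_model Qc). pose proof (W_choice Qc : @has_choice WZ) as AC.
  set (A := atoms Qc : @uni WZ).
  assert (HA : isatomset uni A) by apply atoms_isatomset.
  assert (HAc : exists ι, fn ι omega A /\ forall a, a ∊ A -> exists n, pair n a ∊ ι).
  { destruct (atoms_enumerated Qc Qc_enum Qc_enum_surj) as (ι & H1 & H2 & _). exists ι; auto. }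
  set (L := pairs Qc {p : Qc * Qc | (fst p < snd p)%Qc}
              (fun s => atom Qc (fst (proj1_sig s))) (fun s => atom Qc (snd (proj1_sig s))) : @uni WZ).
  assert (HLin : forall a b, pair a b ∊ L <-> exists x y : Qc, (x < y)%Qc /\ a = atom Qc x /\ b = atom Qc y).
  { intros a b. eapply iff_trans; [apply (in_pairs Qc)|]. split.
    - intros ([[x y] Hxy] & -> & ->). simpl in *. eauto.
    - intros (x & y & Hxy & -> & ->). exists (exist _ (x, y) Hxy); auto. }
  assert (HLat : forall x y, pair (atom Qc x) (atom Qc y) ∊ L <-> (x < y)%Qc).
  { intros x y. rewrite HLin. split; [|eauto].
    intros (x' & y' & H & E1 & E2). apply atom_inj in E1, E2; subst; auto. }
  assert (HAin : forall a, a ∊ A <-> exists x, a = atom Qc x) by apply in_atoms.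
  assert (HL : dense_order A L).
  { split.
    - intros a b H. apply HLin in H as (x & y & _ & -> & ->). rewrite !HAin; eauto.
    - intros a H. pose proof H as H'. apply HLin in H' as (x & _ & _ & -> & _).
      apply HLat in H. apply (Qclt_not_eq x x H); auto.
    - intros a b c H K. apply HLin in H as (x & y & Hxy & -> & ->).
      apply HLin in K as (y' & z & Hyz & E & ->). apply atom_inj in E; subst y'.
      apply HLat. apply (Qclt_trans x y z); auto.
    - intros a b Ha Hb. apply HAin in Ha as [x ->], Hb as [y ->]. rewrite !HLat.
      destruct (Qc_dec x y) as [[H|H]|H]; auto. right; left. rewrite H; auto.
    - intros a b H. apply HLin in H as (x & y & Hxy & -> & ->).
      exists (atom Qc (Q2Qc ((this x + this y) * (1 # 2)))). rewrite !HLat.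
      pose proof (Qred_correct ((this x + this y) * (1 # 2)) :
        (this (Q2Qc ((this x + this y) * (1 # 2))) == (this x + this y) * (1 # 2))%Q) as E.
      unfold Qclt in *. split; lra.
    - intros a Ha. apply HAin in Ha as [x ->]. exists (atom Qc (Q2Qc (this x + 1))).
      apply HLat. 
      pose proof (Qred_correct (this x + 1) : (this (Q2Qc (this x + 1)) == this x + 1)%Q) as E.
      unfold Qclt. lra.
    - intros a Ha. apply HAin in Ha as [x ->]. exists (atom Qc (Q2Qc (this x - 1))).
      apply HLat. 
      pose proof (Qred_correct (this x - 1) : (this (Q2Qc (this x - 1)) == this x - 1)%Q) as E.
      unfold Qclt. lra.
    - exists (atom Qc (Q2Qc 0)). apply HAin; eauto. }
  assert (HLs : set L) by apply set_pairs.
  assert (HLp : forall p, p ∊ L -> exists a b, p = pair a b).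
  { intros p Hp. apply in_pairs_ex in Hp as [i ->]. eauto. }
  assert (HD : D1 (fun g => isorderaut uni g A L)) by (unfold isorderaut; dn).
  set (G := sep (pow (prod A A)) (fun g => isorderaut uni g A L)).
  assert (HGs : set G) by (apply set_sep; auto).
  assert (HGa : forall g, g ∊ G <-> isorderaut uni g A L).
  { intros g. unfold G. rewrite in_sep by auto. split; [tauto|]. intros Hg; split; auto.
    pose proof (bij_fn A g (proj1 Hg)) as Fg. apply in_pow. split; [apply (fn_set _ _ _ Fg)|].
    intros p Hp. destruct (fn_pairs _ _ _ Fg p Hp) as (a & b & ->). apply in_prod.
    split; [apply (fn_dom _ _ _ Fg _ _ Hp) | apply (fn_cod _ _ _ Fg _ _ Hp)]. }
  pose proof (order_perm_group A L HA G HGs HGa) as HG.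
  destruct (filter_exists A G HG) as [F HF].
  apply (RRT_not_implies A G F).
  - apply W_full_separation.
  - apply W_full_replacement.
  - split; auto. split; auto. split.
    + apply (order_moving A L HL HAc HA G HGs HGa).
    + apply (order_primitive A L HL HAc HA G HGs HGa).
  - apply (HQ WZ AC A L G F); auto.
Qed.

Theorem theorem4p1 (n m : nat) (hn : 2 <= n) (hm : 2 <= m) :
  ((forall (M : structure) (G F : M), models_ZFA_AC M -> holds2 M IsN1 G F ->
      holds (PermModel M G F) (RRT m n)) /\
   does_not_imply (RRT m n) NoAmorphous) /\
  ((forall (M : structure) (G F : M), models_ZFA_AC M -> holds2 M IsN3 G F ->
      holds (PermModel M G F) (RRT m n)) /\
   does_not_imply (RRT m n) WOAM /\
   does_not_imply (RRT m n) CS /\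
   does_not_imply (RRT m n) AntichainPrinciple) /\
  (forall (M : structure) (G F : M), models_ZFA_AC M -> holds2 M IsN26 G F ->
      holds (PermModel M G F) (RRT m n) /\ holds (PermModel M G F) DeltaSL).
Proof.
  split; [split|split; [split; [|split; [|split]]|]].
  - intros M G F [HM HAC] H.
    (* The default value may be any element of [M]; [G] is at hand. *)
    pose (Z := {| uni := M; dflt := G; zfa_sat := HM |}).
    destruct (@isN1_good Z G F H) as (A & HG & HF & Hm & Hp).
    intros e. apply sat_RRT. exact (@N_rrt Z A G F HG HF Hm Hp HAC m n).
  - apply not_implies_no_amorphous.
  - intros M G F [HM HAC] H.
    pose (Z := {| uni := M; dflt := G; zfa_sat := HM |}).
    destruct (@isN3_good Z HAC G F H) as (A & HG & HF & Hm & Hp).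
    intros e. apply sat_RRT. exact (@N_rrt Z A G F HG HF Hm Hp HAC m n).
  - apply mostowski_instance. intros Z AC A L G F H1 H2 H3 H4 H5 H6 H7 H8 e He.
    apply sat_WOAM in He. exact (not_woam A L G F H1 H2 H3 H6 H7 H8 He).
  - apply mostowski_instance. intros Z AC A L G F H1 H2 H3 H4 H5 H6 H7 H8 e He.
    apply sat_CS in He. exact (not_cs A L G F H1 H2 H3 H6 H7 H8 He).
  - apply mostowski_instance. intros Z AC A L G F H1 H2 H3 H4 H5 H6 H7 H8 e He.
    apply sat_Antichain in He. exact (not_antichain_principle A L G F H1 H2 H3 H4 H5 H6 H7 H8 He).
  - intros M G F [HM HAC] H.
    pose (Z := {| uni := M; dflt := G; zfa_sat := HM |}).
    destruct (@isN26_good Z G F H) as (A & HG & HF & Hm & Hp). split; intros e.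
    + apply sat_RRT. exact (@N_rrt Z A G F HG HF Hm Hp HAC m n).
    + exact (@N_deltasl Z A G F HG HF Hm Hp HAC).
Qed.
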